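(* Let $M$ be a compact connected smooth manifold without boundary, let $H$ be a Tonelli Hamiltonian on $T^*M$ and let $F:T^*M\to\mathbb{R}$ be a $C^2$ integral of motion of $H$. Denote by $\Phi_H$ and $\Phi_F$ the respective Hamiltonian flows. Then: (i) For each $c\in H^1(M;\mathbb{R})$, if $\mu$ is a $c$-action minimizing measure of $H$, then the push-forward $(\Phi^t_F)_*\mu$ is still a $c$-action minimizing measure of $H$, for each $t\in\mathbb{R}$. (ii) The Mather set $\mathcal{M}^*_c(H)$ and the Aubry set $\mathcal{A}^*_c(H)$ are invariant under the action of $\Phi^t_F$, for each $t\in\mathbb{R}$ and each $c\in H^1(M;\mathbb{R})$. In particular, for each $t\in\mathbb{R}$, $\Phi^t_F$ maps each connected component of $\mathcal{M}^*_c(H)$ and of $\mathcal{A}^*_c(H)$ into itself.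
   Context: $T^*M$ carries its canonical symplectic form $\omega$; $X_f$ denotes the Hamiltonian vector field of $f$ (so $df=\omega(X_f,\cdot)$), $\Phi_f^t$ its flow, and $\{f,g\}=\omega(X_f,X_g)$. A Tonelli Hamiltonian is a $C^2$ function $H:T^*M\to\mathbb{R}$ that is strictly convex in each fiber ($\partial^2H/\partial p^2$ positive definite) and uniformly superlinear in each fiber. An integral of motion of $H$ is a function $F$ with $\{H,F\}\equiv0$. The Lagrangian associated to $H$ is $L(x,v)=\sup_{p\in T^*_xM}(\langle p,v\rangle-H(x,p))$ on $TM$, and the Legendre transform $\mathcal{L}_L(x,v)=(x,\partial L/\partial v(x,v))$ conjugates the Euler–Lagrange flow of $L$ to $\Phi_H$. For $c\in H^1(M;\mathbb{R})$, fix a smooth closed 1-form $\eta$ with $[\eta]=c$ and set $-\alpha_H(c)=\min_\mu\int_{TM}(L(x,v)-\langle\eta(x),v\rangle)\,d\mu$, the minimum being over Borel probability measures on $TM$ invariant under the Euler–Lagrange flow; minimizers (and their push-forwards to $T^*M$ by $\mathcal{L}_L$) are called $c$-action minimizing measures. This does not depend on the choice of $\eta$ in $c$. The Mather set $\mathcal{M}^*_c(H)\subset T^*M$ is the union of the supports of the ($T^*M$-versions of the) $c$-action minimizing measures. The Aubry set is $\mathcal{A}^*_c(H)=\bigcap_u\{(x,\eta_x+d_xu):x\in M\}$, the intersection over all $u\in C^{1,1}(M)$ with $H(x,\eta_x+d_xu)\le\alpha_H(c)$ for all $x\in M$. *)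

(* Defs.v *)
From HB Require Import structures.
From mathcomp Require Import all_boot all_order all_algebra.
From mathcomp Require Import all_classical all_reals all_analysis.

Set Implicit Arguments.
Unset Strict Implicit.
Unset Printing Implicit Defensive.

Import Order.TTheory GRing.Theory Num.Theory.
Import numFieldNormedType.Exports.

Local Open Scope classical_set_scope.
Local Open Scope ring_scope.

Section calculus.
Context {R : realType}.

(* [f] is only constrained on the open set [U], although it is a total
   function.  In finite dimension, C^(k+1) on U means differentiable on U with
   all directional derivatives of class C^k on U. *)
Fixpoint Ck (V W : normedModType R) (k : nat) (U : set V) (f : V -> W) : Prop :=
  match k with
  | 0%N => forall x, U x -> {for x, continuous f}
  | k'.+1 => (forall x, U x -> differentiable f x) /\
             (forall v, Ck k' U (fun x => 'D_v f x))
  end.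

Definition smooth_on (V W : normedModType R) (U : set V) (f : V -> W) : Prop :=
  forall k, Ck k U f.

Definition pairing n (p v : 'rV[R]_n) : R := (p *m v^T) 0 0.

Definition grad n (f : 'rV[R]_n -> R) (y : 'rV[R]_n) : 'rV[R]_n :=
  \row_j 'D_(delta_mx 0 j) f y.

Definition hessian n (f : 'rV[R]_n -> R) (y : 'rV[R]_n) : 'M[R]_n :=
  \matrix_(j, k) 'D_(delta_mx 0 j) (fun z => 'D_(delta_mx 0 k) f z) y.

Definition positive_definite n (A : 'M[R]_n) : Prop :=
  forall w : 'rV[R]_n, w != 0 -> 0 < pairing (w *m A) w.

Definition grad1 n (G : 'rV[R]_n * 'rV[R]_n -> R) (z : 'rV[R]_n * 'rV[R]_n) :=
  grad (fun y => G (y, z.2)) z.1.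

Definition grad2 n (G : 'rV[R]_n * 'rV[R]_n -> R) (z : 'rV[R]_n * 'rV[R]_n) :=
  grad (fun p => G (z.1, p)) z.2.

(* The canonical form \sum_j dx_j /\ dp_j of R^n x (R^n)^*, in the
   coordinates (x, p). *)
Definition omega n (X Y : 'rV[R]_n * 'rV[R]_n) : R :=
  pairing X.1 Y.2 - pairing X.2 Y.1.

(* Hamiltonian vector field of a function of the canonical coordinates;
   [ham_vectorP] states that it satisfies dG = omega(X_G, .). *)
Definition ham_vector n (G : 'rV[R]_n * 'rV[R]_n -> R)
    (z : 'rV[R]_n * 'rV[R]_n) : 'rV[R]_n * 'rV[R]_n :=
  (grad2 G z, - grad1 G z).

Lemma eq_derive (V V' W : normedModType R) (f : V -> W) (f' : V' -> W)
    x x' v v' :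
  (forall h : R, f (h *: v + x) = f' (h *: v' + x')) ->
  'D_v f x = 'D_v' f' x'.
Proof.
move=> ff'; have fx : f x = f' x' by have := ff' 0; rewrite !scale0r !add0r.
rewrite /derive; set F := (X in X @ _); set F' := (X in _ = lim (X @ _)).
suff -> : F = F' by [].
by apply/funext => h; rewrite /F /F' /= /shift /= fx ff'.
Qed.

Lemma ham_vectorP n (G : 'rV[R]_n * 'rV[R]_n -> R) z w :
  differentiable G z -> 'd G z w = omega (ham_vector G z) w.
Proof.
move=> dG.
have split_w : w = \sum_j w.1 0 j *: ((delta_mx 0 j, 0) : 'rV[R]_n * 'rV[R]_n)
    + \sum_j w.2 0 j *: ((0, delta_mx 0 j) : 'rV[R]_n * 'rV[R]_n).
  case: w => w1 w2 /=.
  have sumE (I : finType) (f g : I -> 'rV[R]_n) :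
      \sum_k ((f k, g k) : 'rV[R]_n * 'rV[R]_n) = (\sum_k f k, \sum_k g k).
    by elim: (index_enum I) => [|a r IH]; rewrite ?big_nil // !big_cons IH.
  rewrite !sumE /= -!row_sum_delta.
  rewrite !big1 => [|j _|j _]; rewrite ?scaler0 //.
  by congr pair; rewrite ?addr0 ?add0r.
have D1 j : grad1 G z 0 j = 'd G z (delta_mx 0 j, 0).
  rewrite mxE -deriveE //; apply: eq_derive => h; congr G.
  by case: (z) => y p; congr pair; rewrite /= scaler0 add0r.
have D2 j : grad2 G z 0 j = 'd G z (0, delta_mx 0 j).
  rewrite mxE -deriveE //; apply: eq_derive => h; congr G.
  by case: (z) => y p; congr pair; rewrite /= scaler0 add0r.
rewrite {1}split_w linearD !linear_sum /omega /pairing /= mulNmx !mxE opprK addrC.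
congr (_ + _); apply: eq_bigr => j _; rewrite linearZ /= !mxE.
  by rewrite -D2 mulrC mxE.
by rewrite -D1 mulrC mxE.
Qed.

(* Value at time [t] of the solution starting from [z] at time 0, where
   [sol a b g] means that the curve [g] is a solution on the interval ]a, b[.
   The value is [z] when no solution reaches time [t]. *)
Definition flow (T : choiceType) (sol : R -> R -> (R -> T) -> Prop)
    (t : R) (z : T) : T :=
  xget z [set w | exists a b (g : R -> T),
    [/\ a < 0 < b, a < t < b, sol a b g, g 0 = z & g t = w]].

End calculus.

Record smooth_manifold (R : realType) (n : nat) := SmoothManifold {
  carrier :> ptopologicalType ;
  chart_index : Type ;
  chart_dom : chart_index -> set carrier ;
  chart : chart_index -> carrier -> 'rV[R]_n ;
  chart_inv : chart_index -> 'rV[R]_n -> carrier ;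
  (* a chosen chart around each point *)
  chart_at : carrier -> chart_index ;
  mem_chart_at : forall x, chart_dom (chart_at x) x ;
  chart_dom_open : forall i, open (chart_dom i) ;
  chart_img_open : forall i, open (chart i @` chart_dom i) ;
  chartK : forall i x, chart_dom i x -> chart_inv i (chart i x) = x ;
  chart_continuous : forall i x,
    chart_dom i x -> {for x, continuous (chart i)} ;
  chart_inv_continuous : forall i y,
    (chart i @` chart_dom i) y -> {for y, continuous (chart_inv i)} ;
  transition_smooth : forall i j,
    smooth_on (chart i @` (chart_dom i `&` chart_dom j))
      (chart j \o chart_inv i) ;
  manifold_hausdorff : hausdorff_space carrier ;
  manifold_second_countable : @second_countable carrier
}.

Arguments chart_index {R n}.
Arguments chart_dom {R n s} _.
Arguments chart {R n s} _.
Arguments chart_inv {R n s} _.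
Arguments chart_at {R n s} _.

Definition chart_img (R : realType) n (M : smooth_manifold R n)
    (i : chart_index M) : set 'rV[R]_n :=
  chart i @` chart_dom i.

Definition transition (R : realType) n (M : smooth_manifold R n)
    (i j : chart_index M) : 'rV[R]_n -> 'rV[R]_n :=
  chart j \o chart_inv i.

(* The fibers of TM and T^*M over x are both R^n: a tangent vector v and a
   covector p at x are given by their coordinates in the chart [chart_at x], so
   that <p, v> is [pairing p v].  The coordinates in the other charts follow
   from the usual transformation laws (vectors are rows, hence
   'D_v f x = v *m 'J f x). *)
Definition tangent_bundle (R : realType) n (M : smooth_manifold R n) : Type :=
  (M * 'rV[R]_n)%type.

Definition cotangent_bundle (R : realType) n (M : smooth_manifold R n) : Type :=
  (M * 'rV[R]_n)%type.

Section bundle_charts.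
Context {R : realType} {n : nat} {M : smooth_manifold R n}.
Implicit Types (i : chart_index M).

Definition tangent_chart i (z : tangent_bundle M) : 'rV[R]_n * 'rV[R]_n :=
  let c := chart_at z.1 in
  (chart i z.1, z.2 *m 'J (transition c i) (chart c z.1)).

Definition tangent_chart_inv i (yv : 'rV[R]_n * 'rV[R]_n) : tangent_bundle M :=
  let x := chart_inv i yv.1 in
  (x, yv.2 *m 'J (transition i (chart_at x)) yv.1).

Definition cotangent_chart i (z : cotangent_bundle M) :
    'rV[R]_n * 'rV[R]_n :=
  let c := chart_at z.1 in
  (chart i z.1, z.2 *m ('J (transition i c) (chart i z.1))^T).

Definition cotangent_chart_inv i (yp : 'rV[R]_n * 'rV[R]_n) :
    cotangent_bundle M :=
  let x := chart_inv i yp.1 in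
  let c := chart_at x in
  (x, yp.2 *m ('J (transition c i) (chart c x))^T).

Definition bundle_open (E : Type)
    (f : chart_index M -> 'rV[R]_n * 'rV[R]_n -> E) (A : set E) : Prop :=
  forall i, open [set z | chart_img i z.1 /\ A (f i z)].

Section bundle_open_topology.
Context {E : Type} (f : chart_index M -> 'rV[R]_n * 'rV[R]_n -> E).

Lemma bundle_openT : bundle_open f setT.
Proof.
move=> i; rewrite (_ : [set z | _] = fst @^-1` chart_img i).
  by apply: open_comp; [move=> z _; exact: cvg_fst|exact: chart_img_open].
by apply/seteqP; split=> z; [case|].
Qed.

Lemma bundle_openI : setI_closed (bundle_open f).
Proof.
move=> A B oA oB i; have := openI (oA i) (oB i).
by congr open; apply/seteqP; split=> z /= => [[[? ?] [? ?]]|[? []]].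
Qed.

Lemma bundle_open_bigU (I : Type) (g : I -> set E) :
  (forall k, bundle_open f (g k)) -> bundle_open f (\bigcup_k g k).
Proof.
move=> og i.
rewrite (_ : [set z | _] =
    \bigcup_k [set z | chart_img i z.1 /\ g k (f i z)]).
  by apply: bigcup_open => k _; exact: og.
apply/seteqP; split=> z /=; first by case=> zi [k _ gz]; exists k.
by case=> k _ [zi gz]; split=> //; exists k.
Qed.

End bundle_open_topology.
End bundle_charts.

(* The topologies of TM and T^*M are those for which the charts induced by the
   charts of M are homeomorphisms onto open sets, not the product topologies. *)
HB.instance Definition _ (R : realType) n (M : smooth_manifold R n) :=
  Pointed.copy (tangent_bundle M) (M * 'rV[R]_n)%type.
HB.instance Definition _ (R : realType) n (M : smooth_manifold R n) :=
  isOpenTopological.Build (tangent_bundle M)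
    (@bundle_openT R n M _ tangent_chart_inv)
    (@bundle_openI R n M _ tangent_chart_inv)
    (@bundle_open_bigU R n M _ tangent_chart_inv).

HB.instance Definition _ (R : realType) n (M : smooth_manifold R n) :=
  Pointed.copy (cotangent_bundle M) (M * 'rV[R]_n)%type.
HB.instance Definition _ (R : realType) n (M : smooth_manifold R n) :=
  isOpenTopological.Build (cotangent_bundle M)
    (@bundle_openT R n M _ cotangent_chart_inv)
    (@bundle_openI R n M _ cotangent_chart_inv)
    (@bundle_open_bigU R n M _ cotangent_chart_inv).

Notation borel T := (g_sigma_algebraType (@open T)).

Definition msupport (R : realType) (T : ptopologicalType)
    (mu : probability (borel T) R) : set T :=
  [set z | forall U : set T, open U -> U z -> (0 < mu U)%E].

Section functions_and_forms.
Context {R : realType} {n : nat} {M : smooth_manifold R n}.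

Definition smooth_function (u : M -> R) : Prop :=
  forall i : chart_index M, smooth_on (chart_img i) (u \o chart_inv i : _ -> R).

(* continuously differentiable with locally Lipschitz differential *)
Definition C11_function (u : M -> R) : Prop :=
  forall i : chart_index M,
    Ck 1 (chart_img i) (u \o chart_inv i : _ -> R) /\
    forall y, chart_img i y ->
      exists2 V, nbhs y V & [lipschitz grad (u \o chart_inv i) z | z in V].

Definition dfun (u : M -> R) (x : M) : 'rV[R]_n :=
  grad (u \o chart_inv (chart_at x)) (chart (chart_at x) x).

(* [eta x] is a covector at x *)
Definition one_form : Type := M -> 'rV[R]_n.

Definition form_in_chart (eta : one_form) (i : chart_index M)
    (y : 'rV[R]_n) : 'rV[R]_n :=
  (cotangent_chart i (chart_inv i y, eta (chart_inv i y))).2.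

Definition smooth_form (eta : one_form) : Prop :=
  forall i, smooth_on (chart_img i) (form_in_chart eta i).

Definition closed_form (eta : one_form) : Prop :=
  forall i y, chart_img i y -> forall j k,
    'D_(delta_mx 0 j) (fun z => form_in_chart eta i z 0 k) y =
    'D_(delta_mx 0 k) (fun z => form_in_chart eta i z 0 j) y.

Definition cohomology_class (eta : one_form) : set one_form :=
  [set eta' | [/\ smooth_form eta', closed_form eta' &
    exists2 u, smooth_function u & forall x, eta' x = eta x + dfun u x]].

End functions_and_forms.

Arguments one_form {R n} M.

(* H^1(M; R), a de Rham class being the set of its representatives *)
Record H1 (R : realType) n (M : smooth_manifold R n) := {
  representatives :> set (one_form M) ;
  representativesP : exists eta : one_form M,
    [/\ smooth_form eta, closed_form eta &
        representatives = cohomology_class eta]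
}.

Record riemannian_metric (R : realType) n (M : smooth_manifold R n) := {
  gram : M -> 'M[R]_n ;
  gram_sym : forall x, (gram x)^T = gram x ;
  gram_pos : forall x, positive_definite (gram x) ;
  gram_smooth : forall i : chart_index M, smooth_on (chart_img i)
    (fun y => let x := chart_inv i y in
      let J := 'J (transition i (chart_at x)) y in J *m gram x *m J^T)
}.

Definition conorm (R : realType) n (M : smooth_manifold R n)
    (g : riemannian_metric M) (x : M) (p : 'rV[R]_n) : R :=
  Num.sqrt (pairing (p *m invmx (gram g x)) p).

Section hamiltonian_dynamics.
Context {R : realType} {n : nat} {M : smooth_manifold R n}.
Implicit Types (f g F H : cotangent_bundle M -> R).

Definition C2_cotangent f : Prop :=
  forall i : chart_index M, Ck 2 [set z | chart_img i z.1]
    (f \o cotangent_chart_inv i : _ -> R).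

(* [conorm] is here with respect to some metric; as M is compact, any two
   metrics are equivalent and the choice is immaterial. *)
Definition uniformly_superlinear H : Prop :=
  exists g : riemannian_metric M, forall A : R, exists B : R,
    forall (x : M) (p : 'rV[R]_n), A * conorm g x p - B <= H (x, p).

Definition tonelli H : Prop :=
  [/\ C2_cotangent H,
      forall (x : M) (p : 'rV[R]_n),
        positive_definite (hessian (fun q => H (x, q)) p) &
      uniformly_superlinear H].

Definition ham_field_in_chart (i : chart_index M) f (z : cotangent_bundle M) :
    'rV[R]_n * 'rV[R]_n :=
  ham_vector (f \o cotangent_chart_inv i) (cotangent_chart i z).

Definition poisson f g (z : cotangent_bundle M) : R :=
  omega (ham_field_in_chart (chart_at z.1) f z)
        (ham_field_in_chart (chart_at z.1) g z).

Definition integral_of_motion H F : Prop := forall z, poisson H F z = 0.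

Definition ham_curve f (a b : R) (gamma : R -> cotangent_bundle M) : Prop :=
  forall t, a < t < b ->
    {for t, continuous gamma} /\
    forall i, chart_dom i (gamma t).1 ->
      is_derive t 1 (fun s => cotangent_chart i (gamma s))
        (ham_field_in_chart i f (gamma t)).

Definition ham_flow f : R -> cotangent_bundle M -> cotangent_bundle M :=
  flow (ham_curve f).

Definition lagrangian H (z : tangent_bundle M) : R :=
  sup [set pairing p z.2 - H (z.1, p) | p in [set: 'rV[R]_n]].

Definition legendre H (z : tangent_bundle M) : cotangent_bundle M :=
  (z.1, grad (fun v => lagrangian H (z.1, v)) z.2).

(* [gamma] is the velocity curve of its projection to M, which satisfies
   d/dt (\partial_v L) = \partial_x L in every chart. *)
Definition euler_lagrange_curve (L : tangent_bundle M -> R) (a b : R)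
    (gamma : R -> tangent_bundle M) : Prop :=
  forall t, a < t < b ->
    {for t, continuous gamma} /\
    forall i, chart_dom i (gamma t).1 ->
      let Li := L \o tangent_chart_inv i in
      let c := fun s => tangent_chart i (gamma s) in
      is_derive t 1 (fun s => (c s).1) (c t).2 /\
      is_derive t 1 (fun s => grad2 Li (c s)) (grad1 Li (c t)).

Definition el_flow (L : tangent_bundle M -> R) :
    R -> tangent_bundle M -> tangent_bundle M :=
  flow (euler_lagrange_curve L).

Definition el_invariant H (nu : probability (borel (tangent_bundle M)) R) :
    Prop :=
  forall t (A : set (borel (tangent_bundle M))), measurable A ->
    nu (el_flow (lagrangian H) t @^-1` A) = nu A.

Definition action H (eta : one_form M)
    (nu : probability (borel (tangent_bundle M)) R) : \bar R :=
  \int[nu]_(z in setT) ((lagrangian H z - pairing (eta z.1) z.2)%:E).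

Definition alpha H (eta : one_form M) : R :=
  - fine (ereal_inf [set action H eta nu | nu in el_invariant H]).

Definition minimizing H (eta : one_form M)
    (nu : probability (borel (tangent_bundle M)) R) : Prop :=
  el_invariant H nu /\
  forall nu', el_invariant H nu' -> (action H eta nu <= action H eta nu')%E.

Definition is_pushforward (S T : ptopologicalType) (h : S -> T)
    (mu : probability (borel S) R) (mu' : probability (borel T) R) : Prop :=
  forall A : set (borel T), measurable A ->
    mu' A = pushforward mu (h : borel S -> borel T) A.

(* the version of [minimizing] for measures on T^*M *)
Definition cotangent_minimizing H (eta : one_form M)
    (mu : probability (borel (cotangent_bundle M)) R) : Prop :=
  exists2 nu, minimizing H eta nu & is_pushforward (legendre H) nu mu.

Definition mather_set H (eta : one_form M) : set (cotangent_bundle M) :=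
  \bigcup_(mu in cotangent_minimizing H eta) msupport mu.

Definition graph_form (eta : one_form M) : set (cotangent_bundle M) :=
  [set ((x, eta x) : cotangent_bundle M) | x in [set: M]].

Definition critical_subsolution H (eta : one_form M) : set (M -> R) :=
  [set u | C11_function u /\
    forall x, H (x, eta x + dfun u x) <= alpha H eta].

Definition aubry_set H (eta : one_form M) : set (cotangent_bundle M) :=
  \bigcap_(u in critical_subsolution H eta)
    graph_form (fun x => eta x + dfun u x).

End hamiltonian_dynamics.

Definition flow_invariant (R : realType) (T : Type) (phi : R -> T -> T)
    (A : set T) : Prop :=
  forall t, phi t @` A = A.

Definition preserves_components (R : realType) (T : topologicalType)
    (phi : R -> T -> T) (A : set T) : Prop :=
  forall t z, A z ->
    phi t @` connected_component A z `<=` connected_component A z.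

(* Main.v *)
(** Since {H,F} = 0, the flow of F preserves the compact sublevels of H, hence is
    complete, and commutes with the flow of H.  Put A_f = <p - eta, f_p> - f.
    The function A_H is the integrand of the action, carried over to T^*M, and
    the derivative of A_H along X_F is that of A_F along X_H, because {H,F} = 0
    and eta is closed.  So A_H o Phi_F^d - A_H is, up to o(d), a coboundary of
    the flow of H, and Phi_F^t preserves the action of invariant measures.

    For the Aubry set, fix a critical subsolution v.  For any other one u, the
    subsolution w = l u + (1 - l) v has, for l small, a graph that is close to
    that of v, with a Lipschitz constant depending only on v.  So there is e > 0,
    depending only on v, such that for |t| < e the image of the graph of eta + dw
    by Phi_F^t is the graph of eta + dw' for a C^{1,1} function w', obtained by
    integrating A_F along the flow; w' is critical by conservation of H.  If z
    is in the Aubry set, Phi_F^(-t) z is therefore on the graphs of both eta + dw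
    and eta + dv, hence on that of eta + du, as l <> 0. *)

Require Import Defs.
From HB Require Import structures.
From mathcomp Require Import all_boot all_order all_algebra.
From mathcomp Require Import all_classical all_reals all_analysis.
From mathcomp Require Import measurable_realfun.
From mathcomp Require Import ring lra.

Set Implicit Arguments.
Unset Strict Implicit.
Unset Printing Implicit Defensive.

Import Order.TTheory GRing.Theory Num.Theory.
Import numFieldNormedType.Exports.

Local Open Scope classical_set_scope.
Local Open Scope ring_scope.

(* A decision procedure for identities of vectors: both sides are expanded on
   the atoms and [ring] compares the coefficients. *)
Section module_identities.
Context {R : pzRingType} {V : lmodType R}.

Inductive vexp :=
  VZero | VAtom of nat | VAdd of vexp & vexp | VOpp of vexp | VScale of R & vexp.

Fixpoint veval (env : seq V) e : V :=
  match e with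
  | VZero => 0
  | VAtom k => nth 0 env k
  | VAdd a b => veval env a + veval env b
  | VOpp a => - veval env a
  | VScale r a => r *: veval env a
  end.

Fixpoint vcoef e (k : nat) : R :=
  match e with
  | VZero => 0
  | VAtom j => if Nat.eqb j k then 1 else 0
  | VAdd a b => vcoef a k + vcoef b k
  | VOpp a => - vcoef a k
  | VScale r a => r * vcoef a k
  end.

Fixpoint vbounded (n : nat) e : bool :=
  match e with
  | VZero => true
  | VAtom j => (j < n)%N
  | VAdd a b => vbounded n a && vbounded n b
  | VOpp a => vbounded n a
  | VScale r a => vbounded n a
  end.

Fixpoint vsame (n : nat) a b : Prop :=
  if n is m.+1 then vcoef a m = vcoef b m /\ vsame m a b else True.

Lemma veval_coef env e : vbounded (size env) e ->
  veval env e = \sum_(k < size env) vcoef e k *: nth 0 env k.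
Proof.
elim: e => [_|j /= jn|a IHa b IHb /= /andP[/IHa -> /IHb ->]|a IHa /= /IHa ->
  |r a IHa /= /IHa ->] /=.
- by rewrite big1 // => i _; rewrite scale0r.
- rewrite (bigD1 (Ordinal jn)) //= PeanoNat.Nat.eqb_refl scale1r big1 ?addr0 //.
  move=> i ij; case: PeanoNat.Nat.eqb_spec => [ji|]; last by rewrite scale0r.
  by move: ij; rewrite -val_eqE /= ji eqxx.
- by rewrite -big_split; apply: eq_bigr => i _; rewrite /= scalerDl.
- by rewrite -sumrN; apply: eq_bigr => i _; rewrite scaleNr.
- by rewrite scaler_sumr; apply: eq_bigr => i _; rewrite scalerA.
Qed.

Lemma vsameP n a b : vsame n a b -> forall k, (k < n)%N -> vcoef a k = vcoef b k.
Proof.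
by elim: n => // n IH [ab /IH{}IH] k; rewrite ltnS leq_eqVlt => /orP[/eqP->|/IH].
Qed.

Lemma veval_eq env a b : vbounded (size env) a -> vbounded (size env) b ->
  vsame (size env) a b -> veval env a = veval env b.
Proof.
move=> ba bb /vsameP ab; rewrite !veval_coef //.
by apply: eq_bigr => i _; rewrite ab.
Qed.

End module_identities.

Ltac vmem x l :=
  lazymatch l with
  | nil => constr:(false)
  | x :: _ => constr:(true)
  | _ :: ?l' => vmem x l'
  end.

Ltac vatoms l t :=
  lazymatch t with
  | (?a + ?b)%R => let l := vatoms l a in vatoms l b
  | (- ?a)%R => vatoms l a
  | (_ *: ?a)%R => vatoms l a
  | 0%R => l
  | _ => let b := vmem t l in
         lazymatch b with true => l | false => constr:(t :: l) end
  end.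

Ltac vindex x l :=
  lazymatch l with
  | x :: _ => constr:(0%N)
  | _ :: ?l' => let k := vindex x l' in constr:(S k)
  end.

Ltac vreify R l t :=
  lazymatch t with
  | (?a + ?b)%R =>
      let a' := vreify R l a in let b' := vreify R l b in constr:(@VAdd R a' b')
  | (- ?a)%R => let a' := vreify R l a in constr:(@VOpp R a')
  | (?r *: ?a)%R => let a' := vreify R l a in constr:(@VScale R r a')
  | 0%R => constr:(@VZero R)
  | _ => let k := vindex t l in constr:(@VAtom R k)
  end.

Ltac vring_over R :=
  lazymatch goal with
  | |- @eq ?T ?a ?b =>
      let l := vatoms (@nil T) a in
      let l := vatoms l b in
      let a' := vreify R l a in
      let b' := vreify R l b in
      apply: (@veval_eq R _ l a' b' isT isT); rewrite /vsame /=;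
      repeat split; ring
  end.

Ltac vring := match goal with R : realType |- _ => vring_over R end.

(** * Calculus in normed spaces *)

Section normed.
Context {R : realType}.
Implicit Types V W : normedModType R.

Lemma nearNP V (x : V) (P : V -> Prop) :
  (\forall y \near x, P y) <->
  exists2 d : R, 0 < d & forall y, `|y - x| < d -> P y.
Proof.
split=> [/nbhs_normP[d /= d0 dP]|[d d0 dP]].
  by exists d => // y yx; apply: dP; rewrite /= distrC.
by apply/nbhs_normP; exists d => //= y; rewrite /= distrC; exact: dP.
Qed.

Lemma le_epsN V (u : V) (K c : R) : 0 <= c ->
  (forall e : R, 0 < e -> `|u| <= (K + e) * c) -> `|u| <= K * c.
Proof.
move=> c0 H; apply/ler_addgt0Pr => e e0.
have c1 : 0 < c + 1 by lra.
apply: le_trans (H (e / (c + 1)) _) _; first exact: divr_gt0.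
rewrite mulrDl lerD2l -mulrA ler_piMr ?(ltW e0) // mulrC ler_pdivrMr //; lra.
Qed.

Lemma is_deriveNP V (c : R -> V) (t : R) (d : V) :
  is_derive t 1 c d <->
  forall e : R, 0 < e -> exists2 r : R, 0 < r &
    forall s, `|s - t| < r -> `|c s - c t - (s - t) *: d| <= e * `|s - t|.
Proof.
split=> [[dc dE] e e0|H].
  have := dc; rewrite /derivable => /cvg_ex[l ldc].
  have ld : l = d.
    by rewrite -dE /derive; apply/esym/cvg_lim => //; exact: norm_hausdorff.
  move/cvgrPdist_le : ldc => /(_ e e0); rewrite ld near_withinE => /nearNP[r r0 rP].
  exists r => // s sr; have [->|st] := eqVneq s t.
    by rewrite !subrr scale0r subr0 !normr0 mulr0.
  have st0 : s - t != 0 by rewrite subr_eq0.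
  have := rP (s - t); rewrite subr0 => /(_ sr st0).
  rewrite /= /shift /= scaler1 subrK => K.
  rewrite -[X in `|X - _|](scalerKV st0) -scalerBr normrZ mulrC.
  by rewrite ler_wpM2r // distrC.
have cv : h^-1 *: ((c \o shift t) (h *: 1) - c t) @[h --> 0^'] --> d.
  apply/cvgrPdist_le => e e0; rewrite near_withinE.
  apply: (proj2 (nearNP (0 : R^o) (fun h => h != 0 ->
    `|d - h^-1 *: ((c \o shift t) (h *: 1) - c t)| <= e))).
  have [r r0 rP] := H e e0; exists r => // h; rewrite subr0 => hr h0.
  rewrite /= /shift /= [h *: 1]mulr1.
  have := rP (h + t); rewrite addrK => /(_ hr) K.
  rewrite -[X in `|X - _|](scalerK h0) -scalerBr normrZ normfV.
  by rewrite ler_pdivrMl ?normr_gt0 // mulrC distrC.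
by split; [apply/cvg_ex; exists d|apply/cvg_lim => //; exact: norm_hausdorff].
Qed.

Lemma is_derive_continuous V (c : R -> V) (t : R) (d : V) :
  is_derive t 1 c d -> {for t, continuous c}.
Proof.
by case=> /derivable1_diffP /differentiable_continuous.
Qed.

Lemma is_derive_comp V W (c : R -> V) (f : V -> W) (t : R) (d : V) :
  is_derive t 1 c d -> differentiable f (c t) ->
  is_derive t 1 (f \o c) ('d f (c t) d).
Proof.
move=> [/derivable1_diffP dc <-] df.
have dfc : differentiable (f \o c) t by exact: differentiable_comp.
split; first by apply/derivable1_diffP.
by rewrite !deriveE // diff_comp.
Qed.

(* Real induction: the set of the good endpoints is closed and open to the
   right. *)
Lemma increment_le V (c : R -> V) (K a b : R) : a <= b ->
  (forall t, a <= t <= b -> exists2 r : R, 0 < r &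
    forall s, a <= s <= b -> `|s - t| < r -> `|c s - c t| <= K * `|s - t|) ->
  `|c b - c a| <= K * (b - a).
Proof.
move=> ab H.
pose A := [set t | a <= t <= b /\ forall s, a <= s <= t ->
  `|c s - c a| <= K * (s - a)].
have Aa : A a.
  split=> [|s /andP[h1 h2]]; first by rewrite lexx.
  have -> : s = a by apply: le_anti; rewrite h2.
  by rewrite !subrr normr0 mulr0.
have Ab : has_sup A by split; [exists a|exists b => t [/andP[]]].
set m := sup A.
have am : a <= m by apply: ub_le_sup => //; exact: Ab.2.
have mb : m <= b by apply: ge_sup; [exists a|move=> t [/andP[]]].
have mab : a <= m <= b by rewrite am.
have [r r0 rP] := H m mab.
have Alt s : a <= s -> s < m -> `|c s - c a| <= K * (s - a).
  move=> sa sm; have [|t At st] := @sup_adherent _ A (m - s) _ Ab.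
    by rewrite subr_gt0.
  apply: At.2; rewrite sa /=; rewrite -/m in st; lra.
have Km : `|c m - c a| <= K * (m - a).
  have [->|ma] := eqVneq m a; first by rewrite !subrr normr0 mulr0.
  have {}ma : a < m by rewrite lt_neqAle eq_sym ma am.
  pose s := Num.max a (m - r / 2).
  have sa : a <= s by rewrite le_max lexx.
  have sm : s < m by rewrite gt_max ma /=; lra.
  have sr : m - r / 2 <= s by rewrite le_max lexx orbT.
  have h1 := Alt s sa sm.
  have h2 : `|c s - c m| <= K * `|s - m|.
    apply: rP; first by lra.
    by rewrite ltr_norml; lra.
  rewrite -(subrK (c s) (c m)) -addrA; apply: (le_trans (ler_normD _ _)).
  have -> : K * (m - a) = K * (m - s) + K * (s - a) by ring.
  rewrite lerD // distrC; move: h2; rewrite (distrC s m) (ger0_norm (_ : 0 <= m - s)) //; lra.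
have Am : A m.
  split=> // s /andP[sa sm]; have [->//|sm'] := eqVneq s m.
  by apply: Alt => //; rewrite lt_neqAle sm'.
have [mb'|] := eqVneq m b; first by rewrite -mb'.
move=> mneq; have {mneq}mltb : m < b by rewrite lt_neqAle mneq.
pose s := Num.min b (m + r / 2).
have ms : m < s by rewrite lt_min mltb /=; lra.
have sb : s <= b by rewrite ge_min lexx.
have sr : s <= m + r / 2 by rewrite ge_min lexx orbT.
suff : s <= m by lra.
apply: ub_le_sup; first exact: Ab.2.
split; first by lra.
move=> u /andP[ua us]; have [um|um] := leP u m; first by apply: Am.2; lra.
have h2 : `|c u - c m| <= K * `|u - m|.
  apply: rP; first by lra.
  by rewrite ltr_norml; lra.
rewrite -(subrK (c m) (c u)) -addrA; apply: (le_trans (ler_normD _ _)).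
have -> : K * (u - a) = K * (u - m) + K * (m - a) by ring.
rewrite lerD //; move: h2; rewrite (ger0_norm (_ : 0 <= u - m)) //; lra.
Qed.

Lemma mean_value_le V (c dc : R -> V) (K a b : R) : a <= b ->
  (forall t, a <= t <= b -> is_derive t 1 c (dc t)) ->
  (forall t, a <= t <= b -> `|dc t| <= K) ->
  `|c b - c a| <= K * (b - a).
Proof.
move=> ab dcP dcK; apply: le_epsN => [|e e0]; first by lra.
apply: increment_le => // t tab.
have /is_deriveNP/(_ e e0)[r r0 rP] := dcP t tab; exists r => // s _ sr.
rewrite -(subrK ((s - t) *: dc t) (c s - c t)).
apply: (le_trans (ler_normD _ _)).
rewrite normrZ mulrDl addrC lerD ?rP // mulrC ler_wpM2r //; exact: dcK.
Qed.

Lemma local_lipschitz_segment V W (f : V -> W) (x y : V) (K : R) : 0 <= K ->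
  (forall t : R, 0 <= t <= 1 -> exists2 r : R, 0 < r &
    forall z, `|z - (x + t *: (y - x))| < r ->
      `|f z - f (x + t *: (y - x))| <= K * `|z - (x + t *: (y - x))|) ->
  `|f y - f x| <= K * `|y - x|.
Proof.
move=> K0 H; pose c t := f (x + t *: (y - x)).
have -> : f y = c 1 by rewrite /c scale1r addrC subrK.
have -> : f x = c 0 by rewrite /c scale0r addr0.
rewrite -[leRHS]mulr1 -[X in _ * X](subr0 1); apply: increment_le => // t t01.
have [r r0 rP] := H t t01.
have d1 : 0 < `|y - x| + 1 by rewrite ltr_wpDl.
exists (r / (`|y - x| + 1)); first exact: divr_gt0.
move=> s s01; rewrite ltr_pdivlMr // => sr.
have E : x + s *: (y - x) - (x + t *: (y - x)) = (s - t) *: (y - x).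
  by rewrite opprD addrACA subrr add0r scalerBl.
have := rP (x + s *: (y - x)); rewrite E normrZ.
have h : `|s - t| * `|y - x| < r.
  by apply: le_lt_trans sr; rewrite ler_wpM2l // lerDl.
by move=> /(_ h); rewrite /c (mulrC `|s - t|) mulrA.
Qed.

End normed.

Section calculus_in_normed_spaces.
Context {R : realType}.
Implicit Types V W : normedModType R.

Lemma is_derive_line V W (f : V -> W) (x v : V) (t : R) :
  differentiable f (x + t *: v) ->
  is_derive t 1 (fun s => f (x + s *: v)) ('D_v f (x + t *: v)).
Proof.
move=> df; rewrite deriveE //.
apply: (@is_derive_comp _ _ _ (fun s => x + s *: v)) => //.
apply/is_deriveNP => e e0; exists 1 => // s _.
rewrite opprD addrACA subrr add0r -scalerBl subrr normr0.
by rewrite mulr_ge0 // ltW.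
Qed.

Lemma continuousNP V W (f : V -> W) (x : V) : {for x, continuous f} ->
  forall e : R, 0 < e -> exists2 d : R, 0 < d &
    forall y, `|y - x| < d -> `|f y - f x| <= e.
Proof.
move=> /cvgrPdist_le fx e e0; have /nearNP[d d0 dP] := fx e e0.
by exists d => // y /dP; rewrite distrC.
Qed.

Lemma openNP V (U : set V) (x : V) : open U -> U x ->
  exists2 d : R, 0 < d & forall y, `|y - x| < d -> U y.
Proof. by move=> oU Ux; apply/nearNP; exact: open_nbhs_nbhs. Qed.

Lemma segment_ball V (x a b : V) (d t : R) : 0 <= t <= 1 ->
  `|a - x| < d -> `|b - x| < d -> `|b + t *: (a - b) - x| < d.
Proof.
move=> /andP[t0 t1] ad bd.
have -> : b + t *: (a - b) - x = t *: (a - x) + (1 - t) *: (b - x). by vring.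
apply: le_lt_trans (ler_normD _ _) _; rewrite !normrZ (ger0_norm t0).
rewrite (ger0_norm (_ : 0 <= 1 - t)) ?subr_ge0 //.
have [->|tn] := eqVneq t 0; first by rewrite mul0r add0r subr0 mul1r.
have tp : 0 < t by rewrite lt_neqAle eq_sym tn.
have -> : d = t * d + (1 - t) * d by ring.
rewrite ltr_leD //; first by rewrite ltr_pM2l.
by rewrite ler_wpM2l ?subr_ge0 // ltW.
Qed.

Record findim (V : normedModType R) := FinDim {
  fdI :> finType ;
  fde : fdI -> V ;
  fdc : fdI -> V -> R ;
  fdE : forall v, v = \sum_i fdc i v *: fde i ;
  fdB : forall i u v, fdc i (u - v) = fdc i u - fdc i v ;
  fd_le : forall i v, `|fdc i v| <= `|v|
}.

Arguments fde {V _} _.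
Arguments fdc {V _} _ _.
Arguments fdE {V} _ _.
Arguments fd_le {V _} _ _.

Lemma Ck1_sdiff V W (fd : findim V) (U : set V) (f : V -> W) (x : V) :
  open U -> U x -> Ck 1 U f ->
  forall e : R, 0 < e -> exists2 d : R, 0 < d & forall a b,
    `|a - x| < d -> `|b - x| < d ->
    `|f a - f b - 'd f x (a - b)| <= e * `|a - b|.
Proof.
move=> oU Ux [dfU DfU] e e0.
pose N : R := #|fd|%:R + 1.
have N0 : 0 < N by rewrite ltr_wpDl.
have eN : 0 < e / N by exact: divr_gt0.
have near_i : \forall z \near x, forall i : fd,
    `|'D_(fde i) f z - 'D_(fde i) f x| <= e / N.
  apply: filter_forall => i; apply/nearNP.
  by apply: continuousNP => //; exact: DfU.
have [d1 d10 d1P] := proj1 (nearNP _ _) near_i.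
have [d2 d20 d2P] := openNP oU Ux.
exists (Num.min d1 d2); first by rewrite lt_min d10.
move=> a b; rewrite !lt_min => /andP[a1 a2] /andP[b1 b2].
pose c t := f (b + t *: (a - b)) - t *: 'd f x (a - b).
have -> : f a - f b - 'd f x (a - b) = c 1 - c 0.
  by rewrite /c !scale1r !scale0r addr0 subr0 (addrC b) subrK addrAC.
rewrite -[leRHS]mulr1 -[X in _ * X](subr0 1).
apply: (@mean_value_le _ _ _
  (fun t => 'D_(a - b) f (b + t *: (a - b)) - 'd f x (a - b))) => // t t01.
  have zU : U (b + t *: (a - b)) by apply: d2P; exact: segment_ball.
  apply: is_deriveB; first by apply: is_derive_line; exact: dfU.
  by apply/is_deriveNP => r r0; exists 1 => // s _;
     rewrite -scalerBl subrr normr0 mulr_ge0 // ltW.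
set z := b + _; have zU : U z by apply: d2P; exact: segment_ball.
have zd1 : `|z - x| < d1 by exact: segment_ball.
rewrite deriveE; last exact: dfU.
have lin y : 'd f y (a - b) =
    \sum_(i : fd) fdc i (a - b) *: 'd f y (fde i).
  rewrite {1}(fdE fd (a - b)) linear_sum.
  by apply: eq_bigr => i _; rewrite linearZ.
rewrite !lin -sumrB.
apply: (le_trans (ler_norm_sum _ _ _)).
apply: (@le_trans _ _ (\sum_(i : fd) `|a - b| * (e / N))).
  apply: ler_sum => i _; rewrite -scalerBr normrZ.
  apply: ler_pM => //; first exact: fd_le.
  by have := d1P z zd1 i; rewrite !deriveE //; exact: dfU.
rewrite sumr_const -mulr_natl mulrCA [leRHS]mulrC ler_wpM2l //.
by rewrite mulrA ler_pdivrMr // mulrC ler_pM2l // lerDl.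
Qed.

Lemma Ck1_lipschitz V W (fd : findim V) (U : set V) (f : V -> W) (x : V) :
  open U -> U x -> Ck 1 U f ->
  exists2 L : R, 0 < L & exists2 d : R, 0 < d & forall a b,
    `|a - x| < d -> `|b - x| < d -> `|f a - f b| <= L * `|a - b|.
Proof.
move=> oU Ux Cf; have [d d0 dP] := Ck1_sdiff fd oU Ux Cf ltr01.
pose K : R := \sum_(i : fd) `|'d f x (fde i)|.
exists (1 + K); first by rewrite ltr_pwDl // sumr_ge0.
exists d => // a b ax bx.
rewrite -(subrK ('d f x (a - b)) (f a - f b)) mulrDl.
apply: (le_trans (ler_normD _ _)); rewrite lerD ?dP //.
rewrite [X in 'd f x X](fdE fd) linear_sum /K mulr_suml.
apply: (le_trans (ler_norm_sum _ _ _)); apply: ler_sum => i _.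
by rewrite linearZ normrZ mulrC ler_wpM2l // fd_le.
Qed.

Lemma schwarz V W (U : set V) (f : V -> W) (x a b : V) :
  open U -> U x -> Ck 2 U f ->
  'D_a (fun z => 'D_b f z) x = 'D_b (fun z => 'D_a f z) x.
Proof.
move=> oU Ux [dfU D2]; apply/eqP; rewrite -subr_eq0 -normr_le0.
have key : forall (a b : V) (e : R), 0 < e -> exists2 r : R, 0 < r &
    forall h : R, 0 < h -> h < r ->
    `|f (x + h *: a + h *: b) - f (x + h *: a) - f (x + h *: b) + f x
      - (h ^+ 2) *: 'D_b (fun z => 'D_a f z) x| <= e * h ^+ 2.
  move=> {}a {}b e e0.
  have cD : {for x, continuous (fun z => 'D_b (fun z => 'D_a f z) z)}.
    exact: (D2 a).2.
  have [d1 d10 d1P] := continuousNP cD e0.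
  have [d2 d20 d2P] := openNP oU Ux.
  pose d := Num.min d1 d2; have d0 : 0 < d by rewrite lt_min d10.
  pose N := `|a| + `|b| + 1; have N0 : 0 < N by rewrite ltr_wpDl ?addr_ge0.
  exists (d / N); first exact: divr_gt0.
  move=> h h0; rewrite ltr_pdivlMr // => hd.
  have near_x (s t : R) : 0 <= s <= h -> 0 <= t <= h ->
      `|x + s *: a + t *: b - x| < d.
    move=> /andP[s0 sh] /andP[t0 th].
    rewrite addrC !addrA addNr add0r; apply: le_lt_trans (ler_normD _ _) _.
    rewrite !normrZ (ger0_norm s0) (ger0_norm t0); apply: le_lt_trans hd.
    rewrite !mulrDr mulr1 -[leLHS]addr0 lerD ?(ltW h0) //.
    by rewrite lerD // ler_wpM2r.
  have in1 y : `|y - x| < d -> `|y - x| < d1 by rewrite lt_min => /andP[].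
  have in2 y : `|y - x| < d -> U y by rewrite lt_min => /andP[_ /d2P].
  have h00 : 0 <= (0 : R) <= h by rewrite lexx ltW.
  pose Dba : V -> W := 'D_b (fun z => 'D_a f z).
  rewrite -/(Dba x).
  pose phi s := f (x + h *: b + s *: a) - f (x + s *: a) - (s * h) *: Dba x.
  have -> : f (x + h *: a + h *: b) - f (x + h *: a) - f (x + h *: b) + f x
      - (h ^+ 2) *: Dba x = phi h - phi 0.
    rewrite /phi mul0r !scale0r !addr0 [x + h *: b + _]addrAC expr2.
    set f1 := f _; set f2 := f (x + h *: a); set f3 := f (x + h *: b).
    by set f4 := f x; set D := Dba x; vring.
  have -> : e * h ^+ 2 = e * h * (h - 0) by ring.
  apply: (@mean_value_le _ _ _ (fun s => 'D_a f (x + h *: b + s *: a)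
      - 'D_a f (x + s *: a) - h *: Dba x)); first exact: ltW.
    move=> s sh; apply: is_deriveB; first apply: is_deriveB.
    - apply: is_derive_line; apply: dfU; apply: in2.
      by rewrite [x + h *: b + _]addrAC; apply: near_x => //; rewrite lexx ltW.
    - apply: is_derive_line; apply: dfU; apply: in2.
      by have := near_x s 0 sh h00; rewrite scale0r addr0.
    - apply/is_deriveNP => r r0; exists 1 => // u _.
      by rewrite -scalerBl -mulrBl scalerA subrr normr0 mulr_ge0 // ltW.
  move=> s sh; pose psi t := 'D_a f (x + s *: a + t *: b) - t *: Dba x.
  have -> : 'D_a f (x + h *: b + s *: a) - 'D_a f (x + s *: a) - h *: Dba x
      = psi h - psi 0.
    rewrite /psi [x + h *: b + _]addrAC !scale0r addr0 subr0.
    by rewrite [LHS]addrAC.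
  have -> : e * h = e * (h - 0) by ring.
  apply: (@mean_value_le _ _ _ (fun t => Dba (x + s *: a + t *: b) - Dba x)).
  - exact: ltW.
  - move=> t th; apply: is_deriveB.
      apply: is_derive_line; apply: (D2 a).1; apply: in2; exact: near_x.
    by apply/is_deriveNP => r r0; exists 1 => // u _;
      rewrite -scalerBl subrr normr0 mulr_ge0 // ltW.
  - by move=> t th; apply: d1P; apply: in1; exact: near_x.
apply/ler_addgt0Pr => e e0; rewrite add0r.
have e2 : 0 < e / 2 by lra.
have [r1 r10 r1P] := key a b _ e2; have [r2 r20 r2P] := key b a _ e2.
pose h := Num.min r1 r2 / 2.
have m0 : 0 < Num.min r1 r2 by rewrite lt_min r10.
have h0 : 0 < h by rewrite /h; lra.
have hm : h < Num.min r1 r2 by rewrite /h; lra.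
move: hm; rewrite lt_min => /andP[hr1 hr2].
have K1 := r1P h h0 hr1; have K2 := r2P h h0 hr2.
have h20 : 0 < h ^+ 2 by rewrite exprn_gt0.
rewrite -(ler_pM2r h20) -[X in _ * X](ger0_norm (ltW h20)) mulrC -normrZ scalerBr.
set A := _ *: 'D_a _ _; set B := _ *: 'D_b _ _.
move: K1 K2; rewrite -/A -/B [x + h *: b + _]addrAC.
set f1 := f _; set f2 := f (x + h *: a); set f3 := f (x + h *: b).
move=> K1 K2.
have -> : A - B = (f1 - f2 - f3 + f x - B) - (f1 - f3 - f2 + f x - A).
  by vring.
apply: (le_trans (ler_normB _ _)); apply: (le_trans (lerD K1 K2)).
by rewrite -mulrDl -splitr.
Qed.

Lemma gronwall V (e de : R -> V) (L K t : R) : 0 <= L -> 0 <= K ->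
  L * `|t| <= 1 / 2 ->
  (forall s : R, `|s| <= `|t| -> is_derive s 1 e (de s)) ->
  (forall s : R, `|s| <= `|t| -> `|de s| <= L * `|e s| + K) ->
  `|e t| <= 2 * (`|e 0| + K * `|t|).
Proof.
move=> L0 K0.
have pos : forall (e de : R -> V) (t : R), 0 <= t -> L * t <= 1 / 2 ->
    (forall s, 0 <= s <= t -> is_derive s 1 e (de s)) ->
    (forall s, 0 <= s <= t -> `|de s| <= L * `|e s| + K) ->
    `|e t| <= 2 * (`|e 0| + K * t).
  move=> {}e {}de {}t t0 Lt dP dle.
  have cn : {within `[0, t], continuous (fun s => `|e s|)}.
    apply: continuous_in_subspaceT => s; rewrite inE /= in_itv /= => sP.
    apply: (@continuous_comp _ _ _ e (fun v : V => `|v|)).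
      by apply: is_derive_continuous; exact: dP.
    exact: norm_continuous.
  have [m mt mP] := EVT_max t0 cn.
  move: mt; rewrite in_itv /= => /andP[m0 mt].
  have M : `|e m - e 0| <= (L * `|e m| + K) * (m - 0).
    apply: (@mean_value_le _ _ _ de) => // s /andP[s0 sm].
      by apply: dP; rewrite s0 (le_trans sm).
    have st : 0 <= s <= t by rewrite s0 (le_trans sm).
    apply: (le_trans (dle s st)); rewrite lerD2r ler_wpM2l //.
    by apply: mP; rewrite in_itv.
  have em : `|e m| <= `|e 0| + `|e m - e 0|.
    by rewrite -{1}(subrK (e 0) (e m)) addrC; exact: ler_normD.
  have et : `|e t| <= `|e m| by apply: mP; rewrite in_itv /= t0 lexx.
  have Lm : L * m <= 1 / 2 by apply: le_trans Lt; rewrite ler_wpM2l.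
  have Lme : L * m * `|e m| <= 1 / 2 * `|e m| by rewrite ler_wpM2r.
  have Km : K * m <= K * t by rewrite ler_wpM2l.
  have := normr_ge0 (e m); rewrite subr0 in M; nra.
have [t0|t0] := leP 0 t.
  rewrite (ger0_norm t0) => Lt dP dle; apply: pos Lt _ _ => // s /andP[s0 st];
  [apply: dP|apply: dle]; by rewrite ger0_norm.
rewrite (ltr0_norm t0) => Lt dP dle.
have := pos (fun s => e (- s)) (fun s => - de (- s)) (- t).
rewrite opprK oppr0; apply => //; first by lra.
  move=> s /andP[s0 st].
  have D : is_derive (- s) 1 e (de (- s)) by apply: dP; rewrite normrN ger0_norm.
  apply/is_deriveNP => r r0.
  have /is_deriveNP/(_ r r0)[q q0 qP] := D; exists q => // u us.
  have := qP (- u); rewrite -opprD normrN => /(_ us).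
  by rewrite scaleNr scalerN.
by move=> s /andP[s0 st]; rewrite normrN; apply: dle; rewrite normrN ger0_norm.
Qed.

End calculus_in_normed_spaces.

Section picard.
Context {R : realType}.
Implicit Types V W : normedModType R.

Lemma between_norm (s t q : R) :
  Num.min s t <= q <= Num.max s t -> `|q - t| <= `|s - t|.
Proof.
case: (leP s t) => st /andP[h1 h2].
  by rewrite (ler0_norm (_ : s - t <= 0)) ?ler0_norm; lra.
by rewrite (ger0_norm (_ : 0 <= s - t)) ?ger0_norm; lra.
Qed.

Lemma mean_value_abs V (c dc : R -> V) (K s t : R) :
  (forall r : R, Num.min s t <= r <= Num.max s t ->
    is_derive r 1 c (dc r) /\ `|dc r| <= K) ->
  `|c s - c t| <= K * `|s - t|.
Proof.
wlog ts : s t / t <= s => [W H|].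
  have [/W|/ltW st] := leP t s; first by apply.
  by rewrite distrC (distrC s); apply: W => // r; rewrite minC maxC; exact: H.
rewrite (min_idPr ts) (max_idPl ts) => H.
rewrite (ger0_norm (_ : 0 <= s - t)) ?subr_ge0 //.
by apply: (@mean_value_le _ _ _ dc) => // r /H[].
Qed.


Lemma FTC_interval (f : R -> R) (T : R) : continuous f ->
  exists2 F : R -> R, F 0 = 0 &
    forall t : R, `|t| < T -> is_derive t 1 F (f t).
Proof.
move=> cf; pose a := - T - 1.
pose G x := (\int[lebesgue_measure]_(t in [set` `[a, x]]) (f t))%R.
have Gi y : lebesgue_measure.-integrable `[a, y] (EFin \o f).
  apply: continuous_compact_integrable; first exact: segment_compact.
  exact: continuous_subspaceT.
have GD x : a < x -> is_derive x 1 G (f x).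
  move=> ax; have xu : x < x + 1 by lra.
  have [D E] := continuous_FTC1_closed xu (Gi (x + 1)) ax (cf x).
  by split; [exact: D|rewrite -derive1E; exact: E].
exists (fun t => G t - G 0); first by rewrite subrr.
move=> t; rewrite ltr_norml => /andP[tT _].
have ta : a < t by rewrite /a; lra.
apply/is_deriveNP => e e0; have /is_deriveNP/(_ e e0)[r r0 rP] := GD t ta.
exists r => // s /rP; congr (`| _ - _ | <= _); ring.
Qed.

Definition has_primitives V := forall (f : R -> V) (T : R), continuous f ->
  exists2 F : R -> V, F 0 = 0 &
    forall t : R, `|t| < T -> is_derive t 1 F (f t).

Lemma is_derive_sum (V : normedModType R) (I : finType) (F : I -> R -> V)
    (dF : I -> V) (t : R) :
  (forall i, is_derive t 1 (F i) (dF i)) ->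
  is_derive t 1 (fun s => \sum_i F i s) (\sum_i dF i).
Proof.
move=> H; rewrite -big_enum.
have -> : (fun s => \sum_i F i s) = (fun s => \sum_(i <- enum I) F i s).
  by apply/funext => s; rewrite big_enum.
elim: (enum I) => [|i s IH].
  rewrite big_nil (_ : (fun s => _) = cst 0); first exact: is_derive_cst.
  by apply/funext => s; rewrite big_nil.
rewrite big_cons (_ : (fun s => _) = F i + (fun u => \sum_(j <- s) F j u)).
  exact: is_deriveD.
by apply/funext => u; rewrite big_cons.
Qed.

Lemma is_derive_scalel (V : normedModType R) (F : R -> R) (dF t : R) (v : V) :
  is_derive t 1 F dF -> is_derive t 1 (fun s => F s *: v) (dF *: v).
Proof.
move=> /is_deriveNP H; apply/is_deriveNP => e e0.
have v1 : 0 < `|v| + 1 by rewrite ltr_wpDl.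
have [r r0 rP] := H _ (divr_gt0 e0 v1); exists r => // s /rP K.
rewrite scalerA -!scalerBl normrZ.
apply: (@le_trans _ _ (e / (`|v| + 1) * `|s - t| * (`|v| + 1))).
  by rewrite ler_pM // lerDl.
by rewrite mulrAC divfK // gt_eqF.
Qed.

Lemma findim_primitives V : findim V -> has_primitives V.
Proof.
move=> fd f T cf.
have cfi (i : fd) : continuous (fun t => fdc i (f t)).
  move=> t; apply/cvgrPdist_le => e e0; apply/(@nearNP _ _ (t : R^o)).
  have [d d0 dP] := continuousNP (cf t) e0; exists d => // s /dP.
  by rewrite distrC -fdB; apply: le_trans; exact: fd_le.
have [F FP] := boolp.choice (fun i => (exists2P _ _).1 (FTC_interval T (cfi i))).
exists (fun t => \sum_(i : fd) F i t *: fde i).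
  by apply: big1 => i _; rewrite (FP i).1 scale0r.
move=> t tT; rewrite (fdE fd (f t)); apply: is_derive_sum => i.
by apply: is_derive_scalel; exact: (FP i).2.
Qed.

Lemma geometric_limit (u : nat -> R) (B : R) :
  (forall k, `|u k.+1 - u k| <= B / 2 ^+ k) ->
  exists l, forall k, `|u k - l| <= 2 * B / 2 ^+ k.
Proof.
move=> uB; pose d k := 2 * B / 2 ^+ k.
have dS k : d k = d k.+1 + B / 2 ^+ k.
  by rewrite /d exprS invfM; field; rewrite expf_neq0.
have dn k : 0 <= d k.
  rewrite /d -mulrA mulr_ge0 //; exact: le_trans (uB k).
have up j k : u j - d j <= u (j + k)%N - d (j + k)%N.
  elim: k => [|k IH]; rewrite ?addn0 // addnS (le_trans IH) // (dS (j + k)%N).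
  by have := uB (j + k)%N; rewrite ler_norml; lra.
have dw j k : u (j + k)%N + d (j + k)%N <= u j + d j.
  elim: k => [|k IH]; rewrite ?addn0 // addnS (le_trans _ IH) // (dS (j + k)%N).
  by have := uB (j + k)%N; rewrite ler_norml; lra.
have ud j k : u j - d j <= u k + d k.
  have := up j k; have := dw k j; rewrite addnC; have := dn (j + k)%N; lra.
pose l := sup (range (fun j => u j - d j)).
exists l => k; rewrite -/(d k).
have h1 : u k - d k <= l.
  apply: ub_le_sup; last by exists k.
  by exists (u k + d k) => _ [j _ <-].
have h2 : l <= u k + d k.
  by apply: ge_sup; [exists (u 0%N - d 0%N); exists 0%N|move=> _ [j _ <-]].
rewrite ler_norml; lra.
Qed.

Lemma findim_limit V (fd : findim V) (u : nat -> V) (B : R) :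
  (forall k, `|u k.+1 - u k| <= B / 2 ^+ k) ->
  exists l, forall k,
    `|u k - l| <= 2 * B / 2 ^+ k * \sum_(i : fd) `|fde i|.
Proof.
move=> uB; have [l lP] : exists l : fd -> R, forall i k,
    `|fdc i (u k) - l i| <= 2 * B / 2 ^+ k.
  have H (i : fd) : exists l, forall k, `|fdc i (u k) - l| <= 2 * B / 2 ^+ k.
    by apply: geometric_limit => k; rewrite -fdB (le_trans (fd_le _ _)).
  by have [l lP] := boolp.choice H; exists l.
exists (\sum_(i : fd) l i *: fde i) => k.
rewrite {1}(fdE fd (u k)) -sumrB mulr_sumr.
apply: (le_trans (ler_norm_sum _ _ _)); apply: ler_sum => i _.
by rewrite -scalerBl normrZ ler_wpM2r.
Qed.

Lemma le_pow2 (a b c : R) : 0 <= c ->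
  (forall k, a <= b + c / 2 ^+ k) -> a <= b.
Proof.
move=> c0 H; apply/ler_addgt0Pr => e e0.
have := upper_nthrootP (leqnn (Num.bound (c / e))); set k := Num.bound _ => K.
apply: (le_trans (H k)); rewrite lerD2l ler_pdivrMr ?exprn_gt0 //.
by rewrite mulrC -ler_pdivrMr // ltW.
Qed.

Lemma picard V (fd : findim V) (X : V -> V) (L T : R) (z : V) :
  0 < L -> L * T <= 1 / 2 ->
  (forall a b, `|X a - X b| <= L * `|a - b|) ->
  exists2 c : R -> V, c 0 = z &
    forall t : R, `|t| < T -> is_derive t 1 c (X (c t)).
Proof.
move=> L0 LT XL.
have [T0|T0] := leP T 0.
  exists (cst z) => // t tT; suff : `|t| < 0 by rewrite ltNge normr_ge0.
  exact: lt_le_trans tT T0.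
have cX : continuous X.
  move=> x; apply/cvgrPdist_le => e e0; apply/nearNP.
  exists (e / L); first exact: divr_gt0.
  move=> y; rewrite ltr_pdivlMr // mulrC distrC => yx.
  exact: le_trans (XL _ _) (ltW yx).
pose cl (t : R) := Num.max (- T) (Num.min t T).
have clin t : `|cl t| <= T.
  by rewrite ler_norml /cl le_max lexx /= ge_max ge_min lexx orbT; lra.
have clE t : `|t| <= T -> cl t = t.
  rewrite ler_norml => /andP[h1 h2]; rewrite /cl.
  by rewrite (min_idPl h2) (max_idPr h1).
have ccl : continuous cl.
  move=> t; apply: (@continuous_max _ _ (cst (- T)) (fun t => Num.min t T)).
    exact: cst_continuous.
  apply: (@continuous_min _ _ idfun (cst T)); last exact: cst_continuous.
  exact: cvg_id.
have step (c : R -> V) : continuous c -> exists F : R -> V,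
    [/\ continuous F, F 0 = z &
      forall t : R, `|t| < T -> is_derive t 1 F (X (c t))].
  move=> cc; have cXc : continuous (X \o c).
    by move=> t; apply: continuous_comp; [exact: cc|exact: cX].
  have [F F0 FD] := findim_primitives fd (T + 1) cXc.
  exists (fun t => z + F (cl t)); split.
  - move=> t; apply: (@continuousD _ _ _ (cst z) (F \o cl)).
      exact: cst_continuous.
    apply: continuous_comp; first exact: ccl.
    apply: is_derive_continuous; apply: FD.
    by apply: le_lt_trans (clin t) _; lra.
  - by rewrite clE ?normr0 ?(ltW T0) // F0 addr0.
  - move=> t tT; have /FD/is_deriveNP H : `|t| < T + 1 by lra.
    apply/is_deriveNP => e e0; have [r r0 rP] := H e e0.
    exists (Num.min r (T - `|t|)); first by rewrite lt_min r0 subr_gt0.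
    move=> s; rewrite lt_min => /andP[sr sT].
    have sT' : `|s| <= T.
      rewrite -(subrK t s); apply: le_trans (ler_normD _ _) _.
      by rewrite -lerBrDr ltW.
    rewrite !clE ?(ltW tT) //; have := rP s sr.
    by congr (`| _ - _| <= _); vring.
pose C := {c : R -> V | continuous c}.
have stepC (c : C) : exists F : C,
    [/\ projT1 F 0 = z &
      forall t : R, `|t| < T -> is_derive t 1 (projT1 F) (X (projT1 c t))].
  by case: c => c cc; have [F [cF F0 FD]] := step c cc; exists (exist _ F cF).
have [nxt nxtP] := boolp.choice stepC.
have cz : continuous (cst z : R -> V) by exact: cst_continuous.
pose g k : R -> V := projT1 (iter k.+1 nxt (exist _ _ cz)).
have g0 k : g k 0 = z by have [] := nxtP (iter k nxt (exist _ _ cz)).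
have gD k (t : R) : `|t| < T -> is_derive t 1 (g k.+1) (X (g k t)).
  by have [_] := nxtP (iter k.+1 nxt (exist _ _ cz)); apply.
have gD0 (t : R) : `|t| < T -> is_derive t 1 (g 0%N) (X z).
  by have [_] := nxtP (exist _ _ cz); apply.
have gc k : continuous (g k) by exact: (projT2 (iter k.+1 nxt (exist _ _ cz))).
have LT' : L * T <= 2^-1 by lra.
pose B := `|X z| * T.
have rT (r s t : R) : Num.min s t <= r <= Num.max s t ->
    `|s| < T -> `|t| < T -> `|r| < T.
  rewrite ge_min le_max !ltr_norml.
  by move=> /andP[/orP[?|?] /orP[?|?]] /andP[? ?] /andP[? ?]; apply/andP; split; lra.
have r0T (r t : R) : Num.min t 0 <= r <= Num.max t 0 -> `|t| < T -> `|r| < T.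
  by move=> H tT; apply: (rT r t 0); rewrite ?normr0.
have sub0 (c d : R -> V) (t : R) : c 0 = d 0 -> c t - d t = (c - d) t - (c - d) 0.
  by move=> cd; rewrite !fctE cd subrr subr0.
have gz (t : R) : `|t| < T -> `|g 0%N t - z| <= `|X z| * `|t|.
  move=> tT; have -> : g 0%N t - z = g 0%N t - g 0%N 0 by rewrite g0.
  rewrite -[X in _ * `|X|]subr0.
  apply: (@mean_value_abs _ _ (fun=> X z)) => r rt.
  by split=> //; apply: gD0; exact: (r0T r t).
have gB k (t : R) : `|t| < T -> `|g k.+1 t - g k t| <= B / 2 ^+ k.
  elim: k t => [|k IH] t tT; rewrite sub0 ?g0 //.
    apply: (@le_trans _ _ (`|X z| / 2 * `|t - 0|)).
      apply: (@mean_value_abs _ _ (fun r => X (g 0%N r) - X z)) => r /r0T/(_ tT) rT'.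
      split; first by apply: is_deriveB; [exact: gD|exact: gD0].
      apply: (le_trans (XL _ _)); apply: le_trans (ler_wpM2l (ltW L0) (gz r rT')) _.
      rewrite mulrCA ler_wpM2l // (le_trans _ LT') // ler_wpM2l ?(ltW L0) //.
      exact: ltW.
    rewrite expr0 divr1 subr0 /B -mulrA ler_wpM2l //.
    by have := normr_ge0 t; lra.
  apply: (@le_trans _ _ (L * (B / 2 ^+ k) * `|t - 0|)).
    apply: (@mean_value_abs _ _ (fun r => X (g k.+1 r) - X (g k r))) => r /r0T/(_ tT) rT'.
    split; first by apply: is_deriveB; exact: gD.
    by apply: (le_trans (XL _ _)); rewrite ler_wpM2l ?(ltW L0) // IH.
  have BK : 0 <= B / 2 ^+ k by rewrite divr_ge0 ?mulr_ge0 // ltW.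
  have -> : B / 2 ^+ k.+1 = B / 2 ^+ k / 2 by rewrite exprS invfM mulrA mulrAC.
  rewrite subr0 -mulrA mulrCA ler_wpM2l // (le_trans _ LT') //.
  by rewrite ler_wpM2l ?(ltW L0) ?(ltW tT).
pose D := 2 * B * \sum_(i : fd) `|fde i|.
have D0 : 0 <= D by rewrite !mulr_ge0 ?(ltW T0) // sumr_ge0.
have [c cP] : exists c : R -> V, forall t : R, `|t| < T ->
    forall k, `|g k t - c t| <= D / 2 ^+ k.
  have H (t : R) : exists l, `|t| < T -> forall k, `|g k t - l| <= D / 2 ^+ k.
    have [tT|tT] := ltP `|t| T; last by exists 0.
    have [l lP] := findim_limit fd (fun k => gB k t tT).
    by exists l => _ k; apply: le_trans (lP k) _; rewrite /D mulrAC.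
  by have [c cP] := boolp.choice H; exists c.
have c_cont (t : R) : `|t| < T -> forall e : R, 0 < e -> exists2 r : R, 0 < r &
    forall s, `|s - t| < r -> `|s| < T /\ `|c s - c t| <= e.
  move=> tT e e0; have e4 : 0 < e / 4 by lra.
  have [k kP] : exists k, D / 2 ^+ k <= e / 4.
    exists (Num.bound (D / (e / 4))).
    rewrite ler_pdivrMr ?exprn_gt0 // mulrC -ler_pdivrMr // ltW //.
    exact: upper_nthrootP.
  have [r r0 rP] := @continuousNP _ _ _ (g k) (t : R^o) (gc k t) _ e4.
  exists (Num.min r (T - `|t|)); first by rewrite lt_min r0 subr_gt0.
  move=> s; rewrite lt_min => /andP[sr sT].
  have sT' : `|s| < T.
    rewrite -(subrK t s); apply: le_lt_trans (ler_normD _ _) _.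
    by rewrite -ltrBrDr.
  split=> //.
  have -> : c s - c t = - (g k s - c s) + (g k s - g k t) + (g k t - c t) by vring.
  have h1 := le_trans (cP s sT' k) kP; have h2 := le_trans (cP t tT k) kP.
  have h3 := rP s sr.
  apply: le_trans (ler_normD _ _) _; rewrite -lerBrDr.
  apply: le_trans (ler_normD _ _) _; rewrite normrN; lra.
exists c.
  apply/eqP; rewrite -subr_eq0 -normr_le0; apply: (@le_pow2 _ _ D) => // k.
  by rewrite add0r distrC -(g0 k) cP ?normr0.
move=> t tT; apply/is_deriveNP => e e0.
have eL : 0 < e / L by exact: divr_gt0.
have [r r0 rP] := c_cont t tT _ eL; exists r => // s st.
have [sT _] := rP s st.
apply: (@le_pow2 _ _ (D * (2 + L * `|s - t|))) => [|k].
  by rewrite mulr_ge0 // addr_ge0 // mulr_ge0 // ltW.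
have stp : `|(g k.+1 s - s *: X (c t)) - (g k.+1 t - t *: X (c t))|
    <= L * (D / 2 ^+ k + e / L) * `|s - t|.
  apply: (@mean_value_abs _ (fun s => g k.+1 s - s *: X (c t))
    (fun r => X (g k r) - X (c t))) => q qst.
  have qT := rT _ _ _ qst sT tT; split.
    apply: is_deriveB; first exact: gD.
    by rewrite -[X in is_derive _ _ _ X]scale1r; apply: is_derive_scalel; exact: is_derive_id.
  apply: (le_trans (XL _ _)); rewrite ler_wpM2l ?(ltW L0) //.
  rewrite -(subrK (c q) (g k q)) -addrA; apply: (le_trans (ler_normD _ _)).
  rewrite lerD ?cP //; apply: (rP q _).2; apply: le_lt_trans st.
  exact: between_norm.
have h1 := cP s sT k.+1; have h2 := cP t tT k.+1.
have DS : D / 2 ^+ k.+1 <= D / 2 ^+ k.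
  by rewrite ler_wpM2l // lef_pV2 ?posrE ?exprn_gt0 // exprS ler_peMl ?exprn_ge0 // ler1n.
have -> : c s - c t - (s - t) *: X (c t) = - (g k.+1 s - c s) + (g k.+1 t - c t) +
   ((g k.+1 s - s *: X (c t)) - (g k.+1 t - t *: X (c t))) by vring.
apply: (le_trans (ler_normD _ _)).
apply: (le_trans (lerD (ler_normD _ _) (lexx _))); rewrite normrN.
have -> : e * `|s - t| + D * (2 + L * `|s - t|) / 2 ^+ k =
  D / 2 ^+ k + D / 2 ^+ k + L * (D / 2 ^+ k + e / L) * `|s - t|.
  by field; rewrite gt_eqF //= expf_neq0.
by rewrite !lerD // (le_trans _ DS).
Qed.

End picard.

Section local_solutions.
Context {R : realType}.
Implicit Types V W : normedModType R.

Lemma radial_retraction V (w0 : V) (rho : R) : 0 < rho ->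
  exists ret : V -> V, [/\ forall a b, `|ret a - ret b| <= 2 * `|a - b|,
    forall a, `|ret a - w0| <= rho & forall a, `|a - w0| <= rho -> ret a = a].
Proof.
move=> r0; pose m (u : V) := Num.max rho `|u|.
have mr u : rho <= m u by rewrite le_max lexx.
have mu u : `|u| <= m u by rewrite le_max lexx orbT.
have m0 u : 0 < m u by exact: lt_le_trans (mr u).
have mL u v : `|m u - m v| <= `|u - v|.
  have h := ler_dist_dist u v; rewrite /m; move: h.
  case: (leP rho `|u|); case: (leP rho `|v|) => h1 h2; rewrite ?subrr ?normr0 //.
    move=> h; apply: le_trans h; rewrite !ger0_norm; lra.
  move=> h; apply: le_trans h; rewrite !ler0_norm; lra.
exists (fun a => w0 + (rho / m (a - w0)) *: (a - w0)); split.
- move=> a b; set u := a - w0; set v := b - w0.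
  have -> : a - b = u - v by rewrite /u /v; vring.
  have E : w0 + rho / m u *: u - (w0 + rho / m v *: v) =
      (rho / m u) *: (u - v) + (rho / m u * ((m v - m u) / m v)) *: v.
    have -> : rho / m u * ((m v - m u) / m v) = rho / m u - rho / m v.
      by field; rewrite !gt_eqF.
    by vring.
  rewrite E; apply: le_trans (ler_normD _ _) _.
  rewrite (normrZ _ (u - v)) (normrZ _ v).
  have hu : `|rho / m u| <= 1.
    rewrite ger0_norm; last by rewrite divr_ge0 // ltW.
    by rewrite ler_pdivrMr // mul1r.
  have -> : 2 * `|u - v| = 1 * `|u - v| + 1 * `|u - v| by ring.
  apply: lerD; first by rewrite ler_wpM2r.
  rewrite normrM -mulrA; apply: ler_pM => //.
  rewrite normrM normfV (gtr0_norm (m0 v)) -mulrA distrC mulrC.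
  apply: le_trans (mL u v); rewrite ler_piMl // mulrC ler_pdivrMr // mul1r.
  exact: mu.
- move=> a; rewrite addrAC subrr add0r normrZ ger0_norm; last first.
    by rewrite divr_ge0 // ltW.
  by rewrite mulrAC ler_pdivrMr // ler_wpM2l // ltW.
- move=> a ar; rewrite /m (max_idPl ar) divff ?gt_eqF // scale1r.
  by rewrite addrC subrK.
Qed.

Lemma local_solution V (fd : findim V) (X : V -> V) (w0 z : V) (rho L B T : R) :
  0 < rho -> 0 < L -> 4 * L * T <= 1 -> B * T <= rho / 2 ->
  (forall a b, `|a - w0| <= rho -> `|b - w0| <= rho ->
    `|X a - X b| <= L * `|a - b|) ->
  (forall a, `|a - w0| <= rho -> `|X a| <= B) ->
  `|z - w0| <= rho / 2 ->
  exists2 c : R -> V, c 0 = z & forall t : R, `|t| < T ->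
    [/\ is_derive t 1 c (X (c t)), `|c t - w0| <= rho & `|c t - z| <= B * `|t|].
Proof.
move=> r0 L0 LT BT XL XB zr.
have [ret [retL retB retE]] := radial_retraction w0 r0.
have [c c0 cD] : exists2 c : R -> V, c 0 = z &
    forall t : R, `|t| < T -> is_derive t 1 c (X (ret (c t))).
  apply: (@picard _ _ fd (X \o ret) (2 * L)); [lra|lra|].
  move=> a b; apply: le_trans (XL _ _ (retB a) (retB b)) _.
  by rewrite (mulrC 2) -mulrA ler_wpM2l // ltW.
exists c => // t tT.
have ctz : `|c t - z| <= B * `|t|.
  rewrite -c0 -[t in leRHS]subr0; apply: (@mean_value_abs _ _ _ (fun t => X (ret (c t)))).
  move=> r /between_norm; rewrite !subr0 => rt; split; last exact: XB.
  by apply: cD; exact: le_lt_trans tT.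
have B0 : 0 <= B by apply: le_trans (XB w0 _); rewrite ?subrr ?normr0 // ltW.
have ctr : `|c t - w0| <= rho.
  have -> : c t - w0 = (c t - z) + (z - w0) by vring.
  apply: le_trans (ler_normD _ _) _.
  have : B * `|t| <= B * T by rewrite ler_wpM2l // ltW.
  lra.
by split=> //; have := cD t tT; rewrite retE.
Qed.

Lemma compare_solutions V (X : V -> V) (A : set V) (L T : R) (c d : R -> V) :
  0 <= L -> L * T <= 1 / 2 ->
  (forall a b, A a -> A b -> `|X a - X b| <= L * `|a - b|) ->
  (forall t : R, `|t| < T -> is_derive t 1 c (X (c t)) /\ A (c t)) ->
  (forall t : R, `|t| < T -> is_derive t 1 d (X (d t)) /\ A (d t)) ->
  forall t : R, `|t| < T -> `|c t - d t| <= 2 * `|c 0 - d 0| /\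
    `|(c t - d t) - (c 0 - d 0)| <= 2 * L * `|t| * `|c 0 - d 0|.
Proof.
move=> L0 LT XL cD dD.
have est (t : R) : `|t| < T -> `|c t - d t| <= 2 * `|c 0 - d 0|.
  move=> tT.
  have := @gronwall _ _ (c - d) (fun s => X (c s) - X (d s)) L 0 t L0 (lexx _).
  rewrite !fctE mul0r addr0; apply.
  - by apply: le_trans LT; rewrite ler_wpM2l // ltW.
  - move=> s st; have sT := le_lt_trans st tT.
    by apply: is_deriveB; [exact: (cD s sT).1|exact: (dD s sT).1].
  - move=> s st; have sT := le_lt_trans st tT; rewrite addr0.
    by apply: XL; [exact: (cD s sT).2|exact: (dD s sT).2].
move=> t tT; split; first exact: est.
have -> : 2 * L * `|t| * `|c 0 - d 0| = L * (2 * `|c 0 - d 0|) * `|t - 0|.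
  by rewrite subr0; ring.
apply: (@mean_value_abs _ _ (c - d) (fun s => X (c s) - X (d s))) => s /between_norm.
rewrite !subr0 => st; have sT := le_lt_trans st tT; split.
  by apply: is_deriveB; [exact: (cD s sT).1|exact: (dD s sT).1].
apply: le_trans (XL _ _ (cD s sT).2 (dD s sT).2) _.
by rewrite ler_wpM2l // est.
Qed.

Lemma diffNP V W (f : V -> W) (df : {linear V -> W}) (x : V) : continuous df ->
  (forall e : R, 0 < e -> exists2 d : R, 0 < d & forall y, `|y - x| < d ->
    `|f y - f x - df (y - x)| <= e * `|y - x|) ->
  differentiable f x /\ 'd f x = df :> (V -> W).
Proof.
move=> cdf H.
have E : f \o shift x = cst (f x) + df +o_ (0 : V) id.
  apply/eqaddoP => e e0; apply/nearNP; have [d d0 dP] := H e e0; exists d => // h.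
  rewrite subr0 => hd; have := dP (h + x); rewrite addrK => /(_ hd).
  by rewrite !fctE /= opprD addrA.
have dE := diff_unique cdf E.
by split => //; apply/diff_locallyP; rewrite dE.
Qed.

Lemma diff_nearN V W (f : V -> W) (x : V) : differentiable f x ->
  forall e : R, 0 < e -> exists2 d : R, 0 < d & forall y, `|y - x| < d ->
    `|f y - f x - 'd f x (y - x)| <= e * `|y - x|.
Proof.
move=> /diff_locallyP[_ /eqaddoP H] e e0.
have /nearNP[d d0 dP] := H e e0; exists d => // y yd.
have := dP (y - x); rewrite subr0 => /(_ yd); rewrite !fctE /= subrK.
by rewrite opprD addrA.
Qed.

Lemma near_differentiable V W (f g : V -> W) (x : V) :
  (\forall y \near x, f y = g y) -> differentiable f x ->
  differentiable g x /\ 'd g x = 'd f x :> (V -> W).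
Proof.
move=> fg df; apply: diffNP => [|e e0]; first exact: diff_continuous.
have [d d0 dP] := diff_nearN df e0; have [r r0 rP] := proj1 (nearNP _ _) fg.
exists (Num.min d r); first by rewrite lt_min d0.
move=> y; rewrite lt_min => /andP[yd yr].
by rewrite -(rP y yr) -(rP x) ?subrr ?normr0 // dP.
Qed.

Lemma Ck_eq V W k (U : set V) (f g : V -> W) : open U ->
  (forall x, U x -> f x = g x) -> Ck k U f -> Ck k U g.
Proof.
move=> oU; elim: k f g => [|k IH] f g fg.
  move=> cf x Ux; rewrite /prop_for /continuous_at -(fg x Ux).
  apply: cvg_trans (cf x Ux); apply: near_eq_cvg.
  by apply: filterS fg _; exact: open_nbhs_nbhs.
move=> [df Df]; have near_fg x : U x -> \forall y \near x, f y = g y.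
  by move=> Ux; apply: filterS fg _; exact: open_nbhs_nbhs.
split=> [x Ux|v]; first exact: (near_differentiable (near_fg x Ux) (df x Ux)).1.
apply: IH (Df v) => x Ux.
have [dg E] := near_differentiable (near_fg x Ux) (df x Ux).
rewrite (deriveE _ (df x Ux)) (deriveE _ dg).
exact: (congr1 (@^~ v) (esym E)).
Qed.

Lemma Ck_add V W k (U : set V) (f g : V -> W) : open U ->
  Ck k U f -> Ck k U g -> Ck k U (f + g).
Proof.
move=> oU; elim: k f g => [|k IH] f g; first by move=> cf cg x Ux; apply: continuousD; [exact: cf|exact: cg].
move=> [df Df] [dg Dg]; split=> [x Ux|v].
  by apply: differentiableD; [exact: df|exact: dg].
apply: Ck_eq (IH _ _ (Df v) (Dg v)) => // x Ux.
have dfx := df x Ux; have dgx := dg x Ux.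
rewrite fctE (deriveE _ dfx) (deriveE _ dgx) (deriveE _ (differentiableD dfx dgx)).
have E := diffD dfx dgx.
exact: (congr1 (@^~ v) (esym E)).
Qed.

Lemma Ck_cst V W k (U : set V) (w : W) : Ck k U (cst w : V -> W).
Proof.
elim: k w => [|k IH] w; first by move=> x _; exact: cst_continuous.
split=> [x _|v]; first exact: differentiable_cst.
have -> : (fun x => 'D_v (cst w : V -> W) x) = cst 0.
  by apply/funext => x; rewrite derive_cst.
exact: IH.
Qed.

Lemma Ck_lin V W W' k (U : set V) (f : V -> W) (l : {linear W -> W'}) :
  open U -> continuous l -> Ck k U f -> Ck k U (l \o f).
Proof.
move=> oU cl; elim: k f => [|k IH] f.
  by move=> cf x Ux; apply: continuous_comp; [exact: cf|exact: cl].
move=> [df Df]; have dl y : differentiable l y by exact: linear_differentiable.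
split=> [x Ux|v]; first by apply: differentiable_comp; [exact: df|exact: dl].
apply: Ck_eq (IH _ (Df v)) => // x Ux; have dfx := df x Ux.
rewrite /= (deriveE _ dfx) (deriveE _ (differentiable_comp dfx (dl (f x)))).
by rewrite (diff_comp dfx (dl (f x))) (diff_lin _ cl).
Qed.

Lemma Ck_scalel V W k (U : set V) (g : V -> R) (w : W) :
  open U -> Ck k U g -> Ck k U (fun x => g x *: w).
Proof.
move=> oU Cg.
pose l : R^o -> W := fun r => r *: w.
have ll : linear l by move=> r a b; rewrite /l scalerDl scalerA.
pose lB := GRing.isLinear.Build _ _ _ _ l ll.
pose lL : {linear R^o -> W} := HB.pack l lB.
apply: (@Ck_lin _ _ _ _ _ _ lL) => // r.
by apply: cvgZr_tmp; exact: cvg_id.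
Qed.

Lemma Ck_lincomb V W (I : finType) k (U : set V) (g : I -> V -> R) (w : I -> W) :
  open U -> (forall i, Ck k U (g i)) ->
  Ck k U (fun x => \sum_i g i x *: w i).
Proof.
move=> oU Cg.
have -> : (fun x => \sum_i g i x *: w i) = (fun x => \sum_(i <- enum I) g i x *: w i).
  by apply/funext => x; rewrite big_enum.
elim: (enum I) => [|i s IH].
  rewrite (_ : (fun x => _) = cst 0); first exact: Ck_cst.
  by apply/funext => x; rewrite big_nil.
rewrite (_ : (fun x => _) =
  (fun x => g i x *: w i) + (fun x => \sum_(j <- s) g j x *: w j)).
  by apply: Ck_add => //; apply: Ck_scalel.
by apply/funext => x; rewrite big_cons.
Qed.

Lemma CkS V W k (U : set V) (f : V -> W) : open U -> Ck k.+1 U f -> Ck k U f.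
Proof.
move=> oU; elim: k f => [|k IH] f [df Df].
  by move=> x Ux; apply: differentiable_continuous; exact: df.
by split=> // v; apply: IH.
Qed.

Lemma norm_row_coord n (v : 'rV[R]_n) (j : 'I_n) : `|v 0 j| <= `|v|.
Proof.
rewrite [leRHS]mx_normrE; apply: le_trans (le_bigmax _ _ (0, j)); exact: lexx.
Qed.

Lemma norm_row_le n (v : 'rV[R]_n) (K : R) : 0 <= K ->
  (forall j, `|v 0 j| <= K) -> `|v| <= K.
Proof.
move=> K0 H; rewrite [leLHS]mx_normrE; apply: bigmax_le => // -[i j] _ /=.
by rewrite ord1.
Qed.

Definition findim_row n : findim 'rV[R]_n.
Proof.
apply: (@FinDim _ _ 'I_n (fun j => delta_mx 0 j) (fun j v => v 0 j)).
- exact: row_sum_delta.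
- by move=> j u v; rewrite !mxE.
- by move=> j v; exact: norm_row_coord.
Defined.

Lemma norm_pair_le V W (z : V * W) (K : R) :
  `|z.1| <= K -> `|z.2| <= K -> `|z| <= K.
Proof. by move=> h1 h2; rewrite prod_normE ge_max h1. Qed.

Lemma norm_fst V W (z : V * W) : `|z.1| <= `|z|.
Proof. by rewrite prod_normE le_max lexx. Qed.

Lemma norm_snd V W (z : V * W) : `|z.2| <= `|z|.
Proof. by rewrite prod_normE le_max lexx orbT. Qed.

Definition findim_pair V W : findim V -> findim W -> findim (V * W)%type.
Proof.
move=> fV fW; apply: (@FinDim _ _ (fV + fW)%type
  (fun s => match s with inl i => (fde i, 0) | inr j => (0, fde j) end)
  (fun s z => match s with inl i => fdc i z.1 | inr j => fdc j z.2 end)).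
- move=> z; rewrite big_sumType /=.
  have sumE (I : finType) (f : I -> V) (g : I -> W) :
      \sum_k ((f k, g k) : V * W) = (\sum_k f k, \sum_k g k).
    by elim: (index_enum I) => [|a r IH]; rewrite ?big_nil // !big_cons IH.
  rewrite (eq_bigr (fun i => (fdc i z.1 *: fde i, 0))); last first.
    by move=> i _; congr pair; rewrite /= scaler0.
  rewrite [X in _ + X](eq_bigr (fun i => (0, fdc i z.2 *: fde i))); last first.
    by move=> i _; congr pair; rewrite /= scaler0.
  rewrite !sumE -!fdE !big1 //; case: z => a b.
  by congr pair; rewrite /= ?addr0 ?add0r.
- by move=> [i|j] u v; exact: fdB.
- move=> [i|j] v; apply: le_trans (fd_le _ _) _; [exact: norm_fst|exact: norm_snd].
Defined.

Lemma uniform_over_compact (T : topologicalType) (K : set T) (P : T -> R -> Prop) :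
  compact K ->
  (forall x, K x -> exists2 e : R, 0 < e &
    \forall y \near x, forall d : R, 0 < d -> d < e -> P y d) ->
  exists2 e : R, 0 < e & forall x d, K x -> 0 < d -> d < e -> P x d.
Proof.
move=> /compact_near_coveringP cK H.
have : \forall e \near (0 : R)^'+, K `<=` (fun x => P x e).
  apply: (cK R _ (fun e x => P x e)) => x Kx; have [e e0 He] := H x Kx.
  exists ([set y | forall d, 0 < d -> d < e -> P y d], [set d | 0 < d < e]) => /=.
    split=> //; have h1 := nbhs_right_gt (0 : R); have h2 := nbhs_right_lt e0.
    by apply: filterS (filterI h1 h2) => d [d0 de]; apply/andP.
  by move=> [y d] /= [Py /andP[]]; exact: Py.
rewrite /at_right near_withinE => /nbhs_ballP[e /= e0 eP].
exists e => // x d Kx d0 de; apply: eP => //.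
by rewrite /ball /= sub0r normrN gtr0_norm.
Qed.

End local_solutions.

(** * Charts of the cotangent bundle *)

Lemma mul_jacobian {R : realType} {n : nat} (m : nat) (f : 'rV[R]_n -> 'rV[R]_m)
  (y v : 'rV[R]_n) : v *m 'J f y = 'd f y v.
Proof. by rewrite /jacobian mul_rV_lin1. Qed.

(* Directional derivatives as a relation: rewriting with equations between
   differentials would make unification unfold them. *)
Section directional_derivatives.
Context {R : realType}.
Implicit Types V W : normedModType R.

Definition hasD V W (f : V -> W) (x h : V) (d : W) :=
  differentiable f x /\ 'd f x h = d.

Lemma hasD_self V W (f : V -> W) (x h : V) : differentiable f x -> hasD f x h ('d f x h).
Proof. by []. Qed.

Lemma hasD_uniq V W (f : V -> W) (x h : V) (d d' : W) :
  hasD f x h d -> hasD f x h d' -> d = d'.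
Proof. by move=> [_ <-] [_ <-]. Qed.

Lemma hasD_near V W (f g : V -> W) (x h : V) (d : W) :
  (\forall y \near x, f y = g y) -> hasD f x h d -> hasD g x h d.
Proof.
move=> E [df <-]; have [dg e] := near_differentiable E df.
by split; [exact: dg|exact: (congr1 (@^~ h) e)].
Qed.

Lemma hasD_comp V W W' (f : V -> W) (g : W -> W') (x h : V) (d : W) (e : W') :
  hasD f x h d -> hasD g (f x) d e -> hasD (g \o f) x h e.
Proof.
move=> [df <-] [dg <-]; split; first exact: differentiable_comp.
exact: (congr1 (@^~ h) (diff_comp df dg)).
Qed.

Lemma hasD_lin V W (l : {linear V -> W}) (x h : V) : continuous l -> hasD l x h (l h).
Proof. by move=> cl; split; [exact: linear_differentiable|rewrite diff_lin]. Qed.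

Lemma hasD_id V (x h : V) : hasD id x h h.
Proof. by split; [exact: ex_diff|rewrite diff_val]. Qed.

Lemma hasD_cst V W (w : W) (x h : V) : hasD (cst w) x h 0.
Proof. by split; [exact: differentiable_cst|rewrite diff_cst]. Qed.

Lemma hasD_fst V W (z h : V * W) : hasD (fst : V * W -> V) z h h.1.
Proof. by apply: hasD_lin => ?; exact: cvg_fst. Qed.

Lemma hasD_snd V W (z h : V * W) : hasD (snd : V * W -> W) z h h.2.
Proof. by apply: hasD_lin => ?; exact: cvg_snd. Qed.

Lemma hasD_pair V W W' (f : V -> W) (g : V -> W') (x h : V) (d : W) (e : W') :
  hasD f x h d -> hasD g x h e -> hasD (fun z => (f z, g z)) x h (d, e).
Proof.
move=> [df <-] [dg <-]; split; first exact: differentiable_pair.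
exact: (congr1 (@^~ h) (diff_pair df dg)).
Qed.

Lemma hasD_add V W (f g : V -> W) (x h : V) (d e : W) :
  hasD f x h d -> hasD g x h e -> hasD (fun z => f z + g z) x h (d + e).
Proof.
move=> [df <-] [dg <-]; split; first exact: differentiableD.
exact: (congr1 (@^~ h) (diffD df dg)).
Qed.

Lemma hasD_opp V W (f : V -> W) (x h : V) (d : W) :
  hasD f x h d -> hasD (fun z => - f z) x h (- d).
Proof.
move=> [df <-]; split; first exact: differentiableN.
exact: (congr1 (@^~ h) (diffN df)).
Qed.

Lemma hasD_sub V W (f g : V -> W) (x h : V) (d e : W) :
  hasD f x h d -> hasD g x h e -> hasD (fun z => f z - g z) x h (d - e).
Proof. by move=> hf hg; apply: hasD_add => //; exact: hasD_opp. Qed.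

Lemma hasD_derive V W (f : V -> W) (x h : V) (d : W) : hasD f x h d -> 'D_h f x = d.
Proof. by move=> [df <-]; exact: deriveE. Qed.

Lemma derive_hasD V W (f : V -> W) (x h : V) : differentiable f x -> hasD f x h ('D_h f x).
Proof. by move=> df; split=> //; rewrite deriveE. Qed.

Lemma hasD_curve V W (c : R -> V) (f : V -> W) (t : R) (v : V) (d : W) :
  is_derive t 1 c v -> hasD f (c t) v d -> is_derive t 1 (fun s => f (c s)) d.
Proof. by move=> hc [df <-]; exact: (is_derive_comp hc df). Qed.

End directional_derivatives.

Section charts.
Context {R : realType} {n : nat} {M : smooth_manifold R n}.
Implicit Types (i j k : chart_index M) (x : M) (y p v : 'rV[R]_n).

Lemma img_chart i x : chart_dom i x -> chart_img i (chart i x).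
Proof. by move=> ix; exists x. Qed.

Lemma chart_imgP i y : chart_img i y ->
  chart_dom i (chart_inv i y) /\ chart i (chart_inv i y) = y.
Proof. by case=> x ix <-; rewrite chartK. Qed.

Definition overlap i j : set 'rV[R]_n :=
  [set y | chart_img i y /\ chart_dom j (chart_inv i y)].

Lemma overlapE i j : overlap i j = chart i @` (chart_dom i `&` chart_dom j).
Proof.
apply/seteqP; split=> y /=.
  by move=> [iy jy]; have [h1 h2] := chart_imgP iy; exists (chart_inv i y).
by case=> x [ix jx] <-; split; [exact: img_chart|rewrite chartK].
Qed.

Lemma chart_img_isopen i : open (chart_img i).
Proof. exact: chart_img_open. Qed.

Lemma overlap_open i j : open (overlap i j).
Proof.
rewrite openE => y [iy jy].
have c := chart_inv_continuous iy.
apply: filterI.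
  by apply: open_nbhs_nbhs; split; [exact: chart_img_isopen|].
by apply: c; apply: open_nbhs_nbhs; split; [exact: chart_dom_open|].
Qed.

Lemma overlap_chart i j x : chart_dom i x -> chart_dom j x -> overlap i j (chart i x).
Proof. by move=> ix jx; split; [exact: img_chart|rewrite chartK]. Qed.

Lemma overlap_id i y : chart_img i y -> overlap i i y.
Proof. by move=> iy; split=> //; have [] := chart_imgP iy. Qed.

Lemma Ck_transition (m : nat) i j : Ck m (overlap i j) (transition i j).
Proof. by rewrite overlapE; exact: transition_smooth. Qed.

Lemma transition_chart i j x : chart_dom i x -> transition i j (chart i x) = chart j x.
Proof. by move=> ix; rewrite /transition /= chartK. Qed.

Lemma overlap_transition i j y : overlap i j y -> overlap j i (transition i j y).
Proof.
move=> [iy jy]; have [h1 h2] := chart_imgP iy.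
by rewrite /transition /=; apply: overlap_chart.
Qed.

Lemma chart_inv_transition i j y : overlap i j y ->
  chart_inv j (transition i j y) = chart_inv i y.
Proof. by move=> [iy jy]; rewrite /transition /= chartK. Qed.

Lemma transition_comp i j k y : overlap i j y ->
  transition j k (transition i j y) = transition i k y.
Proof. by move=> ij; rewrite {1}/transition /= chart_inv_transition. Qed.

Lemma transition_id i y : chart_img i y -> transition i i y = y.
Proof. by move=> iy; rewrite /transition /=; have [] := chart_imgP iy. Qed.

Lemma differentiable_transition i j y : overlap i j y ->
  differentiable (transition i j) y.
Proof. by move=> ij; have [+ _] := Ck_transition 1 i j; apply. Qed.

Lemma mx_eqP (m m' : nat) (A B : 'M[R]_(m, m')) :
  (forall v : 'rV[R]_m, v *m A = v *m B) -> A = B.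
Proof. by move=> H; apply/row_matrixP => r; rewrite !rowE. Qed.

Lemma mul_tr_tr (m m' m'' : nat) (u : 'rV[R]_m) (A : 'M[R]_(m', m))
    (B : 'M[R]_(m'', m')) : u *m A^T *m B^T = u *m (B *m A)^T.
Proof. by rewrite trmx_mul mulmxA. Qed.

Lemma jacobian_comp i j k y : overlap i j y -> overlap i k y ->
  'J (transition i k) y =
  'J (transition i j) y *m 'J (transition j k) (transition i j y).
Proof.
move=> ij ik; apply: mx_eqP => v.
have -> : v *m ('J (transition i j) y *m 'J (transition j k) (transition i j y)) =
  v *m 'J (transition i j) y *m 'J (transition j k) (transition i j y).
  exact: mulmxA.
rewrite [LHS]mul_jacobian [X in X *m _]mul_jacobian [RHS]mul_jacobian.
have jk : overlap j k (transition i j y).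
  split; first by have [] := overlap_transition ij.
  by rewrite chart_inv_transition //; case: ik.
have E : \forall z \near y, (transition j k \o transition i j) z = transition i k z.
  have : nbhs y (overlap i j).
    by apply: open_nbhs_nbhs; split; [exact: overlap_open|].
  by apply: filterS => z zij; exact: transition_comp.
have dij := differentiable_transition ij; have djk := differentiable_transition jk.
have D1 : hasD (transition j k \o transition i j) y v
    ('d (transition j k) (transition i j y) ('d (transition i j) y v)).
  exact: hasD_comp (hasD_self v dij) (hasD_self _ djk).
exact: (hasD_near E D1).2.
Qed.

Lemma jacobian_id i y : chart_img i y -> 'J (transition i i) y = 1%:M.
Proof.
move=> iy; apply: mx_eqP => v; rewrite mul_jacobian mulmx1.
have E : \forall z \near y, id z = transition i i z.
  have : nbhs y (chart_img i).
    by apply: open_nbhs_nbhs; split; [exact: chart_img_isopen|].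
  by apply: filterS => z zi; rewrite transition_id.
exact: (hasD_near E (hasD_id y v)).2.
Qed.

Lemma jacobianK i j y : overlap i j y ->
  'J (transition i j) y *m 'J (transition j i) (transition i j y) = 1%:M.
Proof.
move=> ij; rewrite -jacobian_comp //; first exact: jacobian_id ij.1.
exact: overlap_id ij.1.
Qed.

Definition cotangent_transition i j (z : 'rV[R]_n * 'rV[R]_n) :
    'rV[R]_n * 'rV[R]_n :=
  (transition i j z.1,
   z.2 *m ('J (transition j i) (transition i j z.1))^T).

Definition tangent_transition i j (z : 'rV[R]_n * 'rV[R]_n) :
    'rV[R]_n * 'rV[R]_n :=
  (transition i j z.1, z.2 *m 'J (transition i j) z.1).

Lemma dom_chart_at x : chart_dom (chart_at x) x.
Proof. exact: mem_chart_at. Qed.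

Lemma cotangent_chart_trans i j (w : 'rV[R]_n * 'rV[R]_n) : overlap i j w.1 ->
  cotangent_chart j (cotangent_chart_inv i w) = cotangent_transition i j w.
Proof.
move=> ij; have [iy jy] := ij; set x := chart_inv i w.1 in jy *.
have [ix wE] := chart_imgP iy; rewrite -/x in ix wE.
have cx := dom_chart_at x; set c := chart_at x in cx *.
rewrite /cotangent_chart /cotangent_chart_inv /cotangent_transition /= -/x -/c.
have tE : transition i j w.1 = chart j x by [].
rewrite tE mul_tr_tr.
have jc : overlap j c (chart j x) by exact: overlap_chart.
have ji : overlap j i (chart j x) by exact: overlap_chart.
have E := jacobian_comp jc ji; rewrite (@transition_chart j c x jy) in E.
by rewrite -E.
Qed.

Lemma tangent_chart_trans i j (w : 'rV[R]_n * 'rV[R]_n) : overlap i j w.1 ->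
  tangent_chart j (tangent_chart_inv i w) = tangent_transition i j w.
Proof.
move=> ij; have [iy jy] := ij; set x := chart_inv i w.1 in jy *.
have [ix wE] := chart_imgP iy; rewrite -/x in ix wE.
have cx := dom_chart_at x; set c := chart_at x in cx *.
rewrite /tangent_chart /tangent_chart_inv /tangent_transition /= -/x -/c.
have tE : transition i j w.1 = chart j x by [].
have ic : overlap i c w.1 by rewrite -wE; exact: overlap_chart.
have E := jacobian_comp ic ij.
have cE : transition i c w.1 = chart c x by [].
rewrite cE in E; rewrite tE E.
by rewrite [X in (_, X) = _](_ : _ = w.2 *m ('J (transition i c) w.1 *m
  'J (transition c j) (chart c x))) //; rewrite mulmxA.
Qed.

Lemma cotangent_transition_id i w : chart_img i w.1 -> cotangent_transition i i w = w.
Proof.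
move=> iw; rewrite /cotangent_transition transition_id // jacobian_id //.
by rewrite trmx1 mulmx1; case: w iw.
Qed.

Lemma cotangent_chartK i (w : 'rV[R]_n * 'rV[R]_n) : chart_img i w.1 ->
  cotangent_chart i (cotangent_chart_inv i w) = w.
Proof.
move=> iw; rewrite cotangent_chart_trans ?cotangent_transition_id //.
exact: overlap_id.
Qed.

Lemma cotangent_chart_invK i (z : cotangent_bundle M) : chart_dom i z.1 ->
  cotangent_chart_inv i (cotangent_chart i z) = z.
Proof.
case: z => x p /= ix; rewrite /cotangent_chart_inv /cotangent_chart /= chartK //.
congr pair; set c := chart_at x; have cx : chart_dom c x := dom_chart_at x.
rewrite mul_tr_tr -(transition_chart i cx) jacobianK; last exact: overlap_chart.
by rewrite trmx1 mulmx1.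
Qed.

Lemma tangent_chart_invK i (z : tangent_bundle M) : chart_dom i z.1 ->
  tangent_chart_inv i (tangent_chart i z) = z.
Proof.
case: z => x p /= ix; rewrite /tangent_chart_inv /tangent_chart /= chartK //.
congr pair; set c := chart_at x; have cx : chart_dom c x := dom_chart_at x.
have ci := overlap_chart cx ix; rewrite -(transition_chart i cx).
have E := jacobianK ci.
by rewrite -[LHS]mulmxA E mulmx1.
Qed.

Lemma cotangent_chart_at (z : cotangent_bundle M) :
  cotangent_chart (chart_at z.1) z = (chart (chart_at z.1) z.1, z.2).
Proof.
rewrite /cotangent_chart jacobian_id ?trmx1 ?mulmx1 //.
exact: img_chart (dom_chart_at _).
Qed.

Lemma tangent_chart_at (z : tangent_bundle M) :
  tangent_chart (chart_at z.1) z = (chart (chart_at z.1) z.1, z.2).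
Proof.
rewrite /tangent_chart jacobian_id ?mulmx1 //.
exact: img_chart (dom_chart_at _).
Qed.

Lemma jacobian_coord i j y (r s : 'I_n) : overlap i j y ->
  'J (transition i j) y r s = 'D_(delta_mx 0 r) (transition i j) y 0 s.
Proof.
move=> ij; rewrite deriveEjacobian; last exact: differentiable_transition.
by rewrite -rowE [RHS]mxE.
Qed.

End charts.

Section pairing.
Context {R : realType}.
Implicit Types V : normedModType R.

Lemma differentiable_rowP m V (f : V -> 'rV[R]_m) (x : V) :
  (forall r, differentiable (fun z => f z 0 r : R) x) -> differentiable f x.
Proof.
move=> H; pose e (r : 'I_m) := delta_mx 0 r : 'rV[R]_m.
have -> : f = \sum_r (fun z => f z 0 r *: e r).
  by apply/funext => z; rewrite fct_sumE {1}(row_sum_delta (f z)).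
by apply: differentiable_sum => r; exact: differentiableZl.
Qed.

Lemma differentiable_row_coord m V (f : V -> 'rV[R]_m) (x : V) r :
  differentiable f x -> differentiable (fun z => f z 0 r : R) x.
Proof.
move=> df; apply: (@differentiable_comp _ _ _ _ f (fun N : 'rV[R]_m => N 0 r : R)) => //.
exact: differentiable_coord.
Qed.

Lemma derive_row_coord m V (f : V -> 'rV[R]_m) (x h : V) r :
  differentiable f x -> 'D_h (fun z => f z 0 r : R) x = ('D_h f x) 0 r.
Proof. by move=> df; rewrite derive_mx ?mxE //; exact: diff_derivable. Qed.

Lemma pairingE m (p v : 'rV[R]_m) : pairing p v = \sum_j p 0 j * v 0 j.
Proof. by rewrite /pairing mxE; apply: eq_bigr => j _; rewrite mxE. Qed.

Lemma pairingC m (p v : 'rV[R]_m) : pairing p v = pairing v p.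
Proof. by rewrite !pairingE; apply: eq_bigr => j _; rewrite mulrC. Qed.

Lemma pairingDl m (p q v : 'rV[R]_m) : pairing (p + q) v = pairing p v + pairing q v.
Proof. by rewrite /pairing mulmxDl mxE. Qed.

Lemma pairingDr m (p v w : 'rV[R]_m) : pairing p (v + w) = pairing p v + pairing p w.
Proof. by rewrite !(pairingC p) pairingDl. Qed.

Lemma pairingZl m (a : R) (p v : 'rV[R]_m) : pairing (a *: p) v = a * pairing p v.
Proof. by rewrite /pairing -scalemxAl mxE. Qed.

Lemma pairingZr m (a : R) (p v : 'rV[R]_m) : pairing p (a *: v) = a * pairing p v.
Proof. by rewrite pairingC pairingZl pairingC. Qed.

Lemma pairingNl m (p v : 'rV[R]_m) : pairing (- p) v = - pairing p v.
Proof. by rewrite -scaleN1r pairingZl mulN1r. Qed.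

Lemma pairingNr m (p v : 'rV[R]_m) : pairing p (- v) = - pairing p v.
Proof. by rewrite pairingC pairingNl pairingC. Qed.

Lemma pairingBl m (p q v : 'rV[R]_m) : pairing (p - q) v = pairing p v - pairing q v.
Proof. by rewrite pairingDl pairingNl. Qed.

Lemma pairingBr m (p v w : 'rV[R]_m) : pairing p (v - w) = pairing p v - pairing p w.
Proof. by rewrite pairingDr pairingNr. Qed.

Lemma pairing0l m (v : 'rV[R]_m) : pairing 0 v = 0.
Proof. by rewrite -(scale0r 0) pairingZl mul0r. Qed.

Lemma pairing0r m (p : 'rV[R]_m) : pairing p 0 = 0.
Proof. by rewrite pairingC pairing0l. Qed.

Lemma pairing_delta m (p : 'rV[R]_m) j : pairing p (delta_mx 0 j) = p 0 j.
Proof.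
rewrite pairingE (bigD1 j) //= mxE !eqxx mulr1 big1 ?addr0 // => i ij.
by rewrite mxE eqxx /= (negbTE ij) mulr0.
Qed.

Lemma pairing_mul m k (p : 'rV[R]_m) (A : 'M[R]_(m, k)) (v : 'rV[R]_k) :
  pairing p (v *m A^T) = pairing (p *m A) v.
Proof. by rewrite /pairing trmx_mul trmxK mulmxA. Qed.

Lemma pairing_eq m (p q : 'rV[R]_m) : (forall v, pairing p v = pairing q v) -> p = q.
Proof. by move=> H; apply/rowP => j; rewrite -!pairing_delta. Qed.

Lemma pairing_le m (p v : 'rV[R]_m) : `|pairing p v| <= m%:R * (`|p| * `|v|).
Proof.
rewrite pairingE; apply: le_trans (ler_norm_sum _ _ _) _.
apply: (@le_trans _ _ (\sum_(j < m) `|p| * `|v|)).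
  by apply: ler_sum => j _; rewrite normrM ler_pM // norm_row_coord.
by rewrite sumr_const card_ord mulr_natl.
Qed.

Lemma hasD_pairing m V (f g : V -> 'rV[R]_m) (x h : V) (d e : 'rV[R]_m) :
  hasD f x h d -> hasD g x h e ->
  hasD (fun z => pairing (f z) (g z)) x h (pairing d (g x) + pairing (f x) e).
Proof.
move=> [df dE] [dg eE].
have dfj j := differentiable_row_coord j df.
have dgj j := differentiable_row_coord j dg.
have E : (fun z => pairing (f z) (g z)) =
    \sum_j ((fun z => f z 0 j) * (fun z => g z 0 j) : V -> R).
  by apply/funext => z; rewrite fct_sumE pairingE.
have D : differentiable (fun z => pairing (f z) (g z)) x.
  by rewrite E; apply: differentiable_sum => j; exact: differentiableM.
split; first exact: D.
rewrite -(deriveE h D).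
have dfg j : derivable ((fun z => f z 0 j) * (fun z => g z 0 j) : V -> R) x h.
  by apply: diff_derivable; exact: differentiableM.
rewrite E (derive_sum dfg) !pairingE -big_split; apply: eq_bigr => j _.
have h1 := diff_derivable (v := h) (dfj j); have h2 := diff_derivable (v := h) (dgj j).
rewrite (deriveM h1 h2) (derive_row_coord h j df) (derive_row_coord h j dg).
have fE : 'D_h f x = d by exact: hasD_derive (conj df dE).
have gE : 'D_h g x = e by exact: hasD_derive (conj dg eE).
rewrite -fE -gE; apply: etrans (addrC _ _) _.
by apply: (f_equal2 +%R); [exact: mulrC|].
Qed.

End pairing.

Section cotangent_transitions.
Context {R : realType} {n : nat} {M : smooth_manifold R n}.
Implicit Types (i j k : chart_index M) (z w a b : 'rV[R]_n * 'rV[R]_n).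

Lemma open_fst (V W : normedModType R) (U : set V) : open U ->
  open [set w : V * W | U w.1].
Proof. by move=> oU; apply: open_comp => // w _; exact: cvg_fst. Qed.

Lemma near_overlap i j (z : 'rV[R]_n * 'rV[R]_n) : overlap i j z.1 ->
  \forall w \near z, overlap i j w.1.
Proof.
move=> ij; have : nbhs z [set w : 'rV[R]_n * 'rV[R]_n | overlap i j w.1].
  by apply: open_nbhs_nbhs; split; [apply: open_fst; exact: overlap_open|].
by [].
Qed.

Lemma hasD_comp_fst (V W V' : normedModType R) (f : V -> V') (z h : V * W) (d : V') :
  hasD f z.1 h.1 d -> hasD (fun w : V * W => f w.1) z h d.
Proof. exact: hasD_comp (hasD_fst z h). Qed.

Lemma cotangent_transition_coord i j (z : 'rV[R]_n * 'rV[R]_n) (r : 'I_n) :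
  overlap i j z.1 -> (cotangent_transition i j z).2 0 r =
  pairing z.2 ('D_(delta_mx 0 r) (transition j i) (transition i j z.1)).
Proof.
move=> ij; have ji := overlap_transition ij.
rewrite pairingE /cotangent_transition [LHS]mxE; apply: eq_bigr => s _.
by rewrite [X in _ * X]mxE jacobian_coord.
Qed.

Lemma differentiable_derive_transition i j (y v : 'rV[R]_n) : overlap i j y ->
  differentiable (fun y => 'D_v (transition i j) y) y.
Proof. by have [_ /(_ v)[+ _]] := Ck_transition 2 i j; apply. Qed.

Lemma differentiable_cotangent_transition i j z : overlap i j z.1 ->
  differentiable (cotangent_transition i j) z.
Proof.
move=> ij; have ji := overlap_transition ij.
have dij := differentiable_transition ij.
have [d1 _] := hasD_comp_fst (hasD_self (0 : 'rV[R]_n * 'rV[R]_n).1 dij).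
apply: differentiable_pair => //; apply: differentiable_rowP => r.
have Dji := differentiable_derive_transition (delta_mx 0 r) ji.
have [D3 _] := hasD_pairing (hasD_snd z 0)
  (hasD_comp_fst (hasD_comp (hasD_self (0 : 'rV[R]_n * 'rV[R]_n).1 dij) (hasD_self _ Dji))).
apply: (near_differentiable _ D3).1.
by apply: filterS (near_overlap ij) => w wij; rewrite cotangent_transition_coord.
Qed.

Lemma cotangent_transition_pairing i j z (v : 'rV[R]_n) : overlap i j z.1 ->
  pairing (cotangent_transition i j z).2 ('D_v (transition i j) z.1) = pairing z.2 v.
Proof.
move=> ij; rewrite deriveEjacobian; last exact: differentiable_transition.
rewrite pairingC /cotangent_transition pairing_mul pairingC.
have E := jacobianK ij; congr (pairing _ _).
by rewrite -[LHS]mulmxA E mulmx1.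
Qed.

Lemma omega_cotangent_transition i j z a b : overlap i j z.1 ->
  omega ('d (cotangent_transition i j) z a) ('d (cotangent_transition i j) z b) =
  omega a b.
Proof.
move=> ij; pose T := cotangent_transition i j; pose t := transition i j.
have dT := differentiable_cotangent_transition ij.
have dt := differentiable_transition ij.
have D1 (h : 'rV[R]_n * 'rV[R]_n) : ('d T z h).1 = 'D_h.1 t z.1.
  apply: (@hasD_uniq _ _ _ (fun w => (T w).1) z h).
    exact: hasD_comp (hasD_self h dT) (hasD_fst _ _).
  exact: hasD_comp_fst (derive_hasD _ dt).
have D2 (h : 'rV[R]_n * 'rV[R]_n) : hasD (fun w => (T w).2) z h ('d T z h).2.
  exact: hasD_comp (hasD_self h dT) (hasD_snd _ _).
(* differentiate the invariance of the canonical form along [h] *)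
have key (c h : 'rV[R]_n * 'rV[R]_n) :
    pairing ('d T z h).2 ('d T z c).1 +
    pairing (T z).2 ('D_h.1 (fun y => 'D_c.1 t y) z.1) = pairing h.2 c.1.
  have Dc := differentiable_derive_transition c.1 ij.
  have h1 := hasD_pairing (D2 h) (hasD_comp_fst (derive_hasD h.1 Dc)).
  have h2 := hasD_pairing (hasD_snd z h) (hasD_cst c.1 z h).
  rewrite D1; move: h2; rewrite pairing0r addr0 /= => h2.
  apply: hasD_uniq h1 _; apply: hasD_near h2.
  apply: filterS (near_overlap ij) => w wij.
  by rewrite (cotangent_transition_pairing c.1 wij).
have S : 'D_a.1 (fun y => 'D_b.1 t y) z.1 = 'D_b.1 (fun y => 'D_a.1 t y) z.1.
  exact: (schwarz a.1 b.1 (@overlap_open _ _ _ i j) ij (@Ck_transition _ _ _ 2 i j)).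
have k1 := key b a; have k2 := key a b; rewrite S in k1.
rewrite /omega -/T (pairingC ('d T z a).1) (pairingC a.1).
by rewrite -k1 -k2 opprD addrACA subrr addr0.
Qed.

End cotangent_transitions.

Section bundle_topology.
Context {R : realType} {n : nat} {M : smooth_manifold R n}.
Notation E := ('rV[R]_n * 'rV[R]_n)%type.
Notation N := (cotangent_bundle M).
Notation TM := (tangent_bundle M).
Implicit Types (i j k : chart_index M) (w a b : E).

Lemma open_cotangentP (A : set N) : open A <->
  forall i, open [set w : E | chart_img i w.1 /\ A (cotangent_chart_inv i w)].
Proof. by []. Qed.

Lemma open_tangentP (A : set TM) : open A <->
  forall i, open [set w : E | chart_img i w.1 /\ A (tangent_chart_inv i w)].
Proof. by []. Qed.

Lemma cotangent_chart_inv_continuous i w : chart_img i w.1 ->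
  {for w, continuous (cotangent_chart_inv i : E -> N)}.
Proof.
move=> iw A; rewrite nbhsE => -[B [/open_cotangentP oB Bw] BA].
have : nbhs w [set w : E | chart_img i w.1 /\ B (cotangent_chart_inv i w)].
  by apply: open_nbhs_nbhs; split; [exact: oB|].
by apply: filterS => v [_ /BA].
Qed.

Lemma tangent_chart_inv_continuous i w : chart_img i w.1 ->
  {for w, continuous (tangent_chart_inv i : E -> TM)}.
Proof.
move=> iw A; rewrite nbhsE => -[B [/open_tangentP oB Bw] BA].
have : nbhs w [set w : E | chart_img i w.1 /\ B (tangent_chart_inv i w)].
  by apply: open_nbhs_nbhs; split; [exact: oB|].
by apply: filterS => v [_ /BA].
Qed.

Lemma differentiable_tangent_transition i j w : overlap i j w.1 ->
  differentiable (tangent_transition i j) w.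
Proof.
move=> ij; have dij := differentiable_transition ij.
have [d1 _] := hasD_comp_fst (hasD_self (0 : E).1 dij).
apply: differentiable_pair => //; apply: differentiable_rowP => s.
pose q (y : 'rV[R]_n) : 'rV[R]_n := \row_r 'D_(delta_mx 0 r) (transition i j) y 0 s.
have dq : differentiable q w.1.
  apply: differentiable_rowP => r.
  rewrite (_ : (fun z => _) = (fun z => 'D_(delta_mx 0 r) (transition i j) z 0 s)).
    exact/differentiable_row_coord/differentiable_derive_transition.
  by apply/funext => z; rewrite mxE.
have [D _] := hasD_pairing (hasD_snd w 0) (hasD_comp_fst (hasD_self (0 : E).1 dq)).
apply: (near_differentiable _ D).1.
apply: filterS (near_overlap ij) => v vij.
rewrite pairingE [RHS]mxE; apply: eq_bigr => r _; rewrite mxE.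
by rewrite jacobian_coord.
Qed.

Lemma open_cotangent_chart i (W : set E) : open W ->
  open [set z : N | chart_dom i z.1 /\ W (cotangent_chart i z)].
Proof.
move=> oW; apply/open_cotangentP => j; rewrite openE => w [jw [iw Ww]].
have ji : overlap j i w.1 by [].
rewrite cotangent_chart_trans // in Ww.
have c := differentiable_continuous (differentiable_cotangent_transition ji).
have nW : nbhs w [set v | W (cotangent_transition j i v)].
  by apply: c; apply: open_nbhs_nbhs.
apply: filterS (filterI (near_overlap ji) nW) => v [vji Wv].
by split; [case: vji|split; [case: vji|rewrite cotangent_chart_trans]].
Qed.

Lemma open_tangent_chart i (W : set E) : open W ->
  open [set z : TM | chart_dom i z.1 /\ W (tangent_chart i z)].
Proof.
move=> oW; apply/open_tangentP => j; rewrite openE => w [jw [iw Ww]].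
have ji : overlap j i w.1 by [].
rewrite tangent_chart_trans // in Ww.
have c := differentiable_continuous (differentiable_tangent_transition ji).
have nW : nbhs w [set v | W (tangent_transition j i v)].
  by apply: c; apply: open_nbhs_nbhs.
apply: filterS (filterI (near_overlap ji) nW) => v [vji Wv].
by split; [case: vji|split; [case: vji|rewrite tangent_chart_trans]].
Qed.

Lemma cotangent_chart_continuous i (z : N) : chart_dom i z.1 ->
  {for z, continuous (cotangent_chart i : N -> E)}.
Proof.
move=> iz A; rewrite nbhsE => -[B [oB Bz] BA].
have : nbhs z [set z : N | chart_dom i z.1 /\ B (cotangent_chart i z)].
  by apply: open_nbhs_nbhs; split; [exact: open_cotangent_chart|].
by apply: filterS => v [_ /BA].
Qed.

Lemma tangent_chart_continuous i (z : TM) : chart_dom i z.1 ->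
  {for z, continuous (tangent_chart i : TM -> E)}.
Proof.
move=> iz A; rewrite nbhsE => -[B [oB Bz] BA].
have : nbhs z [set z : TM | chart_dom i z.1 /\ B (tangent_chart i z)].
  by apply: open_nbhs_nbhs; split; [exact: open_tangent_chart|].
by apply: filterS => v [_ /BA].
Qed.

Lemma open_inv_fst (A : set M) i : open A ->
  open [set w : E | chart_img i w.1 /\ A (chart_inv i w.1)].
Proof.
move=> oA; rewrite openE => w [iw Aw].
have c := chart_inv_continuous iw.
have h1 : nbhs w.1 (chart_img i).
  by apply: open_nbhs_nbhs; split; [exact: chart_img_isopen|].
have h2 : nbhs w.1 [set y | A (chart_inv i y)].
  by apply: c; apply: open_nbhs_nbhs.
have h3 : nbhs w [set v : E | chart_img i v.1 /\ A (chart_inv i v.1)].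
  exact: (@cvg_fst _ _ (nbhs w.1) (nbhs w.2) _ _ (filterI h1 h2)).
by [].
Qed.

Lemma open_cotangent_base (A : set M) : open A -> open [set z : N | A z.1].
Proof. by move=> oA; apply/open_cotangentP => i; exact: open_inv_fst. Qed.

Lemma open_tangent_base (A : set M) : open A -> open [set z : TM | A z.1].
Proof. by move=> oA; apply/open_tangentP => i; exact: open_inv_fst. Qed.

Lemma near_cotangent_dom i (z : N) : chart_dom i z.1 ->
  \forall z' \near z, chart_dom i z'.1.
Proof.
move=> iz; have : nbhs z [set z : N | chart_dom i z.1].
  by apply: open_nbhs_nbhs; split; [apply: open_cotangent_base; exact: chart_dom_open|].
by [].
Qed.

Lemma near_tangent_dom i (z : TM) : chart_dom i z.1 ->
  \forall z' \near z, chart_dom i z'.1.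
Proof.
move=> iz; have : nbhs z [set z : TM | chart_dom i z.1].
  by apply: open_nbhs_nbhs; split; [apply: open_tangent_base; exact: chart_dom_open|].
by [].
Qed.

Lemma cotangent_separated (z z' : N) : z <> z' ->
  exists A B : set N, [/\ open A, open B, A z, B z' & forall u, A u -> B u -> False].
Proof.
move=> zz'; have [e|ne] := pselect (z.1 = z'.1).
  have [i iz] : exists i, chart_dom i z.1 by exists (chart_at z.1); exact: dom_chart_at.
  have iz' : chart_dom i z'.1 by rewrite -e.
  have ne : cotangent_chart i z != cotangent_chart i z'.
    apply/eqP => ce; apply: zz'.
    exact: (etrans (esym (cotangent_chart_invK iz))
      (etrans (congr1 _ ce) (cotangent_chart_invK iz'))).
  have := @norm_hausdorff _ E; rewrite open_hausdorff.
  move=> /(_ _ _ ne)[[A B] /= [zA zB] [oA oB /eqP AB]].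
  exists [set u : N | chart_dom i u.1 /\ A (cotangent_chart i u)].
  exists [set u : N | chart_dom i u.1 /\ B (cotangent_chart i u)].
  split.
  - exact: open_cotangent_chart.
  - exact: open_cotangent_chart.
  - split; [exact: iz|exact: set_mem zA].
  - split; [exact: iz'|exact: set_mem zB].
  - move=> u [_ h1] [_ h2].
    have : (A `&` B) (cotangent_chart i u) by split; [exact: h1|exact: h2].
    by rewrite AB.
have := @manifold_hausdorff _ _ M; rewrite open_hausdorff.
have ne' : z.1 != z'.1 by exact/eqP.
move=> /(_ _ _ ne')[[A B] /= [zA zB] [oA oB /eqP AB]].
exists [set u : N | A u.1], [set u : N | B u.1]; split.
- exact: open_cotangent_base.
- exact: open_cotangent_base.
- exact: set_mem zA.
- exact: set_mem zB.
- by move=> u Au Bu; have : (A `&` B) u.1 by []; rewrite AB.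
Qed.

End bundle_topology.

Section canonical_atlas.
Context {R : realType} {n : nat}.
Notation E := ('rV[R]_n * 'rV[R]_n)%type.

(* A space with an atlas of canonical coordinates: this is all that the
   Hamiltonian dynamics uses of the cotangent bundle. *)
Record canonical_atlas (P : topologicalType) := CanonicalAtlas {
  ca_index : Type ;
  ca_dom : ca_index -> set P ;
  ca_img : ca_index -> set E ;
  ca_chart : ca_index -> P -> E ;
  ca_inv : ca_index -> E -> P ;
  ca_cover : forall z, exists i, ca_dom i z ;
  ca_open_dom : forall i, open (ca_dom i) ;
  ca_open_img : forall i, open (ca_img i) ;
  ca_chart_img : forall i z, ca_dom i z -> ca_img i (ca_chart i z) ;
  ca_inv_dom : forall i w, ca_img i w -> ca_dom i (ca_inv i w) ;
  ca_chartK : forall i z, ca_dom i z -> ca_inv i (ca_chart i z) = z ;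
  ca_invK : forall i w, ca_img i w -> ca_chart i (ca_inv i w) = w ;
  ca_chart_cont : forall i z, ca_dom i z -> {for z, continuous (ca_chart i)} ;
  ca_inv_cont : forall i w, ca_img i w -> {for w, continuous (ca_inv i)} ;
  ca_trans : forall i j w, ca_img i w -> ca_dom j (ca_inv i w) ->
    differentiable (ca_chart j \o ca_inv i) w /\
    forall a b, omega ('d (ca_chart j \o ca_inv i) w a)
      ('d (ca_chart j \o ca_inv i) w b) = omega a b ;
  ca_separated : forall z z', z <> z' -> exists A B : set P,
    [/\ open A, open B, A z, B z' & forall u, A u -> B u -> False]
}.

End canonical_atlas.

Section cotangent_atlas.
Context {R : realType} {n : nat} (M : smooth_manifold R n).
Notation E := ('rV[R]_n * 'rV[R]_n)%type.
Notation N := (cotangent_bundle M).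
Implicit Types (i j k : chart_index M) (w a b : E).

Lemma open_chart_img2 i : open [set w : E | chart_img i w.1].
Proof. by apply: open_fst; exact: chart_img_isopen. Qed.

Lemma cotangent_chart_img i (z : N) : chart_dom i z.1 ->
  chart_img i (cotangent_chart i z).1.
Proof. exact: img_chart. Qed.

Lemma cotangent_chart_inv_dom i w : chart_img i w.1 ->
  chart_dom i (cotangent_chart_inv i w).1.
Proof. by move=> /chart_imgP[]. Qed.

Lemma cotangent_atlas_symplectic i j w : chart_img i w.1 ->
  chart_dom j (cotangent_chart_inv i w).1 ->
  differentiable (cotangent_chart j \o cotangent_chart_inv i) w /\
  forall a b, omega ('d (cotangent_chart j \o cotangent_chart_inv i) w a)
    ('d (cotangent_chart j \o cotangent_chart_inv i) w b) = omega a b.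
Proof.
move=> iw jw; have ij : overlap i j w.1 by split; [exact: iw|exact: jw].
have dT := differentiable_cotangent_transition ij.
have near_T : \forall v \near w, cotangent_transition i j v =
    (cotangent_chart j \o cotangent_chart_inv i) v.
  apply: filterS (near_overlap ij) => v vij; apply: esym.
  exact: (cotangent_chart_trans vij).
split; first exact: (near_differentiable near_T dT).1.
move=> a b; have h c := (hasD_near near_T (hasD_self c dT)).2.
apply: etrans (omega_cotangent_transition a b ij).
exact: (f_equal2 _ (h a) (h b)).
Qed.

Definition cotangent_atlas : @canonical_atlas R n N.
Proof.
apply: (@CanonicalAtlas _ _ N (chart_index M) (fun i => [set z : N | chart_dom i z.1])
  (fun i => [set w : E | chart_img i w.1]) cotangent_chart cotangent_chart_inv).
- by move=> z; exists (chart_at z.1); exact: dom_chart_at.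
- by move=> i; apply: open_cotangent_base; exact: chart_dom_open.
- exact: open_chart_img2.
- exact: cotangent_chart_img.
- exact: cotangent_chart_inv_dom.
- by move=> i z; exact: cotangent_chart_invK.
- by move=> i w; exact: cotangent_chartK.
- by move=> i z; exact: cotangent_chart_continuous.
- by move=> i w; exact: cotangent_chart_inv_continuous.
- exact: cotangent_atlas_symplectic.
- exact: cotangent_separated.
Defined.

End cotangent_atlas.

Section hamiltonian_fields.
Context {R : realType} {n : nat} {P : topologicalType} (A : @canonical_atlas R n P).
Notation E := ('rV[R]_n * 'rV[R]_n)%type.
Implicit Types (i j k : ca_index A) (w a b : E) (f : P -> R).

Local Notation chart := (@ca_chart _ _ _ A).
Local Notation inv := (@ca_inv _ _ _ A).
Local Notation dom := (@ca_dom _ _ _ A).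
Local Notation img := (@ca_img _ _ _ A).

Definition in_chart f i : E -> R := f \o inv i.

Definition C2 f := forall i, Ck 2 (img i) (in_chart f i).

Definition field f i : E -> E := ham_vector (in_chart f i).

Definition trans i j : E -> E := chart j \o inv i.

Definition both i j : set E := [set w | img i w /\ dom j (inv i w)].

Lemma near_img i w : img i w -> \forall v \near w, img i v.
Proof. by move=> iw; apply: open_nbhs_nbhs; split; [exact: ca_open_img|]. Qed.

Lemma near_dom i z : dom i z -> \forall v \near z, dom i v.
Proof. by move=> iw; apply: open_nbhs_nbhs; split; [exact: ca_open_dom|]. Qed.

Lemma near_both i j w : both i j w -> \forall v \near w, both i j v.
Proof.
move=> [iw jw]; apply: filterI; first exact: near_img.
by apply: (ca_inv_cont iw); exact: near_dom.
Qed.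

Lemma both_trans i j w : both i j w -> both j i (trans i j w).
Proof.
move=> [iw jw]; split; first exact: ca_chart_img.
by rewrite /trans /= ca_chartK //; exact: ca_inv_dom.
Qed.

Lemma transK i j w : both i j w -> trans j i (trans i j w) = w.
Proof. by move=> [iw jw]; rewrite /trans /= ca_chartK // ca_invK. Qed.

Lemma differentiable_trans i j w : both i j w -> differentiable (trans i j) w.
Proof. by move=> [iw jw]; have [] := ca_trans iw jw. Qed.

Lemma C2_differentiable f i w : C2 f -> img i w -> differentiable (in_chart f i) w.
Proof. by move=> /(_ i)[+ _] iw; apply. Qed.

Lemma omega_nondeg (a a' : E) : (forall b, omega a b = omega a' b) -> a = a'.
Proof.
move=> H; case: a a' H => [a1 a2] [b1 b2] H; congr pair; apply: pairing_eq => v.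
  by have := H (0, v); rewrite /omega /= !pairing0r !subr0.
by have := H (v, 0); rewrite /omega /= !pairing0r !sub0r => /oppr_inj.
Qed.

Lemma diff_trans_surj i j w b : both i j w -> exists a, 'd (trans i j) w a = b.
Proof.
move=> ij; have ji := both_trans ij; pose w' := trans i j w.
have d1 := differentiable_trans ji.
have wE : trans j i w' = w by exact: transK.
have d2 : differentiable (trans i j) (trans j i w').
  by rewrite wE; exact: differentiable_trans.
exists ('d (trans j i) w' b).
have h := hasD_comp (hasD_self b d1) (hasD_self _ d2).
have h' : hasD (trans i j \o trans j i) w' b b.
  apply: hasD_near (hasD_id w' b).
  by apply: filterS (near_both ji) => v vji; rewrite /= transK.
by have := hasD_uniq h h'; rewrite wE.
Qed.

Lemma field_trans f i j w : C2 f -> both i j w ->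
  field f j (trans i j w) = 'd (trans i j) w (field f i w).
Proof.
move=> Cf ij; have ji := both_trans ij; have dT := differentiable_trans ij.
have dfi : differentiable (in_chart f i) w by apply: C2_differentiable => //; case: ij.
have dfj : differentiable (in_chart f j) (trans i j w).
  by apply: C2_differentiable => //; case: ji.
apply: omega_nondeg => b'.
have [b <-] := diff_trans_surj b' ij.
have [iw jw] := ij; have [_ om] := ca_trans iw jw.
rewrite om -(ham_vectorP _ dfi) -(ham_vectorP _ dfj).
have h := hasD_comp (hasD_self b dT) (hasD_self _ dfj).
apply: (hasD_uniq h); apply: hasD_near (hasD_self b dfi).
apply: filterS (near_both ij) => v [vi vj].
by rewrite /in_chart /trans /= ca_chartK.
Qed.

Definition ham_at f (gamma : R -> P) (t : R) :=
  {for t, continuous gamma} /\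
  forall i, dom i (gamma t) ->
    is_derive t 1 (fun s => chart i (gamma s)) (field f i (chart i (gamma t))).

Lemma is_derive_near (V : normedModType R) (c d : R -> V) (t : R) (v : V) :
  (\forall s \near t, c s = d s) -> is_derive t 1 c v -> is_derive t 1 d v.
Proof.
move=> cd /is_deriveNP H; apply/is_deriveNP => e e0.
have [r r0 rP] := H e e0; have [q q0 qP] := proj1 (@nearNP _ R^o _ _) cd.
exists (Num.min r q); first by rewrite lt_min r0.
move=> s; rewrite lt_min => /andP[sr sq].
by rewrite -(qP s sq) -(qP t) ?subrr ?normr0 // rP.
Qed.

Lemma ham_at_chart f gamma (t : R) i : C2 f ->
  {for t, continuous gamma} -> dom i (gamma t) ->
  is_derive t 1 (fun s => chart i (gamma s)) (field f i (chart i (gamma t))) ->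
  ham_at f gamma t.
Proof.
move=> Cf ct it D; split=> // j jt.
have gE z : dom i z -> trans i j (chart i z) = chart j z.
  by move=> iz; rewrite /trans /= ca_chartK.
have ij : both i j (chart i (gamma t)).
  by split; [exact: ca_chart_img|rewrite ca_chartK].
have dT := differentiable_trans ij.
have := hasD_curve D (hasD_self _ dT).
rewrite -(field_trans Cf ij) gE // => D'.
apply: is_derive_near D'.
have h1 : \forall s \near t, dom i (gamma s) by apply: ct; exact: near_dom.
by apply: filterS h1 => s si; rewrite gE.
Qed.

Lemma ham_at_lift f i (c : R -> E) (t : R) : C2 f ->
  img i (c t) -> is_derive t 1 c (field f i (c t)) ->
  ham_at f (fun s => inv i (c s)) t.
Proof.
move=> Cf it D; have cc := is_derive_continuous D.
have it' := ca_inv_dom it.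
apply: (@ham_at_chart _ _ _ i) => //.
  by apply: continuous_comp; [exact: cc|exact: ca_inv_cont].
rewrite ca_invK //; apply: is_derive_near D.
have : \forall s \near t, img i (c s) by apply: cc; exact: near_img.
by apply: filterS => s si; rewrite ca_invK.
Qed.

Lemma ham_at_near f (gamma delta : R -> P) (t : R) :
  (\forall s \near t, gamma s = delta s) -> ham_at f gamma t -> ham_at f delta t.
Proof.
move=> gd [cg D]; have gdt : gamma t = delta t by exact: nbhs_singleton gd.
split=> [|i]; first by apply: cvg_trans (near_eq_cvg gd) _; rewrite -gdt.
rewrite -gdt => it; apply: is_derive_near (D i it).
by apply: filterS gd => s ->.
Qed.

Lemma is_derive_along f gamma (t : R) (g : P -> R) i : ham_at f gamma t ->
  dom i (gamma t) -> differentiable (in_chart g i) (chart i (gamma t)) ->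
  is_derive t 1 (g \o gamma) ('d (in_chart g i) (chart i (gamma t))
     (field f i (chart i (gamma t)))).
Proof.
move=> [cg D] it dg; have D' := hasD_curve (D i it) (hasD_self _ dg).
apply: is_derive_near D'.
have h1 : \forall s \near t, dom i (gamma s) by apply: cg; exact: near_dom.
by apply: filterS h1 => s si; rewrite /in_chart /= ca_chartK.
Qed.

End hamiltonian_fields.

(** * Hamiltonian flows *)

Section local_flow.
Context {R : realType} {n : nat} {P : topologicalType} (A : @canonical_atlas R n P).
Notation E := ('rV[R]_n * 'rV[R]_n)%type.
Implicit Types (i j k : ca_index A) (w a b : E) (f : P -> R).

Local Notation chart := (@ca_chart _ _ _ A).
Local Notation inv := (@ca_inv _ _ _ A).
Local Notation dom := (@ca_dom _ _ _ A).
Local Notation img := (@ca_img _ _ _ A).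

Definition findim_E : findim E := findim_pair (findim_row _) (findim_row _).

Lemma field_coord (g : E -> R) : ham_vector g = fun w =>
  \sum_j ('D_((0 : 'rV[R]_n), (delta_mx 0 j : 'rV[R]_n)) g w) *: ((delta_mx 0 j, 0) : E) +
  \sum_j ('D_((delta_mx 0 j : 'rV[R]_n), (0 : 'rV[R]_n)) g w) *: ((0, - delta_mx 0 j) : E).
Proof.
apply/funext => w; rewrite /ham_vector.
have sumE (I : finType) (u v : I -> 'rV[R]_n) :
    \sum_k ((u k, v k) : E) = (\sum_k u k, \sum_k v k).
  by elim: (index_enum I) => [|c r IH]; rewrite ?big_nil // !big_cons IH.
rewrite (eq_bigr (fun r => ('D_((0 : 'rV[R]_n), (delta_mx 0 r : 'rV[R]_n)) g w *:
  delta_mx 0 r : 'rV[R]_n, 0))); last by move=> j _; congr pair; rewrite /= scaler0.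
rewrite [X in _ + X](eq_bigr (fun r => (0, - ('D_((delta_mx 0 r : 'rV[R]_n), (0 : 'rV[R]_n)) g w *:
  delta_mx 0 r) : 'rV[R]_n))); last by move=> j _; congr pair; rewrite /= ?scaler0 ?scalerN.
rewrite !sumE /= !big1_eq; apply: injective_projections; rewrite /= ?addr0 ?add0r.
  rewrite [LHS]row_sum_delta; apply: eq_bigr => j _; congr (_ *: _).
  rewrite mxE; apply: eq_derive => h; congr g.
  by case: (w) => y p; congr pair; rewrite /= scaler0 add0r.
rewrite sumrN; congr (- _).
rewrite [LHS]row_sum_delta; apply: eq_bigr => j _; congr (_ *: _).
rewrite mxE; apply: eq_derive => h; congr g.
by case: (w) => y p; congr pair; rewrite /= scaler0 add0r.
Qed.

Lemma Ck1_field f i : C2 A f -> Ck 1 (img i) (field f i).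
Proof.
move=> Cf; have o := @ca_open_img _ _ _ A i; rewrite /field field_coord.
by apply: Ck_add => //; apply: Ck_lincomb => // j; exact: (Cf i).2.
Qed.

Lemma differentiable_field f i w : C2 A f -> img i w -> differentiable (field f i) w.
Proof. by move=> Cf iw; have [+ _] := Ck1_field i Cf; apply. Qed.

Lemma field_box f i w0 (r0 : R) : C2 A f -> img i w0 -> 0 < r0 ->
  exists rho L B : R, [/\ 0 < rho <= r0, 0 < L & 0 < B] /\
    [/\ forall a, `|a - w0| <= rho -> img i a,
      forall a b, `|a - w0| <= rho -> `|b - w0| <= rho ->
        `|field f i a - field f i b| <= L * `|a - b| &
      forall a, `|a - w0| <= rho -> `|field f i a| <= B].
Proof.
move=> Cf iw r00; have o := @ca_open_img _ _ _ A i.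
have [L L0 [d d0 dP]] := Ck1_lipschitz findim_E o iw (Ck1_field i Cf).
have [d' d'0 d'P] := openNP o iw.
pose rho := Num.min (Num.min d d') r0 / 2.
have m0 : 0 < Num.min (Num.min d d') r0 by rewrite !lt_min d0 d'0.
have rm : rho < Num.min (Num.min d d') r0 by rewrite /rho; lra.
have rho0 : 0 < rho by rewrite /rho; lra.
move: rm; rewrite !lt_min => /andP[/andP[rd rd'] rr0].
exists rho, L, (L * rho + `|field f i w0| + 1); split; first split=> //.
- by rewrite rho0 ltW.
- by rewrite ltr_wpDl // addr_ge0 // mulr_ge0 // ltW.
split=> [a ar|a b ar br|a ar].
- by apply: d'P; exact: le_lt_trans ar rd'.
- by apply: dP; [exact: le_lt_trans ar rd|exact: le_lt_trans br rd].
- have K : `|field f i a - field f i w0| <= L * rho.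
    apply: le_trans (dP _ _ _ _) _; [exact: le_lt_trans ar rd| |].
      by rewrite subrr normr0.
    by rewrite ler_wpM2l // ltW.
  rewrite -(subrK (field f i w0) (field f i a)).
  apply: le_trans (ler_normD _ _) _; lra.
Qed.

Lemma ham_at_shift f (gamma : R -> P) (s t : R) : ham_at A f gamma (s + t) ->
  ham_at A f (fun u => gamma (s + u)) t.
Proof.
move=> [cg D]; split=> [|i it].
  apply: (@continuous_comp _ _ _ (fun u => s + u) gamma) => //.
  by apply: continuousD; [exact: cst_continuous|exact: cvg_id].
have /is_deriveNP H := D i it; apply/is_deriveNP => e e0.
have [r r0 rP] := H e e0; exists r => // u ur.
have E1 : s + u - (s + t) = u - t by ring.
by have := rP (s + u); rewrite E1; apply.
Qed.

Lemma ham_unique_near f (gamma delta : R -> P) (t : R) : C2 A f ->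
  (\forall s \near t, ham_at A f gamma s) -> (\forall s \near t, ham_at A f delta s) ->
  gamma t = delta t -> \forall s \near t, gamma s = delta s.
Proof.
move=> Cf Hg Hd gd; have [i it] := ca_cover A (gamma t).
have [cg _] : ham_at A f gamma t by exact: nbhs_singleton Hg.
have [cd _] : ham_at A f delta t by exact: nbhs_singleton Hd.
have iw := ca_chart_img it.
have [rho [L [B [[/andP[rho0 _] L0 B0] [_ XL _]]]]] := field_box Cf iw ltr01.
have ball_near (g : R -> P) : {for t, continuous g} -> g t = gamma t ->
    \forall s \near t, dom i (g s) /\ `|chart i (g s) - chart i (gamma t)| <= rho.
  move=> cgt gt; have it' : dom i (g t) by rewrite gt.
  have h1 : \forall s \near t, dom i (g s) by apply: cgt; exact: near_dom.
  have c : {for t, continuous (chart i \o g)}.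
    by apply: continuous_comp => //; exact: ca_chart_cont.
  apply: filterI h1 _; apply/(@nearNP _ R^o).
  have [d d0 dP] := @continuousNP _ R^o _ _ _ c rho rho0.
  by exists d => // s /dP /=; rewrite gt.
have b1 := ball_near gamma cg erefl; have b2 := ball_near delta cd (esym gd).
have [r r0 rP] := proj1 (@nearNP _ R^o _ _) (filterI (filterI Hg b1) (filterI Hd b2)).
pose T := Num.min r (2 * L)^-1.
have T0 : 0 < T by rewrite lt_min r0 invr_gt0 mulr_gt0.
have LT : L * T <= 1 / 2.
  have : T <= (2 * L)^-1 by rewrite ge_min lexx orbT.
  rewrite -(ler_pM2l L0) => /le_trans; apply.
  by rewrite invfM mulrCA mulfV ?gt_eqF // mulr1 mul1r.
have Tr : T <= r by rewrite ge_min lexx.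
apply/(@nearNP _ R^o); exists T => // s sT.
pose c u := chart i (gamma (t + u)); pose d u := chart i (delta (t + u)).
have near_u (u : R) : `|u| < T -> `|t + u - t| < r.
  by rewrite addrAC subrr add0r => /lt_le_trans; apply.
have := @compare_solutions _ _ (field f i)
  [set a | `|a - chart i (gamma t)| <= rho] L T c d (ltW L0) LT.
move=> /(_ (fun a b ha hb => XL a b ha hb)) C.
have {C} := C _ _ (s - t) sT; rewrite /c /d !addr0 gd subrr normr0 !mulr0 (addrC t) subrK.
have stE : `|t + (s - t) - t| < r by exact: near_u.
rewrite addrCA subrr addr0 in stE.
have [[_ [s1 _]] [_ [s2 _]]] := rP s stE.
move=> C; have [] := C.
- move=> u uT; have [[hg [u1 u2]] _] := rP _ (near_u u uT); split; last by rewrite /= -gd.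
  by have [_ /(_ i u1)] := ham_at_shift hg.
- move=> u uT; have [_ [hd [u1 u2]]] := rP _ (near_u u uT); split; last by rewrite /= -gd.
  by have [_ /(_ i u1)] := ham_at_shift hd.
rewrite normr_le0 subr_eq0 => /eqP ce _.
by rewrite -(ca_chartK s1) ce ca_chartK.
Qed.

Lemma ham_unique f (gamma delta : R -> P) (a b t0 : R) : C2 A f -> a < t0 < b ->
  (forall t, a < t < b -> ham_at A f gamma t) ->
  (forall t, a < t < b -> ham_at A f delta t) ->
  gamma t0 = delta t0 -> forall t, a < t < b -> gamma t = delta t.
Proof.
move=> Cf abt0 Hg Hd gd.
have near_ab t : a < t < b -> \forall s \near t, a < s < b.
  move=> /andP[at_ tb]; have : nbhs t [set` `]a, b[].
    by apply: open_nbhs_nbhs; split; [exact: interval_open|rewrite /= in_itv /= at_].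
  by apply: filterS => s; rewrite /= in_itv.
have conn : connected [set t | a < t < b].
  have -> : [set t | a < t < b] = [set` `]a, b[] by apply/seteqP; split=> t /=; rewrite in_itv.
  by apply/connected_intervalP; exact: interval_is_interval.
pose O1 := [set t | a < t < b /\ gamma t = delta t].
pose O2 := [set t | a < t < b /\ gamma t <> delta t].
have oO1 : open O1.
  rewrite openE => t [abt gdt]; apply: filterI; first exact: near_ab.
  by apply: (ham_unique_near Cf) => //; apply: filterS (near_ab t abt).
have oO2 : open O2.
  rewrite openE => t [abt gdt]; apply: filterI; first exact: near_ab.
  have [U [V [oU oV Ut Vt UV]]] := ca_separated A gdt.
  have h1 : \forall s \near t, U (gamma s).
    by apply: (Hg t abt).1; apply: open_nbhs_nbhs.
  have h2 : \forall s \near t, V (delta s).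
    by apply: (Hd t abt).1; apply: open_nbhs_nbhs.
  apply: filterS (filterI h1 h2) => s [Us Vs] gds.
  by apply: (UV (gamma s)) => //; rewrite gds.
have E : O1 = [set t | a < t < b].
  apply: conn.
  - by exists t0.
  - by exists O1 => //; apply/seteqP; split=> [t [h1 h2]|t [h1 [h2 h3]]].
  - exists (~` O2); first exact: open_closedC.
    apply/seteqP; split=> [t [h1 h2]|t [h1 h2]]; first by split=> // -[_].
    by split=> //; apply: contrapT => h3; exact: h2.
by move=> t abt; have [] : O1 t by rewrite E.
Qed.

End local_flow.

Section global_flow.
Context {R : realType} {n : nat} {P : topologicalType} (A : @canonical_atlas R n P).
Notation E := ('rV[R]_n * 'rV[R]_n)%type.
Context (f H : P -> R).
Hypothesis Cf : C2 A f.
Hypothesis H_compact : forall k, compact [set z | H z <= k].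
Hypothesis H_const : forall gamma t, ham_at A f gamma t -> is_derive t 1 (H \o gamma) 0.

Local Notation chart := (@ca_chart _ _ _ A).
Local Notation inv := (@ca_inv _ _ _ A).
Local Notation dom := (@ca_dom _ _ _ A).
Local Notation img := (@ca_img _ _ _ A).

Lemma energy_const (gamma : R -> P) (a b s t : R) :
  (forall t, a < t < b -> ham_at A f gamma t) ->
  a < s < b -> a < t < b -> H (gamma s) = H (gamma t).
Proof.
move=> Hg abs abt; apply/eqP; rewrite -subr_eq0 -normr_le0.
rewrite -(mul0r `|s - t|); apply: (@mean_value_abs _ _ (H \o gamma) (fun=> 0)) => r rst.
split; last by rewrite normr0.
apply: H_const; apply: Hg; move: rst; rewrite ge_min le_max.
by case/andP: abs => ? ?; case/andP: abt => ? ?;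
  move=> /andP[/orP[?|?] /orP[?|?]]; apply/andP; split; lra.
Qed.

Definition reaches (z : P) (T : R) :=
  exists2 gamma : R -> P, gamma 0 = z & forall t, `|t| < T -> ham_at A f gamma t.

Lemma reaches_near (z0 : P) : exists2 e : R, 0 < e &
  \forall z \near z0, forall d : R, 0 < d -> d < e -> reaches z d.
Proof.
have [i iz] := ca_cover A z0; have iw := ca_chart_img iz.
have [rho [L [B [[/andP[rho0 _] L0 B0] [inb XL XB]]]]] := field_box Cf iw ltr01.
pose e := Num.min (4 * L)^-1 (rho / 2 / B).
have e0 : 0 < e by rewrite lt_min invr_gt0 !divr_gt0 // mulr_gt0.
exists e => //.
have h1' : \forall z \near z0, `|chart i z0 - chart i z| <= rho / 2.
  by have /cvgrPdist_le := ca_chart_cont iz; apply; exact: divr_gt0.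
apply: filterS (filterI (near_dom iz) h1') => z [zi zr] d d0 de.
have d1 : 4 * L * d <= 1.
  have : d <= (4 * L)^-1 by apply: le_trans (ltW de) _; rewrite ge_min lexx.
  by rewrite -ler_pdivlMl ?mulr_gt0 // mulr1.
have d2 : B * d <= rho / 2.
  have : d <= rho / 2 / B by apply: le_trans (ltW de) _; rewrite ge_min lexx orbT.
  by rewrite ler_pdivlMr // mulrC.
rewrite distrC in zr.
have [c c0 cP] := local_solution (@findim_E R n) rho0 L0 d1 d2 XL XB zr.
exists (fun t => inv i (c t)); first by rewrite c0 ca_chartK.
by move=> t /cP[h2 h3 _]; apply: ham_at_lift => //; exact: inb.
Qed.

Lemma reaches_uniform (k : R) :
  exists2 e : R, 0 < e & forall z, H z <= k -> reaches z e.
Proof.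
have [e e0 eP] := uniform_over_compact (@H_compact k) (fun z _ => reaches_near z).
exists (e / 2) => [|z zk]; first by rewrite divr_gt0.
by apply: eP => //; [rewrite divr_gt0|lra].
Qed.

Lemma reaches_extend (k e T : R) : 0 < e -> e <= T ->
  (forall z, H z <= k -> reaches z e) -> (forall z, H z <= k -> reaches z T) ->
  forall z, H z <= k -> reaches z (T + e / 2).
Proof.
move=> e0 eT He HT z zk; have [g g0 gH] := HT z zk.
pose r := T - e / 2.
have gH' t : - T < t < T -> ham_at A f g t by move=> h; apply: gH; rewrite ltr_norml.
have Hg t : - T < t < T -> H (g t) <= k.
  by move=> h; rewrite (energy_const gH' h (_ : - T < 0 < T)) ?g0 //; lra.
have Tr : - T < r < T by rewrite /r; lra.
have Tr' : - T < - r < T by rewrite /r; lra.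
have [p p0 pH] := He (g r) (Hg _ Tr); have [m m0 mH] := He (g (- r)) (Hg _ Tr').
have pH' t : `|t - r| < e -> ham_at A f (fun u => p (- r + u)) t.
  by move=> h; apply: ham_at_shift; apply: pH; rewrite addrC.
have mH' t : `|t + r| < e -> ham_at A f (fun u => m (r + u)) t.
  by move=> h; apply: ham_at_shift; apply: mH; rewrite addrC.
have pE t : T - e < t < T -> g t = p (- r + t).
  apply: (@ham_unique R n P A f g (fun u => p (- r + u)) (T - e) T r Cf); first by rewrite /r; lra.
  - by move=> s sT; apply: gH'; lra.
  - by move=> s sT; apply: pH'; rewrite ltr_norml /r; lra.
  - by rewrite addNr p0.
have mE t : - T < t < - T + e -> g t = m (r + t).
  apply: (@ham_unique R n P A f g (fun u => m (r + u)) (- T) (- T + e) (- r) Cf); first by rewrite /r; lra.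
  - by move=> s sT; apply: gH'; lra.
  - by move=> s sT; apply: mH'; rewrite ltr_norml /r; lra.
  - by rewrite subrr m0.
pose q t := if t < - r then m (r + t) else if t <= r then g t else p (- r + t).
have near_itv (t a b : R) : a < t < b -> \forall s \near t, a < s < b.
  move=> /andP[at_ tb]; have : nbhs t [set` `]a, b[].
    by apply: open_nbhs_nbhs; split; [exact: interval_open|rewrite /= in_itv /= at_].
  by apply: filterS => s; rewrite /= in_itv.
have qg t : - T < t < T -> g t = q t.
  move=> tT; rewrite /q; case: ifP => [tr|/negbT]; first by apply: mE; rewrite /r in tr; lra.
  rewrite -leNgt => tr; case: ifP => // /negbT; rewrite -ltNge => tr'.
  by apply: pE; rewrite /r in tr'; lra.
exists q; first by rewrite -qg ?g0 //; lra.
move=> t; rewrite ltr_norml => /andP[t1 t2].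
have [tT|tT] := ltP t T; last first.
  apply: ham_at_near (pH' t _); last by rewrite ltr_norml /r; lra.
  have : r < t < t + 1 by rewrite /r; lra.
  move=> /near_itv; apply: filterS => s /andP[rs _].
  rewrite /q ltNge (_ : - r <= s) /=; last by rewrite /r in rs *; lra.
  by rewrite leNgt rs.
have [tT'|tT'] := ltP (- T) t.
  have tTT : - T < t < T by rewrite tT'.
  apply: ham_at_near (gH' t tTT).
  by apply: filterS (near_itv _ _ _ tTT) => s; exact: qg.
apply: ham_at_near (mH' t _); last by rewrite ltr_norml /r; lra.
have : t - 1 < t < - r by rewrite /r; lra.
by move=> /near_itv; apply: filterS => s /andP[_ rs]; rewrite /q rs.
Qed.

Lemma reaches_global (z : P) : exists2 gamma : R -> P, gamma 0 = z &
  forall t, ham_at A f gamma t.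
Proof.
have [e e0 He] := reaches_uniform (H z).
pose T (N : nat) := e + N%:R * (e / 2).
have HN N : forall y, H y <= H z -> reaches y (T N).
  elim: N => [|N IH]; first by rewrite /T mul0r addr0.
  have -> : T N.+1 = T N + e / 2 by rewrite /T -addn1 natrD; ring.
  apply: reaches_extend => //; rewrite /T lerDl mulr_ge0 //; lra.
have [g gP] := boolp.choice (fun N => (exists2P _ _).1 (HN N z (lexx _))).
pose b (t : R) := Num.bound (`|t| / (e / 2)).
have bT t : `|t| < T (b t).
  have h : `|t| / (e / 2) < (b t)%:R by apply: archi_boundP; rewrite divr_ge0 //; lra.
  rewrite ltr_pdivrMr in h; last by lra.
  by rewrite /T; lra.
have gE N N' t : `|t| < T N -> `|t| < T N' -> g N t = g N' t.
  move=> tN tN'; pose m := Num.min (T N) (T N').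
  have m0 : 0 < m.
    by rewrite lt_min; apply/andP; split; rewrite /T ltr_pwDl // mulr_ge0 //; lra.
  apply: (@ham_unique R n P A f (g N) (g N') (- m) m 0 Cf).
  - by rewrite m0 oppr_lt0 m0.
  - move=> s sm; apply: (gP N).2; rewrite ltr_norml; move: sm.
    by rewrite /m; case: (leP (T N) (T N')) => ? /andP[? ?]; apply/andP; split; lra.
  - move=> s sm; apply: (gP N').2; rewrite ltr_norml; move: sm.
    by rewrite /m; case: (leP (T N) (T N')) => ? /andP[? ?]; apply/andP; split; lra.
  - by rewrite (gP N).1 (gP N').1.
  - by rewrite -ltr_norml lt_min tN.
exists (fun t => g (b t) t); first by rewrite (gP _).1.
move=> t; apply: ham_at_near ((gP (b t)).2 t (bT t)).
apply/(@nearNP _ R^o); exists (T (b t) - `|t|); first by rewrite subr_gt0.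
move=> s st; apply: gE => //.
rewrite -(subrK t s); apply: le_lt_trans (ler_normD _ _) _.
by rewrite -ltrBrDr.
Qed.

Definition cflow (t : R) (z : P) : P :=
  flow (fun a b (g : R -> P) => forall t : R, a < t < b -> ham_at A f g t) t z.

Lemma cflowE (gamma : R -> P) (t : R) (z : P) :
  (forall t, ham_at A f gamma t) -> gamma 0 = z -> cflow t z = gamma t.
Proof.
move=> Hg g0; apply: xget_unique.
  exists (- (`|t| + 1)), (`|t| + 1), gamma; split=> //.
  - by rewrite oppr_lt0 ltr_wpDl.
  - by rewrite -ltr_norml ltrDl.
move=> _ [a [b [g [ab0 abt Hd d0 <-]]]].
by apply: (@ham_unique R n P A f g gamma a b 0 Cf) => //; rewrite d0.
Qed.

Lemma cflow_ham z t : ham_at A f (fun t => cflow t z) t.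
Proof.
have [g g0 Hg] := reaches_global z.
by have -> : (fun t => cflow t z) = g by apply/funext => s; exact: cflowE.
Qed.

Lemma cflow0 z : cflow 0 z = z.
Proof. by have [g g0 Hg] := reaches_global z; rewrite (cflowE _ Hg g0). Qed.

Lemma cflowD s t z : cflow (s + t) z = cflow s (cflow t z).
Proof.
apply: esym; rewrite addrC.
apply: (@cflowE (fun u => cflow (t + u) z)); last by rewrite addr0.
move=> u; apply: (@ham_at_shift _ _ _ _ _ (fun u => cflow u z)).
exact: cflow_ham.
Qed.

Lemma cflow_energy t z : H (cflow t z) = H z.
Proof.
rewrite -[in RHS](cflow0 z).
apply: (@energy_const (fun t => cflow t z) (- (`|t| + 1)) (`|t| + 1)).
- by move=> s _; exact: cflow_ham.
- by rewrite -ltr_norml ltrDl.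
- by rewrite oppr_lt0 andbb ltr_wpDl.
Qed.

Lemma local_cflow i z0 (r0 : R) : dom i z0 -> 0 < r0 ->
  exists rho e L B : R, [/\ 0 < rho <= r0, 0 < e, 0 < L, 0 < B & L * e <= 1 / 2] /\
   let w0 := chart i z0 in let X := field f i in
   let phi t w := chart i (cflow t (inv i w)) in
   [/\ forall a, `|a - w0| <= 2 * rho -> img i a /\ `|X a| <= B,
     forall a b, `|a - w0| <= 2 * rho -> `|b - w0| <= 2 * rho ->
        `|X a - X b| <= L * `|a - b|,
     forall w t, `|w - w0| <= rho -> `|t| < e ->
      [/\ dom i (cflow t (inv i w)), `|phi t w - w0| <= 2 * rho,
        `|phi t w - w| <= B * `|t| & is_derive t 1 (phi^~ w) (X (phi t w))] &
     forall w w' t, `|w - w0| <= rho -> `|w' - w0| <= rho -> `|t| < e ->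
      `|(phi t w - phi t w') - (w - w')| <= 2 * L * `|t| * `|w - w'|].
Proof.
move=> iz r00; have iw := ca_chart_img iz.
have [rho2 [L [B [[/andP[rho0 rr] L0 B0] [inb XL XB]]]]] := field_box Cf iw r00.
pose rho := rho2 / 2; have r2 : rho2 = 2 * rho by rewrite /rho; lra.
pose e := Num.min (4 * L)^-1 (rho2 / 2 / B).
have e0 : 0 < e by rewrite lt_min invr_gt0 !divr_gt0 // mulr_gt0.
have d1 : 4 * L * e <= 1.
  have : e <= (4 * L)^-1 by rewrite ge_min lexx.
  by rewrite -ler_pdivlMl ?mulr_gt0 // mulr1.
have d2 : B * e <= rho2 / 2.
  have : e <= rho2 / 2 / B by rewrite ge_min lexx orbT.
  by rewrite ler_pdivlMr // mulrC.
exists rho, e, L, B; split.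
  by split=> //; [rewrite /rho; lra|lra].
have flowc w : `|w - chart i z0| <= rho -> exists2 c : R -> E, c 0 = w &
    forall t : R, `|t| < e -> [/\ chart i (cflow t (inv i w)) = c t,
     dom i (cflow t (inv i w)), `|c t - chart i z0| <= rho2,
     `|c t - w| <= B * `|t| & is_derive t 1 c (field f i (c t))].
  move=> wr; have [c c0 cP] := local_solution (@findim_E R n) rho0 L0 d1 d2 XL XB wr.
  exists c => // t te; have [D h1 h2] := cP t te.
  have E1 : cflow t (inv i w) = inv i (c t).
    apply: (@ham_unique R n P A f (fun t => cflow t (inv i w))
      (fun t => inv i (c t)) (- e) e 0 Cf); rewrite -?ltr_norml ?normr0 //.
    - by move=> s _; exact: cflow_ham.
    - move=> s; rewrite -ltr_norml => /cP[D' h1' _].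
      by apply: ham_at_lift => //; exact: inb.
    - by rewrite cflow0 c0.
  by split=> //; rewrite E1; [rewrite ca_invK //; exact: inb|apply: ca_inv_dom; exact: inb].
have phiD w (t : R) : `|w - chart i z0| <= rho -> `|t| < e ->
    is_derive t 1 (fun t => chart i (cflow t (inv i w)))
      (field f i (chart i (cflow t (inv i w)))).
  move=> wr te; have [c _ cP] := flowc w wr; have [-> _ _ _ D] := cP t te.
  apply: is_derive_near D; apply/(@nearNP _ R^o).
  exists (e - `|t|); first by rewrite subr_gt0.
  move=> s st; have se : `|s| < e.
    rewrite -(subrK t s); apply: le_lt_trans (ler_normD _ _) _.
    by rewrite -ltrBrDr.
  by have [-> _ _ _ _] := cP s se.
split=> /=; rewrite -?r2.
- by move=> a ar; split; [exact: inb|exact: XB].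
- exact: XL.
- move=> w t wr te; have [c _ cP] := flowc w wr; have [h1 h2 h3 h4 _] := cP t te.
  by split; rewrite ?h1 //; rewrite -h1; exact: phiD.
- move=> w w' t wr wr' te.
  have := @compare_solutions _ _ (field f i) [set a | `|a - chart i z0| <= rho2] L e
    (fun t => chart i (cflow t (inv i w))) (fun t => chart i (cflow t (inv i w'))) (ltW L0).
  have Le : L * e <= 1 / 2 by lra.
  move=> /(_ Le (fun a b ha hb => XL a b ha hb)) C.
  have [||_] := C _ _ t te.
  + move=> s se; split; first exact: phiD.
    by have [c _ cP] := flowc w wr; have [h1 _ h3 _ _] := cP s se; rewrite /= h1.
  + move=> s se; split; first exact: phiD.
    by have [c _ cP] := flowc w' wr'; have [h1 _ h3 _ _] := cP s se; rewrite /= h1.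
  + by rewrite !cflow0 !ca_invK //; apply: inb; rewrite /rho in wr wr'; lra.
Qed.

Lemma cflow_continuous_small (z0 : P) : exists2 e : R, 0 < e &
  \forall z \near z0, forall d, 0 < d -> d < e ->
    forall t, `|t| < d -> {for z, continuous (cflow t)}.
Proof.
have [i iz] := ca_cover A z0.
have [rho [e [L [B [[/andP[r0 _] e0 L0 B0 Le] /= [inb XL phiP phiL]]]]]] :=
  local_cflow iz ltr01.
exists e => //; have iw := ca_chart_img iz.
have h1 : \forall z \near z0, `|chart i z0 - chart i z| < rho.
  by have /cvgrPdist_lt := ca_chart_cont iz; apply.
apply: filterS (filterI (near_dom iz) h1) => z1 [iz1 zr1] d0 _ de t td.
have {td de} te : `|t| < e by exact: lt_trans de.
rewrite distrC in zr1; pose w1 := chart i z1.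
pose phi w := chart i (cflow t (inv i w)).
have phic : {for w1, continuous phi}.
  apply/cvgrPdist_le => d {}d0; apply/(@nearNP _ E).
  exists (Num.min (rho - `|w1 - chart i z0|) (d / 2)).
    by rewrite lt_min subr_gt0 zr1 divr_gt0.
  move=> w; rewrite lt_min => /andP[wr wd].
  have wr' : `|w - chart i z0| <= rho.
    have -> : w - chart i z0 = (w - w1) + (w1 - chart i z0) by vring.
    by apply: le_trans (ler_normD _ _) _; rewrite -lerBrDr ltW.
  have K := phiL w w1 t wr' (ltW zr1) te.
  rewrite distrC -(subrK (w - w1) (phi w - phi w1)).
  apply: le_trans (ler_normD _ _) _.
  have Lt : 2 * L * `|t| <= 1.
    have : L * `|t| <= L * e by rewrite ler_wpM2l // ltW.
    lra.
  have : 2 * L * `|t| * `|w - w1| <= 1 * `|w - w1| by rewrite ler_wpM2r.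
  rewrite -/(phi w) -/(phi w1) in K; lra.
have iz' : dom i (cflow t z1).
  by have [+ _ _ _] := phiP _ _ (ltW zr1) te; rewrite ca_chartK.
have c2 : {for z1, continuous (fun z => inv i (phi (chart i z)))}.
  apply: (@continuous_comp _ _ _ (fun z => phi (chart i z)) (inv i)).
    apply: (@continuous_comp _ _ _ (chart i) phi); first exact: ca_chart_cont.
    exact: phic.
  by apply: ca_inv_cont; rewrite /phi ca_chartK //; exact: ca_chart_img.
have E2 : \forall z \near z1, inv i (phi (chart i z)) = cflow t z.
  have h2 : \forall z \near z1, `|chart i z1 - chart i z| < rho - `|chart i z1 - chart i z0|.
    by have /cvgrPdist_lt := ca_chart_cont iz1; apply; rewrite subr_gt0.
  apply: filterS (filterI (near_dom iz1) h2) => z [zi zr].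
  have wr' : `|chart i z - chart i z0| <= rho.
    have -> : chart i z - chart i z0 = (chart i z - w1) + (w1 - chart i z0) by vring.
    apply: le_trans (ler_normD _ _) _; rewrite -lerBrDr ltW //.
    by rewrite distrC.
  have [h _ _ _] := phiP _ _ wr' te.
  by rewrite /phi ca_chartK // in h *; rewrite ca_chartK.
have E3 : inv i (phi (chart i z1)) = cflow t z1 by exact: nbhs_singleton E2.
apply: cvg_trans (near_eq_cvg E2) _; rewrite -E3.
exact: c2.
Qed.

Lemma cflow_near (z0 : P) (U : set P) : nbhs z0 U -> exists2 e : R, 0 < e &
  \forall z \near z0, forall d, 0 < d -> d < e -> forall t, `|t| < d -> U (cflow t z).
Proof.
move=> nU; have [i iz] := ca_cover A z0.
have [rho [e [L [B [[/andP[r0 _] e0 L0 B0 Le] /= [inb XL phiP phiL]]]]]] :=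
  local_cflow iz ltr01.
have iw := ca_chart_img iz.
have [d d0 dP] : exists2 d : R, 0 < d & forall w, `|w - chart i z0| < d -> U (inv i w).
  apply/(@nearNP _ E (chart i z0)); apply: (ca_inv_cont iw).
  by rewrite ca_chartK.
exists (Num.min e (d / 2 / B)); first by rewrite lt_min e0 !divr_gt0.
have h1 : \forall z \near z0, `|chart i z0 - chart i z| < Num.min rho (d / 2).
  by have /cvgrPdist_lt := ca_chart_cont iz; apply; rewrite lt_min r0 divr_gt0.
apply: filterS (filterI (near_dom iz) h1) => z [zi zr] q _ qe t tq.
rewrite distrC lt_min in zr; case/andP: zr => zr zd.
have te : `|t| < Num.min e (d / 2 / B) by exact: lt_trans qe.
rewrite lt_min in te; case/andP: te => te tB.
have [h _ h2 _] := phiP _ _ (ltW zr) te; rewrite ca_chartK // in h h2.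
rewrite -(ca_chartK h); apply: dP.
have -> : chart i (cflow t z) - chart i z0 =
  (chart i (cflow t z) - chart i z) + (chart i z - chart i z0) by vring.
apply: le_lt_trans (ler_normD _ _) _; rewrite ltr_pdivlMr // in tB; lra.
Qed.

Lemma cflow_continuous t : continuous (cflow t).
Proof.
move=> z0.
have [e' e'0 He'] := uniform_over_compact (@H_compact (H z0))
  (fun z _ => cflow_continuous_small z).
pose e := e' / 2; have e0 : 0 < e by rewrite /e; lra.
have He z s : H z <= H z0 -> `|s| < e -> {for z, continuous (cflow s)}.
  by move=> zk se; apply: (He' z e zk) => //; rewrite /e; lra.
have tN : exists N : nat, `|t| < N.+1%:R * e.
  exists (Num.bound (`|t| / e)).
  have : `|t| / e < (Num.bound (`|t| / e))%:R by apply: archi_boundP; rewrite divr_ge0 // ltW.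
  by rewrite ltr_pdivrMr // => h; apply: lt_trans h _; rewrite ltr_pM2r // ltr_nat.
have {tN} [N tN] := tN; pose s := t / N.+1%:R.
have se : `|s| < e.
  rewrite /s normrM normfV ltr_pdivrMr ?normr_gt0 //.
  by rewrite [X in _ < _ * X]ger0_norm // mulrC.
have -> : t = N.+1%:R * s by rewrite /s mulrC divfK.
elim: (N.+1) => [|m IH].
  rewrite mul0r (_ : cflow 0 = id); first exact: cvg_id.
  by apply/funext => z; rewrite cflow0.
have -> : cflow (m.+1%:R * s) = cflow s \o cflow (m%:R * s).
  by apply/funext => z; rewrite /= -cflowD -addn1 natrD mulrDl mul1r addrC.
apply: (@continuous_comp _ _ _ (cflow (m%:R * s)) (cflow s)) => //.
by apply: He => //; rewrite cflow_energy.
Qed.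

End global_flow.

(** * Functions in involution *)

Section uniform_differentiability.
Context {R : realType}.
Implicit Types V W : normedModType R.

Lemma diff_approx V W (f : V -> W) (l : {linear V -> W}) (x : V) (K : R) :
  differentiable f x ->
  (exists2 d : R, 0 < d & forall y, `|y - x| < d ->
    `|f y - f x - l (y - x)| <= K * `|y - x|) ->
  forall v, `|'d f x v - l v| <= K * `|v|.
Proof.
move=> df [d d0 dP] v; apply: le_epsN => // e e0.
have z1 : 'd f x 0 = 0 by exact: linear0.
have z2 : l 0 = 0 by exact: linear0.
have [->|v0] := eqVneq v 0; first by rewrite z1 z2 subrr !normr0 mulr0.
have vp : 0 < `|v| by rewrite normr_gt0.
have [r r0 rP] := diff_nearN df e0.
pose s := Num.min d r / 2 / `|v|.
have m0 : 0 < Num.min d r by rewrite lt_min d0.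
have s0 : 0 < s by rewrite !divr_gt0.
have sE : x + s *: v - x = s *: v by vring.
have sv : `|x + s *: v - x| < Num.min d r.
  by rewrite sE normrZ gtr0_norm // /s divfK ?gt_eqF //; lra.
have [sd sr] : `|x + s *: v - x| < d /\ `|x + s *: v - x| < r.
  by apply/andP; rewrite -lt_min.
have h1 := dP _ sd; have h2 := rP _ sr.
rewrite sE normrZ (gtr0_norm s0) in h1 h2.
have e1 : l (s *: v) = s *: l v by exact: linearZ.
have e2 : 'd f x (s *: v) = s *: 'd f x v by exact: linearZ.
rewrite -(ler_pM2l s0) -[X in X * _ <= _](gtr0_norm s0) -normrZ scalerBr -e1 -e2.
set a := f _ in h1 h2; set p := l _ in h1 *; set q := 'd f x (s *: v) in h2 *.
have -> : q - p = (a - f x - p) - (a - f x - q) by vring.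
apply: le_trans (ler_normB _ _) _; apply: le_trans (lerD h1 h2) _.
by rewrite -mulrDl mulrCA.
Qed.

Lemma diff_subZ V W (f : V -> W) (x u v : V) (r : R) :
  'd f x (u - r *: v) = 'd f x u - r *: 'd f x v.
Proof. by rewrite linearB linearZ. Qed.

Lemma sub_split V (x y p q r : V) : r = p - q -> x - y - q = (x - y - p) + r.
Proof. by move=> ->; vring. Qed.

Lemma diff_le_lipschitz V W (f : V -> W) (x : V) (L d : R) : 0 < d ->
  differentiable f x ->
  (forall y, `|y - x| < d -> `|f y - f x| <= L * `|y - x|) ->
  forall v, `|'d f x v| <= L * `|v|.
Proof.
move=> d0 df H v; rewrite -[X in `|X|]subr0.
apply: (@diff_approx _ _ f \0%R x L df).
by exists d => // y /H; rewrite subr0.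
Qed.

Lemma Ck1_udiff V W (fd : findim V) (U : set V) (f : V -> W) (x : V) :
  open U -> U x -> Ck 1 U f ->
  forall e : R, 0 < e -> exists2 d : R, 0 < d & forall a b,
    `|a - x| < d -> `|b - x| < d ->
    `|f a - f b - 'd f b (a - b)| <= e * `|a - b|.
Proof.
move=> oU Ux Cf e e0; have e2 : 0 < e / 2 by lra.
have [d d0 dP] := Ck1_sdiff fd oU Ux Cf e2.
have [r r0 rP] := openNP oU Ux.
exists (Num.min d r); first by rewrite lt_min d0.
move=> a b; rewrite !lt_min => /andP[ad ar] /andP[bd br].
have dfb : differentiable f b by apply: Cf.1; exact: rP.
have K : `|'d f b (a - b) - 'd f x (a - b)| <= e / 2 * `|a - b|.
  apply: diff_approx => //; exists (d - `|b - x|); first by rewrite subr_gt0.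
  move=> y yb; apply: dP => //.
  have -> : y - x = (y - b) + (b - x) by vring.
  by apply: le_lt_trans (ler_normD _ _) _; rewrite -ltrBrDr.
have := dP a b ad bd; set u := 'd f x (a - b) in K *; set v := 'd f b (a - b) in K *.
move=> K2; have -> : f a - f b - v = (f a - f b - u) - (v - u) by vring.
apply: le_trans (ler_normB _ _) _; apply: le_trans (lerD K2 K) _.
by rewrite -mulrDl -splitr.
Qed.

Lemma Ck1_diff_continuous V W (fd : findim V) (U : set V) (f : V -> W) (X : V -> V) (x : V) :
  open U -> U x -> Ck 1 U f -> {for x, continuous X} ->
  {for x, continuous (fun y => 'd f y (X y))}.
Proof.
move=> oU Ux [dfU DfU] cX.
have E : \forall y \near x, \sum_(i : fd) fdc i (X y) *: 'D_(fde i) f y = 'd f y (X y).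
  have : nbhs x U by exact: open_nbhs_nbhs.
  apply: filterS => y Uy; rewrite [in RHS](fdE fd (X y)) linear_sum.
  by apply: eq_bigr => i _; rewrite linearZ deriveE //; exact: dfU.
have c : {for x, continuous (fun y => \sum_(i : fd) fdc i (X y) *: 'D_(fde i) f y)}.
  have -> : (fun y => \sum_(i : fd) fdc i (X y) *: 'D_(fde i) f y) =
      (fun y => \sum_(i <- enum fd) fdc i (X y) *: 'D_(fde i) f y).
    by apply/funext => y; rewrite big_enum.
  elim: (enum fd) => [|i s IH].
    rewrite (_ : (fun _ => _) = cst 0); first exact: cst_continuous.
    by apply/funext => y; rewrite big_nil.
  rewrite (_ : (fun _ => _) = (fun y => fdc i (X y) *: 'D_(fde i) f y) +
    (fun y => \sum_(j <- s) fdc j (X y) *: 'D_(fde j) f y)); last first.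
    by apply/funext => y; rewrite big_cons.
  apply: (@continuousD _ _ _ (fun y => fdc i (X y) *: 'D_(fde i) f y)) => //.
  apply: (@cvgZ _ _ _ (nbhs x)); last exact: DfU.
  apply/cvgrPdist_le => e e0; move/cvgrPdist_le : cX => /(_ e e0).
  by apply: filterS => y; rewrite -fdB; apply: le_trans; exact: fd_le.
have Ex := nbhs_singleton E.
by apply: cvg_trans (near_eq_cvg E) _; rewrite -Ex.
Qed.

End uniform_differentiability.

Section commuting_hamiltonians.
Context {R : realType} {n : nat} {P : topologicalType} (A : @canonical_atlas R n P).
Notation E := ('rV[R]_n * 'rV[R]_n)%type.
Context (F H : P -> R).
Hypothesis CF : C2 A F.
Hypothesis CH : C2 A H.
Hypothesis H_compact : forall k, compact [set z | H z <= k].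
Hypothesis FH0 : forall (i : ca_index A) w, ca_img i w ->
  omega (field H i w) (field F i w) = 0.

Local Notation chart := (@ca_chart _ _ _ A).
Local Notation inv := (@ca_inv _ _ _ A).
Local Notation dom := (@ca_dom _ _ _ A).
Local Notation img := (@ca_img _ _ _ A).

Lemma omega_anti (a b : E) : omega a b = - omega b a.
Proof. by rewrite /omega opprB (pairingC a.1) (pairingC a.2) addrC. Qed.

Lemma omega_diag (a : E) : omega a a = 0.
Proof. by rewrite /omega (pairingC a.1) subrr. Qed.

Lemma F_H_const gamma t : ham_at A F gamma t -> is_derive t 1 (H \o gamma) 0.
Proof.
move=> h; have [i it] := ca_cover A (gamma t).
have iw := ca_chart_img it; have dH := C2_differentiable CH iw.
by have := is_derive_along h it dH; rewrite ham_vectorP // FH0.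
Qed.

Lemma H_H_const gamma t : ham_at A H gamma t -> is_derive t 1 (H \o gamma) 0.
Proof.
move=> h; have [i it] := ca_cover A (gamma t).
have iw := ca_chart_img it; have dH := C2_differentiable CH iw.
by have := is_derive_along h it dH; rewrite ham_vectorP // omega_diag.
Qed.

Lemma hasD_omega (V : normedModType R) (f g : V -> E) (x h : V) (d e : E) :
  hasD f x h d -> hasD g x h e ->
  hasD (fun z => omega (f z) (g z)) x h (omega d (g x) + omega (f x) e).
Proof.
move=> hf hg.
have f1 := hasD_comp hf (hasD_fst _ d); have f2 := hasD_comp hf (hasD_snd _ d).
have g1 := hasD_comp hg (hasD_fst _ e); have g2 := hasD_comp hg (hasD_snd _ e).
have := hasD_sub (hasD_pairing f1 g2) (hasD_pairing f2 g1).
by rewrite /omega opprD addrACA.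
Qed.

Lemma hessian_field (f : P -> R) i w a b : C2 A f -> img i w ->
  omega ('d (field f i) w a) b = omega ('d (field f i) w b) a.
Proof.
move=> Cf iw; have dX := differentiable_field Cf iw.
have o := @ca_open_img _ _ _ A i.
have key (c d : E) : omega ('d (field f i) w c) d =
    'D_c (fun z => 'D_d (in_chart f i) z) w.
  have h := hasD_omega (hasD_self c dX) (hasD_cst d w c).
  have e0 : omega (field f i w) 0 = 0 by rewrite /omega !pairing0r subrr.
  rewrite e0 addr0 /= in h; rewrite -(hasD_derive h); apply: near_eq_derive.
  apply: filterS (near_img iw) => v iv.
  have dv := C2_differentiable Cf iv.
  by rewrite deriveE // ham_vectorP.
by rewrite !key; exact: schwarz o iw (Cf i).
Qed.

Lemma fields_commute i w : img i w ->
  'd (field F i) w (field H i w) = 'd (field H i) w (field F i w).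
Proof.
move=> iw; have dF := differentiable_field CF iw; have dH := differentiable_field CH iw.
apply: omega_nondeg => b.
have h := hasD_omega (hasD_self b dH) (hasD_self b dF).
have h0 : hasD (fun z => omega (field H i z) (field F i z)) w b 0.
  apply: hasD_near (hasD_cst 0 w b).
  by apply: filterS (near_img iw) => v iv; rewrite FH0.
have := hasD_uniq h h0.
rewrite (hessian_field _ _ CH iw) (omega_anti (field H i w)) (hessian_field _ _ CF iw).
by move=> k; exact: (esym (subr0_eq k)).
Qed.

Local Notation flowF := (cflow A F).
Local Notation flowH := (cflow A H).

Let F_const := F_H_const.
Let H_const := H_H_const.

Lemma commute_near (z0 : P) : exists2 e : R, 0 < e &
  \forall z \near z0, forall d, 0 < d -> d < e ->
    forall t, `|t| < d -> ham_at A H (fun s => flowF t (flowH s z)) 0.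
Proof.
have [i iz] := ca_cover A z0.
have [rho [e [L [B [[/andP[r0 _] e0 L0 B0 Le] /= [inb XL phiP phiL]]]]]] :=
  local_cflow CF H_compact F_const iz ltr01.
exists (Num.min e (rho / 2 / B)); first by rewrite lt_min e0 !divr_gt0.
have h1 : \forall z \near z0, `|chart i z0 - chart i z| < rho.
  by have /cvgrPdist_lt := ca_chart_cont iz; apply.
apply: filterS (filterI (near_dom iz) h1) => z [zi zr] q _ qe t tq.
rewrite distrC in zr.
have te : `|t| < Num.min e (rho / 2 / B) by exact: lt_trans qe.
rewrite lt_min in te; case/andP: te => te tB.
pose X := field F i; pose Y := field H i; pose w := chart i z.
pose c s := chart i (flowH s z).
have c0 : c 0 = w by rewrite /c (cflow0 CH H_compact H_const).
have [cH /(_ i)] := cflow_ham CH H_compact H_const z 0.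
rewrite (cflow0 CH H_compact H_const) => /(_ zi) cD.
pose a s (u : R) := chart i (flowF u (inv i (c s))).
have near_s : \forall s \near (0 : R), dom i (flowH s z) /\ `|c s - chart i z0| <= rho.
  apply: filterI.
    by apply: cH; rewrite (cflow0 CH H_compact H_const); exact: near_dom.
  have cc : {for (0 : R), continuous c} by exact: is_derive_continuous cD.
  have [d d0 dP] := @continuousNP _ R^o _ _ _ cc (rho - `|w - chart i z0|) ltac:(by rewrite subr_gt0).
  apply/(@nearNP _ R^o); exists d => // s /dP.
  rewrite c0 => sw; have -> : c s - chart i z0 = (c s - w) + (w - chart i z0) by vring.
  by apply: le_trans (ler_normD _ _) _; rewrite -lerBrDr.
have [d1 d10 d1P] := proj1 (@nearNP _ R^o _ _) near_s.
have wr : `|w - chart i z0| <= rho by exact: ltW.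
have inside u : `|u| <= `|t| -> `|a 0 u - chart i z0| < 2 * rho.
  move=> ut; have ue := le_lt_trans ut te.
  have [_ _ h _] := phiP w u wr ue.
  have -> : a 0 u - chart i z0 = (a 0 u - w) + (w - chart i z0) by vring.
  apply: le_lt_trans (ler_normD _ _) _.
  have : B * `|u| <= B * `|t| by rewrite ler_wpM2l // ltW.
  rewrite ltr_pdivlMr // mulrC in tB; rewrite /a c0; lra.
have a_img u : `|u| <= `|t| -> img i (a 0 u).
  by move=> /inside/ltW/inb[].
have XD u v : `|u| <= `|t| -> `|'d X (a 0 u) v| <= L * `|v|.
  move=> ut; have iu := inside u ut.
  apply: (@diff_le_lipschitz _ _ _ _ _ _ (2 * rho - `|a 0 u - chart i z0|)).
  - by rewrite subr_gt0.
  - exact: differentiable_field CF (a_img u ut).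
  - move=> y yu; apply: XL; last exact: ltW.
    have -> : y - chart i z0 = (y - a 0 u) + (a 0 u - chart i z0) by vring.
    by apply: le_trans (ler_normD _ _) _; rewrite -lerBrDr ltW.
have aD (s u : R) : `|c s - chart i z0| <= rho -> `|u| < e ->
    is_derive u 1 (a s) (X (a s u)).
  by move=> sr ue; have [_ _ _ h] := phiP _ _ sr ue.
(* the differentiability of the field is uniform along the compact arc *)
have udiff (kappa : R) : 0 < kappa -> exists2 d : R, 0 < d & forall u b,
    `|u| <= `|t| -> `|b - a 0 u| < d ->
    `|X b - X (a 0 u) - 'd X (a 0 u) (b - a 0 u)| <= kappa * `|b - a 0 u|.
  move=> k0; have cK : compact [set` `[- `|t|, `|t|] ] by exact: segment_compact.
  pose Q (u d : R) := forall b, `|b - a 0 u| < d ->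
    `|X b - X (a 0 u) - 'd X (a 0 u) (b - a 0 u)| <= kappa * `|b - a 0 u|.
  have [|d d0 dP] := @uniform_over_compact R R _ Q cK.
    move=> u; rewrite /= in_itv /= -ler_norml => ut.
    have o := @ca_open_img _ _ _ A i.
    have [d d0 dP] := Ck1_udiff (@findim_E R n) o (a_img u ut) (Ck1_field i CF) k0.
    exists (d / 2); first by rewrite divr_gt0.
    have d40 : 0 < d / 4 by rewrite divr_gt0.
    have ue := le_lt_trans ut te.
    have cc := is_derive_continuous (aD 0 u ltac:(by rewrite c0) ue).
    have [d' d'0 d'P] := @continuousNP _ R^o _ _ _ cc _ d40.
    apply/(@nearNP _ R^o); exists d' => // u' /d'P u'u q' q'0 q'd b bu.
    apply: dP; last by apply: le_lt_trans u'u _; lra.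
    have -> : b - a 0 u = (b - a 0 u') + (a 0 u' - a 0 u) by vring.
    apply: le_lt_trans (ler_normD _ _) _; lra.
  exists (d / 2); first by rewrite divr_gt0.
  have d2p : 0 < d / 2 by exact: divr_gt0.
  have d2d : d / 2 < d by rewrite ltr_pdivrMr // ltr_pMr // ltr1n.
  move=> u b ut bu; apply: (dP u (d / 2) _ d2p d2d b bu).
  by rewrite /= in_itv /= -ler_norml.
have Lt : L * `|t| <= 1 / 2.
  by apply: le_trans Le; rewrite ler_wpM2l // ltW.
have sum2 s u : `|c s - chart i z0| <= rho -> `|u| <= `|t| ->
    `|a s u - a 0 u| <= 2 * `|c s - w|.
  move=> sr ut; have ue := le_lt_trans ut te.
  have := phiL (c s) w u sr wr ue; rewrite -/(a s u) => K.
  have a0E : a 0 u = chart i (flowF u (inv i w)) by rewrite /a c0.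
  rewrite -a0E in K.
  rewrite -(subrK (c s - w) (a s u - a 0 u)); apply: le_trans (ler_normD _ _) _.
  have : 2 * L * `|u| * `|c s - w| <= 1 * `|c s - w|.
    rewrite ler_wpM2r //; have : L * `|u| <= L * `|t| by rewrite ler_wpM2l // ltW.
    lra.
  lra.
have main : is_derive (0 : R) 1 (fun s => a s t) (Y (a 0 t)).
  apply/is_deriveNP => kappa k0.
  pose C := `|Y w| + 1; have C0 : 0 < C by rewrite /C ltr_wpDl.
  pose k1 := kappa / 4; have k10 : 0 < k1 by rewrite /k1; lra.
  pose k2 := kappa / (8 * C * (`|t| + 1)).
  have t1 : 0 < `|t| + 1 by rewrite ltr_wpDl.
  have k20 : 0 < k2 by rewrite divr_gt0 // !mulr_gt0.
  have [d2 d20 d2P] := udiff k2 k20.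
  have /is_deriveNP cD' := cD.
  have [d3 d30 d3P] := cD' _ k10; have [d4 d40 d4P] := cD' 1 ltr01.
  exists (Num.min (Num.min d1 (d2 / 2 / C)) (Num.min d3 d4)).
    by rewrite !lt_min d10 d30 d40 !divr_gt0.
  move=> s; rewrite !lt_min => /andP[/andP[s1 s2] /andP[s3 s4]].
  have [sdom sr] := d1P s s1; have K3 := d3P s s3; have K4 := d4P s s4.
  rewrite subr0 in s2 s3 s4 K3 K4.
  rewrite -/(c s) -/(c 0) c0 -/w -/(Y w) in K3; rewrite -/(c s) -/(c 0) c0 -/w -/(Y w) in K4.
  rewrite !subr0.
  have cs : `|c s - w| <= C * `|s|.
    rewrite -(subrK (s *: Y w) (c s - w)); apply: le_trans (ler_normD _ _) _.
    rewrite mul1r in K4; have -> : C * `|s| = `|s| + `|s| * `|Y w| by rewrite /C; ring.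
    by apply: lerD; [exact: K4|rewrite normrZ].
  pose Es u := a s u - a 0 u - s *: Y (a 0 u).
  have inv_c0 u : a 0 u = chart i (flowF u (inv i w)) by rewrite /a c0.
  have G := @gronwall _ _ Es
    (fun u => X (a s u) - X (a 0 u) - s *: 'd Y (a 0 u) (X (a 0 u))) L
    (k2 * (2 * (C * `|s|))) t (ltW L0) _ Lt.
  have K0 : 0 <= k2 * (2 * (C * `|s|)) 
    by apply: mulr_ge0; [exact: ltW|apply: mulr_ge0 => //; apply: mulr_ge0 => //; exact: ltW].
  have {G} : `|Es t| <= 2 * (`|Es 0| + k2 * (2 * (C * `|s|)) * `|t|).
    apply: G => // u ut; have ue := le_lt_trans ut te.
      have D0 := aD 0 u ltac:(by rewrite c0) ue.
      have D1 := aD s u sr ue.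
      have D01 : is_derive u 1 (fun v => a s v - a 0 v) (X (a s u) - X (a 0 u)).
        exact: is_deriveB.
      have dY := differentiable_field CH (a_img u ut).
      have DY := hasD_curve D0 (hasD_self _ dY).
      have DZ : is_derive u 1 (fun v => s *: Y (a 0 v)) (s *: 'd Y (a 0 u) (X (a 0 u))).
        exact: is_deriveZ.
      exact: is_deriveB.
    have au := sum2 s u sr ut.
    have E1 : 'd X (a 0 u) (Es u) =
        'd X (a 0 u) (a s u - a 0 u) - s *: 'd Y (a 0 u) (X (a 0 u)).
      have E2 := diff_subZ X (a 0 u) (a s u - a 0 u) (Y (a 0 u)) s.
      exact: (etrans E2 (congr1 (fun v => _ - s *: v) (fields_commute (a_img u ut)))).
    have EE : X (a s u) - X (a 0 u) - s *: 'd Y (a 0 u) (X (a 0 u)) =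
        (X (a s u) - X (a 0 u) - 'd X (a 0 u) (a s u - a 0 u)) + 'd X (a 0 u) (Es u).
      exact: sub_split E1.
    rewrite EE.
    rewrite addrC; apply: le_trans (ler_normD _ _) _; apply: lerD; first exact: XD.
    have smallu : `|a s u - a 0 u| < d2.
      apply: le_lt_trans au _; apply: le_lt_trans (ler_wpM2l _ cs) _ => //.
      by move: s2; rewrite ltr_pdivlMr // ltr_pdivlMr // mulrC [_ * C]mulrC.
    apply: le_trans (d2P u (a s u) ut smallu) _.
    by rewrite ler_wpM2l ?(ltW k20) // (le_trans au) // ler_wpM2l.
  have E0 : `|Es 0| <= k1 * `|s|.
    rewrite /Es /a !(cflow0 CF H_compact F_const) !ca_invK; last 2 first.
    - by rewrite c0; exact: ca_chart_img.
    - by apply: ca_chart_img.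
    by rewrite c0; exact: K3.
  rewrite /Es => G; apply: le_trans G _.
  have -> : kappa * `|s| = 2 * (k1 * `|s| + kappa / 4 * `|s|) by rewrite /k1; field.
  rewrite ler_pM2l // lerD //.
  have -> : k2 * (2 * (C * `|s|)) * `|t| = kappa / 4 * `|s| * (`|t| / (`|t| + 1)).
    by rewrite /k2; field; rewrite !gt_eqF.
  rewrite ler_piMr //; first by rewrite mulr_ge0 // divr_ge0 // ltW.
  by rewrite ler_pdivrMr // mul1r lerDl.
have tez := ltac:(exact: (phiP w t wr te)).
have Ez : inv i (c 0) = z by rewrite c0 ca_chartK.
have tdom : dom i (flowF t z) by have [+ _ _ _] := tez; rewrite /w ca_chartK.
apply: (@ham_at_chart _ _ _ _ _ _ _ i CH).
- apply: (@continuous_comp _ _ _ (fun s => flowH s z) (flowF t)); first exact: cH.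
  exact: (cflow_continuous CF H_compact F_const).
- by rewrite (cflow0 CH H_compact H_const).
- rewrite (cflow0 CH H_compact H_const).
  have <- : a 0 t = chart i (flowF t z) by rewrite /a Ez.
  apply: is_derive_near main; apply: filterS near_s => s [sdom _].
  by rewrite /a /c ca_chartK.
Qed.

Lemma commute_small (k : R) : exists2 e : R, 0 < e & forall z s t, H z <= k ->
  `|t| < e -> flowF t (flowH s z) = flowH s (flowF t z).
Proof.
have [e' e'0 He'] := uniform_over_compact (@H_compact k) (fun z _ => commute_near z).
exists (e' / 2) => [|z s t zk te]; first lra.
apply: esym; apply: (@cflowE _ _ _ _ _ CH (fun s => flowF t (flowH s z))); last first.
  by rewrite (cflow0 CH H_compact H_const).
move=> u.
have Hu : ham_at A H (fun v => flowF t (flowH v (flowH u z))) 0.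
  apply: (He' (flowH u z) (e' / 2)) => //; [|lra|lra].
  by rewrite /= (cflow_energy CH H_compact H_const).
have := @ham_at_shift _ _ _ A H _ (- u) u.
rewrite addNr => /(_ _ Hu); apply: ham_at_near.
apply/(@nearNP _ R^o); exists 1 => // v _.
by rewrite -(cflowD CH H_compact H_const) addrAC addNr add0r.
Qed.

Lemma flows_commute s t z : flowF t (flowH s z) = flowH s (flowF t z).
Proof.
have [e e0 He] := commute_small (H z).
have [N tN] : exists N : nat, `|t| < N.+1%:R * e.
  exists (Num.bound (`|t| / e)).
  have : `|t| / e < (Num.bound (`|t| / e))%:R by apply: archi_boundP; rewrite divr_ge0 // ltW.
  by rewrite ltr_pdivrMr // => h; apply: lt_trans h _; rewrite ltr_pM2r // ltr_nat.
pose r := t / N.+1%:R.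
have re : `|r| < e.
  rewrite /r normrM normfV ltr_pdivrMr ?normr_gt0 //.
  by rewrite [X in _ < _ * X]ger0_norm // mulrC.
have -> : t = N.+1%:R * r by rewrite /r mulrC divfK.
elim: (N.+1) => [|m IH].
  by rewrite mul0r !(cflow0 CF H_compact F_const).
have -> : m.+1%:R * r = r + m%:R * r by rewrite -addn1 natrD mulrDl mul1r addrC.
rewrite !(cflowD CF H_compact F_const) IH; apply: He => //.
by rewrite (cflow_energy CF H_compact F_const).
Qed.

(* Both functions have the same derivative, [g] along the flow of [F] and [h]
   along the flow of [H]. *)
Lemma increments_agree (g h : P -> R) :
  (forall i, Ck 1 (img i) (in_chart g i)) -> (forall i, Ck 1 (img i) (in_chart h i)) ->
  (forall i w, img i w -> 'd (in_chart g i) w (field F i w) =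
                          'd (in_chart h i) w (field H i w)) ->
  forall k kappa : R, 0 < kappa -> exists2 e : R, 0 < e & forall z t, H z <= k -> `|t| < e ->
    `|(g (flowF t z) - g z) - (h (flowH t z) - h z)| <= kappa * `|t|.
Proof.
move=> Cg Ch gh k kappa k0.
suff near_e (z0 : P) : exists2 e : R, 0 < e & \forall z \near z0, forall d, 0 < d -> d < e ->
    forall t, `|t| < d ->
    `|(g (flowF t z) - g z) - (h (flowH t z) - h z)| <= kappa * `|t|.
  have [e' e'0 He'] := uniform_over_compact (@H_compact k) (fun z _ => near_e z).
  exists (e' / 2) => [|z t zk te]; first lra.
  by apply: (He' z (e' / 2)) => //; lra.
have tri (x y x0 : R) : `|x - x0| <= kappa / 2 -> `|y - x0| <= kappa / 2 ->
    `|x - y| <= kappa.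
  move=> h1 h2; have -> : x - y = (x - x0) - (y - x0) by ring.
  by apply: le_trans (ler_normB _ _) _; lra.
have [i iz] := ca_cover A z0; have iw := ca_chart_img iz.
have o := @ca_open_img _ _ _ A i.
pose p w := 'd (in_chart g i) w (field F i w).
have cp : {for chart i z0, continuous p}.
  apply: (Ck1_diff_continuous (@findim_E R n) o iw (Cg i)).
  exact/differentiable_continuous/differentiable_field.
have nU : nbhs z0 [set z | dom i z /\ `|p (chart i z) - p (chart i z0)| <= kappa / 2].
  apply: filterI; first exact: near_dom.
  have cpz : {for z0, continuous (p \o chart i)}.
    by apply: continuous_comp; [exact: ca_chart_cont|exact: cp].
  have k2 : 0 < kappa / 2 by lra.
  move/cvgrPdist_le : cpz => /(_ _ k2); apply: filterS => z /=.
  by rewrite distrC.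
have [e1 e10 H1] := cflow_near CF H_compact F_const nU.
have [e2 e20 H2] := cflow_near CH H_compact H_const nU.
exists (Num.min e1 e2); first by rewrite lt_min e10.
apply: filterS (filterI H1 H2) => z [h1 h2] d d0; rewrite lt_min => /andP[de1 de2] t td.
pose q s := g (flowF s z) - h (flowH s z).
have -> : (g (flowF t z) - g z) - (h (flowH t z) - h z) = q t - q 0.
  by rewrite /q (cflow0 CF H_compact F_const) (cflow0 CH H_compact H_const); ring.
rewrite -[X in _ * `|X|]subr0.
apply: (@mean_value_abs _ _ q (fun s => p (chart i (flowF s z)) - p (chart i (flowH s z)))).
move=> s /between_norm; rewrite !subr0 => st; have sd := le_lt_trans st td.
have [d1 p1] := h1 d d0 de1 s sd; have [d2 p2] := h2 d d0 de2 s sd.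
have i1 := ca_chart_img d1; have i2 := ca_chart_img d2.
split; last first.
  exact: tri p1 p2.
apply: is_deriveB.
  apply: (is_derive_along (cflow_ham CF H_compact F_const z s) d1).
  exact: (Cg i).1.
rewrite /p gh //.
apply: (is_derive_along (cflow_ham CH H_compact H_const z s) d2).
exact: (Ch i).1.
Qed.

End commuting_hamiltonians.

(** * Tonelli Hamiltonians and the Legendre transform *)

Section properness.
Context {R : realType} {n : nat} {M : smooth_manifold R n}.
Notation E := ('rV[R]_n * 'rV[R]_n)%type.
Notation N := (cotangent_bundle M).
Implicit Types (i j k : chart_index M) (x : M).

Lemma posdef_unit (G : 'M[R]_n) : positive_definite G -> G \in unitmx.
Proof.
move=> pG; rewrite -row_free_unit; apply: inj_row_free => v vG.
apply/eqP; apply: contraT => v0; have := pG v v0.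
by rewrite vG pairing0l ltxx.
Qed.

Lemma cauchy_schwarz (G : 'M[R]_n) (q u : 'rV[R]_n) : G^T = G -> positive_definite G ->
  `|pairing q u| <= Num.sqrt (pairing (q *m invmx G) q) * Num.sqrt (pairing (u *m G) u).
Proof.
move=> sG pG; have uG := posdef_unit pG.
have Q0 (w : 'rV[R]_n) : 0 <= pairing (w *m G) w.
  by have [->|/pG/ltW//] := eqVneq w 0; rewrite pairing0r.
have sym (a b : 'rV[R]_n) : pairing (a *m G) b = pairing a (b *m G).
  by rewrite -{2}sG pairing_mul.
set p := q *m invmx G.
have pGq : p *m G = q by rewrite /p mulmxKV.
have Q1 : 0 <= pairing p q by rewrite -[X in pairing _ X]pGq -sym.
have [->|u0] := eqVneq u 0.
  by rewrite pairing0r normr0 mulr_ge0 // sqrtr_ge0.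
have Qu := pG u u0.
pose s := pairing q u / pairing (u *m G) u.
have := Q0 (p - s *: u).
have -> : pairing ((p - s *: u) *m G) (p - s *: u) =
    pairing p q - pairing q u ^+ 2 / pairing (u *m G) u.
  have E1 : pairing (u *m G) p = pairing q u by rewrite sym pGq pairingC.
  rewrite mulmxBl pGq -scalemxAl !(pairingBl, pairingBr, pairingZl, pairingZr) E1.
  by rewrite (pairingC q p) /s; field; rewrite gt_eqF.
rewrite subr_ge0 ler_pdivrMr // => h.
by rewrite -sqrtrM // -(sqrtr_sqr (pairing q u)) ler_sqrt // mulr_ge0 // ltW.
Qed.

Lemma norm_le_conorm (g : riemannian_metric M) i (y0 : 'rV[R]_n) : chart_img i y0 ->
  exists2 C, 0 < C & exists2 r, 0 < r & forall y (p : 'rV[R]_n), `|y - y0| < r ->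
    chart_img i y /\ `|p| <= C * conorm g (chart_inv i y) (cotangent_chart_inv i (y, p)).2.
Proof.
move=> iy0.
pose G y := let x := chart_inv i y in
  let J := 'J (transition i (chart_at x)) y in J *m gram g x *m J^T.
have Gc : {for y0, continuous G} by exact: (@gram_smooth R n M g i 0%N y0 iy0).
have [r1 r10 r1P] := continuousNP Gc ltr01.
have [r2 r20 r2P] := openNP (@chart_img_open _ _ M i) iy0.
pose K := Num.sqrt (`|G y0| + 1) + 1.
have K0 : 0 < K by rewrite ltr_wpDl // sqrtr_ge0.
exists K => //; exists (Num.min r1 r2); first by rewrite lt_min r10 r20.
move=> y p; rewrite lt_min => /andP[yr1 yr2].
have iy := r2P y yr2; split=> //.
apply: norm_row_le => [|j]; first by apply: mulr_ge0; [exact: ltW|exact: sqrtr_ge0].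
set x := chart_inv i y; set c := chart_at x.
set J1 := 'J (transition i c) y; set J2 := 'J (transition c i) (chart c x).
have JK : J1 *m J2 = 1%:M by apply: (@jacobianK R n M i c y); split=> //; exact: dom_chart_at.
set e := delta_mx 0 j : 'rV[R]_n.
have pj : p 0 j = pairing (p *m J2^T) (e *m J1).
  by rewrite -pairing_mul trmxK -mulmxA JK mulmx1 pairing_delta.
have Ge : pairing (e *m J1 *m gram g x) (e *m J1) = G y j j.
  have -> : e *m J1 *m gram g x = e *m (J1 *m gram g x) by rewrite mulmxA.
  rewrite -[X in pairing _ (_ *m X)]trmxK pairing_mul -mulmxA.
  by rewrite pairing_delta -rowE mxE.
rewrite pj mulrC; apply: le_trans (cauchy_schwarz _ _ (gram_sym g x) (gram_pos g x)) _.
rewrite ler_wpM2l ?sqrtr_ge0 // Ge.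
apply: (@le_trans _ _ (Num.sqrt (`|G y0| + 1))); last by rewrite lerDl.
have Gn : `|G y j j| <= `|G y0| + 1.
  apply: (@le_trans _ _ `|G y|).
    rewrite [leRHS]mx_normrE; apply: le_trans (le_bigmax _ _ (j, j)); exact: lexx.
  by rewrite addrC -lerBlDr; apply: le_trans (r1P y yr1); exact: lerB_dist.
apply: ler_wsqrtr; exact: le_trans (ler_norm _) Gn.
Qed.

Lemma superlinear_chart (H : N -> R) i (y0 : 'rV[R]_n) : uniformly_superlinear H ->
  chart_img i y0 -> exists2 r, 0 < r & forall a : R, exists b : R,
    forall y (p : 'rV[R]_n), `|y - y0| < r ->
    chart_img i y /\ a * `|p| - b <= H (cotangent_chart_inv i (y, p)).
Proof.
move=> [g gP] iy0; have [C C0 [r r0 rP]] := norm_le_conorm g iy0.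
exists r => // a; have [b bP] := gP (`|a| * C); exists b => y p yr.
have [iy pC] := rP y p yr; split=> //.
apply: le_trans (bP _ _); rewrite lerD2r.
apply: (@le_trans _ _ (`|a| * `|p|)); first by rewrite ler_wpM2r // ler_norm.
by rewrite -mulrA ler_wpM2l.
Qed.

Lemma C2_continuous (f : N -> R) : C2_cotangent f -> continuous f.
Proof.
move=> Cf z; set i := chart_at z.1.
have iz : chart_dom i z.1 by exact: dom_chart_at.
have d : {for cotangent_chart i z, continuous (f \o cotangent_chart_inv i)}.
  by apply: differentiable_continuous; apply: (Cf i).1; exact: img_chart.
have E : \forall z' \near z, (f \o cotangent_chart_inv i) (cotangent_chart i z') = f z'.
  apply: filterS (near_cotangent_dom iz) => z' iz'.
  by rewrite /comp (cotangent_chart_invK iz').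
have h : ((f \o cotangent_chart_inv i) \o cotangent_chart i) z' @[z' --> z] -->
    (f \o cotangent_chart_inv i) (cotangent_chart i z).
  exact: (continuous_comp (cotangent_chart_continuous iz) d).
have e0 : (f \o cotangent_chart_inv i) (cotangent_chart i z) = f z.
  by rewrite /comp cotangent_chart_invK.
rewrite e0 in h; apply: cvg_trans h.
move=> B hB; have {}hB : nbhs z (((f \o cotangent_chart_inv i) \o cotangent_chart i) @^-1` B) := hB.
by apply: filterS2 E hB => z' e; rewrite /preimage /= -e.
Qed.

Lemma compact_row_ball (x : 'rV[R]_n) (e : R) : compact [set v : 'rV[R]_n | `|x - v| <= e].
Proof.
apply: bounded_closed_compact; last exact: closed_closed_ball_.
exists (`|x| + e); split=> [|b Hb v /= xv]; first exact: num_real.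
by have := ler_distD x v 0; rewrite !subr0 distrC; lra.
Qed.

Lemma compact_box i (y0 : 'rV[R]_n) (r b : R) :
  (forall y, `|y0 - y| <= r -> chart_img i y) ->
  compact [set cotangent_chart_inv i (yp : E) | yp in
     [set y | `|y0 - y| <= r] `*` [set p | `|0 - p| <= b]].
Proof.
move=> ri; apply: continuous_compact; last by apply: compact_setX; exact: compact_row_ball.
apply: continuous_in_subspaceT => w /set_mem[w1 _].
by apply: cotangent_chart_inv_continuous; exact: ri.
Qed.

Lemma sublevel_compact (H : N -> R) (l : R) : compact [set: M] -> C2_cotangent H ->
  uniformly_superlinear H -> compact [set z | H z <= l].
Proof.
move=> cM CH sH G PG Gl.
have [x [_ xG]] : [set: M] `&` cluster ((fst : N -> M) @ G) !=set0.
  by apply: cM; exact: filterT.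
set i := chart_at x; have ix : chart_dom i x by exact: dom_chart_at.
set y0 := chart i x; have iy0 : chart_img i y0 by exact: img_chart.
have [r r0 rP] := superlinear_chart sH iy0.
have [b bP] := rP 1.
set W := [set x' : M | chart_dom i x' /\ `|y0 - chart i x'| < r / 2].
have W0 : nbhs x W.
  apply: filterI; first by apply: open_nbhs_nbhs; split; [exact: chart_dom_open|].
  have c := chart_continuous ix.
  by apply: (@cvgr_dist_lt _ _ _ (nbhs x) _ _ _ c); rewrite divr_gt0.
set D := [set z : N | W z.1].
have PD : ProperFilter (within D G).
  apply: Build_ProperFilter_ex => A AG.
  have AG' : ((fst : N -> M) @ G) [set x' | exists z : N, x' = z.1 /\ (D z -> A z)].
    have /filterS h : G [set z | D z -> A z] by exact: AG.
    by apply: h => z Az; exists z.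
  have [x' [[z [E Az]] Wx']] := xG _ W AG' W0.
  by exists z; apply: Az; rewrite /D /= -E.
have sub : D `&` [set z | H z <= l] `<=` [set cotangent_chart_inv i (yp : E) | yp in
     [set y | `|y0 - y| <= r / 2] `*` [set p | `|0 - p| <= l + b]].
  move=> z [[iz zr]] /= Hz; exists (cotangent_chart i z); last exact: cotangent_chart_invK.
  split; first exact: ltW.
  have yr : `|chart i z.1 - y0| < r by rewrite distrC; lra.
  rewrite /= -[z.2 *m _]/((cotangent_chart i z).2).
  have [_] := bP (chart i z.1) (cotangent_chart i z).2 yr.
  have -> : cotangent_chart_inv i (chart i z.1, (cotangent_chart i z).2) = z.
    by rewrite -[RHS](cotangent_chart_invK iz).
  by rewrite sub0r normrN; lra.
have cB : compact [set cotangent_chart_inv i (yp : E) | yp in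
     [set y | `|y0 - y| <= r / 2] `*` [set p | `|0 - p| <= l + b]].
  apply: compact_box => y yr.
  by have [] := bP y 0; [rewrite distrC; lra|].
have [z [_ zc]] := cB (within D G) PD (filterS (fun z h Dz => sub z (conj Dz h)) Gl).
have zG : cluster G z.
  by apply: cvg_cluster zc => A AG; rewrite /within /=; apply: filterS AG.
exists z; split=> //.
have : closed [set z | H z <= l].
  have -> : [set z | H z <= l] = H @^-1` [set` `]-oo, l]].
    by apply/seteqP; split=> u /=; rewrite in_itv.
  by apply: preimage_closed; [move=> u _; exact: C2_continuous|exact: interval_closed].
by apply=> B Bz; exact: zG.
Qed.

End properness.

Section integrals_of_motion.
Context {R : realType} {n : nat} {M : smooth_manifold R n}.
Variables F H : cotangent_bundle M -> R.

Lemma integral_in_charts : C2_cotangent F -> C2_cotangent H ->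
  integral_of_motion H F -> forall (i : ca_index (cotangent_atlas M)) w, ca_img i w ->
  omega (field H i w) (field F i w) = 0.
Proof.
move=> CF CH HF i w iw; set z := cotangent_chart_inv i w; set c := chart_at z.1.
have ic : @both _ _ _ (cotangent_atlas M) i c w by split; [exact: iw|exact: dom_chart_at].
have [_ om] := ca_trans ic.1 ic.2.
rewrite -om -(@field_trans _ _ _ (cotangent_atlas M) _ _ _ _ CF ic).
rewrite -(@field_trans _ _ _ (cotangent_atlas M) _ _ _ _ CH ic).
exact: HF z.
Qed.

End integrals_of_motion.

Section fiberwise_legendre.
Context {R : realType}.

Lemma min_hasD_eq0 (V : normedModType R) (f : V -> R) (x u : V) (d : R) :
  (forall y, f x <= f y) -> hasD f x u d -> d = 0.
Proof.
move=> fmin.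
have pos (w : V) (c : R) : hasD f x w c -> 0 <= c.
  move=> [df fw]; apply/ler_addgt0Pr => e e0; rewrite -lerBlDr sub0r.
  have w1 : 0 < `|w| + 1 by rewrite ltr_wpDl.
  have ew : 0 < e / (`|w| + 1) by rewrite divr_gt0.
  have [r r0 rP] := diff_nearN df ew.
  pose h := r / 2 / (`|w| + 1).
  have h0 : 0 < h by rewrite !divr_gt0.
  have hw : h * `|w| < r.
    rewrite /h -mulrA; apply: (@le_lt_trans _ _ (r / 2)); last lra.
    rewrite ler_piMr //; first lra.
    by rewrite mulrC ler_pdivrMr // mul1r; lra.
  have := rP (h *: w + x).
  rewrite addrK normrZ (gtr0_norm h0) => /(_ hw).
  rewrite linearZ /= fw => H1.
  have H2 : e / (`|w| + 1) * (h * `|w|) <= e * h.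
    rewrite mulrAC ler_pdivrMr // mulrDr mulr1 -!mulrA lerDl.
    by rewrite !mulr_ge0 // ltW.
  have H3 := fmin (h *: w + x).
  have H4 : 0 <= h * c + h * e.
    move: (le_trans H1 H2); rewrite ler_distl => /andP[_]; rewrite /GRing.scale /=; lra.
  by move: H4; rewrite -mulrDr pmulr_rge0 //; lra.
move=> D; apply/eqP; rewrite eq_le (pos _ _ D) andbT -oppr_ge0.
apply: (pos (- u)); have [df <-] := D; split=> //; exact: linearN.
Qed.

Lemma convex_contra (s A gq gp g0 a b : R) : 0 < s -> s < 1 ->
  b - g0 <= a - gp -> 0 < gq - g0 - s * (a - b) -> gq + - s * A < g0 ->
  gq + (1 - s) * A <= gp -> false.
Proof. by move=> s0 s1 h1 h2 h3 h4; exfalso; nra. Qed.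

Lemma squeeze_bound (L1 L0 b1 b0 pv p0v p0v0 pv0 g1 g0 g10 g00 D : R) :
  L1 = pv - g1 -> L0 = p0v0 - g00 -> p0v - g10 <= pv - g1 -> pv0 - g0 <= p0v0 - g00 ->
  `|g1 - g0 - D| <= b1 -> `|g10 - g00 - D| <= b1 ->
  `|(pv - p0v) - (pv0 - p0v0)| <= b0 ->
  `|L1 - L0 - (p0v - p0v0 - D)| <= b1 + b0.
Proof.
move=> -> -> h1 h2; rewrite !ler_norml => /andP[a1 a2] /andP[a3 a4] /andP[a5 a6].
by apply/andP; split; lra.
Qed.

Lemma derive_expansion (V : normedModType R) (f : V -> R) (x u : V) (d : R) :
  (forall e : R, 0 < e -> exists2 r : R, 0 < r & forall h : R, `|h| * `|u| < r ->
    `|f (h *: u + x) - f x - h * d| <= e * (`|h| * `|u|)) -> 'D_u f x = d.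
Proof.
move=> H; have E : 'D_u f x = 'D_(1 : R) (fun h : R => f (h *: u + x)) 0.
  by apply: eq_derive => h; rewrite addr0 /GRing.scale /= mulr1.
have D : is_derive (0 : R) (1 : R) (fun h : R => f (h *: u + x)) d.
  apply/is_deriveNP => e e0.
  have u1 : 0 < `|u| + 1 by rewrite ltr_wpDl.
  have [r r0 rP] := H _ (divr_gt0 e0 u1).
  exists (r / (`|u| + 1)); first by rewrite divr_gt0.
  move=> h; rewrite subr0 scale0r add0r ltr_pdivlMr // mulrDr mulr1 => hr.
  have hu : `|h| * `|u| < r by have := normr_ge0 h; lra.
  apply: le_trans (rP h hu) _; rewrite mulrAC ler_pdivrMr // mulrDr mulr1 -!mulrA.
  by rewrite lerDl mulr_ge0 // ltW.
by rewrite E; exact: (@derive_val _ _ _ _ _ _ _ D).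
Qed.

Context {n : nat}.
Notation V := 'rV[R]_n.
Notation E := (V * V)%type.
Variables (U : set V) (G : E -> R).
Hypothesis oU : open U.
Hypothesis CG : Ck 2 [set w : E | U w.1] G.
Hypothesis G_convex : forall y p p', U y -> p != p' ->
  G (y, p) + pairing (grad2 G (y, p)) (p' - p) < G (y, p').
Hypothesis G_superlinear : forall y, U y -> forall a : R, exists b : R,
  forall p : V, a * `|p| - b <= G (y, p).

Let velocity w : V := grad2 G w.

Lemma diff_partial w (eta u : V) : U w.1 ->
  hasD G w (eta, u) (pairing (grad2 G w) u + pairing (grad1 G w) eta).
Proof.
move=> Uw; have dG : differentiable G w by exact: CG.1.
split=> //; rewrite (ham_vectorP _ dG) /omega /ham_vector /=.
by rewrite pairingNl opprK.
Qed.

Lemma hasD_fiber y p u : U y -> hasD (fun q => G (y, q)) p u (pairing (velocity (y, p)) u).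
Proof.
move=> Uy; have h := hasD_pair (hasD_cst y p u) (hasD_id p u).
have Uw : U (y, p).1 by [].
have := hasD_comp h (diff_partial 0 u Uw).
by rewrite pairing0r addr0.
Qed.

Lemma velocity_surj y v : U y -> exists p, velocity (y, p) = v.
Proof.
move=> Uy; have [b bP] := G_superlinear Uy (n%:R * `|v| + 1).
pose psi p := G (y, p) - pairing p v.
have low p : `|p| - b <= psi p.
  have := bP p; have := pairing_le p v; rewrite ler_norml => /andP[_].
  by rewrite /psi; lra.
pose rho := `|psi 0 + b| + 1.
have [c _ cmin] : exists2 c, c \in [set q : V | `|0 - q| <= rho] &
    forall t, t \in [set q : V | `|0 - q| <= rho] -> psi c <= psi t.
  apply: EVT_min_rV.
  - by exists 0; rewrite /= subrr normr0 addr_ge0.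
  - exact: compact_row_ball.
  apply: continuous_in_subspaceT => p _; apply: differentiable_continuous.
  exact: (hasD_sub (hasD_fiber p 0 Uy) (hasD_pairing (hasD_id p 0) (hasD_cst v p 0))).1.
have psi0 : psi c <= psi 0 by apply: cmin; rewrite inE /= subrr normr0 addr_ge0.
have cmin' p : psi c <= psi p.
  have [pr|pr] := leP `|p| rho; first by apply: cmin; rewrite inE /= sub0r normrN.
  apply: le_trans psi0 _; apply: le_trans (low p); move: pr; rewrite /rho.
  by have := ler_norm (psi 0 + b); lra.
exists c; apply: pairing_eq => u.
have := min_hasD_eq0 cmin' (hasD_sub (hasD_fiber c u Uy)
   (hasD_pairing (hasD_id c u) (hasD_cst v c u))).
by rewrite pairing0r addr0 => /subr0_eq ->; rewrite pairingC.
Qed.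

Lemma velocity_inj y p p' : U y -> velocity (y, p) = velocity (y, p') -> p = p'.
Proof.
move=> Uy e; apply/eqP; apply: contraT => ne.
have h1 := G_convex Uy ne; have ne' : p' != p by rewrite eq_sym.
have := G_convex Uy ne'; move: h1; rewrite -/(velocity _) -/(velocity _) e.
rewrite !pairingBr; lra.
Qed.

Definition momentum (w : E) : V := xget 0 [set p | velocity (w.1, p) = w.2].

Lemma momentumP y v : U y -> velocity (y, momentum (y, v)) = v.
Proof.
by move=> Uy; rewrite /momentum; case: xgetP => //= H; have [p /H] := velocity_surj v Uy.
Qed.

Lemma velocityK y p : U y -> momentum (y, velocity (y, p)) = p.
Proof. by move=> Uy; apply: (velocity_inj Uy); rewrite momentumP. Qed.

Lemma young y p p' : U y ->
  pairing p' (velocity (y, p)) - G (y, p') <= pairing p (velocity (y, p)) - G (y, p).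
Proof.
move=> Uy; have [->//|ne] := eqVneq p p'.
have := G_convex Uy ne; rewrite -/(velocity _) (pairingC p) (pairingC p') !pairingBr; lra.
Qed.

Lemma sup_young y p : U y ->
  sup [set pairing p' (velocity (y, p)) - G (y, p') | p' in [set: V]] =
  pairing p (velocity (y, p)) - G (y, p).
Proof.
move=> Uy; apply/eqP; rewrite eq_le; apply/andP; split.
  by apply: ge_sup => [|_ [p' _ <-]]; [exists (pairing 0 (velocity (y, p)) - G (y, 0)), 0|exact: young].
apply: ub_le_sup; last by exists p.
by exists (pairing p (velocity (y, p)) - G (y, p)) => _ [p' _ <-]; exact: young.
Qed.

Lemma momentum_continuous y0 v0 : U y0 -> forall e : R, 0 < e -> exists2 d : R, 0 < d &
  forall y v, `|y - y0| < d -> `|v - v0| < d ->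
    U y /\ `|momentum (y, v) - momentum (y0, v0)| <= e.
Proof.
move=> Uy0 e e0; set p0 := momentum (y0, v0).
have [r r0 rP] := openNP oU Uy0.
pose T := ((V * V) * V)%type.
pose Th (t : T) := G (t.1.1, t.2) - G (t.1.1, p0) - pairing (t.2 - p0) t.1.2.
have cT (t : T) : U t.1.1 -> {for t, continuous Th}.
  move=> Ut; apply: differentiable_continuous.
  have h11 : hasD (fun s : T => s.1.1) t 0 0 := hasD_comp (hasD_fst t 0) (hasD_fst t.1 0).
  have h12 : hasD (fun s : T => s.1.2) t 0 0 := hasD_comp (hasD_fst t 0) (hasD_snd t.1 0).
  have h2 : hasD (fun s : T => s.2) t 0 0 := hasD_snd t 0.
  have U1 : U (t.1.1, t.2).1 by []. have U2 : U (t.1.1, p0).1 by [].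
  have k1 := hasD_comp (hasD_pair h11 h2) (diff_partial 0 0 U1).
  have k2 := hasD_comp (hasD_pair h11 (hasD_cst p0 t 0)) (diff_partial 0 0 U2).
  have k3 := hasD_pairing (hasD_sub h2 (hasD_cst p0 t 0)) h12.
  exact: (hasD_sub (hasD_sub k1 k2) k3).1.
pose S := [set q : V | `|q - p0| = e].
have cS : compact S.
  apply: (@subclosed_compact _ _ [set q : V | `|p0 - q| <= e]).
  - have -> : S = (fun q : V => `|q - p0|) @^-1` [set e] by [].
    apply: preimage_closed; last exact: closed_eq.
    move=> q _; apply: continuous_comp; last exact: norm_continuous.
    exact: differentiable_continuous (hasD_sub (hasD_id q 0) (hasD_cst p0 q 0)).1.
  - exact: compact_row_ball.
  - by move=> q /= <-; rewrite distrC.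
pose P (q : V) (d : R) := forall y v, `|y - y0| < d -> `|v - v0| < d -> 0 < Th ((y, v), q).
have gap q : S q -> exists2 d : R, 0 < d &
    \forall q' \near q, forall d', 0 < d' -> d' < d -> P q' d'.
  move=> Sq; have qp : p0 != q.
    by apply/eqP => E; move: Sq; rewrite /S /= -E subrr normr0 => E'; move: e0; rewrite -E' ltxx.
  have T0 : 0 < Th ((y0, v0), q).
    have := G_convex Uy0 qp; rewrite -/(velocity _) momentumP // /Th /=.
    by rewrite (pairingC v0); lra.
  have U0 : U ((y0, v0), q).1.1 by [].
  have T2 : 0 < Th ((y0, v0), q) / 2 by rewrite divr_gt0.
  have [d d0 dP] := continuousNP (cT _ U0) T2.
  exists d => //.
  apply/nearNP; exists d => // q' qq' d' d'0 d'd y v yd vd.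
  have N3 : `|((y, v), q') - ((y0, v0), q)| < d.
    by rewrite prod_normE gt_max qq' andbT prod_normE gt_max !(lt_trans _ d'd).
  have := dP _ N3; rewrite ler_distl => /andP[+ _].
  by apply: lt_le_trans; rewrite subr_gt0 ltr_pdivrMr //; lra.
have [d d0 dP] := uniform_over_compact cS gap.
exists (Num.min r (d / 2)); first by rewrite lt_min r0 divr_gt0.
move=> y v; rewrite !lt_min => /andP[yr yd] /andP[_ vd].
have Uy := rP y yr; split=> //; set p := momentum (y, v).
have d2 : 0 < d / 2 by rewrite divr_gt0. have d2' : d / 2 < d by lra.
have [//|pe] := leP `|p - p0| e.
pose s := e / `|p - p0|; have pp0 : 0 < `|p - p0| by exact: lt_trans pe.
have s0 : 0 < s by rewrite divr_gt0.
have s1 : s < 1 by rewrite ltr_pdivrMr // mul1r.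
have sE : s * `|p - p0| = e by rewrite divfK // gt_eqF.
pose q := p0 + s *: (p - p0).
have Sq : S q by rewrite /S /= /q (addrC p0) addrK normrZ gtr0_norm.
have qp0 : q != p0.
  by apply/eqP => E; move: Sq; rewrite /S /= E subrr normr0 => E'; move: e0; rewrite -E' ltxx.
have Tq : 0 < Th ((y, v), q) := dP q _ Sq d2 d2' y v yd vd.
have Y := @young y p p0 Uy; rewrite /p momentumP // -/p in Y.
have C0 := G_convex Uy qp0.
have C1 : G (y, q) + pairing (grad2 G (y, q)) (p - q) <= G (y, p).
  have [<-|ne] := eqVneq q p; first by rewrite subrr pairing0r addr0.
  exact/ltW/G_convex.
have e1 : p0 - q = - s *: (p - p0) by rewrite /q opprD addrA subrr sub0r scaleNr.
have e2 : p - q = (1 - s) *: (p - p0).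
  by rewrite /q opprD addrA scalerBl scale1r.
have e3 : q - p0 = s *: (p - p0) by rewrite /q (addrC p0) addrK.
move: Tq C0 C1; rewrite /Th /= e1 e2 e3 !pairingZr pairingZl pairingBl.
move: Y; set A := pairing (grad2 G _) _; set gq := G (y, q); set gp := G (y, p).
set g0 := G (y, p0); set a := pairing p v; set b := pairing p0 v.
exact: convex_contra.
Qed.

(* squeezing the supremum between the values at the two maximizers *)
Lemma legendre_expansion (L : E -> R) (y0 v0 : V) : U y0 ->
  (forall y p, U y -> L (y, velocity (y, p)) = pairing p (velocity (y, p)) - G (y, p)) ->
  forall e : R, 0 < e -> exists2 d : R, 0 < d & forall y v,
    `|y - y0| < d -> `|v - v0| < d ->
    `|L (y, v) - L (y0, v0) - (pairing (momentum (y0, v0)) (v - v0)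
        - pairing (grad1 G (y0, momentum (y0, v0))) (y - y0))| <= e * (`|y - y0| + `|v - v0|).
Proof.
move=> Uy0 LE e e0; set p0 := momentum (y0, v0).
have n1 : 0 < n%:R + 1 :> R by rewrite ltr_wpDl.
have [d1 d10 H1] := momentum_continuous v0 Uy0 (divr_gt0 e0 n1).
have Uw : [set w : E | U w.1] (y0, p0) by [].
have [d2 d20 H2] := Ck1_sdiff (findim_pair (findim_row n) (findim_row n))
  (open_fst oU) Uw (CkS (open_fst oU) CG) e0.
have [d3 d30 H3] := momentum_continuous v0 Uy0 (divr_gt0 d20 (ltr0Sn R 1)).
exists (Num.min d1 (Num.min d2 d3)); first by rewrite !lt_min d10 d20 d30.
move=> y v; rewrite !lt_min => /and3P[y1 y2 y3] /and3P[v1 v2 v3].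
have [Uy pp1] := H1 y v y1 v1; have [_ pp2] := H3 y v y3 v3.
set p := momentum (y, v) in pp1 pp2 *.
have Ey : L (y, v) = pairing p v - G (y, p) by rewrite -{1}(momentumP v Uy) LE // momentumP.
have E0 : L (y0, v0) = pairing p0 v0 - G (y0, p0).
  by rewrite -{1}(momentumP v0 Uy0) LE // momentumP.
have Y1 := @young y p p0 Uy; rewrite /p momentumP // -/p in Y1.
have Y2 := @young y0 p0 p Uy0; rewrite /p0 momentumP // -/p0 in Y2.
have D q : `|q - p0| < d2 -> `|G (y, q) - G (y0, q) - pairing (grad1 G (y0, p0)) (y - y0)|
    <= e * `|y - y0|.
  move=> qd; have := H2 (y, q) (y0, q).
  have -> : ((y, q) : E) - (y0, q) = (y - y0, 0) by rewrite -[LHS]/(_, _) subrr.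
  rewrite (diff_partial (y - y0) 0 Uw).2 pairing0r add0r => h.
  have -> : `|y - y0| = `|(y - y0, 0 : V)| by rewrite prod_normE normr0 max_l.
  by apply: h; rewrite prod_normE gt_max ?qd ?andbT //= subrr normr0.
have X : `|(pairing p v - pairing p0 v) - (pairing p v0 - pairing p0 v0)| <= e * `|v - v0|.
  have -> : (pairing p v - pairing p0 v) - (pairing p v0 - pairing p0 v0) =
      pairing (p - p0) (v - v0).
    by rewrite pairingBl !pairingBr; ring.
  apply: le_trans (pairing_le _ _) _; rewrite mulrA ler_wpM2r //.
  apply: (@le_trans _ _ (n%:R * (e / (n%:R + 1)))); first by rewrite ler_wpM2l.
  rewrite mulrA ler_pdivrMr // mulrC mulrDr mulr1 lerDl; exact: ltW.
rewrite mulrDr pairingBr.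
apply: (@squeeze_bound _ _ _ _ _ _ _ (pairing p v0) _ (G (y0, p)) _ _ _ Ey E0 Y1 Y2).
- by apply: D; lra.
- by apply: D; rewrite subrr normr0.
- exact: X.
Qed.

Lemma grad2_legendre (L : E -> R) (y0 v0 : V) : U y0 ->
  (forall y p, U y -> L (y, velocity (y, p)) = pairing p (velocity (y, p)) - G (y, p)) ->
  grad2 L (y0, v0) = momentum (y0, v0).
Proof.
move=> Uy0 LE; apply/rowP => j; rewrite mxE -pairing_delta; set u := delta_mx 0 j.
apply: derive_expansion => e e0 /=.
have [r r0 rP] := legendre_expansion v0 Uy0 LE e0; exists r => // h hr.
have := rP y0 (h *: u + v0); rewrite !addrK !subrr normr0 pairing0r subr0 add0r.
by rewrite normrZ pairingZr; apply.
Qed.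

Lemma grad1_legendre (L : E -> R) (y0 v0 : V) : U y0 ->
  (forall y p, U y -> L (y, velocity (y, p)) = pairing p (velocity (y, p)) - G (y, p)) ->
  grad1 L (y0, v0) = - grad1 G (y0, momentum (y0, v0)).
Proof.
move=> Uy0 LE; apply/rowP => j; rewrite [RHS]mxE mxE -pairing_delta; set u := delta_mx 0 j.
apply: derive_expansion => e e0 /=.
have [r r0 rP] := legendre_expansion v0 Uy0 LE e0; exists r => // h hr.
have := rP (h *: u + y0) v0; rewrite !addrK !subrr normr0 pairing0r sub0r addr0.
by rewrite normrZ pairingZr mulrN; apply.
Qed.

End fiberwise_legendre.

Section convexity.
Context {R : realType} {n : nat}.
Notation V := 'rV[R]_n.

Lemma derive_row_sum (f : V -> R) (p w : V) : differentiable f p ->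
  'D_w f p = \sum_j w 0 j * 'D_(delta_mx 0 j) f p.
Proof.
move=> df; rewrite deriveE // {1}(row_sum_delta w) linear_sum /=.
by apply: eq_bigr => j _; rewrite linearZ /= -deriveE.
Qed.

Lemma convex_of_hessian (f : V -> R) (p p' : V) : Ck 2 setT f ->
  (forall q, positive_definite (hessian f q)) -> p != p' -> f p + 'D_(p' - p) f p < f p'.
Proof.
move=> Cf pf ne; set w := p' - p.
have w0 : w != 0 by rewrite subr_eq0 eq_sym.
have df q : differentiable f q by exact: Cf.1.
have dDf (j : 'I_n) q : differentiable (fun z => 'D_(delta_mx 0 j) f z) q by exact: (Cf.2 _).1.
have dD (t : R) : is_derive t 1 (fun s : R => f (p + s *: w)) ('D_w f (p + t *: w)).
  exact: is_derive_line.
pose d2 (t : R) := pairing (w *m hessian f (p + t *: w)) w.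
have dD2 (t : R) : is_derive t 1 (fun s : R => 'D_w f (p + s *: w)) (d2 t).
  have -> : (fun s : R => 'D_w f (p + s *: w)) =
      (fun s : R => \sum_j 'D_(delta_mx 0 j) f (p + s *: w) *: (w 0 j : R^o)).
    apply/funext => s; rewrite derive_row_sum //.
    by apply: eq_bigr => j _; rewrite mulrC.
  have -> : d2 t = \sum_j ('D_w (fun z => 'D_(delta_mx 0 j) f z) (p + t *: w)) *: (w 0 j : R^o).
    rewrite /d2 pairingE; apply: eq_bigr => j _.
    rewrite derive_row_sum // mxE; congr (_ * _).
    by apply: eq_bigr => k _; congr (_ * _); rewrite mxE.
  apply: is_derive_sum => j; apply: is_derive_scalel; apply: is_derive_line; exact: dDf.
have cont (g dg : R -> R) (a b : R) : (forall t : R, is_derive t 1 g (dg t)) ->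
    {within `[a, b], continuous g}.
  move=> H; apply: continuous_in_subspaceT => x _.
  exact: is_derive_continuous (H x).
have [c /[!in_itv]/= /andP[c0 _] Ec] := MVT ltr01 (fun x _ => dD x) (cont _ _ 0 1 dD).
have [c' _ Ec'] := MVT c0 (fun x _ => dD2 x) (cont _ _ 0 c dD2).
have pos : 0 < d2 c' by exact: pf.
move: Ec Ec'; rewrite !scale0r !addr0 scale1r subr0 mulr1 /w (addrC p) subrK -/w => Ec Ec'.
by have := mulr_gt0 pos c0; move: Ec'; rewrite subr0 => <-; lra.
Qed.

Lemma fiber_Ck (k : nat) (U : set V) (G : V * V -> R) y : Ck k [set w : V * V | U w.1] G ->
  U y -> Ck k setT (fun q => G (y, q)).
Proof.
move=> + Uy; elim: k G => [|k IH] G /=.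
  move=> H q _; have Uw : [set w : V * V | U w.1] (y, q) by [].
  have c := differentiable_continuous (hasD_pair (hasD_cst y q 0) (hasD_id q 0)).1.
  exact: (continuous_comp c (H _ Uw)).
move=> [dG DG]; split=> [q _|v].
  have Uw : [set w : V * V | U w.1] (y, q) by [].
  have h := hasD_pair (hasD_cst y q 0) (hasD_id q 0).
  exact: (hasD_comp h (hasD_self _ (dG _ Uw))).1.
have -> : (fun x => 'D_v (fun q => G (y, q)) x) = (fun q => (fun w => 'D_(0, v) G w) (y, q)).
  apply/funext => q; apply: eq_derive => h; congr (G _).
  by congr pair; rewrite /= scaler0 add0r.
exact: (IH (fun w => 'D_(0, v) G w) (DG (0, v))).
Qed.

End convexity.

Lemma mulmx_tr_inj (R : realType) (n : nat) (A B : 'M[R]_n) (p p' : 'rV[R]_n) :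
  B *m A = 1%:M -> p *m A^T = p' *m A^T -> p = p'.
Proof.
move=> BA /(congr1 (mulmx^~ B^T)); rewrite !mul_tr_tr BA trmx1 !mulmx1; exact.
Qed.

Lemma continuous_ofN (R : realType) (V W : normedModType R) (f : V -> W) (x : V) :
  (forall e : R, 0 < e -> exists2 d : R, 0 < d &
    forall y, `|y - x| < d -> `|f y - f x| <= e) -> {for x, continuous f}.
Proof.
move=> H; apply/cvgrPdist_le => e e0; have [d d0 dP] := H e e0.
by apply/nearNP; exists d => // y yd; rewrite distrC; exact: dP.
Qed.

Section velocities.
Context {R : realType} {n : nat} {M : smooth_manifold R n}.
Notation N := (cotangent_bundle M).
Notation TM := (tangent_bundle M).
Implicit Types (f : N -> R).

Definition velocity f (z : N) : TM := (z.1, (ham_field_in_chart (chart_at z.1) f z).1).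

Lemma velocity_chart f i (z : N) : C2_cotangent f -> chart_dom i z.1 -> tangent_chart i (velocity f z) =
  (chart i z.1, grad2 (f \o cotangent_chart_inv i) (cotangent_chart i z)).
Proof.
move=> Cf iz; set c := chart_at z.1; have cz : chart_dom c z.1 by exact: dom_chart_at.
set w := cotangent_chart c z.
have cw : chart_img c w.1 by exact: img_chart.
have wK : cotangent_chart_inv c w = z by exact: cotangent_chart_invK.
have ci : both (A := cotangent_atlas M) c i w.
  have iw : chart_dom i (cotangent_chart_inv c w).1 by rewrite wK.
  by split; [exact: cw|exact: iw].
have ov : overlap c i w.1.
  by split=> //; have := ci.2; rewrite /=.
have e1 : trans (A := cotangent_atlas M) c i w = cotangent_chart i z.
  by rewrite /trans /= wK.
have e2 := field_trans (A := cotangent_atlas M) Cf ci.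
rewrite e1 in e2; rewrite /tangent_chart /velocity /=; congr pair.
apply: etrans (esym (congr1 fst e2)).
rewrite mul_jacobian; set a := field _ _ _.
have dT := differentiable_trans ci.
have h1 := hasD_comp (hasD_self a dT) (hasD_fst _ _).
have h2 := hasD_comp_fst (hasD_self a.1 (differentiable_transition ov)).
exact: hasD_uniq h2 h1.
Qed.

End velocities.

Section legendre_charts.
Context {R : realType} {n : nat} {M : smooth_manifold R n}.
Notation V := 'rV[R]_n.
Notation E := (V * V)%type.
Notation N := (cotangent_bundle M).
Notation TM := (tangent_bundle M).
Variable H : N -> R.
Hypothesis TH : tonelli H.

Let CH : C2_cotangent H. Proof. by have [] := TH. Qed.

Lemma fiber_C2 (x : M) : Ck 2 setT (fun r => H (x, r)).
Proof.
have cx : chart_dom (chart_at x) x by exact: dom_chart_at.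
have -> : (fun r => H (x, r)) =
    (fun r => (H \o cotangent_chart_inv (chart_at x)) (chart (chart_at x) x, r)).
  apply/funext => r; rewrite /comp; congr H.
  have := @cotangent_chart_invK R n M (chart_at x) (x, r) cx.
  by rewrite -[X in cotangent_chart X (x, r)]/(chart_at (x, r).1) cotangent_chart_at.
exact: (fiber_Ck (CH _) (img_chart cx)).
Qed.

Lemma fiber_convex (x : M) (q q' : V) : q != q' ->
  H (x, q) + 'D_(q' - q) (fun r => H (x, r)) q < H (x, q').
Proof. by apply: convex_of_hessian; [exact: fiber_C2|have [_ + _] := TH]. Qed.

Lemma chart_convex (i : chart_index M) (y p p' : V) : chart_img i y -> p != p' ->
  (H \o cotangent_chart_inv i) (y, p) +
    pairing (grad2 (H \o cotangent_chart_inv i) (y, p)) (p' - p) <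
  (H \o cotangent_chart_inv i) (y, p').
Proof.
move=> iy ne; rewrite /comp /cotangent_chart_inv /=.
set x := chart_inv i y; set c := chart_at x.
set A := 'J (transition c i) (chart c x).
have JK : 'J (transition i c) y *m A = 1%:M.
  by apply: (@jacobianK R n M i c y); split=> //; exact: dom_chart_at.
have ne' : p *m A^T != p' *m A^T.
  apply/eqP => e; move/eqP: ne; apply; exact: mulmx_tr_inj JK e.
apply: le_lt_trans (fiber_convex x ne'); rewrite lerD2l.
have oU := @chart_img_isopen R n M i.
have := (hasD_derive (hasD_fiber (CH i) p (p' - p) iy)).
rewrite /comp /cotangent_chart_inv /= -/x -/c -/A => <-.
rewrite -mulmxBl le_eqVlt; apply/orP; left; apply/eqP; apply: eq_derive => h.
by rewrite mulmxDl -scalemxAl.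
Qed.

Lemma chart_superlinear (i : chart_index M) (y : V) : chart_img i y -> forall a : R,
  exists b : R, forall p : V, a * `|p| - b <= (H \o cotangent_chart_inv i) (y, p).
Proof.
move=> iy a; have [_ _ sH] := TH; have [r r0 rP] := superlinear_chart sH iy.
have [b bP] := rP a; exists b => p.
by have [] := bP y p; rewrite ?subrr ?normr0.
Qed.

Lemma lagrangian_chart (i : chart_index M) (y p : V) : chart_img i y ->
  let v := grad2 (H \o cotangent_chart_inv i) (y, p) in
  (lagrangian H \o tangent_chart_inv i) (y, v) =
  pairing p v - (H \o cotangent_chart_inv i) (y, p).
Proof.
move=> iy v; rewrite -(sup_young (@chart_convex i) p iy) -/v.
rewrite /comp /lagrangian /tangent_chart_inv /cotangent_chart_inv /=.
set x := chart_inv i y; set c := chart_at x.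
set A := 'J (transition c i) (chart c x); set B := 'J (transition i c) y.
have ic : overlap i c y by split=> //; exact: dom_chart_at.
have JK : B *m A = 1%:M by exact: (@jacobianK R n M i c y).
have KJ : A *m B = 1%:M by exact: mulmx1C.
congr sup; apply/seteqP; split=> [_ [q _ <-]|_ [q _ <-]].
  exists (q *m B^T) => //.
  rewrite mul_tr_tr KJ trmx1 mulmx1; congr (_ - _).
  by rewrite -pairing_mul trmxK.
exists (q *m A^T) => //; congr (_ - _).
by rewrite -pairing_mul trmxK -mulmxA JK mulmx1.
Qed.

Let momentum_chart i := momentum (H \o cotangent_chart_inv i).

Let velocity_momentum i y (v : V) : chart_img i y ->
  grad2 (H \o cotangent_chart_inv i) (y, momentum_chart i (y, v)) = v.
Proof. by move=> iy; exact: (momentumP (CH i) (@chart_superlinear i) v iy). Qed.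

Let momentum_velocity i y (p : V) : chart_img i y ->
  momentum_chart i (y, grad2 (H \o cotangent_chart_inv i) (y, p)) = p.
Proof.
by move=> iy; exact: (velocityK (CH i) (@chart_convex i) (@chart_superlinear i) p iy).
Qed.

Let grad2_lagrangian i y (v : V) : chart_img i y ->
  grad2 (lagrangian H \o tangent_chart_inv i) (y, v) = momentum_chart i (y, v).
Proof.
move=> iy; apply: (grad2_legendre (@chart_img_isopen _ _ _ i) (CH i) (@chart_convex i)
  (@chart_superlinear i) v iy) => y' p iy'; exact: lagrangian_chart.
Qed.

Let grad1_lagrangian i y (v : V) : chart_img i y ->
  grad1 (lagrangian H \o tangent_chart_inv i) (y, v) =
  - grad1 (H \o cotangent_chart_inv i) (y, momentum_chart i (y, v)).
Proof.
move=> iy; apply: (grad1_legendre (@chart_img_isopen _ _ _ i) (CH i) (@chart_convex i)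
  (@chart_superlinear i) v iy) => y' p iy'; exact: lagrangian_chart.
Qed.

Lemma legendreK (z : N) : legendre H (velocity H z) = z.
Proof.
case: z => x p; rewrite /legendre /velocity /=; congr pair; set c := chart_at x.
have cx : chart_dom c x by exact: dom_chart_at.
set v := (ham_field_in_chart c H (x, p)).1.
have -> : (fun u => lagrangian H (x, u)) =
    (fun u => (lagrangian H \o tangent_chart_inv c) (chart c x, u)).
  apply/funext => u; rewrite /comp; congr (lagrangian H _).
  have := @tangent_chart_invK R n M c (x, u) cx.
  by rewrite -[X in tangent_chart X (x, u)]/(chart_at (x, u).1) tangent_chart_at.
have := grad2_lagrangian v (img_chart cx); rewrite /grad2 /= => ->.
have -> : v = grad2 (H \o cotangent_chart_inv c) (chart c x, p).
  by rewrite /v /ham_field_in_chart (cotangent_chart_at (x, p)).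
exact: momentum_velocity (img_chart cx).
Qed.

Lemma velocity_legendre (z : TM) : velocity H (legendre H z) = z.
Proof.
case: z => x v; rewrite /velocity /=; congr pair; set c := chart_at x.
have cx : chart_dom c x by exact: dom_chart_at.
rewrite /ham_field_in_chart /ham_vector /=.
have -> : cotangent_chart c (legendre H (x, v)) =
    (chart c x, momentum_chart c (chart c x, v)).
  apply: etrans (cotangent_chart_at (legendre H (x, v))) _; congr pair; rewrite /=.
  have -> : (fun u => lagrangian H (x, u)) =
      (fun u => (lagrangian H \o tangent_chart_inv c) (chart c x, u)).
    apply/funext => u; rewrite /comp; congr (lagrangian H _).
    have := @tangent_chart_invK R n M c (x, u) cx.
    by rewrite -[X in tangent_chart X (x, u)]/(chart_at (x, u).1) tangent_chart_at.
  exact: grad2_lagrangian (img_chart cx).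
exact: velocity_momentum (img_chart cx).
Qed.

Lemma legendre_chart i (z : TM) : chart_dom i z.1 ->
  cotangent_chart i (legendre H z) = (chart i z.1, momentum_chart i (tangent_chart i z)).
Proof.
move=> iz; have iz' : chart_dom i (legendre H z).1 by [].
have := velocity_chart CH iz'; rewrite velocity_legendre => ->.
have e := momentum_velocity (cotangent_chart i (legendre H z)).2 (img_chart iz).
apply: (etrans (surjective_pairing _)); congr pair.
by rewrite -[LHS]e.
Qed.

Let A := cotangent_atlas M.

Let CHA : C2 A H. Proof. exact: CH. Qed.

Lemma velocity_continuous : continuous (velocity H : N -> TM).
Proof.
move=> z; set i := chart_at z.1; have iz : chart_dom i z.1 by exact: dom_chart_at.
pose k (w : E) : E := (w.1, grad2 (H \o cotangent_chart_inv i) w).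
have iw : chart_img i (cotangent_chart i z).1 by exact: img_chart.
have kc : {for cotangent_chart i z, continuous k}.
  apply: differentiable_continuous.
  have df : differentiable (field (A := A) H i) (cotangent_chart i z).
    have iw2 : @ca_img _ _ _ A i (cotangent_chart i z) by exact: iw.
    exact: (differentiable_field CHA iw2).
  have h := hasD_comp (hasD_self 0 df) (hasD_fst _ _).
  exact: (hasD_pair (hasD_fst _ 0) h).1.
pose K : N -> TM := (tangent_chart_inv i : E -> TM) \o k \o (cotangent_chart i : N -> E).
have E (z' : N) : chart_dom i z'.1 -> K z' = velocity H z'.
  move=> iz'; rewrite /K /comp /k -(velocity_chart CH iz').
  by rewrite -[RHS](@tangent_chart_invK _ _ _ i (velocity H z') iz') (velocity_chart CH iz').
have c : {for z, continuous K}.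
  apply: continuous_comp; first exact: cotangent_chart_continuous iz.
  apply: continuous_comp; first exact: kc.
  exact: tangent_chart_inv_continuous.
move=> B; rewrite -(E z iz) => /c hB; have {}hB : nbhs z (K @^-1` B) := hB.
by apply: filterS2 hB (near_cotangent_dom iz) => z' + iz'; rewrite /preimage /= -(E z' iz').
Qed.

Lemma legendre_continuous : continuous (legendre H : TM -> N).
Proof.
move=> z; set i := chart_at z.1; have iz : chart_dom i z.1 by exact: dom_chart_at.
pose k (w : E) : E := (w.1, momentum_chart i w).
have iw : chart_img i (tangent_chart i z).1 by exact: img_chart.
have mc : {for tangent_chart i z, continuous (momentum_chart i)}.
  case: (tangent_chart i z) iw => y0 v0 iy0; apply: continuous_ofN => e e0.
  have [d d0 dP] := momentum_continuous (@chart_img_isopen _ _ _ i) (CH i)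
    (@chart_convex i) (@chart_superlinear i) v0 iy0 e0.
  exists d => // -[y v]; rewrite prod_normE gt_max => /andP[yd vd].
  by have [] := dP y v yd vd.
have kc : {for tangent_chart i z, continuous k}.
  have fc := differentiable_continuous (hasD_fst (tangent_chart i z) 0).1.
  by apply: (cvg_pair fc mc).
pose K : TM -> N := (cotangent_chart_inv i : E -> N) \o k \o (tangent_chart i : TM -> E).
have E (z' : TM) : chart_dom i z'.1 -> K z' = legendre H z'.
  move=> iz'; rewrite -[RHS](@cotangent_chart_invK _ _ _ i (legendre H z') iz').
  by rewrite (legendre_chart iz').
have c : {for z, continuous K}.
  apply: continuous_comp; first exact: tangent_chart_continuous iz.
  apply: continuous_comp; first exact: kc.
  exact: cotangent_chart_inv_continuous.
move=> B; rewrite -(E z iz) => /c hB; have {}hB : nbhs z (K @^-1` B) := hB.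
by apply: filterS2 hB (near_tangent_dom iz) => z' + iz'; rewrite /preimage /= -(E z' iz').
Qed.

Lemma is_derive_pair (V1 V2 : normedModType R) (c : R -> V1 * V2) (t : R) (d : V1 * V2) :
  is_derive t 1 c d <->
  is_derive t 1 (fun s => (c s).1) d.1 /\ is_derive t 1 (fun s => (c s).2) d.2.
Proof.
split=> [D|[D1 D2]].
  by split; [exact: (hasD_curve D (hasD_fst _ _))|exact: (hasD_curve D (hasD_snd _ _))].
apply/is_deriveNP => e e0.
have [r1 r10 H1] := (is_deriveNP _ _ _).1 D1 e e0.
have [r2 r20 H2] := (is_deriveNP _ _ _).1 D2 e e0.
exists (Num.min r1 r2); first by rewrite lt_min r10.
move=> s; rewrite lt_min => /andP[s1 s2]; apply: norm_pair_le.
- exact: H1 s s1.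
- exact: H2 s s2.
Qed.

Lemma el_ham (gamma : R -> TM) (t : R) : {for t, continuous gamma} ->
  (forall i, chart_dom i (gamma t).1 ->
      let Li := lagrangian H \o tangent_chart_inv i in
      let c := fun s => tangent_chart i (gamma s) in
      is_derive t 1 (fun s => (c s).1) (c t).2 /\
      is_derive t 1 (fun s => grad2 Li (c s)) (grad1 Li (c t))) <->
  ham_at A H (fun s => legendre H (gamma s)) t.
Proof.
move=> cg; set delta := fun s => legendre H (gamma s).
have key i : chart_dom i (gamma t).1 ->
    (is_derive t 1 (fun s => (tangent_chart i (gamma s)).1) (tangent_chart i (gamma t)).2 /\
     is_derive t 1 (fun s => grad2 (lagrangian H \o tangent_chart_inv i) (tangent_chart i (gamma s)))
       (grad1 (lagrangian H \o tangent_chart_inv i) (tangent_chart i (gamma t)))) <->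
    is_derive t 1 (fun s => cotangent_chart i (delta s))
      (field (A := A) H i (cotangent_chart i (delta t))).
  move=> it.
  have near_t : \forall s \near t, chart_dom i (gamma s).1.
    exact: (cg _ (near_tangent_dom it)).
  have g2 s : chart_dom i (gamma s).1 ->
      grad2 (lagrangian H \o tangent_chart_inv i) (tangent_chart i (gamma s)) =
      (cotangent_chart i (delta s)).2.
    move=> si; rewrite (legendre_chart si) /=.
    exact: (grad2_lagrangian _ (img_chart si)).
  have g1 : grad1 (lagrangian H \o tangent_chart_inv i) (tangent_chart i (gamma t)) =
      (field (A := A) H i (cotangent_chart i (delta t))).2.
    by rewrite (legendre_chart it); exact: (grad1_lagrangian _ (img_chart it)).
  have g0 : (tangent_chart i (gamma t)).2 =
      (field (A := A) H i (cotangent_chart i (delta t))).1.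
    by rewrite (legendre_chart it); apply: esym; exact: (velocity_momentum _ (img_chart it)).
  rewrite g1 g0; split=> [[D1 D2]|/is_derive_pair[D1 D2]].
    apply/is_derive_pair; split=> //; apply: is_derive_near D2.
    by apply: filterS near_t => s si; exact: g2.
  split=> //; apply: is_derive_near D2.
  by apply: filterS near_t => s si; apply: esym; exact: g2.
split=> [D|[_ D] i it]; last by apply/key => //; exact: D.
split; last by move=> i it; apply/key => //; exact: D.
apply: continuous_comp; [exact: cg|exact: legendre_continuous].
Qed.

Lemma el_flowE (t : R) (z : TM) : compact [set: M] ->
  el_flow (lagrangian H) t z = velocity H (ham_flow H t (legendre H z)).
Proof.
move=> cM; have [_ _ sH] := TH.
have Hc k : compact [set z | H z <= k] by exact: sublevel_compact.
pose phi s := ham_flow H s (legendre H z).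
have phi_ham s : ham_at A H phi s by exact: (cflow_ham CHA Hc (H_H_const CHA)).
have phi0 : phi 0 = legendre H z by exact: (cflow0 CHA Hc (H_H_const CHA)).
have lphi : (fun s => legendre H (velocity H (phi s))) = phi.
  by apply/funext => s; rewrite legendreK.
apply: xget_unique.
  exists (- (`|t| + 1)), (`|t| + 1), (fun s => velocity H (phi s)); split=> //.
  - by rewrite oppr_lt0 ltr_wpDl.
  - by rewrite -ltr_norml ltrDl.
  - move=> s _; have [cphi _] := phi_ham s.
    have cg : {for s, continuous (fun s => velocity H (phi s))}.
      by apply: continuous_comp; [exact: cphi|exact: velocity_continuous].
    by split=> //; apply/el_ham => //; rewrite lphi.
  - by rewrite phi0 velocity_legendre.
move=> _ [a [b [g [ab0 abt Hg g0 <-]]]]; rewrite -(velocity_legendre (g t)); congr (velocity H).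
apply: (@ham_unique R n N A H (fun s => legendre H (g s)) phi a b 0 CHA) => //.
  by move=> s /Hg[cg Dg]; apply/el_ham.
by rewrite g0 phi0.
Qed.

End legendre_charts.

(** * The action of invariant measures *)

Section pairing_regularity.
Context {R : realType}.

Lemma continuous_pairing (T : topologicalType) (m : nat) (f g : T -> 'rV[R]_m) (x : T) :
  {for x, continuous f} -> {for x, continuous g} ->
  {for x, continuous (fun z => pairing (f z) (g z))}.
Proof.
move=> cf cg; pose B (w : 'rV[R]_m * 'rV[R]_m) := pairing w.1 w.2.
have cB : {for (f x, g x), continuous B}.
  exact: differentiable_continuous (hasD_pairing (hasD_fst _ 0) (hasD_snd _ 0)).1.
have cfg : {for x, continuous (fun z => (f z, g z))} by exact: (cvg_pair cf cg).
exact: (continuous_comp cfg cB).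
Qed.

Lemma Ck1_pairing (V : normedModType R) (m : nat) (U : set V) (f g : V -> 'rV[R]_m) :
  open U -> Ck 1 U f -> Ck 1 U g -> Ck 1 U (fun x => pairing (f x) (g x)).
Proof.
move=> oU Cf Cg; have [df Df] := Cf; have [dg Dg] := Cg.
have h x v : U x -> hasD (fun z => pairing (f z) (g z)) x v
    (pairing ('D_v f x) (g x) + pairing (f x) ('D_v g x)).
  by move=> Ux; apply: hasD_pairing; apply: derive_hasD; [exact: df|exact: dg].
split=> [x Ux|v]; first exact: (h x 0 Ux).1.
apply: (@Ck_eq _ _ _ 0%N U (fun x => pairing ('D_v f x) (g x) + pairing (f x) ('D_v g x)) _ oU).
  by move=> x Ux; apply: esym; exact: hasD_derive (h x v Ux).
move=> x Ux; apply: continuousD; apply: continuous_pairing.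
- exact: Df.
- exact: (differentiable_continuous (dg x Ux)).
- exact: (differentiable_continuous (df x Ux)).
- exact: Dg.
Qed.

Lemma Ck1_id (V : normedModType R) (U : set V) : Ck 1 U (@id V).
Proof.
split=> [x _|v x Ux]; first exact: (hasD_id x 0).1.
have -> : (fun x => 'D_v (@id V) x) = fun=> v by apply/funext => y; exact: hasD_derive (hasD_id y v).
exact: cvg_cst.
Qed.

Lemma Ck1_comp_fst (V W X : normedModType R) (U : set V) (f : V -> W) : open U ->
  Ck 1 U f -> Ck 1 [set w : V * X | U w.1] (fun w : V * X => f w.1).
Proof.
move=> oU [df Df]; have h (w v : V * X) : U w.1 ->
    hasD (fun u : V * X => f u.1) w v ('D_(v.1) f w.1).
  by move=> Uw; apply: hasD_comp_fst; apply: derive_hasD; exact: df.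
split=> [w Uw|v]; first exact: (h w 0 Uw).1.
apply: (@Ck_eq _ _ _ 0%N _ (fun w : V * X => 'D_(v.1) f w.1) _ (open_fst oU)).
  by move=> w Uw; apply: esym; exact: hasD_derive (h w v Uw).
move=> w Uw; have c : {for w, continuous (fst : V * X -> V)} by exact: cvg_fst.
exact: (continuous_comp c (Df _ _ Uw)).
Qed.

End pairing_regularity.

Lemma pairing_transport (R : realType) (n : nat) (A B : 'M[R]_n) (p v : 'rV[R]_n) :
  A *m B = 1%:M -> pairing (p *m B^T) (v *m A) = pairing p v.
Proof. by move=> AB; rewrite -pairing_mul trmxK -mulmxA AB mulmx1. Qed.

Lemma act_symmetry (R : realType) (n : nat) (XF XH dF dH : 'rV[R]_n * 'rV[R]_n)
    (tF tH q : 'rV[R]_n) :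
  dF = dH -> omega XH XF = 0 -> pairing tH XF.1 = pairing tF XH.1 ->
  pairing (XH.2 - tH) XF.1 + pairing q dF.1 - omega XF XH =
  pairing (XF.2 - tF) XH.1 + pairing q dH.1 - omega XH XF.
Proof.
move=> -> e1 e2; rewrite (omega_anti XF) e1 oppr0 !pairingBl e2.
by move: e1; rewrite /omega (pairingC XH.1) => /subr0_eq ->; rewrite subr0 addr0.
Qed.

Section action_function.
Context {R : realType} {n : nat} {M : smooth_manifold R n}.
Notation V := 'rV[R]_n.
Notation E := (V * V)%type.
Notation N := (cotangent_bundle M).
Implicit Types (f F H : N -> R).
Variable eta : one_form M.
Hypotheses (eta_smooth : smooth_form eta) (eta_closed : closed_form eta).
Let A := cotangent_atlas M.

(* [act H] is the integrand of the action, carried over to the cotangent bundle *)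
Definition act f (z : N) : R := pairing (z.2 - eta z.1) (velocity f z).2 - f z.

Lemma form_chart i (x : M) : chart_dom i x ->
  form_in_chart eta i (chart i x) = (cotangent_chart i (x, eta x)).2.
Proof. by move=> ix; rewrite /form_in_chart chartK. Qed.

Lemma act_chart f i (z : N) : C2_cotangent f -> chart_dom i z.1 ->
  act f z = pairing ((cotangent_chart i z).2 - form_in_chart eta i (chart i z.1))
    (ham_field_in_chart i f z).1 - f z.
Proof.
move=> Cf iz; have e1 := congr1 snd (velocity_chart Cf iz).
have e2 := form_chart iz; set c := chart_at z.1.
have cz : overlap c i (chart c z.1).
  have cz := dom_chart_at z.1.
  by split; [exact: img_chart|rewrite chartK].
have JJ := jacobianK cz.
have e3 : transition c i (chart c z.1) = chart i z.1.
  exact: (congr1 (chart i) (chartK (dom_chart_at z.1))).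
have E : pairing (z.2 - eta z.1) (velocity f z).2 =
    pairing ((cotangent_chart i z).2 - form_in_chart eta i (chart i z.1))
    (ham_field_in_chart i f z).1.
  have e4 : (cotangent_chart i z).2 - form_in_chart eta i (chart i z.1) =
      (z.2 - eta z.1) *m ('J (transition i c) (chart i z.1))^T.
    by rewrite e2 mulmxBl.
  have e5 : (ham_field_in_chart i f z).1 =
      (velocity f z).2 *m 'J (transition c i) (chart c z.1) by exact: esym e1.
  rewrite e4 e5; apply: esym; apply: pairing_transport; rewrite -e3; exact: JJ.
exact: (congr1 (fun a => a - f z) E).
Qed.

Let act_in_chart f i (w : E) :=
  pairing (w.2 - form_in_chart eta i w.1) (field (A := A) f i w).1 - in_chart (A := A) f i w.

Let in_chart_act f i (w : E) : C2_cotangent f -> chart_img i w.1 ->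
  in_chart (A := A) (act f) i w = act_in_chart f i w.
Proof.
move=> Cf iw; have [iz zw] := chart_imgP iw.
have iz' : chart_dom i (cotangent_chart_inv i w).1 by exact: iz.
apply: (etrans (act_chart Cf iz')).
exact: (congr1 (fun u : E => pairing (u.2 - form_in_chart eta i u.1)
  (ham_vector (f \o cotangent_chart_inv i) u).1 - f (cotangent_chart_inv i w)) (cotangent_chartK iw)).
Qed.

Let Ck1_form i : Ck 1 [set w : E | chart_img i w.1] (fun w : E => form_in_chart eta i w.1).
Proof. by apply: Ck1_comp_fst; [exact: chart_img_isopen|exact: eta_smooth]. Qed.

Lemma Ck1_act f (i : ca_index A) : C2_cotangent f -> Ck 1 (ca_img i) (in_chart (act f) i).
Proof.
move=> Cf; have oU := @ca_open_img _ _ _ A i; have Cf' : C2 A f by exact: Cf.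
apply: (Ck_eq oU (f := act_in_chart f i)).
  by move=> w iw; apply: esym; exact: in_chart_act.
apply: Ck_add => //; last first.
  have := Ck_scalel (W := R^o) (-1) oU (CkS oU (Cf' i)).
  by apply: Ck_eq => // w _; rewrite /GRing.scale /= mulrN1.
apply: (Ck1_pairing oU).
  apply: (Ck_add oU).
    apply: (Ck_lin (l := snd : {linear E -> V}) oU _ (@Ck1_id _ _ _)).
    by move=> x; exact: cvg_snd.
  apply: (Ck_lin (l := -%R : {linear V -> V}) oU _ (Ck1_form i)).
  exact: opp_continuous.
apply: (Ck_lin (l := fst : {linear E -> V}) oU _ (Ck1_field i Cf')).
by move=> x; exact: cvg_fst.
Qed.

Lemma closed_form_sym i y (a b : V) : chart_img i y ->
  pairing ('d (form_in_chart eta i) y a) b = pairing ('d (form_in_chart eta i) y b) a.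
Proof.
move=> iy; have dth : differentiable (form_in_chart eta i) y by exact: (eta_smooth i 1%N).1.
have ex (u v : V) : pairing ('d (form_in_chart eta i) y u) v = \sum_j \sum_k
    u 0 j * v 0 k * 'D_(delta_mx 0 j) (fun z => form_in_chart eta i z 0 k) y.
  rewrite pairingE exchange_big /=; apply: eq_bigr => k _.
  rewrite {1}(row_sum_delta u) linear_sum summxE mulr_suml; apply: eq_bigr => j _.
  rewrite linearZ mxE derive_row_coord // -deriveE //; ring.
rewrite !ex exchange_big /=; apply: eq_bigr => k _; apply: eq_bigr => j _.
by rewrite (eta_closed iy) (mulrC (a 0 j)).
Qed.

Lemma act_derivatives F H (i : ca_index A) w : C2_cotangent F -> C2_cotangent H ->
  integral_of_motion H F -> ca_img i w ->
  'd (in_chart (act H) i) w (field F i w) = 'd (in_chart (act F) i) w (field H i w).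
Proof.
move=> CF CH HF iw; have FH0 := integral_in_charts CF CH HF.
have CF' : C2 A F by exact: CF. have CH' : C2 A H by exact: CH.
have dth : differentiable (form_in_chart eta i) w.1 by exact: (eta_smooth i 1%N).1.
have D f (a : E) : C2 A f -> hasD (in_chart (act f) i) w a
    (pairing (a.2 - 'd (form_in_chart eta i) (w.1) a.1) (field f i w).1 +
     pairing (w.2 - form_in_chart eta i w.1) ('d (field f i) w a).1 - omega (field f i w) a).
  move=> Cf; have df := C2_differentiable Cf iw.
  apply: (@hasD_near _ _ _ (act_in_chart f i)).
    apply: filterS (near_img iw) => v iv; apply: esym; exact: in_chart_act.
  apply: hasD_sub; last by rewrite -(ham_vectorP _ df); exact: hasD_self.
  apply: hasD_pairing.
    by apply: hasD_sub; [exact: hasD_snd|apply: hasD_comp_fst; exact: hasD_self].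
  have dX := differentiable_field Cf iw.
  exact: (hasD_comp (hasD_self a dX) (hasD_fst _ _)).
apply: (etrans (D H (field F i w) CH').2); apply: esym.
apply: (etrans (D F (field H i w) CF').2).
apply: act_symmetry (closed_form_sym _ _ iw).
- exact: (fields_commute CF' CH' FH0 iw).
- exact: FH0.
Qed.

End action_function.

Section action_bound.
Context {R : realType} {n : nat} {M : smooth_manifold R n}.
Notation V := 'rV[R]_n.
Notation E := (V * V)%type.
Notation N := (cotangent_bundle M).
Notation TM := (tangent_bundle M).

Definition form_section (eta : one_form M) : M -> N := fun x => (x, eta x).

Lemma section_continuous (eta : one_form M) :
  (forall (i : chart_index M) y, chart_img i y -> {for y, continuous (form_in_chart eta i)}) ->
  continuous (form_section eta).
Proof.
move=> ce x; set i := chart_at x; have ix : chart_dom i x by exact: dom_chart_at.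
pose k (y : V) : E := (y, form_in_chart eta i y).
have iy := img_chart ix.
have kc : {for chart i x, continuous k}.
  have c1 : {for chart i x, continuous (@id V)} by exact: cvg_id.
  exact: (cvg_pair c1 (ce i _ iy)).
pose K : M -> N := (cotangent_chart_inv i : E -> N) \o k \o (chart i : M -> V).
have E (x' : M) : chart_dom i x' -> K x' = form_section eta x'.
  move=> ix'; rewrite /K /comp /k (form_chart _ ix').
  exact: (@cotangent_chart_invK _ _ _ i (x', eta x') ix').
have c : {for x, continuous K}.
  apply: continuous_comp; first exact: (chart_continuous ix).
  apply: continuous_comp; first exact: kc.
  exact: (@cotangent_chart_inv_continuous _ _ _ i (k (chart i x)) iy).
have nx : nbhs x (chart_dom i) by apply: open_nbhs_nbhs; split; [exact: chart_dom_open|].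
move=> B; rewrite -(E x ix) => /c hB; have {}hB : nbhs x (K @^-1` B) := hB.
by apply: filterS2 hB nx => x' + ix'; rewrite /preimage /= -(E x' ix').
Qed.

Variable H : N -> R.
Hypothesis TH : tonelli H.

Let base_chart (z : N) : cotangent_chart_inv (chart_at z.1) (chart (chart_at z.1) z.1, z.2) = z.
Proof. by rewrite -cotangent_chart_at cotangent_chart_invK //; exact: dom_chart_at. Qed.

Let velocityE (z : N) : (velocity H z).2 =
  grad2 (H \o cotangent_chart_inv (chart_at z.1)) (chart (chart_at z.1) z.1, z.2).
Proof. by rewrite /velocity /ham_field_in_chart cotangent_chart_at. Qed.

Lemma lagrangian_velocity (z : N) :
  lagrangian H (velocity H z) = pairing z.2 (velocity H z).2 - H z.
Proof.
have iz := dom_chart_at z.1; have iy := img_chart iz.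
have := lagrangian_chart TH z.2 iy; rewrite -velocityE /comp base_chart => <-; congr lagrangian.
have := @tangent_chart_invK _ _ _ _ (velocity H z) iz.
by rewrite -[X in tangent_chart X _]/(chart_at (velocity H z).1) tangent_chart_at.
Qed.

Lemma act_lagrangian (eta : one_form M) (z : N) :
  lagrangian H (velocity H z) - pairing (eta z.1) (velocity H z).2 = act eta H z.
Proof. by rewrite lagrangian_velocity /act pairingBl; ring. Qed.

Lemma act_ge (eta : one_form M) (z : N) : - H (z.1, eta z.1) <= act eta H z.
Proof.
have iz := dom_chart_at z.1; have iy := img_chart iz.
rewrite /act velocityE; have e := base_chart (z.1, eta z.1); rewrite /= in e.
have [<-|ne] := eqVneq z.2 (eta z.1).
  by rewrite subrr pairing0l sub0r lerN2; case: (z).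
have := chart_convex TH iy ne; rewrite /comp e base_chart pairingC.
by rewrite -opprB pairingNl; lra.
Qed.

Lemma act_bounded_below (eta : one_form M) : compact [set: M] -> smooth_form eta ->
  exists C, forall z, - C <= act eta H z.
Proof.
move=> cM se; have [CH _ _] := TH.
have c : continuous (fun x : M => H (x, eta x)).
  move=> x; have c1 : {for x, continuous (form_section eta)}.
    by apply: section_continuous => i; exact: (se i 0%N).
  have c2 : {for form_section eta x, continuous H} by exact: (C2_continuous CH).
  exact: (continuous_comp c1 c2).
have : compact [set H (x, eta x) | x in [set: M]].
  by apply: continuous_compact => //; apply: continuous_subspaceT.
move=> /compact_bounded[C0 [_ /(_ (C0 + 1) (ltr_pwDr ltr01 (lexx _)))]] bC.
exists (C0 + 1) => z; apply: le_trans (act_ge eta z); rewrite lerN2.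
by apply: le_trans (ler_norm _) (bC _ _); exists z.1.
Qed.

End action_bound.

Section integrals_along_flows.
Context {R : realType} {d : measure_display} {T : measurableType d} (P : probability T R).
Local Open Scope ereal_scope.

Lemma prob_lty (K : set T) : measurable K -> P K < +oo.
Proof. by move=> mK; apply: le_lt_trans (probability_le1 P mK) _; rewrite ltey. Qed.

Lemma bounded_integrable (K : set T) (f : T -> R) (B : R) : measurable K ->
  measurable_fun setT f -> (forall z, K z -> `|f z| <= B)%R -> P.-integrable K (EFin \o f).
Proof.
move=> mK mf fB; apply: measurable_bounded_integrable => //; first exact: prob_lty.
  exact: measurable_funS mf.
exists B; split; first exact: num_real.
by move=> b Bb z Kz /=; apply: le_trans (fB z Kz) (ltW Bb).
Qed.

Lemma integrable_subr (K : set T) (f g : T -> R) : measurable K ->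
  P.-integrable K (EFin \o f) -> P.-integrable K (EFin \o g) ->
  P.-integrable K (EFin \o (fun z => f z - g z)%R).
Proof. by move=> mK fi gi; exact: (integrableB mK fi gi). Qed.

Lemma integral_shift (f : T -> R) (C : R) : measurable_fun setT f -> (0 <= C)%R ->
  (forall z, - C <= f z)%R ->
  \int[P]_z (f z)%:E = \int[P]_z (f z + C)%:E - C%:E.
Proof.
move=> mf C0 fC.
have mE : measurable_fun setT (EFin \o f) by apply/measurable_EFinP.
have mC : measurable_fun setT (fun z => (f z + C)%:E).
  by apply/measurable_EFinP; apply: measurable_funD.
have mn := measurable_funeneg mE; have mp := measurable_funepos mE.
have IC : \int[P]_(z in setT) (cst C%:E) z = C%:E.
  have PT : P setT = 1 := probability_setT P.
  by rewrite integral_cst //; apply: etrans (mule1 _); congr (_ * _).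
have e : \int[P]_z (((EFin \o f)^\+ z) + (cst C%:E) z) =
    \int[P]_z ((f z + C)%:E + (EFin \o f)^\- z).
  apply: eq_integral => z _; rewrite funeposE funenegE /= -!EFin_max -!EFinD.
  by congr EFin; rewrite !maxEle; do 2!case: ifP; lra.
have f0 z : setT z -> 0 <= (f z + C)%:E by move=> _; rewrite lee_fin; have := fC z; lra.
rewrite !ge0_integralD // in e.
rewrite IC in e; rewrite integralE.
have nC : \int[P]_z (EFin \o f)^\- z <= C%:E.
  rewrite -IC; apply: ge0_le_integral => // z _; rewrite /= ?lee_fin //.
  rewrite funenegE /= -EFin_max lee_fin ge_max C0 andbT.
  by have := fC z; lra.
have n0 : 0 <= \int[P]_z (EFin \o f)^\- z by exact: integral_ge0.
have : \int[P]_z (EFin \o f)^\- z \is a fin_num.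
  by rewrite fin_numE; apply/andP; split; [apply/eqP => E; rewrite E in n0|apply/eqP => E; rewrite E in nC].
case: (\int[P]_z (EFin \o f)^\- z) e => // r + _.
case: (\int[P]_z (EFin \o f)^\+ z); case: (\int[P]_z (f z + C)%:E) => //= u v.
by rewrite -!EFinD => -[e]; congr EFin; lra.
Qed.

Lemma integral_eq_exhaustion (f g : T -> R) (C : R) (K : nat -> set T) :
  measurable_fun setT f -> measurable_fun setT g -> (0 <= C)%R ->
  (forall z, - C <= f z)%R -> (forall z, - C <= g z)%R ->
  (forall k, measurable (K k)) -> {homo K : j k / (j <= k)%N >-> (j <= k)%O} ->
  \bigcup_k K k = setT ->
  (forall k, exists B, forall z, K k z -> `|f z| <= B /\ `|g z| <= B)%R ->
  (forall k, \int[P]_(z in K k) f z = \int[P]_(z in K k) g z)%R ->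
  \int[P]_z (f z)%:E = \int[P]_z (g z)%:E.
Proof.
move=> mf mg C0 fC gC mK ndK KT bK eK.
rewrite (integral_shift mf C0 fC) (integral_shift mg C0 gC); congr (_ - _).
have lim (h : T -> R) : measurable_fun setT h -> (forall z, - C <= h z)%R ->
    (fun k => \int[P]_(z in K k) (h z + C)%:E) @ \oo --> \int[P]_z (h z + C)%:E.
  move=> mh hC; rewrite -KT; apply: ge0_nondecreasing_set_cvg_integral => // [k|k z _].
    by apply: measurable_funTS; apply/measurable_EFinP; apply: measurable_funD.
  by rewrite lee_fin; have := hC z; lra.
have E k : \int[P]_(z in K k) (f z + C)%:E = \int[P]_(z in K k) (g z + C)%:E.
  have [B HB] := bK k.
  have iC : P.-integrable (K k) (EFin \o cst C).
    by apply: (@bounded_integrable _ _ `|C|).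
  have i_f : P.-integrable (K k) (EFin \o f).
    by apply: (@bounded_integrable _ _ B) => // z /HB[].
  have i_g : P.-integrable (K k) (EFin \o g).
    by apply: (@bounded_integrable _ _ B) => // z /HB[].
  have := congr1 EFin (eK k); rewrite /Rintegral.
  rewrite !fineK ?integrable_fin_num // => e.
  rewrite -[LHS]/(\int[P]_(z in K k) ((EFin \o f) z + (EFin \o cst C) z)).
  rewrite -[RHS]/(\int[P]_(z in K k) ((EFin \o g) z + (EFin \o cst C) z)).
  by rewrite !integralD //= e.
apply: (@cvg_unique _ (@ereal_hausdorff R) _ _ _ _ (lim f mf fC)).
by rewrite (_ : (fun k => _) = (fun k => \int[P]_(z in K k) (g z + C)%:E)); [exact: lim|exact/funext].
Qed.

Local Close Scope ereal_scope.

Lemma Rintegral_invariant (K : set T) (th : T -> T) (f : T -> R) (B : R) : measurable K ->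
  measurable_fun setT th -> measurable_fun setT f ->
  (forall D, measurable D -> P (th @^-1` D) = P D) -> th @^-1` K = K ->
  (forall z, K z -> `|f z| <= B) ->
  \int[P]_(z in K) f (th z) = \int[P]_(z in K) f z.
Proof.
move=> mK mth mf inv thK fB; rewrite /Rintegral; congr fine.
have := @integral_pushforward _ _ _ _ R th mth P K (EFin \o f).
rewrite thK => <- //.
- by apply: eq_measure_integral => D mD _; exact: inv.
- exact/measurable_EFinP.
- apply: (@bounded_integrable _ (f \o th) B) => //; first exact: measurableT_comp.
  by move=> z Kz; apply: fB; move: Kz; rewrite -[in K z]thK.
Qed.

(* The increments of [a] agree to first order with coboundaries of the measure
   preserving maps [th s]. *)
Lemma Rintegral_constant (K : set T) (a b th : R -> T -> _) (B : R) : measurable K ->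
  (forall t, measurable_fun setT (a t : T -> R)) ->
  (forall t, measurable_fun setT (b t : T -> R)) ->
  (forall t, measurable_fun setT (th t : T -> T)) ->
  (forall t D, measurable D -> P (th t @^-1` D) = P D) -> (forall t, th t @^-1` K = K) ->
  (forall t z, K z -> `|a t z| <= B) -> (forall t z, K z -> `|b t z| <= B) ->
  (forall kappa, 0 < kappa -> exists2 e : R, 0 < e & forall s t z, K z -> `|s| < e ->
    `|a (t + s) z - a t z - (b t (th s z) - b t z)| <= kappa * `|s|) ->
  forall t, \int[P]_(z in K) a t z = \int[P]_(z in K) a 0 z.
Proof.
move=> mK ma mb mth inv thK aB bB H t.
pose I t := \int[P]_(z in K) a t z.
have ia t' : P.-integrable K (EFin \o a t') by exact: (bounded_integrable mK (ma t') (aB t')).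
have ib t' : P.-integrable K (EFin \o b t') by exact: (bounded_integrable mK (mb t') (bB t')).
have mbt t' s : measurable_fun setT (b t' \o th s) by exact: measurableT_comp.
have ibt t' s : P.-integrable K (EFin \o (b t' \o th s)).
  apply: (bounded_integrable mK (mbt t' s)) => z Kz; apply: (bB t').
  by move: Kz; rewrite -[in K z](thK s).
have D t' : is_derive (t' : R) (1 : R) (I : R -> R^o) 0.
  apply/is_deriveNP => e e0; have [r r0 rP] := H e e0; exists r => // s sr.
  pose s' := s - t'; have ss : s = t' + s' by rewrite /s' addrC subrK.
  rewrite scaler0 subr0 -/s' {1}ss.
  have i1 := integrable_subr mK (ia (t' + s')) (ia t').
  have i2 := integrable_subr mK (ibt t' s') (ib t').
  have i3 := integrable_subr mK i1 i2.
  have -> : I (t' + s') - I t' =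
      \int[P]_(z in K) (a (t' + s') z - a t' z - (b t' (th s' z) - b t' z)).
    rewrite RintegralB // RintegralB // (RintegralB mK (ibt t' s') (ib t')).
    rewrite -[X in _ - (X - _)]/(\int[P]_(z in K) b t' (th s' z)).
    by rewrite (Rintegral_invariant mK (mth s') (mb t') (inv s') (thK s') (bB t')) subrr subr0.
  apply: le_trans (le_normr_Rintegral mK i3) _.
  apply: (@le_trans _ _ (\int[P]_(z in K) (e * `|s'|))).
    apply: le_Rintegral => //.
    - by rewrite (_ : _ \o _ = abse \o (EFin \o (fun z => a (t' + s') z - a t' z - (b t' (th s' z) - b t' z)))) //; exact: integrable_abse.
    - by apply: (@bounded_integrable _ _ `|e * `|s'| |).
    - by move=> z Kz; apply: rP.
  rewrite Rintegral_cst // ler_piMr //; first by rewrite mulr_ge0 // ltW.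
  rewrite -lee_fin fineK; first exact: probability_le1.
  exact: fin_num_measure.
have : `|(I t : R^o) - I 0| <= 0 * `|t - 0|.
  apply: (@mean_value_abs _ _ (I : R -> R^o) (fun=> 0)) => r _.
  by split; [exact: D|rewrite normr0].
by rewrite mul0r normr_le0 => /eqP/subr0_eq.
Qed.

End integrals_along_flows.

Section borel_measurability.
Context {R : realType}.

Lemma continuous_borel (S T : ptopologicalType) (h : S -> T) : continuous h ->
  measurable_fun setT (h : borel S -> borel T).
Proof.
move=> /continuousP ch; apply: (@measurability _ _ (borel S) (borel T) setT h (@open T) erefl).
by move=> _ [B oB <-]; rewrite setTI; apply: sub_sigma_algebra; exact: ch.
Qed.

Lemma continuous_borel_real (S : ptopologicalType) (h : S -> R) : continuous h ->
  measurable_fun setT (h : borel S -> R).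
Proof.
move=> /continuousP ch; apply: (measurability _ (RGenOpens.measurableE R)).
by move=> _ [B [a [b ->]] <-]; rewrite setTI; apply: sub_sigma_algebra; apply: ch; exact: interval_open.
Qed.

Lemma pushforward_exists (S T : ptopologicalType) (h : S -> T)
    (mu : probability (borel S) R) : continuous h ->
  exists mu' : probability (borel T) R, is_pushforward h mu mu'.
Proof.
move=> ch; have mh := continuous_borel ch.
pose X : {mfun borel S >-> borel T} := HB.pack (h : borel S -> borel T)
  (isMeasurableFun.Build _ _ _ _ _ mh).
by exists (distribution mu X).
Qed.

Lemma pushforward_integral (S : ptopologicalType) (h : S -> S) (f : S -> R) (C : R)
    (mu mu' : probability (borel S) R) : continuous h -> is_pushforward h mu mu' ->
  measurable_fun setT (f : borel S -> R) -> 0 <= C -> (forall z, - C <= f z) ->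
  (\int[mu']_z (f z)%:E = \int[mu]_z (f (h z))%:E)%E.
Proof.
move=> ch hmu mf C0 fC; have mh := continuous_borel ch.
have mfh : measurable_fun setT ((f \o h) : borel S -> R) by exact: (measurableT_comp mf mh).
rewrite (integral_shift mu' mf C0 fC) (integral_shift mu mfh C0) => [|z]; last exact: fC.
congr (_ - _)%E.
have e : (\int[mu']_z (f z + C)%:E =
    \int[pushforward mu (h : borel S -> borel S)]_z (f z + C)%:E)%E.
  by apply: eq_measure_integral => D mD _; exact: hmu.
rewrite e ge0_integral_pushforward //.
- by apply/measurable_EFinP; apply: measurable_funD.
- by move=> z _; rewrite lee_fin; have := fC z; lra.
Qed.

End borel_measurability.

Section cotangent_flows.
Context {R : realType} {n : nat} {M : smooth_manifold R n}.
Notation N := (cotangent_bundle M).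
Notation TM := (tangent_bundle M).
Variables F H : N -> R.
Hypotheses (cM : compact [set: M]) (TH : tonelli H) (CF : C2_cotangent F)
  (HF : integral_of_motion H F).
Let A := cotangent_atlas M.
Let CH : C2 A H. Proof. by have [] := TH. Qed.
Let CFA : C2 A F. Proof. exact: CF. Qed.
Let Hc (k : R) : compact [set z | H z <= k].
Proof. by have [? _ ?] := TH; exact: sublevel_compact. Qed.
Let FH0 := integral_in_charts CF CH HF.

Lemma integral_flow_ham z t : ham_at A F (fun s => ham_flow F s z) t.
Proof. exact: (cflow_ham CFA Hc (F_H_const CH FH0)). Qed.

Lemma integral_flow0 z : ham_flow F 0 z = z.
Proof. exact: (cflow0 CFA Hc (F_H_const CH FH0)). Qed.

Lemma integral_flowD s t z : ham_flow F (s + t) z = ham_flow F s (ham_flow F t z).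
Proof. exact: (cflowD CFA Hc (F_H_const CH FH0)). Qed.

Lemma integral_flow_energy t z : H (ham_flow F t z) = H z.
Proof. exact: (cflow_energy CFA Hc (F_H_const CH FH0)). Qed.

Lemma integral_flow_continuous t : continuous (ham_flow F t).
Proof. exact: (cflow_continuous CFA Hc (F_H_const CH FH0)). Qed.

Lemma tonelli_flow_energy t z : H (ham_flow H t z) = H z.
Proof. exact: (cflow_energy CH Hc (H_H_const CH)). Qed.

Lemma tonelli_flow_continuous t : continuous (ham_flow H t).
Proof. exact: (cflow_continuous CH Hc (H_H_const CH)). Qed.

Lemma ham_flows_commute s t z :
  ham_flow F t (ham_flow H s z) = ham_flow H s (ham_flow F t z).
Proof. exact: (flows_commute CFA CH Hc FH0). Qed.

Lemma act_continuous (eta : one_form M) (f : N -> R) : smooth_form eta -> C2_cotangent f ->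
  continuous (act eta f).
Proof.
move=> se Cf z; have [i iz] := ca_cover A z; have iw := ca_chart_img iz.
have c : {for ca_chart i z, continuous (in_chart (A := A) (act eta f) i)}.
  by apply: differentiable_continuous; apply: (Ck1_act se i Cf).1.
have E : \forall z' \near z, in_chart (A := A) (act eta f) i (ca_chart i z') = act eta f z'.
  by apply: filterS (near_dom iz) => z' iz'; rewrite /in_chart /comp ca_chartK.
have h := continuous_comp (ca_chart_cont iz) c.
move=> B; rewrite -(nbhs_singleton E) => /h hB.
have {}hB : nbhs z ((in_chart (A := A) (act eta f) i \o ca_chart i) @^-1` B) := hB.
by apply: filterS2 E hB => z' e; rewrite /preimage /= e.
Qed.

(* The action of an invariant measure and of its image by the flow of [F]
   agree on each sublevel of [H], hence globally. *)
Lemma action_pushforward (eta : one_form M) (t : R)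
    (nu nu' : probability (borel TM) R) : smooth_form eta -> closed_form eta ->
  el_invariant H nu ->
  is_pushforward (fun z => velocity H (ham_flow F t (legendre H z))) nu nu' ->
  action H eta nu' = action H eta nu.
Proof.
move=> se ce inv push.
have cleg := legendre_continuous TH; have cvel := velocity_continuous TH.
have CHc : C2_cotangent H by exact: CH.
have [C0 C0P] := act_bounded_below TH cM se.
pose C := `|C0|; have CP z : - C <= act eta H z.
  by apply: le_trans (C0P z); rewrite lerN2 ler_norm.
pose S s (z : TM) := velocity H (ham_flow F s (legendre H z)).
have cS s : continuous (S s).
  move=> z; apply: continuous_comp; last exact: cvel.
  by apply: continuous_comp; [exact: cleg|exact: integral_flow_continuous].
pose a (f : N -> R) (s : R) (z : TM) := act eta f (ham_flow F s (legendre H z)).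
have ca f s : C2_cotangent f -> continuous (a f s).
  move=> Cf z; have c1 : {for legendre H z, continuous (ham_flow F s)}.
    exact: integral_flow_continuous.
  have c2 : {for ham_flow F s (legendre H z), continuous (act eta f)}.
    exact: (act_continuous se Cf).
  exact: (continuous_comp (continuous_comp (cleg z) c1) c2).
have LE z : lagrangian H z - pairing (eta z.1) z.2 = act eta H (legendre H z).
  by rewrite -act_lagrangian // velocity_legendre.
have ea s (mu : probability (borel TM) R) :
    (\int[mu]_z (lagrangian H (S s z) - pairing (eta (S s z).1) (S s z).2)%:E =
     \int[mu]_z (a H s z)%:E)%E.
  by apply: eq_integral => z _; rewrite LE /S legendreK.
have mL : measurable_fun setT
    ((fun z : TM => lagrangian H z - pairing (eta z.1) z.2) : borel TM -> R).
  apply: continuous_borel_real => z.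
  have -> : (fun z : TM => lagrangian H z - pairing (eta z.1) z.2) = act eta H \o legendre H.
    by apply/funext => u; exact: LE.
  have c2 : {for legendre H z, continuous (act eta H)} by exact: (act_continuous se CHc).
  exact: (continuous_comp (cleg z) c2).
have LC z : - C <= lagrangian H z - pairing (eta z.1) z.2 by rewrite LE.
rewrite /action (pushforward_integral (cS t) push mL (normr_ge0 C0) LC) ea.
have -> : (\int[nu]_z (lagrangian H z - pairing (eta z.1) z.2)%:E = \int[nu]_z (a H 0 z)%:E)%E.
  by apply: eq_integral => z _; rewrite LE /a integral_flow0.
pose K (k : nat) := [set z : borel TM | H (legendre H z) <= k%:R].
have bounded f (k : nat) : C2_cotangent f -> exists B, forall s z, K k z -> `|a f s z| <= B.
  move=> Cf; have : compact (act eta f @` [set z : N | H z <= k%:R]).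
    have hw : {within [set z : N | H z <= k%:R], continuous (act eta f)}.
      by apply: continuous_subspaceT; exact: (act_continuous se Cf).
    exact: (continuous_compact hw (@Hc k%:R)).
  move=> /compact_bounded[B0 [_ /(_ (B0 + 1) (ltr_pwDr ltr01 (lexx _)))]] bB.
  exists (B0 + 1) => s z Kz; apply: bB; exists (ham_flow F s (legendre H z)) => //=.
  by rewrite integral_flow_energy.
have mK k : measurable (K k).
  have mH : measurable_fun setT ((H \o legendre H) : borel TM -> R).
    apply: continuous_borel_real => z.
    have c2 : {for legendre H z, continuous H} by exact: (C2_continuous CHc).
    exact: (continuous_comp (cleg z) c2).
  have := mH measurableT [set` `]-oo, k%:R]] (measurable_itv _).
  by rewrite setTI (_ : _ @^-1` _ = K k).
have ma f s : C2_cotangent f -> measurable_fun setT (a f s : borel TM -> R).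
  by move=> Cf; apply: continuous_borel_real; exact: ca.
apply: (integral_eq_exhaustion (C := C) (K := K)).
- exact: ma.
- exact: ma.
- exact: normr_ge0.
- by move=> z; exact: CP.
- by move=> z; exact: CP.
- exact: mK.
- move=> j k jk; apply/subsetPset => z; rewrite /K /= => h.
  by apply: le_trans h _; rewrite ler_nat.
- apply/seteqP; split=> // z _; exists (Num.truncn `|H (legendre H z)|).+1 => //.
  rewrite /K /=; apply: le_trans (ler_norm _) (ltW _); exact: truncnS_gt.
- move=> k; have [B HB] := bounded H k CHc; exists B => z Kz.
  by split; exact: HB.
move=> k; have [B HB] := bounded H k CHc; have [B' HB'] := bounded F k CF.
have elE s z : el_flow (lagrangian H) s z = velocity H (ham_flow H s (legendre H z)).
  exact: el_flowE.
apply: (@Rintegral_constant _ _ _ nu (K k) (a H) (a F) (fun s => el_flow (lagrangian H) s)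
  (Num.max B B')).
- exact: mK.
- by move=> s; exact: ma.
- by move=> s; exact: ma.
- move=> s; apply: continuous_borel.
  have -> : el_flow (lagrangian H) s = fun z => velocity H (ham_flow H s (legendre H z)).
    by apply/funext => z; exact: elE.
  move=> z; apply: continuous_comp; last exact: cvel.
  by apply: continuous_comp; [exact: cleg|exact: tonelli_flow_continuous].
- exact: inv.
- move=> s; apply/seteqP; split=> z; rewrite /K /= elE legendreK // tonelli_flow_energy //.
- by move=> s z Kz; rewrite le_max HB.
- by move=> s z Kz; rewrite le_max HB' ?orbT.
move=> kappa kappa0.
have [e e0 eP] := increments_agree CFA CH Hc FH0 (fun i => Ck1_act se i CHc)
  (fun i => Ck1_act se i CF) (fun i w iw => act_derivatives se ce CF CHc HF iw) k%:R kappa0.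
exists e => // s t' z Kz se'; rewrite /a elE legendreK // ham_flows_commute.
rewrite (addrC t') integral_flowD; apply: eP => //.
by rewrite integral_flow_energy.
Qed.

End cotangent_flows.

Lemma preimage_commute (T : Type) (f g : T -> T) (D : set T) :
  (forall z, f (g z) = g (f z)) -> g @^-1` (f @^-1` D) = f @^-1` (g @^-1` D).
Proof. by move=> fg; apply/seteqP; split=> z; rewrite /preimage /= fg. Qed.

Lemma eq_preimage2 (S T U : Type) (f : S -> T) (g : T -> U) (h : S -> U) (D : set U) :
  (forall z, g (f z) = h z) -> f @^-1` (g @^-1` D) = h @^-1` D.
Proof. by move=> fg; apply/seteqP; split=> z; rewrite /preimage /= fg. Qed.

Section part_one.
Context {R : realType} {n : nat} {M : smooth_manifold R n}.
Notation N := (cotangent_bundle M).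
Notation TM := (tangent_bundle M).
Variables F H : N -> R.
Hypotheses (cM : compact [set: M]) (TH : tonelli H) (CF : C2_cotangent F)
  (HF : integral_of_motion H F).
Variable eta : one_form M.
Hypotheses (se : smooth_form eta) (ce : closed_form eta).

Let el_flow_commute s t (z : TM) :
  el_flow (lagrangian H) s (velocity H (ham_flow F t (legendre H z))) =
  velocity H (ham_flow F t (legendre H (el_flow (lagrangian H) s z))).
Proof.
set p := legendre H z.
have e1 : legendre H (el_flow (lagrangian H) s z) = ham_flow H s p.
  exact: (etrans (congr1 (legendre H) (el_flowE TH s z cM)) (legendreK TH _)).
have e2 w : el_flow (lagrangian H) s (velocity H w) = velocity H (ham_flow H s w).
  exact: (etrans (el_flowE TH s _ cM)
    (congr1 (fun u => velocity H (ham_flow H s u)) (legendreK TH w))).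
apply: (etrans (e2 _)); apply: (congr1 (velocity H)).
apply: (etrans (esym (ham_flows_commute cM TH CF HF s t p))).
exact: (congr1 (ham_flow F t) (esym e1)).
Qed.

Lemma el_flow_continuous s : continuous (el_flow (lagrangian H) s).
Proof.
have -> : el_flow (lagrangian H) s = fun z => velocity H (ham_flow H s (legendre H z)).
  by apply/funext => z; exact: el_flowE.
move=> z; apply: continuous_comp; last exact: velocity_continuous.
apply: continuous_comp; first exact: legendre_continuous.
exact: (tonelli_flow_continuous cM TH).
Qed.

Lemma cotangent_minimizing_flow (mu : probability (borel N) R) (t : R) :
  cotangent_minimizing H eta mu ->
  exists2 mu' : probability (borel N) R,
    is_pushforward (ham_flow F t) mu mu' & cotangent_minimizing H eta mu'.
Proof.
move=> [nu [inv mini] push]; have cleg := legendre_continuous TH.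
have cF := integral_flow_continuous cM TH CF HF.
pose S (z : TM) := velocity H (ham_flow F t (legendre H z)).
have cS : continuous S.
  move=> z; apply: continuous_comp; last exact: velocity_continuous.
  by apply: continuous_comp; [exact: cleg|exact: cF].
have [mu' push'] := pushforward_exists mu (@cF t).
have [nu' pushS] := pushforward_exists nu cS.
have pre (X Y : ptopologicalType) (h : X -> Y) (D : set (borel Y)) : continuous h ->
    measurable D -> measurable ((h : borel X -> borel Y) @^-1` D).
  move=> ch mD; rewrite -[X in measurable X]setTI.
  exact: (continuous_borel ch measurableT mD).
exists mu' => //; exists nu'.
  split=> [s D mD|nu2 inv2].
    have mD' := pre _ _ _ _ (@el_flow_continuous s) mD.
    rewrite (pushS _ mD') (pushS _ mD) /pushforward.
    apply: etrans (inv s _ (pre _ _ _ _ cS mD)); apply: (congr1 nu).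
    exact: (@preimage_commute TM (el_flow (lagrangian H) s) S D (el_flow_commute s t)).
  by rewrite (action_pushforward cM TH CF HF se ce inv pushS); exact: mini.
move=> D mD; have mD1 := pre _ _ _ _ cleg mD.
have mD2 := pre _ _ _ _ (@cF t) mD.
rewrite (push' _ mD) /pushforward (push _ mD2) /pushforward (pushS _ mD1) /pushforward.
have e : forall z, legendre H (S z) = ham_flow F t (legendre H z) by move=> z; exact: legendreK.
exact: (congr1 nu (esym (etrans (eq_preimage2 D e) (esym (eq_preimage2 D (fun=> erefl)))))).
Qed.

Lemma mather_set_sub (t : R) (z : N) :
  mather_set H eta z -> mather_set H eta (ham_flow F t z).
Proof.
move=> [mu cm zmu]; have [mu' push cm'] := cotangent_minimizing_flow t cm.
have cF := integral_flow_continuous cM TH CF HF.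
exists mu' => // U oU Uz; rewrite push; last exact: sub_sigma_algebra.
by apply: zmu => //; apply: open_comp => // u _; exact: cF.
Qed.

Lemma invariant_of_sub (B : set N) : (forall t z, B z -> B (ham_flow F t z)) ->
  flow_invariant (ham_flow F) B.
Proof.
move=> sub t; apply/seteqP; split=> [_ [z Bz <-]|z Bz]; first exact: sub.
exists (ham_flow F (- t) z); first exact: sub.
by rewrite -(integral_flowD cM TH CF HF) subrr (integral_flow0 cM TH CF HF).
Qed.

(* a flow line joins a point to its image inside an invariant set *)
Lemma components_of_invariant (B : set N) : (forall t z, B z -> B (ham_flow F t z)) ->
  preserves_components (ham_flow F) B.
Proof.
move=> sub t z Bz _ [w cw <-].
have Bw : B w by exact: connected_component_sub cw.
rewrite (same_connected_component cw).
pose c s := ham_flow F s w.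
have cc : continuous c by move=> s; have [] := integral_flow_ham cM TH CF HF w s.
have sub' : c @` setT `<=` connected_component B w.
  apply: connected_component_max.
  - by exists 0 => //; exact: (integral_flow0 cM TH CF HF).
  - by move=> _ [s _ <-]; exact: sub.
  apply: connected_continuous_connected; last exact: continuous_subspaceT.
  by apply/connected_intervalP.
by apply: sub'; exists t.
Qed.

End part_one.

Lemma representative_form (R : realType) (n : nat) (M : smooth_manifold R n) (c : H1 M)
  (eta : one_form M) : representatives c eta -> smooth_form eta /\ closed_form eta.
Proof. by have [e [_ _ ->]] := representativesP c; case. Qed.

(** * Functions of class C^{1,1} *)

Section quadratic_remainders.
Context {R : realType}.
Implicit Types V W : normedModType R.

Lemma quad_remainder V W (f : V -> W) (x : V) (r L : R) : 0 <= L ->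
  (forall y, `|y - x| < r -> differentiable f y) ->
  (forall y z h, `|y - x| < r -> `|z - x| < r ->
    `|'d f z h - 'd f y h| <= L * `|z - y| * `|h|) ->
  forall y y', `|y - x| < r -> `|y' - x| < r ->
    `|f y' - f y - 'd f y (y' - y)| <= L * `|y' - y| ^+ 2.
Proof.
move=> L0 df Lf y y' yr yr'; set h := y' - y.
pose c (s : R) := f (y + s *: h) - s *: 'd f y h.
have seg (t : R) : 0 <= t <= 1 -> `|y + t *: h - x| < r by move=> t01; exact: segment_ball.
have D (t : R) : 0 <= t <= 1 -> is_derive t 1 c ('d f (y + t *: h) h - 'd f y h).
  move=> t01; have d1 := is_derive_line (df _ (seg t t01)) (v := h).
  rewrite deriveE in d1; last exact: df _ (seg t t01).
  have d2 : is_derive t 1 (fun s : R => s *: 'd f y h) (1 *: 'd f y h).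
    by apply: is_derive_scalel; exact: is_derive_id.
  rewrite scale1r in d2; exact: is_deriveB.
have E0 : c 0 = f y by rewrite /c !scale0r subr0 addr0.
have E1 : c 1 = f y' - 'd f y h by rewrite /c !scale1r /h (addrC y) subrK.
have := @mean_value_le _ _ c _ (L * `|h| ^+ 2) 0 1 ler01 D.
rewrite E1 E0 (subr0 (1 : R)) mulr1 addrAC; apply=> t t01; have /andP[t0 t1] := t01; apply: le_trans (Lf _ _ _ yr (seg t t01)) _.
have -> : y + t *: h - y = t *: h by rewrite (addrC y) addrK.
rewrite normrZ (ger0_norm t0) expr2 !mulrA ler_wpM2r // mulrAC ler_piMr //.
exact: mulr_ge0.
Qed.

Lemma Ck2_diff_lipschitz V W (fd : findim V) (U : set V) (f : V -> W) (x : V) :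
  open U -> U x -> Ck 2 U f ->
  exists2 L : R, 0 < L & exists2 r : R, 0 < r & forall y z h, `|y - x| < r -> `|z - x| < r ->
    [/\ U y, differentiable f y & `|'d f z h - 'd f y h| <= L * `|z - y| * `|h|].
Proof.
move=> oU Ux [df Df].
have H (k : fd) : exists Ld : R * R, [/\ 0 < Ld.1, 0 < Ld.2 & forall y z,
    `|y - x| < Ld.2 -> `|z - x| < Ld.2 ->
    `|'D_(fde k) f z - 'D_(fde k) f y| <= Ld.1 * `|z - y|].
  have [L L0 [d d0 dP]] := Ck1_lipschitz fd oU Ux (Df (fde k)).
  by exists (L, d); split=> // y z yd zd; exact: dP.
have {}[Ld LdP] := boolp.choice H.
have [r0 r00 r0P] := openNP oU Ux.
have [r rp rP] : exists2 r : R, 0 < r & forall k : fd, r <= (Ld k).2.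
  exists (\big[Num.min/1]_(k : fd) (Ld k).2).
    by elim/big_ind : _ => // [a b a0 b0|k _]; [rewrite lt_min a0|case: (LdP k)].
  by move=> k; rewrite (bigD1 k) //= ge_min lexx.
pose L := \sum_(k : fd) (Ld k).1 + 1.
have L0 : 0 < L.
  by rewrite ltr_wpDl // sumr_ge0 // => k _; case: (LdP k) => /ltW.
exists L => //; exists (Num.min r0 r); first by rewrite lt_min r00.
move=> y z h; rewrite !lt_min => /andP[y0 yr] /andP[z0 zr].
have Uy := r0P y y0; have Uz := r0P z z0; split=> //; first exact: df.
have ex u : U u -> 'd f u h = \sum_(k : fd) fdc k h *: 'D_(fde k) f u.
  move=> Uu; rewrite [X in 'd f u X](fdE fd) linear_sum.
  by apply: eq_bigr => k _; rewrite linearZ deriveE //; exact: df.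
rewrite (ex z Uz) (ex y Uy) -sumrB.
apply: (@le_trans _ _ (\sum_(k : fd) (Ld k).1 * (`|z - y| * `|h|))).
  apply: (le_trans (ler_norm_sum _ _ _)); apply: ler_sum => k _.
  rewrite -scalerBr normrZ; have [_ _ LP] := LdP k.
  rewrite mulrA [leRHS]mulrC ler_pM //; first exact: fd_le.
  by apply: LP; apply: lt_le_trans (rP k).
rewrite -mulr_suml -mulrA ler_wpM2r ?mulr_ge0 //; by rewrite /L lerDl.
Qed.

Lemma taylor2 V W (fd : findim V) (U : set V) (f : V -> W) (x : V) :
  open U -> U x -> Ck 2 U f ->
  exists2 C : R, 0 < C & exists2 r : R, 0 < r & forall y y',
    `|y - x| < r -> `|y' - x| < r -> `|f y' - f y - 'd f y (y' - y)| <= C * `|y' - y| ^+ 2.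
Proof.
move=> oU Ux Cf; have [L L0 [r r0 rP]] := Ck2_diff_lipschitz fd oU Ux Cf.
exists L => //; exists r => // y y' yr yr'.
apply: (quad_remainder (ltW L0) _ _ yr yr') => [z zr|z z' h zr zr'].
  by have [] := rP z z 0 zr zr.
by have [] := rP z z' h zr zr'.
Qed.

Lemma lipschitz_on_ball (n : nat) (W : normedModType R) (q : 'rV[R]_n -> W) (x : 'rV[R]_n) (r : R) :
  (forall y, `|x - y| <= r -> exists2 k : R, 0 < k & exists2 d : R, 0 < d &
    forall a b, `|a - y| < d -> `|b - y| < d -> `|q a - q b| <= k * `|a - b|) ->
  exists2 k : R, 0 < k & forall a b, `|a - x| < r -> `|b - x| < r -> `|q a - q b| <= k * `|a - b|.
Proof.
move=> H; have cB := @compact_row_ball R n x r.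
pose P (y : 'rV[R]_n) (d : R) := forall a b, `|a - y| < d -> `|b - y| < d ->
  `|q a - q b| <= d^-1 * `|a - b|.
have loc y : [set v | `|x - v| <= r] y -> exists2 e : R, 0 < e &
    \forall y' \near y, forall d, 0 < d -> d < e -> P y' d.
  move=> /H[k k0 [d d0 dP]]; exists (Num.min (d / 2) k^-1).
    by rewrite lt_min divr_gt0 // invr_gt0.
  apply/nearNP; exists (d / 2); first by rewrite divr_gt0.
  move=> y' yy' d' d'0; rewrite lt_min => /andP[d'd d'k] a b ay by'.
  have tri u : `|u - y'| < d' -> `|u - y| < d.
    by move=> uy; have := ler_distD y' u y; lra.
  apply: le_trans (dP a b (tri a ay) (tri b by')) _; rewrite ler_wpM2r //.
  by rewrite -[k]invrK lef_pV2 ?posrE ?invr_gt0 // ltW.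
have [e e0 eP] := uniform_over_compact cB loc.
pose d := e / 2; have d0 : 0 < d by rewrite divr_gt0.
have de : d < e by rewrite /d; lra.
exists d^-1; first by rewrite invr_gt0.
move=> a b ar br; apply: local_lipschitz_segment; first by rewrite invr_ge0 ltW.
move=> t t01; exists d => // z zd.
have sb := segment_ball t01 ar br.
by apply: (eP (b + t *: (a - b)) d) => //; rewrite ?subrr ?normr0 //= distrC ltW.
Qed.

Lemma perturbed_identity_surj (n : nat) (g : 'rV[R]_n -> 'rV[R]_n) (x0 Y : 'rV[R]_n) (r : R) :
  0 <= r -> (forall y y', `|y - x0| <= r -> `|y' - x0| <= r ->
    `|(g y - g y') - (y - y')| <= 1 / 2 * `|y - y'|) ->
  `|Y - g x0| <= r / 2 -> exists2 y, `|y - x0| <= r & g y = Y.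
Proof.
move=> r0 gl gY; pose T y := y + Y - g y.
have TT y y' : `|y - x0| <= r -> `|y' - x0| <= r -> `|T y - T y'| <= 1 / 2 * `|y - y'|.
  move=> yr yr'; have -> : T y - T y' = - ((g y - g y') - (y - y')) by rewrite /T; vring.
  by rewrite normrN; exact: gl.
have x0r : `|x0 - x0| <= r by rewrite subrr normr0.
have Tx0 : `|T x0 - x0| <= r / 2 by have -> : T x0 - x0 = Y - g x0 by rewrite /T; vring.
have Tb y : `|y - x0| <= r -> `|T y - x0| <= r.
  by move=> yr; have := TT y x0 yr x0r; have := ler_distD (T x0) (T y) x0; lra.
pose u k := iter k T x0.
have ub k : `|u k - x0| <= r by elim: k => //= k; exact: Tb.
have uS k : `|u k.+1 - u k| <= (r / 2) / 2 ^+ k.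
  elim: k => [|k IH]; first by rewrite expr0 divr1.
  apply: le_trans (TT _ _ (ub k.+1) (ub k)) _.
  by rewrite exprS invfM mulrCA mul1r ler_wpM2l.
have [l lP] := findim_limit (findim_row n) uS.
set S := \sum_(i : _) _ in lP; have S0 : 0 <= S by rewrite sumr_ge0.
have ul k : `|u k - l| <= (r * S) / 2 ^+ k.
  by apply: le_trans (lP k) _; rewrite mulrCA mulfV // mulr1 mulrAC.
have rS : 0 <= r * S by rewrite mulr_ge0.
have lr : `|l - x0| <= r.
  apply: (@le_pow2 _ _ _ (r * S)) => // k.
  by have := ul k; have := ub k; have := ler_distD (u k) l x0; rewrite (distrC l (u k)); lra.
exists l => //; have : `|T l - l| <= 0.
  apply: (@le_pow2 _ _ _ (2 * (r * S))) => [|k]; first by rewrite mulr_ge0.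
  have h1 := TT l (u k) lr (ub k); have h2 := ul k; have h3 := ul k.+1.
  have h4 := ler_distD (u k.+1) (T l) l; rewrite -[u k.+1]/(T (u k)) in h3 h4.
  rewrite distrC in h2; rewrite exprS invfM mulrCA in h3.
  have q0 : 0 <= r * S / 2 ^+ k by rewrite divr_ge0 // exprn_ge0.
  by rewrite add0r -(mulrA 2); lra.
rewrite normr_le0 subr_eq0 /T => /eqP e.
have : Y - g l = (l + Y - g l) - l by vring.
by rewrite e subrr => /subr0_eq.
Qed.

End quadratic_remainders.

Lemma eq_norm_le (R : realType) (a b c : R) : a = b -> `|b| <= c -> `|a| <= c.
Proof. by move=> ->. Qed.

Section quadratic_approximation.
Context {R : realType} {n : nat}.
Notation V := 'rV[R]_n.

Lemma continuous_zero (U W : normedModType R) : continuous (\0%R : U -> W).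
Proof. by move=> x; exact: cvg_cst. Qed.

Lemma quad_hasD (u : V -> R) (q : V -> V) (x : V) (r C : R) : 0 < C ->
  (forall y y', `|y - x| < r -> `|y' - x| < r ->
    `|u y' - u y - pairing (q y) (y' - y)| <= C * `|y' - y| ^+ 2) ->
  forall y h, `|y - x| < r -> hasD u y h (pairing (q y) h).
Proof.
move=> C0 Q y h yr.
have l h' : hasD (fun z => pairing (q y) z) y h' (pairing (q y) h').
  have := hasD_pairing (hasD_cst (q y) y h') (hasD_id y h').
  by rewrite pairing0l add0r.
have [dg Dg] : differentiable (fun z => u z - pairing (q y) z) y /\
    'd (fun z => u z - pairing (q y) z) y = \0%R :> (V -> R).
  apply: diffNP; first exact: continuous_zero.
  move=> e e0; exists (Num.min (r - `|y - x|) (e / C)).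
    by rewrite lt_min subr_gt0 yr divr_gt0.
  move=> y'; rewrite lt_min => /andP[y1 y2].
  have y'r : `|y' - x| < r by have := ler_distD y y' x; lra.
  rewrite subr0; have -> : u y' - pairing (q y) y' - (u y - pairing (q y) y) =
      u y' - u y - pairing (q y) (y' - y) by rewrite pairingBr; ring.
  apply: le_trans (Q y y' yr y'r) _; rewrite expr2 mulrA ler_wpM2r //.
  by rewrite mulrC -ler_pdivlMr // ltW.
have h1 : hasD (fun z => u z - pairing (q y) z) y h 0.
  by split=> //; rewrite Dg.
have := hasD_add h1 (l h); rewrite add0r; apply: hasD_near.
by apply/nearNP; exists 1 => // z _; rewrite subrK.
Qed.

Lemma quad_lipschitz (u : V -> R) (q : V -> V) (x : V) (r C : R) : 0 < C ->
  (forall y y', `|y - x| < r -> `|y' - x| < r ->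
    `|u y' - u y - pairing (q y) (y' - y)| <= C * `|y' - y| ^+ 2) ->
  forall y y', `|y - x| < r / 3 -> `|y' - x| < r / 3 -> `|q y' - q y| <= 6 * C * `|y' - y|.
Proof.
move=> C0 Q y y' yr yr'; set k := `|y' - y|.
have kr : k < 2 * (r / 3) by rewrite /k; have := ler_distD x y' y; rewrite (distrC x); lra.
have [/eqP|k0] := eqVneq k 0.
  by rewrite /k normr_eq0 subr_eq0 => /eqP ->; rewrite subrr normr0 mulr_ge0 // mulr_ge0 // ltW.
have kp : 0 < k by rewrite lt_neqAle eq_sym k0 normr_ge0.
have coord (s : R) (j : 'I_n) : `|s| = k -> s * (q y' - q y) 0 j <= 6 * C * k ^+ 2.
  move=> sk; pose h : V := s *: delta_mx 0 j.
  have hk : `|h| <= k.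
    have n1 : `|delta_mx 0 j : V| <= 1.
      by apply: norm_row_le => // i; rewrite mxE eqxx /=; case: (i == j); rewrite ?normr1 ?normr0.
    by rewrite /h normrZ sk ler_piMr // ltW.
  have y2 : `|y' + h - x| < r.
    have -> : y' + h - x = (y' - x) + h by vring.
    by have := ler_normD (y' - x) h; lra.
  have r1 : `|y - x| < r by have := normr_ge0 (y - x); lra.
  have r2 : `|y' - x| < r by have := normr_ge0 (y' - x); lra.
  have a1 := Q y' (y' + h) r2 y2; have a2 := Q y (y' + h) r1 y2; have a3 := Q y y' r1 r2.
  have e1 : y' + h - y' = h by vring.
  have n2 : `|y' + h - y| <= 2 * k.
    have -> : y' + h - y = (y' - y) + h by vring.
    by have := ler_normD (y' - y) h; rewrite -/k; lra.
  rewrite e1 in a1; rewrite -/k in a3.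
  have b1 : C * `|h| ^+ 2 <= C * k ^+ 2 by rewrite ler_wpM2l ?lerXn2r ?nnegrE // ltW.
  have b2 : C * `|y' + h - y| ^+ 2 <= 4 * (C * k ^+ 2).
    have -> : 4 * (C * k ^+ 2) = C * (2 * k) ^+ 2 by ring.
    by rewrite ler_wpM2l ?lerXn2r ?nnegrE // ?ltW // mulr_gt0.
  have -> : s * (q y' - q y) 0 j = pairing (q y' - q y) h.
    by rewrite /h pairingZr pairing_delta.
  have e2 : pairing (q y) (y' + h - y) = pairing (q y) (y' - y) + pairing (q y) h.
    by rewrite -pairingDr; congr pairing; vring.
  rewrite e2 in a2; rewrite pairingBl.
  have -> : 6 * C * k ^+ 2 = C * k ^+ 2 + 4 * (C * k ^+ 2) + C * k ^+ 2 by ring.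
  move: (le_trans a1 b1) (le_trans a2 b2) a3; rewrite !ler_norml.
  by move=> /andP[c1 c2] /andP[c3 c4] /andP[c5 c6]; lra.
apply: norm_row_le => [|j]; first by rewrite !mulr_ge0 // ltW.
rewrite ler_norml; apply/andP; split.
  rewrite -(ler_pM2l kp) mulrN lerNl -mulrN.
  have := coord (- k) j; rewrite normrN gtr0_norm // => /(_ erefl).
  by rewrite mulNr mulrN => /le_trans; apply; rewrite expr2; lra.
rewrite -(ler_pM2l kp).
have := coord k j; rewrite gtr0_norm // => /(_ erefl) /le_trans; apply.
by rewrite expr2; lra.
Qed.

Lemma quad_of_lipschitz_grad (u : V -> R) (x : V) (r K : R) : 0 < K ->
  (forall y, `|y - x| < r -> differentiable u y) ->
  (forall y y', `|y - x| < r -> `|y' - x| < r -> `|grad u y' - grad u y| <= K * `|y' - y|) ->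
  forall y y', `|y - x| < r -> `|y' - x| < r ->
    `|u y' - u y - pairing (grad u y) (y' - y)| <= n%:R * K * `|y' - y| ^+ 2.
Proof.
move=> K0 du Lu y y' yr yr'.
have dE z h : `|z - x| < r -> 'd u z h = pairing (grad u z) h.
  move=> zr; rewrite -deriveE; last exact: du.
  rewrite derive_row_sum; last exact: du.
  by rewrite pairingC pairingE; apply: eq_bigr => j _; rewrite mxE.
rewrite -dE //; apply: (quad_remainder _ du _ yr yr'); first by rewrite mulr_ge0 // ltW.
move=> z z' h zr zr'; apply: (eq_norm_le (f_equal2 (fun a b => a - b) (dE z' h zr') (dE z h zr))).
rewrite -pairingBl; apply: le_trans (pairing_le _ _) _.
by rewrite -!mulrA ler_wpM2l // mulrA ler_wpM2r // Lu.
Qed.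

End quadratic_approximation.

Lemma norm_le_shift (R : realType) (V : normedModType R) (a b : V) (c d : R) :
  `|b - a| <= c -> c <= d -> `|b| <= `|a| + d.
Proof. by move=> h1 h2; have := ler_normD (b - a) a; rewrite subrK; lra. Qed.

Lemma pairing_tr (R : realType) (m k : nat) (p : 'rV[R]_m) (A : 'M[R]_(k, m)) (v : 'rV[R]_k) :
  pairing (p *m A^T) v = pairing p (v *m A).
Proof. by rewrite -pairing_mul trmxK. Qed.

Lemma quad_compose (R : realType) (n : nat) (a b C L Ct B s : R) (q T D : 'rV[R]_n) :
  0 <= C -> 0 <= Ct -> 0 <= B -> 0 <= s ->
  `|a - b - pairing q T| <= C * `|T| ^+ 2 -> `|T| <= L * s -> `|T - D| <= Ct * s ^+ 2 ->
  `|q| <= B -> `|a - b - pairing q D| <= (C * L ^+ 2 + n%:R * B * Ct + 1) * s ^+ 2.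
Proof.
move=> C0 Ct0 B0 s0 h1 h2 h3 h4.
have -> : a - b - pairing q D = (a - b - pairing q T) + pairing q (T - D).
  by rewrite pairingBr; ring.
have D2 : `|pairing q (T - D)| <= n%:R * B * Ct * s ^+ 2.
  apply: le_trans (pairing_le _ _) _; rewrite -!mulrA ler_wpM2l //.
  by apply: ler_pM.
have D3 : C * `|T| ^+ 2 <= C * L ^+ 2 * s ^+ 2.
  rewrite -mulrA -exprMn ler_wpM2l // lerXn2r ?nnegrE //.
  exact: le_trans (normr_ge0 _) h2.
have s2 : 0 <= s ^+ 2 by rewrite exprn_ge0.
by apply: le_trans (ler_normD _ _) _; move: (le_trans h1 D3) D2; lra.
Qed.

Section C11_functions.
Context {R : realType} {n : nat} {M : smooth_manifold R n}.
Notation V := 'rV[R]_n.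
Implicit Types (u : M -> R) (th : one_form M) (i j : chart_index M) (x : M).

(* [u] is C^{1,1} near [x] with differential [th], in a form that is stable
   under changes of charts. *)
Definition quad_at u th i x := exists C r : R, [/\ 0 < C, 0 < r & forall y y',
  `|y - chart i x| < r -> `|y' - chart i x| < r -> chart_img i y /\
  `|u (chart_inv i y') - u (chart_inv i y) - pairing (form_in_chart th i y) (y' - y)|
    <= C * `|y' - y| ^+ 2].

Lemma form_transition th i j x : chart_dom i x -> chart_dom j x ->
  form_in_chart th j (chart j x) =
  form_in_chart th i (chart i x) *m ('J (transition j i) (chart j x))^T.
Proof.
move=> ix jx; rewrite (form_chart th ix) (form_chart th jx).
set z : cotangent_bundle M := (x, th x); have iz : chart_dom i z.1 by exact: ix.
have ij : overlap i j (cotangent_chart i z).1 by exact: overlap_chart.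
have h := cotangent_chart_trans ij; rewrite (cotangent_chart_invK iz) in h.
by rewrite h /cotangent_transition /= (transition_chart j ix).
Qed.

Lemma quad_at_chart u th i j x : chart_dom i x -> chart_dom j x ->
  quad_at u th i x -> quad_at u th j x.
Proof.
move=> ix jx [C [r [C0 r0 Q]]]; set y0 := chart j x; set t := transition j i.
have ji : overlap j i y0 by exact: overlap_chart.
have ty0 : t y0 = chart i x by exact: transition_chart.
have oU := @overlap_open R n M j i.
have [Ct Ct0 [r1 r10 T1]] := taylor2 (findim_row n) oU ji (Ck_transition 2 j i).
have [L L0 [r2 r20 T2]] := Ck1_lipschitz (findim_row n) oU ji (Ck_transition 1 j i).
have [r3 r30 T3] := openNP oU ji.
have Q' y y' : `|y - chart i x| < r -> `|y' - chart i x| < r ->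
    `|u (chart_inv i y') - u (chart_inv i y) - pairing (form_in_chart th i y) (y' - y)|
    <= C * `|y' - y| ^+ 2 by move=> yr yr'; have [] := Q y y' yr yr'.
have Lq := quad_lipschitz C0 Q'.
pose B := `|form_in_chart th i (chart i x)| + 6 * C * (r / 3).
have Bq y : `|y - chart i x| < r / 3 -> `|form_in_chart th i y| <= B.
  move=> yr; have r3' : `|chart i x - chart i x| < r / 3 by rewrite subrr normr0 divr_gt0.
  apply: (norm_le_shift (Lq _ _ r3' yr)).
  by rewrite ler_wpM2l ?mulr_ge0 // ltW.
have B0 : 0 <= B by rewrite addr_ge0 // !mulr_ge0 // ltW.
exists (C * L ^+ 2 + n%:R * B * Ct + 1).
exists (Num.min (Num.min r1 r2) (Num.min r3 (r / 3 / L))); split.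
- by rewrite ltr_wpDl // addr_ge0 // ?mulr_ge0 ?exprn_ge0 // ltW.
- by rewrite !lt_min r10 r20 r30 !divr_gt0.
move=> y y'; rewrite !lt_min => /andP[/andP[y1 y2] /andP[y3 y4]] /andP[/andP[z1 z2] /andP[z3 z4]].
have jy := T3 y y3; have jy' := T3 y' z3; split; first exact: jy.1.
have y02 : `|y0 - y0| < r2 by rewrite subrr normr0.
have tr z : `|z - y0| < r2 -> `|z - y0| < r / 3 / L -> `|t z - chart i x| < r / 3.
  move=> zr2; rewrite ltr_pdivlMr // mulrC => zr; rewrite -ty0.
  exact: le_lt_trans (T2 z y0 zr2 y02) zr.
have ty := tr y y2 y4; have ty' := tr y' z2 z4.
have r3r : r / 3 < r by lra.
have [jx1 jc1] := chart_imgP jy.1; have [jx2 jc2] := chart_imgP jy'.1.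
have iy1 : chart_inv i (t y) = chart_inv j y by exact: chart_inv_transition.
have iy2 : chart_inv i (t y') = chart_inv j y' by exact: chart_inv_transition.
have fE : form_in_chart th j y = form_in_chart th i (t y) *m ('J (transition j i) y)^T.
  by have := form_transition th jy.2 jx1; rewrite jc1.
have pE : pairing (form_in_chart th j y) (y' - y) =
    pairing (form_in_chart th i (t y)) ('d t y (y' - y)).
  rewrite fE; apply: etrans (pairing_tr _ _ _) _; apply: (congr1 (pairing _)).
  exact: mul_jacobian.
rewrite pE -iy1 -iy2.
have Tq := T1 y y' y1 z1; rewrite -/t in Tq.
have D1 := Q' _ _ (lt_trans ty r3r) (lt_trans ty' r3r).
apply: (quad_compose (ltW C0) (ltW Ct0) B0 _ D1 (T2 _ _ z2 y2) Tq (Bq _ ty)).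
exact: normr_ge0.
Qed.

End C11_functions.

Section C11_characterization.
Context {R : realType} {n : nat} {M : smooth_manifold R n}.
Notation V := 'rV[R]_n.
Implicit Types (u v : M -> R) (th : one_form M) (i j : chart_index M) (x : M).

Lemma diff_grad (f : V -> R) (y h : V) : differentiable f y -> 'd f y h = pairing (grad f y) h.
Proof.
move=> df; rewrite -deriveE // derive_row_sum //.
by rewrite pairingC pairingE; apply: eq_bigr => j _; rewrite mxE.
Qed.

Lemma grad_hasD (f : V -> R) (y q : V) : (forall h, hasD f y h (pairing q h)) -> grad f y = q.
Proof.
move=> H; apply/rowP => j; rewrite mxE (hasD_derive (H _)); exact: pairing_delta.
Qed.

Lemma dfun_chart u i x : C11_function u -> chart_dom i x ->
  form_in_chart (dfun u) i (chart i x) = grad (u \o chart_inv i) (chart i x).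
Proof.
move=> Cu ix; rewrite (form_chart _ ix) /=; set c := chart_at x; set y := chart i x.
have cx : chart_dom c x by exact: dom_chart_at.
have ic : overlap i c y by exact: overlap_chart.
have ty : transition i c y = chart c x by exact: transition_chart.
have du j z : chart_dom j z -> differentiable (u \o chart_inv j) (chart j z).
  by move=> jz; apply: (Cu j).1.1; exact: img_chart.
apply: pairing_eq => h; apply: etrans (pairing_tr _ _ _) _.
have dt := differentiable_transition ic.
have dc : differentiable (u \o chart_inv c) (transition i c y) by rewrite ty; exact: du.
have h1 := hasD_comp (hasD_self h dt) (hasD_self _ dc).
have h2 : hasD (u \o chart_inv i) y h ('d (u \o chart_inv c) (transition i c y) ('d (transition i c) y h)).
  apply: hasD_near h1.
  have nO : nbhs y (overlap i c) by apply: open_nbhs_nbhs; split; [exact: overlap_open|].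
  by apply: filterS nO => z zo; rewrite /comp -/(transition i c z) (chart_inv_transition zo).
have e := hasD_uniq (hasD_self h (du i x ix)) h2.
have e5 := diff_grad ('d (transition i c) y h) dc.
have e7 : pairing (grad (u \o chart_inv c) (transition i c y)) ('d (transition i c) y h) =
    pairing (dfun u x) (h *m 'J (transition i c) y).
  exact: (f_equal2 (fun a b => pairing a b) (congr1 (grad _) ty) (esym (mul_jacobian _ _ _))).
exact: (etrans (esym e7) (etrans (esym e5) (etrans (esym e) (diff_grad h (du i x ix))))).
Qed.

Lemma C11_quad u i x : C11_function u -> chart_dom i x -> quad_at u (dfun u) i x.
Proof.
move=> Cu ix; have [[du Du] Lu] := Cu i; have iy := img_chart ix.
have [W /nearNP[r r0 rP] HW] := Lu _ iy.
have [r1 r10 r1P] := openNP (@chart_img_isopen _ _ M i) iy.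
have [K K0 KP] : exists2 K : R, 0 < K & forall y y', W y -> W y' ->
    `|grad (u \o chart_inv i) y' - grad (u \o chart_inv i) y| <= K * `|y' - y|.
  move: HW => [K0 [_ HK]]; exists (`|K0| + 1); first by rewrite ltr_wpDl.
  have /HK HK' : K0 < `|K0| + 1 by rewrite (le_lt_trans (ler_norm _)) // ltrDl.
  by move=> y y' Wy Wy'; exact: (HK' (y', y)).
exists (n%:R * K + 1), (Num.min r r1); split.
- by rewrite ltr_wpDl // mulr_ge0 // ltW.
- by rewrite lt_min r0.
move=> y y'; rewrite !lt_min => /andP[y1 y2] /andP[z1 z2].
have iy1 := r1P y y2; split=> //.
have [dx xy] := chart_imgP iy1.
have fE : form_in_chart (dfun u) i y = grad (u \o chart_inv i) y.
  by have := dfun_chart Cu dx; rewrite xy.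
have m0 : 0 < Num.min r r1 by rewrite lt_min r0.
have m1 z : `|z - chart i x| < Num.min r r1 -> `|z - chart i x| < r /\ `|z - chart i x| < r1.
  by rewrite lt_min => /andP.
have Q := @quad_of_lipschitz_grad _ _ (u \o chart_inv i) (chart i x) (Num.min r r1) K K0.
have Q1 z : `|z - chart i x| < Num.min r r1 -> differentiable (u \o chart_inv i) z.
  by move=> /m1[_ zr]; apply: du; exact: r1P.
have Q2 z z' : `|z - chart i x| < Num.min r r1 -> `|z' - chart i x| < Num.min r r1 ->
    `|grad (u \o chart_inv i) z' - grad (u \o chart_inv i) z| <= K * `|z' - z|.
  by move=> /m1[zr _] /m1[zr' _]; apply: KP; exact: rP.
rewrite fE; apply: le_trans (Q Q1 Q2 y y' _ _) _; rewrite ?lt_min ?y1 ?z1 //.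
by rewrite ler_wpM2r ?exprn_ge0 // lerDl.
Qed.

Lemma quad_C11 u th : (forall x, exists2 i, chart_dom i x & quad_at u th i x) ->
  C11_function u /\ forall x, dfun u x = th x.
Proof.
move=> H; have Qa i x : chart_dom i x -> quad_at u th i x.
  by move=> ix; have [j jx Q] := H x; exact: quad_at_chart Q.
have loc i y : chart_img i y -> exists C r : R, [/\ 0 < C, 0 < r,
    forall z, `|z - y| < r -> forall h,
      hasD (u \o chart_inv i) z h (pairing (form_in_chart th i z) h) &
    forall z z', `|z - y| < r -> `|z' - y| < r ->
      `|form_in_chart th i z' - form_in_chart th i z| <= C * `|z' - z|].
  move=> iy; have [ix xy] := chart_imgP iy; have [C [r [C0 r0 Q]]] := Qa i _ ix.
  rewrite xy in Q; have Q' z z' : `|z - y| < r -> `|z' - y| < r ->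
    `|(u \o chart_inv i) z' - (u \o chart_inv i) z - pairing (form_in_chart th i z) (z' - z)| <=
      C * `|z' - z| ^+ 2 by move=> zr zr'; have [] := Q z z' zr zr'.
  exists (6 * C), (r / 3); split; rewrite ?mulr_gt0 ?divr_gt0 //.
    move=> z zr h; apply: (quad_hasD C0 Q'); lra.
  exact: (quad_lipschitz C0 Q').
have gE i y : chart_img i y -> grad (u \o chart_inv i) y = form_in_chart th i y.
  move=> iy; have [C [r [C0 r0 D _]]] := loc i y iy.
  by apply: grad_hasD => h; apply: D; rewrite subrr normr0.
split=> [i|x].
  split=> [|y iy].
    split=> [y iy|v y iy]; have [C [r [C0 r0 D L]]] := loc i y iy.
      by apply: (D y _ 0).1; rewrite subrr normr0.
    have cth : {for y, continuous (form_in_chart th i)}.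
      apply: continuous_ofN => e e0; exists (Num.min r (e / C)).
        by rewrite lt_min r0 divr_gt0.
      move=> z; rewrite lt_min => /andP[zr ze].
      have y0 : `|y - y| < r by rewrite subrr normr0.
      by apply: le_trans (L y z y0 zr) _; rewrite mulrC -ler_pdivlMr // ltW.
    have E : \forall z \near y, pairing (form_in_chart th i z) v = 'D_v (u \o chart_inv i) z.
      apply/nearNP; exists r => // z zr; apply: esym; exact: hasD_derive (D z zr v).
    have cv : {for y, continuous (cst v : V -> V)} by exact: cst_continuous.
    have c := continuous_pairing cth cv.
    have Ey := nbhs_singleton E.
    by apply: cvg_trans (near_eq_cvg E) _; rewrite -Ey.
  have [C [r [C0 r0 D L]]] := loc i y iy.
  have [r1 r10 r1P] := openNP (@chart_img_isopen _ _ M i) iy.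
  exists [set z | `|z - y| < Num.min r r1].
    have m0 : 0 < Num.min r r1 by rewrite lt_min r0.
    by apply: filterS (nbhsx_ballx y _ m0) => z; rewrite -ball_normE /= distrC.
  exists C; split=> [|K CK]; first exact: num_real.
  move=> -[z z'] [] /=; rewrite !lt_min => /andP[zr zr1] /andP[zr' zr1'].
  rewrite !gE; [|exact: r1P..].
  by apply: le_trans (L _ _ zr' zr) _; rewrite ler_wpM2r // ltW.
have cx := dom_chart_at x; rewrite /dfun gE; last exact: img_chart.
rewrite (form_chart _ cx).
exact: (congr1 snd (cotangent_chart_at ((x, th x) : cotangent_bundle M))).
Qed.

Lemma quad_at_lin (l m : R) u v th th' i x : quad_at u th i x -> quad_at v th' i x ->
  quad_at (fun y => l * u y + m * v y) (fun y => l *: th y + m *: th' y) i x.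
Proof.
move=> [C [r [C0 r0 Q]]] [C' [r' [C0' r0' Q']]].
exists (`|l| * C + `|m| * C' + 1), (Num.min r r'); split.
- by rewrite ltr_wpDl // addr_ge0 // mulr_ge0 // ltW.
- by rewrite lt_min r0.
move=> y y'; rewrite !lt_min => /andP[y1 y2] /andP[z1 z2].
have [iy Q1] := Q y y' y1 z1; have [_ Q2] := Q' y y' y2 z2; split=> //.
have fE : form_in_chart (fun y => l *: th y + m *: th' y) i y =
    l *: form_in_chart th i y + m *: form_in_chart th' i y.
  by rewrite /form_in_chart /cotangent_chart /= mulmxDl !scalemxAl.
rewrite fE pairingDl !pairingZl.
move: Q1 Q2; set a := u _; set a' := u _; set b := v _; set b' := v _.
set p := pairing _ _; set q := pairing _ _ => Q1 Q2.
have -> : l * a + m * b - (l * a' + m * b') - (l * p + m * q) =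
    l * (a - a' - p) + m * (b - b' - q) by ring.
apply: le_trans (ler_normD _ _) _; rewrite !normrM 2!mulrDl mul1r -!mulrA.
have s0 : 0 <= `|y' - y| ^+ 2 by rewrite exprn_ge0.
have := ler_wpM2l (normr_ge0 l) Q1; have := ler_wpM2l (normr_ge0 m) Q2; lra.
Qed.

End C11_characterization.

Section action_increments.
Context {R : realType} {n : nat}.
Notation V := 'rV[R]_n.
Notation E := (V * V)%type.

Lemma increment_identity (a b xa xb : E) (ta tb d e : V) (ga gb : R) :
  pairing d xa.1 = pairing e (b.1 - a.1) ->
  (pairing (b.2 - tb) xb.1 - gb) - (pairing (a.2 - ta) xa.1 - ga) -
    (pairing (xa.2 - e) (b.1 - a.1) + pairing (a.2 - ta) (xb.1 - xa.1)) =
  pairing (b.2 - a.2) (xb.1 - xa.1) - pairing (tb - ta) (xb.1 - xa.1)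
    - pairing (tb - ta - d) xa.1 - (gb - ga - omega xa (b - a)).
Proof.
rewrite /omega /= => h; rewrite (pairingC xa.1) !(pairingBl, pairingBr) h pairingBr.
ring.
Qed.

Lemma increment_bound (L Lt Ct Cg B q s : R) (db dx dt dr xa : V) (g : R) :
  0 <= L -> 0 <= Lt -> 0 <= Ct -> 0 <= Cg -> 0 <= q ->
  `|db| <= q -> `|dx| <= L * q -> `|xa| <= B -> `|dt| <= Lt * q -> `|dr| <= Ct * q ^+ 2 ->
  `|g| <= Cg * q ^+ 2 -> q <= s ->
  `|pairing db dx - pairing dt dx - pairing dr xa - g| <=
    (n%:R * L + n%:R * (Lt * L) + n%:R * (Ct * B) + Cg) * s ^+ 2.
Proof.
move=> L0 Lt0 Ct0 Cg0 q0 hdb hdx hxa hdt hdr hg qs.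
have B0 : 0 <= B by exact: le_trans (normr_ge0 _) hxa.
have qs2 : q ^+ 2 <= s ^+ 2 by rewrite lerXn2r ?nnegrE // (le_trans q0).
have P (a b : V) (c d : R) : `|a| <= c -> `|b| <= d -> `|pairing a b| <= n%:R * (c * d).
  by move=> ha hb; apply: le_trans (pairing_le _ _) _; rewrite ler_wpM2l // ler_pM.
apply: (@le_trans _ _ ((n%:R * L + n%:R * (Lt * L) + n%:R * (Ct * B) + Cg) * q ^+ 2)); last first.
  by rewrite ler_wpM2l // !addr_ge0 // !mulr_ge0.
apply: le_trans (ler_normB _ _) _; rewrite mulrDl lerD //.
apply: le_trans (ler_normB _ _) _; rewrite mulrDl lerD //; last first.
  by apply: le_trans (P _ _ _ _ hdr hxa) _; rewrite le_eqVlt; apply/orP; left; apply/eqP; ring.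
apply: le_trans (ler_normB _ _) _; rewrite mulrDl lerD //.
  by apply: le_trans (P _ _ _ _ hdb hdx) _; rewrite le_eqVlt; apply/orP; left; apply/eqP; ring.
by apply: le_trans (P _ _ _ _ hdt hdx) _; rewrite le_eqVlt; apply/orP; left; apply/eqP; ring.
Qed.

Lemma norm_fst_le (w : E) : `|w.1| <= `|w|.
Proof. by rewrite prod_normE le_max lexx. Qed.

Lemma norm_snd_le (w : E) : `|w.2| <= `|w|.
Proof. by rewrite prod_normE le_max lexx orbT. Qed.

Variables (X : E -> E) (G : E -> R) (th : V -> V) (S : set E) (B L Cg Ct Lt : R).
Hypotheses (L0 : 0 <= L) (Lt0 : 0 <= Lt) (Ct0 : 0 <= Ct) (Cg0 : 0 <= Cg).
Hypothesis XB : forall a, S a -> `|X a| <= B.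
Hypothesis XL : forall a b, S a -> S b -> `|X b - X a| <= L * `|b - a|.
Hypothesis GT : forall a b, S a -> S b ->
  `|G b - G a - omega (X a) (b - a)| <= Cg * `|b - a| ^+ 2.
Hypothesis thD : forall a, S a -> differentiable th a.1.
Hypothesis thT : forall a b, S a -> S b ->
  `|th b.1 - th a.1 - 'd th (a.1) (b.1 - a.1)| <= Ct * `|b.1 - a.1| ^+ 2.
Hypothesis thL : forall a b, S a -> S b -> `|th b.1 - th a.1| <= Lt * `|b.1 - a.1|.
Hypothesis th_closed : forall a u v, S a ->
  pairing ('d th (a.1) u) v = pairing ('d th (a.1) v) u.

(* The action along the flow is a primitive of the difference between the pulled
   back Liouville form and the form itself (Cartan's formula). *)
Lemma action_increment (al be : R -> E) (A A' : R -> R) (e s : R) : A 0 = 0 -> A' 0 = 0 ->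
  (forall t : R, `|t| < e -> [/\ S (al t), S (be t), is_derive t 1 al (X (al t)),
    is_derive t 1 be (X (be t)) & `|be t - al t| <= s]) ->
  (forall t : R, `|t| < e ->
    is_derive t 1 A (pairing ((al t).2 - th (al t).1) (X (al t)).1 - G (al t)) /\
    is_derive t 1 A' (pairing ((be t).2 - th (be t).1) (X (be t)).1 - G (be t))) ->
  forall t : R, `|t| < e -> 0 < e ->
    `|A' t - A t - pairing ((al t).2 - th (al t).1) ((be t).1 - (al t).1)
       + pairing ((al 0).2 - th (al 0).1) ((be 0).1 - (al 0).1)| <=
    (n%:R * L + n%:R * (Lt * L) + n%:R * (Ct * B) + Cg) * s ^+ 2 * `|t|.
Proof.
move=> A0 A'0 Hc HA t te e0.
pose D (r : R) := A' r - A r - pairing ((al r).2 - th (al r).1) ((be r).1 - (al r).1).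
pose dD (r : R) := (pairing ((be r).2 - th (be r).1) (X (be r)).1 - G (be r)) -
  (pairing ((al r).2 - th (al r).1) (X (al r)).1 - G (al r)) -
  (pairing ((X (al r)).2 - 'd th ((al r).1) (X (al r)).1) ((be r).1 - (al r).1) +
   pairing ((al r).2 - th (al r).1) ((X (be r)).1 - (X (al r)).1)).
have DD (r : R) : `|r| < e -> is_derive r 1 D (dD r).
  move=> re; have [Sa Sb Da Db _] := Hc r re; have [DA DA'] := HA r re.
  have [Da1 Da2] := (is_derive_pair _ _ _).1 Da; have [Db1 Db2] := (is_derive_pair _ _ _).1 Db.
  have Dt := hasD_curve Da1 (hasD_self _ (thD Sa)).
  have Dp : is_derive r 1 (fun u => ((al u).2 - th (al u).1, (be u).1 - (al u).1))
      ((X (al r)).2 - 'd th ((al r).1) (X (al r)).1, (X (be r)).1 - (X (al r)).1).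
    by apply/is_derive_pair; split; exact: is_deriveB.
  have Hp := hasD_pairing (hasD_fst ((al r).2 - th (al r).1, (be r).1 - (al r).1) _)
    (hasD_snd ((al r).2 - th (al r).1, (be r).1 - (al r).1) _).
  have DP := hasD_curve Dp (Hp _).
  exact: (is_deriveB (is_deriveB DA' DA) DP).
have D0 : D 0 = - pairing ((al 0).2 - th (al 0).1) ((be 0).1 - (al 0).1).
  by rewrite /D A0 A'0 subrr sub0r.
have -> : A' t - A t - pairing ((al t).2 - th (al t).1) ((be t).1 - (al t).1)
       + pairing ((al 0).2 - th (al 0).1) ((be 0).1 - (al 0).1) = D t - D 0.
  by rewrite D0 opprK.
rewrite -[X in _ * `|X|]subr0; apply: (@mean_value_abs _ _ D dD) => r rt.
have re : `|r| < e.
  apply: le_lt_trans te; have h := @between_norm R t 0 r rt.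
  by rewrite !subr0 in h.
split; first exact: DD.
have [Sa Sb _ _ ab] := Hc r re.
have hd : pairing ('d th ((al r).1) ((be r).1 - (al r).1)) (X (al r)).1 =
   pairing ('d th ((al r).1) (X (al r)).1) ((be r).1 - (al r).1) by exact: th_closed.
rewrite /dD (increment_identity _ _ _ _ _ hd).
set q := `|be r - al r| in ab.
have q0 : 0 <= q by exact: normr_ge0.
have q1 : `|(be r).1 - (al r).1| <= q by exact: (norm_fst_le (be r - al r)).
have q2 : `|(be r).2 - (al r).2| <= q by exact: (norm_snd_le (be r - al r)).
have x1 : `|(X (be r)).1 - (X (al r)).1| <= L * q.
  exact: le_trans (norm_fst_le (X (be r) - X (al r))) (XL Sa Sb).
have x2 : `|(X (al r)).1| <= B by exact: le_trans (norm_fst_le (X (al r))) (XB Sa).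
have q12 : `|(be r).1 - (al r).1| ^+ 2 <= q ^+ 2 by rewrite lerXn2r ?nnegrE.
apply: (increment_bound L0 Lt0 Ct0 Cg0 q0 q2 x1 x2 _ _ (GT Sa Sb) ab).
- by apply: le_trans (thL Sa Sb) _; rewrite ler_wpM2l.
- by apply: le_trans (thT Sa Sb) _; rewrite ler_wpM2l.
Qed.

End action_increments.

(** * Images of graphs under the flow *)

Lemma is_derive_eqval (R : realType) (f : R -> R) (s a b : R) :
  is_derive s 1 f a -> a = b -> is_derive s 1 f b.
Proof. by move=> h <-. Qed.

Lemma half_bound (R : realFieldType) (L s e : R) :
  0 <= L -> s <= e -> L * e <= 1 / 2 -> 2 * L * s <= 1.
Proof. by move=> L0 se Le; have := ler_wpM2l L0 se; rewrite -mulrA; lra. Qed.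

Lemma norm_le_double (R : realType) (V : normedModType R) (a b : V) :
  `|a - b| <= `|b| -> `|a| <= 2 * `|b|.
Proof. by move=> h; have := ler_normD (a - b) b; rewrite subrK; move: h; lra. Qed.

Section pushed_graphs.
Context {R : realType} {n : nat} {M : smooth_manifold R n}.
Notation V := 'rV[R]_n.
Notation E := (V * V)%type.
Notation N := (cotangent_bundle M).
Variables F H : N -> R.
Hypotheses (cM : compact [set: M]) (TH : tonelli H) (CF : C2_cotangent F)
  (HF : integral_of_motion H F).
Variable eta : one_form M.
Hypotheses (se : smooth_form eta) (ce : closed_form eta).
Variable al : R.
Let A := cotangent_atlas M.
Let CH : C2 A H. Proof. by have [] := TH. Qed.
Let CFA : C2 A F. Proof. exact: CF. Qed.
Let Hc (k : R) : compact [set z | H z <= k].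
Proof. by have [? _ ?] := TH; exact: sublevel_compact. Qed.
Let FH0 := integral_in_charts CF CH HF.
Let phi := ham_flow F.

Lemma sublevel_chart_bound (i : chart_index M) (y0 : V) : chart_img i y0 ->
  exists2 r : R, 0 < r & exists2 C : R, 0 < C & forall y p, `|y - y0| < r ->
    chart_img i y /\ (H (cotangent_chart_inv i (y, p)) <= al -> `|p| <= C).
Proof.
move=> iy; have [_ _ sH] := TH; have [r r0 rP] := superlinear_chart sH iy.
have [b bP] := rP 1; exists r => //; exists (`|al + b| + 1); first by rewrite ltr_wpDl.
move=> y p yr; have [iy' Hp] := bP y p yr; split=> // Hal.
by move: Hp; rewrite mul1r; have := ler_norm (al + b); lra.
Qed.

Lemma sublevel_displacement (i : chart_index M) (y0 : V) (r C : R) : 0 < r ->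
  (forall y p, `|y - y0| < r ->
    chart_img i y /\ (H (cotangent_chart_inv i (y, p)) <= al -> `|p| <= C)) ->
  exists2 e : R, 0 < e & forall (z : N) (t : R), H z <= al -> chart_dom i z.1 ->
    `|chart i z.1 - y0| <= r / 2 -> `|t| < e ->
    chart_dom i (phi t z).1 /\ `|chart i (phi t z).1 - y0| < r.
Proof.
move=> r0 rP; have r2 : r / 2 < r by lra.
have box : forall y, `|y0 - y| <= r / 2 -> chart_img i y.
  by move=> y yr; have [] := rP y 0; rewrite // distrC (le_lt_trans yr).
have cK := @compact_box R n M i y0 (r / 2) C box.
pose U : set N := [set z | chart_dom i z.1 /\ `|chart i z.1 - y0| < r].
have nU (z : N) : chart_dom i z.1 -> `|chart i z.1 - y0| < r -> nbhs z U.
  move=> iz zr; apply: filterI; first exact: near_cotangent_dom.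
  have c1 := cotangent_chart_continuous iz.
  have c2 : {for cotangent_chart i z, continuous (fun w : E => `|w.1 - y0|)}.
    have c3 := differentiable_continuous (hasD_sub (hasD_fst (cotangent_chart i z) 0) (hasD_cst y0 (cotangent_chart i z) 0)).1.
    exact: (continuous_comp c3 (@norm_continuous _ _ _)).
  have c := continuous_comp c1 c2.
  have : \forall z' \near z, ((fun w : E => `|w.1 - y0|) \o cotangent_chart i) z' < r.
    by apply: (cvgr_lt _ c).
  by [].
pose P (z : N) (d : R) := forall t, `|t| < d -> U (phi t z).
have loc (z : N) : [set cotangent_chart_inv i (yp : E) | yp in
     [set y | `|y0 - y| <= r / 2] `*` [set p | `|0 - p| <= C]] z ->
    exists2 e : R, 0 < e & \forall z' \near z, forall d : R, 0 < d -> d < e -> P z' d.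
  move=> [[y p] [/= yr _] <-]; have iy := box y yr; have [h1 h2] := chart_imgP iy.
  have nz : nbhs (cotangent_chart_inv i (y, p)) U.
    by apply: nU => //=; rewrite h2 distrC (le_lt_trans yr).
  have [e e0 eP] := cflow_near CFA Hc (F_H_const CH FH0) nz.
  exists e => //; apply: filterS eP => z' He d d0 de t td; exact: (He d _ de).
have [e e0 eP] := uniform_over_compact cK loc.
exists e => // z t Hz iz zr te; pose d := (`|t| + e) / 2.
have d1 : `|t| < d by rewrite /d; lra.
have d2 : d < e by rewrite /d; lra.
have d0 : 0 < d by rewrite (le_lt_trans _ d1).
apply: (eP z d _ d0 d2 t d1); exists (cotangent_chart i z); last exact: cotangent_chart_invK.
split; first by rewrite /= distrC.
have zr' : `|chart i z.1 - y0| < r by exact: le_lt_trans r2.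
rewrite /= sub0r normrN; apply: (rP (chart i z.1) _ zr').2.
have e1 : (chart i z.1, (cotangent_chart i z).2) = cotangent_chart i z by [].
by rewrite [X in cotangent_chart_inv i X]e1 cotangent_chart_invK.
Qed.

Variable prim : N -> R -> R.
Hypothesis prim0 : forall z, prim z 0 = 0.
Hypothesis primD : forall z (t : R), `|t| < 1 -> is_derive t 1 (prim z) (act eta F (phi t z)).

Let Theta i (w : E) : V := w.2 - form_in_chart eta i w.1.

Lemma flow_box_action (i : chart_index M) (z0 : N) : chart_dom i z0.1 ->
  exists rho e L B K : R, [/\ 0 < rho, 0 < e, 0 < L, 0 < B & 0 < K] /\
  [/\ L * e <= 1 / 2,
   forall z t, chart_dom i z.1 -> `|cotangent_chart i z - cotangent_chart i z0| <= rho ->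
     `|t| < e -> chart_dom i (phi t z).1 /\
       `|cotangent_chart i (phi t z) - cotangent_chart i z| <= B * `|t| &
   forall z z' t, chart_dom i z.1 -> chart_dom i z'.1 ->
     `|cotangent_chart i z - cotangent_chart i z0| <= rho ->
     `|cotangent_chart i z' - cotangent_chart i z0| <= rho ->
     let w := cotangent_chart i z in let w' := cotangent_chart i z' in
     let wt := cotangent_chart i (phi t z) in let wt' := cotangent_chart i (phi t z') in `|t| < e ->
     `|(wt' - wt) - (w' - w)| <= 2 * L * `|t| * `|w' - w| /\
     `|prim z' t - prim z t - pairing (Theta i wt) (wt'.1 - wt.1)
         + pairing (Theta i w) (w'.1 - w.1)| <= K * `|w' - w| ^+ 2].
Proof.
move=> iz; set w0 := cotangent_chart i z0; have iw : chart_img i w0.1 by exact: img_chart.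
pose G := in_chart (A := A) F i; pose th := form_in_chart eta i.
have iwA : @ca_img _ _ _ A i w0 by exact: iw.
have fdV := findim_row (R := R) n; have fdE2 := findim_pair fdV fdV.
have [Cg Cg0 [rg rg0 GT]] := taylor2 fdE2 (@ca_open_img _ _ _ A i) iwA (CFA i).
have [Ct Ct0 [rt rt0 thT]] := taylor2 fdV (@chart_img_isopen _ _ M i) iw (se i 2%N).
have [Lt Lt0 [rl rl0 thL]] := Ck1_lipschitz fdV (@chart_img_isopen _ _ M i) iw (se i 1%N).
pose r0 := Num.min rg (Num.min rt rl) / 3.
have m0 : 0 < Num.min rg (Num.min rt rl) by rewrite !lt_min rg0 rt0.
have r00 : 0 < r0 by rewrite divr_gt0.
have izA : @ca_dom _ _ _ A i z0 by exact: iz.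
have [rho [e [L [B [[/andP[rho0 rhor] e0 L0 B0 Le] /= [inb XL phiP phiL]]]]]] :=
  local_cflow CFA Hc (F_H_const CH FH0) izA r00.
pose S : set E := [set a | `|a - w0| <= 2 * rho].
have Sr a : S a -> [/\ `|a - w0| < rg, `|a.1 - w0.1| < rt & `|a.1 - w0.1| < rl].
  rewrite /S /= => ha; have h1 : `|a - w0| < Num.min rg (Num.min rt rl).
    by move: rhor; rewrite /r0; lra.
  have h2 := le_lt_trans (norm_fst_le (a - w0)) h1.
  by move: h1 h2; rewrite !lt_min => /and3P[? _ _] /and3P[_ ? ?].
have Sim a : S a -> @ca_img _ _ _ A i a by move=> /inb[].
pose X := field (A := A) F i.
have XB a : S a -> `|X a| <= B by move=> /inb[].
have XL' a b : S a -> S b -> `|X b - X a| <= L * `|b - a| by move=> ha hb; exact: XL.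
have GT' a b : S a -> S b -> `|G b - G a - omega (X a) (b - a)| <= Cg * `|b - a| ^+ 2.
  move=> ha hb; have [ha1 _ _] := Sr a ha; have [hb1 _ _] := Sr b hb.
  have dG : differentiable G a by exact: (C2_differentiable CFA (Sim a ha)).
  by rewrite -(ham_vectorP _ dG); exact: GT.
have thD a : S a -> differentiable th a.1.
  by move=> /Sim ia; apply: (se i 1%N).1; exact: ia.
have thT' a b : S a -> S b ->
    `|th b.1 - th a.1 - 'd th (a.1) (b.1 - a.1)| <= Ct * `|b.1 - a.1| ^+ 2.
  by move=> /Sr[_ ha _] /Sr[_ hb _]; exact: thT.
have thL' a b : S a -> S b -> `|th b.1 - th a.1| <= Lt * `|b.1 - a.1|.
  by move=> /Sr[_ _ ha] /Sr[_ _ hb]; exact: thL.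
have thC a u v : S a -> pairing ('d th (a.1) u) v = pairing ('d th (a.1) v) u.
  by move=> /Sim ia; apply: closed_form_sym => //; exact: ia.
pose e1 := Num.min e 1; have e10 : 0 < e1 by rewrite lt_min e0 ltr01.
pose K0 := n%:R * L + n%:R * (Lt * L) + n%:R * (Ct * B) + Cg.
have K00 : 0 < K0.
  by rewrite ltr_wpDl // !addr_ge0 // !mulr_ge0 // ltW.
exists rho, e1, L, B, (K0 * 4); split; first by split; rewrite ?mulr_gt0.
have cE z : chart_dom i z.1 -> cotangent_chart_inv i (cotangent_chart i z) = z.
  by move=> izz; exact: cotangent_chart_invK.
have phiP' (w : E) (z : N) : cotangent_chart_inv i w = z -> `|w - w0| <= rho ->
    forall t : R, `|t| < e -> [/\ chart_dom i (phi t z).1,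
      S (cotangent_chart i (phi t z)), `|cotangent_chart i (phi t z) - w| <= B * `|t| &
      is_derive t 1 (fun r => cotangent_chart i (phi r z)) (X (cotangent_chart i (phi t z)))].
  by move=> <- wr t te; exact: phiP.
have phiL' (w w' : E) (z z' : N) : cotangent_chart_inv i w = z ->
    cotangent_chart_inv i w' = z' -> `|w - w0| <= rho -> `|w' - w0| <= rho ->
    forall t : R, `|t| < e ->
    `|(cotangent_chart i (phi t z') - cotangent_chart i (phi t z)) - (w' - w)|
      <= 2 * L * `|t| * `|w' - w|.
  by move=> <- <- wr wr' t te; exact: phiL.
split.
- by apply: le_trans Le; rewrite ler_pM2l // ge_min lexx.
- move=> z t izz zr; rewrite lt_min => /andP[te _].
  by have [] := phiP' _ _ (cE z izz) zr t te.
move=> z z' t izz izz' zr zr'; rewrite lt_min => /andP[te t1].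
set w := cotangent_chart i z; set w' := cotangent_chart i z'.
split; first exact: (phiL' _ _ _ _ (cE z izz) (cE z' izz') zr zr' t te).
have flow0 y : phi 0 y = y by exact: (cflow0 CFA Hc (F_H_const CH FH0)).
have Hc2 (s : R) : `|s| < e1 -> [/\ S (cotangent_chart i (phi s z)), S (cotangent_chart i (phi s z')),
    is_derive s 1 (fun r => cotangent_chart i (phi r z)) (X (cotangent_chart i (phi s z))),
    is_derive s 1 (fun r => cotangent_chart i (phi r z')) (X (cotangent_chart i (phi s z'))) &
    `|cotangent_chart i (phi s z') - cotangent_chart i (phi s z)| <= 2 * `|w' - w|].
  rewrite lt_min => /andP[se' _].
  have [_ Sa _ Da] := phiP' _ _ (cE z izz) zr s se'.
  have [_ Sb _ Db] := phiP' _ _ (cE z' izz') zr' s se'.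
  split=> //; have Ls := phiL' _ _ _ _ (cE z izz) (cE z' izz') zr zr' s se'.
  have Ls2 : 2 * L * `|s| * `|w' - w| <= `|w' - w|.
    by apply: ler_piMl; [exact: normr_ge0|exact: (half_bound (ltW L0) (ltW se') Le)].
  exact: (norm_le_double (le_trans Ls Ls2)).
have HA (s : R) : `|s| < e1 ->
    is_derive s 1 (prim z) (pairing (Theta i (cotangent_chart i (phi s z)))
      (X (cotangent_chart i (phi s z))).1 - G (cotangent_chart i (phi s z))) /\
    is_derive s 1 (prim z') (pairing (Theta i (cotangent_chart i (phi s z')))
      (X (cotangent_chart i (phi s z'))).1 - G (cotangent_chart i (phi s z'))).
  rewrite lt_min => /andP[se' s1].
  have aE y : chart_dom i y.1 -> act eta F y =
      pairing (Theta i (cotangent_chart i y)) (X (cotangent_chart i y)).1 - G (cotangent_chart i y).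
    move=> iy; rewrite /G /in_chart /comp -[ca_inv _ _]/(cotangent_chart_inv i (cotangent_chart i y)).
    by rewrite (cE y iy); exact: (act_chart eta CF iy).
  have [dz _ _ _] := phiP' _ _ (cE z izz) zr s se'.
  have [dz' _ _ _] := phiP' _ _ (cE z' izz') zr' s se'.
  split; first exact: (is_derive_eqval (primD z s1) (aE _ dz)).
  exact: (is_derive_eqval (primD z' s1) (aE _ dz')).
have te1 : `|t| < e1 by rewrite lt_min te.
have := action_increment (ltW L0) (ltW Lt0) (ltW Ct0) (ltW Cg0) XB XL' GT' thD thT' thL' thC
  (prim0 z) (prim0 z') Hc2 HA te1 e10.
rewrite !flow0 => h; apply: le_trans h _; rewrite -/K0 exprMn.
have q0 : 0 <= `|w' - w| ^+ 2 by rewrite exprn_ge0.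
have -> : K0 * (2 ^+ 2 * `|w' - w| ^+ 2) = K0 * 4 * `|w' - w| ^+ 2 by ring.
rewrite ler_piMr //; last exact: ltW.
by rewrite mulr_ge0 // mulr_ge0 // ltW.
Qed.

End pushed_graphs.

Section euclidean_push.
Context {R : realType} {n : nat}.
Notation V := 'rV[R]_n.
Notation E := (V * V)%type.

Lemma push_bound (a b q q0 C K k s d : R) : 0 <= C -> 0 <= K -> 0 <= s -> 0 <= d -> 0 <= k ->
  `|a - q0| <= C * s ^+ 2 -> `|b - q + q0| <= K * d ^+ 2 -> d <= k * s ->
  forall S, s <= 2 * S -> `|a + b - q| <= (C + K * k ^+ 2) * 4 * S ^+ 2.
Proof.
move=> C0 K0 s0 d0 k0 ha hb hd S sS.
have -> : a + b - q = (a - q0) + (b - q + q0) by ring.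
apply: le_trans (ler_normD _ _) _.
have h1 : d ^+ 2 <= k ^+ 2 * s ^+ 2.
  by rewrite -exprMn ler_pXn2r // nnegrE // mulr_ge0.
have h2 : s ^+ 2 <= 4 * S ^+ 2.
  have -> : 4 * S ^+ 2 = (2 * S) ^+ 2 by ring.
  by rewrite ler_pXn2r // nnegrE //; exact: le_trans sS.
have h3 := ler_wpM2l K0 h1; have CK : 0 <= C + K * k ^+ 2.
  by rewrite addr_ge0 // mulr_ge0 // exprn_ge0.
have h4 := ler_wpM2l CK h2.
apply: le_trans (lerD ha hb) _; move: h3 h4; rewrite mulrDl !mulrA; lra.
Qed.

Lemma contraction_expansion (W : normedModType R) (y y' g g' : W) :
  `|(g - g') - (y - y')| <= 1 / 2 * `|y - y'| -> `|y - y'| <= 2 * `|g - g'|.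
Proof.
move=> h; have := ler_normD (g - g') (- ((g - g') - (y - y'))).
by rewrite normrN opprB addrC subrK; lra.
Qed.

Lemma norm_graph_le (y y' p p' : V) (k : R) : 0 <= k -> `|p' - p| <= k * `|y' - y| ->
  `|((y', p') : E) - (y, p)| <= (1 + k) * `|y' - y|.
Proof.
move=> k0 h; have y0 := normr_ge0 (y' - y).
have ky : 0 <= k * `|y' - y| by rewrite mulr_ge0.
by apply: norm_pair_le => /=; rewrite mulrDl mul1r; lra.
Qed.

Lemma push_estimate (D : set V) (U b : V -> R) (p q T : V -> V) (g : V -> E) (k c C K : R) :
  0 <= k -> 0 <= c -> 0 <= C -> 0 <= K -> c * (1 + k) <= 1 / 2 ->
  (forall y y', D y -> D y' -> [/\ `|p y' - p y| <= k * `|y' - y|,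
     `|U y' - U y - pairing (q y) (y' - y)| <= C * `|y' - y| ^+ 2,
     `|(g y' - g y) - (((y', p y') : E) - (y, p y))| <= c * `|((y', p y') : E) - (y, p y)| &
     `|b y' - b y - pairing (T y) ((g y').1 - (g y).1) + pairing (q y) (y' - y)|
       <= K * `|((y', p y') : E) - (y, p y)| ^+ 2]) ->
  forall y y', D y -> D y' ->
    `|((g y').1 - (g y).1) - (y' - y)| <= 1 / 2 * `|y' - y| /\
    `|(U y' + b y') - (U y + b y) - pairing (T y) ((g y').1 - (g y).1)|
       <= (C + K * (1 + k) ^+ 2) * 4 * `|(g y').1 - (g y).1| ^+ 2.
Proof.
move=> k0 c0 C0 K0 ck H y y' Dy Dy'; have [h1 h2 h3 h4] := H y y' Dy Dy'.
have hs := norm_graph_le k0 h1; have k1 : 0 <= 1 + k by rewrite addr_ge0.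
have e1 : `|((g y').1 - (g y).1) - (y' - y)| <= 1 / 2 * `|y' - y|.
  apply: le_trans (norm_fst_le ((g y' - g y) - (((y', p y') : E) - (y, p y)))) _.
  apply: le_trans h3 _; apply: le_trans (ler_wpM2l c0 hs) _.
  by rewrite mulrA ler_wpM2r.
split=> //; have e2 := contraction_expansion e1.
have -> : U y' + b y' - (U y + b y) = (U y' - U y) + (b y' - b y) by ring.
exact: (push_bound C0 K0 (normr_ge0 _) (normr_ge0 _) k1 h2 h4 hs e2).
Qed.

End euclidean_push.

Section form_charts.
Context {R : realType} {n : nat} {M : smooth_manifold R n}.
Notation V := 'rV[R]_n.
Implicit Types (u v : M -> R) (th : one_form M) (i : chart_index M).

Lemma form_in_chart_lin (l m : R) th th' i y :
  form_in_chart (fun x => l *: th x + m *: th' x) i y =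
  l *: form_in_chart th i y + m *: form_in_chart th' i y.
Proof. by rewrite /form_in_chart /cotangent_chart /= mulmxDl !scalemxAl. Qed.

Lemma quad_on_ball u th i (y0 : V) (r : R) :
  (forall x, chart_dom i x -> quad_at u th i x) ->
  (forall y, `|y0 - y| <= r -> chart_img i y) ->
  exists2 K : R, 0 < K & forall y y', `|y - y0| < r -> `|y' - y0| < r ->
    `|form_in_chart th i y' - form_in_chart th i y| <= K * `|y' - y| /\
    `|u (chart_inv i y') - u (chart_inv i y) - pairing (form_in_chart th i y) (y' - y)|
      <= K * `|y' - y| ^+ 2.
Proof.
move=> Q im.
have loc y : chart_img i y -> exists C d : R, [/\ 0 < C, 0 < d & forall z z',
    `|z - y| < d -> `|z' - y| < d ->
    `|u (chart_inv i z') - u (chart_inv i z) - pairing (form_in_chart th i z) (z' - z)|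
      <= C * `|z' - z| ^+ 2].
  move=> iy; have [ix yE] := chart_imgP iy; have [C [d [C0 d0 Qd]]] := Q _ ix.
  move: Qd; rewrite yE => Qd.
  by exists C, d; split=> // z z' zd zd'; have [] := Qd z z' zd zd'.
have [K K0 KP] : exists2 k : R, 0 < k & forall a b, `|a - y0| < r -> `|b - y0| < r ->
    `|form_in_chart th i a - form_in_chart th i b| <= k * `|a - b|.
  apply: lipschitz_on_ball => y yr; have [C [d [C0 d0 Qd]]] := loc y (im y yr).
  exists (6 * C); first by rewrite mulr_gt0.
  exists (d / 3); first by rewrite divr_gt0.
  move=> a b ad bd; exact: (quad_lipschitz C0 Qd bd ad).
have gE y : `|y - y0| < r -> differentiable (u \o chart_inv i) y /\
    grad (u \o chart_inv i) y = form_in_chart th i y.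
  rewrite distrC => yr; have [C [d [C0 d0 Qd]]] := loc y (im y (ltW yr)).
  have yd : `|y - y| < d by rewrite subrr normr0.
  have hD h := @quad_hasD R n (u \o chart_inv i) (form_in_chart th i) y d C C0 Qd y h yd.
  by split; [exact: (hD 0).1|exact: grad_hasD].
exists (K + n%:R * K); first by rewrite ltr_wpDr // mulr_ge0 // ltW.
move=> y y' yr yr'; split.
  apply: le_trans (KP y' y yr' yr) _.
  by rewrite ler_wpM2r // lerDl mulr_ge0 // ltW.
have := @quad_of_lipschitz_grad R n (u \o chart_inv i) y0 r K K0 (fun z zr => (gE z zr).1) _ y y' yr yr'.
rewrite (gE y yr).2 => h.
apply: le_trans (h _) _.
  by move=> z z' zr zr'; rewrite (gE z zr).2 (gE z' zr').2; exact: KP.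
by rewrite ler_wpM2r ?exprn_ge0 // lerDr ltW.
Qed.

End form_charts.

Lemma small_bounds (R : realFieldType) (A x B : R) : 0 < A -> x < B / A -> 0 <= x -> A * x <= B.
Proof. by move=> A0; rewrite ltr_pdivlMr // mulrC => /ltW. Qed.

Lemma mix_lipschitz (R : realType) (n : nat) (a b c a' b' c' : 'rV[R]_n) (l L Ku Kv s : R) :
  0 <= l -> l <= 1 -> l * Ku <= 1 -> 0 <= s -> 0 <= Kv ->
  `|a' - a| <= L * s -> `|b' - b| <= Ku * s -> `|c' - c| <= Kv * s ->
  `|(a' + (l *: b' + (1 - l) *: c')) - (a + (l *: b + (1 - l) *: c))| <= (L + 1 + Kv) * s.
Proof.
move=> l0 l1 lK s0 Kv0 ha hb hc.
have -> : (a' + (l *: b' + (1 - l) *: c')) - (a + (l *: b + (1 - l) *: c)) =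
    (a' - a) + (l *: (b' - b) + (1 - l) *: (c' - c)).
  by apply/rowP => j; rewrite !mxE; ring.
have h1 : `|l *: (b' - b)| <= s.
  rewrite normrZ ger0_norm //; apply: le_trans (ler_wpM2l l0 hb) _.
  by rewrite mulrA ler_piMl.
have h2 : `|(1 - l) *: (c' - c)| <= Kv * s.
  rewrite normrZ ger0_norm; last by rewrite subr_ge0.
  apply: le_trans (ler_wpM2l _ hc) _; first by rewrite subr_ge0.
  by rewrite ler_piMl ?mulr_ge0 // lerBlDr lerDl.
apply: le_trans (ler_normD _ _) _; have := ler_normD (l *: (b' - b)) ((1 - l) *: (c' - c)).
rewrite !mulrDl mul1r; lra.
Qed.

Lemma mix_quad (R : realType) (l A B Ku Kv s : R) : 0 <= l -> l <= 1 -> 0 <= Ku -> 0 <= Kv ->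
  0 <= s -> `|A| <= Ku * s -> `|B| <= Kv * s -> `|l * A + (1 - l) * B| <= (Ku + Kv) * s.
Proof.
move=> l0 l1 Ku0 Kv0 s0 hA hB; have l1' : 0 <= 1 - l by rewrite subr_ge0.
apply: le_trans (ler_normD _ _) _; rewrite !normrM (ger0_norm l0) (ger0_norm l1') [X in _ <= X]mulrDl; apply: lerD.
  by apply: le_trans hA; rewrite ler_piMl.
by apply: le_trans hB; rewrite ler_piMl // lerBlDr lerDl.
Qed.

Lemma half_lt (R : realFieldType) (x : R) : 0 < x -> x / 2 < x.
Proof. by lra. Qed.

Lemma double_le (R : realFieldType) (a x b : R) : 2 * a * x <= b -> a * x <= b / 2.
Proof. by rewrite -mulrA; lra. Qed.

Lemma norm_add_half (R : realType) (W : normedModType R) (a b : W) (r : R) :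
  `|a| <= r / 2 -> `|b| <= r / 2 -> `|a + b| <= r.
Proof. by move=> ha hb; have := ler_normD a b; lra. Qed.

Lemma dist_eighth (R : realType) (W : normedModType R) (a b c : W) (r : R) :
  `|a - b| <= r / 8 -> `|b - c| <= r / 8 -> `|a - c| <= r / 2 / 2.
Proof. by move=> ha hb; have := ler_distD b a c; lra. Qed.

Lemma mix_expand (R : comPzRingType) (l u v u' v' a b : R) :
  l * u' + (1 - l) * v' - (l * u + (1 - l) * v) - (l * a + (1 - l) * b) =
  l * (u' - u - a) + (1 - l) * (v' - v - b).
Proof. ring. Qed.

Lemma mix_dist (R : realType) (W : normedModType R) (a b c : W) (l C : R) : 0 <= l ->
  `|a + b| <= C -> `|a + c| <= C ->
  `|(a + (l *: b + (1 - l) *: c)) - (a + c)| <= l * (2 * C).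
Proof.
move=> l0 hb hc.
have -> : (a + (l *: b + (1 - l) *: c)) - (a + c) = l *: ((a + b) - (a + c)).
  rewrite !opprD addrACA subrr add0r addrACA subrr add0r scalerBl scale1r scalerBr -addrA.
  by rewrite [_ - _ - _]addrAC subrr add0r.
rewrite normrZ ger0_norm // ler_wpM2l //.
by apply: le_trans (ler_normB _ _) _; lra.
Qed.

Section local_push.
Context {R : realType} {n : nat} {M : smooth_manifold R n}.
Notation V := 'rV[R]_n.
Notation E := (V * V)%type.
Notation N := (cotangent_bundle M).
Variables F H : N -> R.
Hypotheses (cM : compact [set: M]) (TH : tonelli H) (CF : C2_cotangent F)
  (HF : integral_of_motion H F).
Variable eta : one_form M.
Hypotheses (se : smooth_form eta) (ce : closed_form eta).
Variable al : R.
Variable prim : N -> R -> R.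
Hypothesis prim0 : forall z, prim z 0 = 0.
Hypothesis primD : forall z (t : R), `|t| < 1 ->
  is_derive t 1 (prim z) (act eta F (ham_flow F t z)).
Let phi := ham_flow F.
Implicit Types (u v w : M -> R) (th : one_form M).

Definition shift_form th (x : M) : N := (x, eta x + th x).

(* [th] plays the role of [du]. *)
Definition subsolution u th : Prop :=
  (forall i x, chart_dom i x -> quad_at u th i x) /\
  forall x, H (shift_form th x) <= al.

(* The image under [phi t] of the graph of [eta + th] is, near [xs], the graph
   of [eta + dw'] with [w' ((phi t z).1) = w z.1 + prim z t]. *)
Definition push_at w th (t : R) (xs : M) : Prop :=
  (exists x, (phi t (shift_form th x)).1 = xs) /\
  exists (i : chart_index M) (C r : R), [/\ chart_dom i xs, 0 < C, 0 < r,
    forall y, `|y - chart i xs| < r -> chart_img i y &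
    forall x1 x2, let z1 := phi t (shift_form th x1) in let z2 := phi t (shift_form th x2) in
      chart_dom i z1.1 -> chart_dom i z2.1 ->
      `|chart i z1.1 - chart i xs| < r -> `|chart i z2.1 - chart i xs| < r ->
      `|(w x2 + prim (shift_form th x2) t) - (w x1 + prim (shift_form th x1) t) -
        pairing ((cotangent_chart i z1).2 - form_in_chart eta i (chart i z1.1))
          (chart i z2.1 - chart i z1.1)| <= C * `|chart i z2.1 - chart i z1.1| ^+ 2].

Lemma shift_form_chart th i x : chart_dom i x -> cotangent_chart i (shift_form th x) =
  (chart i x, form_in_chart eta i (chart i x) + form_in_chart th i (chart i x)).
Proof.
move=> ix; rewrite (form_chart eta ix) (form_chart th ix).
by rewrite /cotangent_chart /shift_form /= mulmxDl.
Qed.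

Definition mix (T : lmodType R) (l : R) (f g : M -> T) (x : M) : T := l *: f x + (1 - l) *: g x.

Lemma mix_subsolution l u v th th' : 0 <= l -> l <= 1 -> subsolution u th ->
  subsolution v th' -> subsolution (mix l (u : M -> R^o) v) (mix l th th').
Proof.
move=> l0 l1 [Qu Hu] [Qv Hv]; split=> [i x ix|x]; first exact: quad_at_lin (Qu i x ix) (Qv i x ix).
pose a := eta x + th x; pose b := eta x + th' x.
have qE : shift_form (mix l th th') x = (x, l *: a + (1 - l) *: b).
  congr pair; rewrite /a /b /mix !scalerDr addrACA -scalerDl addrC [in LHS]addrC.
  by rewrite addrCA subrr addr0 scale1r.
have ha : H (x, a) <= al by exact: Hu.
have hb : H (x, b) <= al by exact: Hv.
rewrite qE; set q := l *: a + (1 - l) *: b.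
have [ab|nab] := eqVneq a b.
  by rewrite /q ab -scalerDl addrC subrK scale1r.
pose D h := 'D_h (fun r => H (x, r)) q.
have qa : a - q = (1 - l) *: (a - b).
  by rewrite /q opprD addrA -{1}(scale1r a) -scalerBl -scalerBr.
have qb : b - q = (- l) *: (a - b).
  by apply/rowP => j; rewrite !mxE; ring.
have [l0'|l0'] := eqVneq l 0.
  by rewrite /q l0' scale0r add0r subr0 scale1r.
have [l1'|l1'] := eqVneq l 1.
  by rewrite /q l1' subrr scale0r addr0 scale1r.
have nqa : q != a.
  by rewrite eq_sym -subr_eq0 qa scaler_eq0 !subr_eq0 negb_or eq_sym l1'.
have nqb : q != b.
  by rewrite eq_sym -subr_eq0 qb scaler_eq0 oppr_eq0 subr_eq0 negb_or l0'.
have ca := fiber_convex TH x nqa; have cb := fiber_convex TH x nqb.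
have dH : differentiable (fun r => H (x, r)) q by exact: (fiber_C2 TH x).1 q I.
have Da : 'D_(a - q) (fun r => H (x, r)) q = (1 - l) * D (a - b).
  by rewrite qa /D !deriveE // linearZ.
have Db : 'D_(b - q) (fun r => H (x, r)) q = - l * D (a - b).
  by rewrite qb /D !deriveE // linearZ.
move: ca cb; rewrite Da Db => ca cb.
have l10 : 0 <= 1 - l by rewrite subr_ge0.
have := ler_wpM2l l0 (le_trans (ltW ca) ha); have := ler_wpM2l l10 (le_trans (ltW cb) hb); lra.
Qed.

Lemma local_push v th (x0 : M) : subsolution v th ->
  exists2 e : R, 0 < e & exists2 W, nbhs x0 W & forall u th', subsolution u th' ->
    exists2 l0 : R, 0 < l0 & forall l t xs, 0 < l -> l < l0 -> `|t| < e -> W xs ->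
      push_at (mix l (u : M -> R^o) v) (mix l th' th) t xs.
Proof.
move=> sv; have [Qv Hv] := sv; set i := chart_at x0; have ix0 : chart_dom i x0 by exact: dom_chart_at.
set y0 := chart i x0; have iy0 : chart_img i y0 by exact: img_chart.
pose z0 := shift_form th x0; have iz0 : chart_dom i z0.1 by exact: ix0.
have [rho [e [L [B [K [[rho0 e0 L0 B0 K0] [Le box act_box]]]]]]] :=
  @flow_box_action R n M F H cM TH CF HF eta se ce prim prim0 primD i z0 iz0.
have [rs rs0 [Cp Cp0 sP]] := @sublevel_chart_bound R n M H TH al i y0 iy0.
have fdV := findim_row (R := R) n.
have [Lt Lt0 [rl rl0 thL]] := Ck1_lipschitz fdV (@chart_img_isopen _ _ M i) iy0 (se i 1%N).
pose r' := Num.min rs rl / 2.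
have m0 : 0 < Num.min rs rl by rewrite lt_min rs0.
have r'0 : 0 < r' by rewrite divr_gt0.
have [r's r'l] : r' < rs /\ r' < rl.
  by apply/andP; rewrite -lt_min; exact: half_lt.
have im' y : `|y0 - y| <= r' -> chart_img i y.
  by move=> yr; have [] := sP y 0; rewrite // distrC (le_lt_trans yr).
have [Kv Kv0 Kvp] := quad_on_ball (Qv i) im'.
pose A1 := 2 * (1 + Lt + Kv); have A10 : 0 < A1 by rewrite mulr_gt0 // !addr_gt0.
pose r1 := Num.min r' (rho / A1 / 2).
have ra0 : 0 < rho / A1 / 2 by rewrite !divr_gt0.
have r10 : 0 < r1 by rewrite lt_min r'0.
have r1r' : r1 <= r' by rewrite /r1 ge_min lexx.
have r1A : (1 + Lt + Kv) * r1 <= rho / 2.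
  have h : r1 < rho / A1 by apply: le_lt_trans (_ : _ <= rho / A1 / 2) _;
    [rewrite /r1 ge_min lexx orbT|rewrite half_lt // divr_gt0].
  exact: (double_le (small_bounds A10 h (ltW r10))).
have r1s : r1 < rs := le_lt_trans r1r' r's.
have [e2 e20 disp] := @sublevel_displacement R n M F H cM TH CF HF al i y0 r1 Cp r10
  (fun y p yr => sP y p (lt_trans yr r1s)).
pose Kp := Lt + 1 + Kv; have Kp0 : 0 < Kp by rewrite !addr_gt0.
pose A2 := 2 * L * (1 + Kp); have A20 : 0 < A2 by rewrite !mulr_gt0 // addr_gt0.
pose ee := Num.min (Num.min e e2) (Num.min ((1 / 2) / A2) ((r1 / 8) / B)).
have ee0 : 0 < ee by rewrite !lt_min e0 e20 !divr_gt0.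
exists ee => //.
pose W : set M := [set x | chart_dom i x /\ `|chart i x - y0| < r1 / 8].
exists W.
  have cx := chart_continuous ix0.
  have r80 : 0 < r1 / 8 by rewrite divr_gt0.
  have h1 : \forall x \near x0, chart_dom i x.
    by apply: open_nbhs_nbhs; split; [exact: chart_dom_open|].
  have h2 : \forall x \near x0, `|y0 - chart i x| < r1 / 8.
    by move/cvgrPdist_lt : cx; exact.
  by apply: filterS2 h1 h2 => x hx1 hx2; split=> //; rewrite distrC.
move=> u thu su; have [Qu Hu] := su; have [Ku Ku0 Kup] := quad_on_ball (Qu i) im'.
pose l0 := Num.min 1 (Num.min (1 / Ku) ((rho / 2) / (2 * Cp))).
have l00 : 0 < l0 by rewrite !lt_min ltr01 !divr_gt0 // mulr_gt0.
exists l0 => // l t xs lp; rewrite !lt_min => /and3P[l1 lK lC] /andP[/andP[te te2] /andP[tA tB]].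
move=> [ixs xsr].
have lKu : l * Ku <= 1 by rewrite mulrC; exact: (small_bounds Ku0 lK (ltW lp)).
have lCp : l * (2 * Cp) <= rho / 2.
  by rewrite mulrC; apply: (small_bounds _ lC (ltW lp)); rewrite mulr_gt0.
have tA' := small_bounds A20 tA (normr_ge0 t); have tB' := small_bounds B0 tB (normr_ge0 t).
pose thw := mix l thu th; pose w := mix l (u : M -> R^o) v.
have sw : subsolution w thw := mix_subsolution (ltW lp) (ltW l1) su sv.
pose p y := form_in_chart eta i y + form_in_chart thw i y.
pose D : set V := [set y | `|y - y0| < r1].
have Dr' y : D y -> `|y - y0| < r' by move=> Dy; exact: lt_le_trans Dy r1r'.
have Dim y : D y -> chart_img i y by move=> /Dr' Dy; apply: im'; rewrite distrC ltW.
pose sg y := shift_form thw (chart_inv i y).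
have sgE y : D y -> chart_dom i (sg y).1 /\ cotangent_chart i (sg y) = (y, p y).
  move=> /Dim iy; have [dy cy] := chart_imgP iy; split; first exact: dy.
  by have := shift_form_chart thw dy; rewrite cy; exact.
pose q y := form_in_chart thw i y.
have qE y : q y = l *: form_in_chart thu i y + (1 - l) *: form_in_chart th i y.
  exact: form_in_chart_lin.
have fb u1 th1 y : subsolution u1 th1 -> D y ->
    `|form_in_chart eta i y + form_in_chart th1 i y| <= Cp.
  move=> [_ H1] Dy; have iy := Dim y Dy; have [dy cy] := chart_imgP iy.
  apply: (sP y _ (lt_trans Dy r1s)).2.
  have := H1 (chart_inv i y); have := shift_form_chart th1 dy; rewrite cy => <-.
  by rewrite (@cotangent_chart_invK R n M i (shift_form th1 (chart_inv i y)) dy).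
have Dy0 : D y0 by rewrite /D /= subrr normr0.
have z0E : cotangent_chart i z0 = (y0, form_in_chart eta i y0 + form_in_chart th i y0).
  by rewrite /z0 shift_form_chart.
have nearw0 y : D y -> `|cotangent_chart i (sg y) - cotangent_chart i z0| <= rho.
  move=> Dy; rewrite (sgE y Dy).2 z0E.
  pose pv y := form_in_chart eta i y + form_in_chart th i y.
  have h1 : `|((y, pv y) : E) - (y0, pv y0)| <= (1 + (Lt + Kv)) * `|y - y0|.
    apply: norm_graph_le; first by rewrite addr_ge0 // ltW.
    have -> : pv y - pv y0 = (form_in_chart eta i y - form_in_chart eta i y0) +
        (form_in_chart th i y - form_in_chart th i y0) by rewrite /pv opprD addrACA.
    apply: le_trans (ler_normD _ _) _; rewrite mulrDl; apply: lerD.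
      by apply: thL; [exact: lt_trans (Dr' y Dy) r'l|rewrite subrr normr0].
    by have [] := Kvp y0 y (Dr' _ Dy0) (Dr' _ Dy).
  have h2 : `|p y - pv y| <= l * (2 * Cp).
    rewrite /p -/(q y) qE; apply: mix_dist; [exact: ltW|exact: fb su Dy|exact: fb sv Dy].
  have h3 : `|((y, p y) : E) - (y, pv y)| <= rho / 2.
    apply: norm_pair_le => /=; last exact: le_trans h2 lCp.
    by rewrite subrr normr0 divr_ge0 // ltW.
  have h4 : (1 + (Lt + Kv)) * `|y - y0| <= rho / 2.
    apply: le_trans r1A; rewrite addrA ler_wpM2l //; last exact: ltW.
    by rewrite !addr_ge0 // ltW.
  by have := norm_add_half h3 (le_trans h1 h4); rewrite addrA subrK.
pose g y := cotangent_chart i (phi t (sg y)).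
have gD y : D y -> chart_dom i (phi t (sg y)).1 /\ `|g y - (y, p y)| <= B * `|t|.
  move=> Dy; have [dy ey] := sgE y Dy; rewrite -ey.
  exact: box dy (nearw0 y Dy) te.
pose b y := prim (sg y) t.
pose U y := w (chart_inv i y).
pose T y := (g y).2 - form_in_chart eta i (g y).1.
have wE y : U y = l * u (chart_inv i y) + (1 - l) * v (chart_inv i y) by [].
have L2t : 0 <= 2 * L * `|t| by rewrite !mulr_ge0 // ltW.
have cK : 2 * L * `|t| * (1 + Kp) <= 1 / 2 by rewrite mulrAC.
have est := @push_estimate R n D U b p q T g Kp (2 * L * `|t|) (Ku + Kv) K (ltW Kp0) L2t
  (addr_ge0 (ltW Ku0) (ltW Kv0)) (ltW K0) cK.
have {}est : forall y y', D y -> D y' ->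
    `|((g y').1 - (g y).1) - (y' - y)| <= 1 / 2 * `|y' - y| /\
    `|(U y' + b y') - (U y + b y) - pairing (T y) ((g y').1 - (g y).1)|
       <= ((Ku + Kv) + K * (1 + Kp) ^+ 2) * 4 * `|(g y').1 - (g y).1| ^+ 2.
  apply: est => y y' Dy Dy'; have [dy ey] := sgE y Dy; have [dy' ey'] := sgE y' Dy'.
  have [ku1 ku2] := Kup y y' (Dr' _ Dy) (Dr' _ Dy').
  have [kv1 kv2] := Kvp y y' (Dr' _ Dy) (Dr' _ Dy').
  have [b1 b2] := act_box _ _ t dy dy' (nearw0 y Dy) (nearw0 y' Dy') te.
  split.
  - rewrite /p -/(q y) -/(q y') !qE; apply: mix_lipschitz ku1 kv1 => //; try exact: ltW.
    by apply: thL; [exact: lt_trans (Dr' _ Dy') r'l|exact: lt_trans (Dr' _ Dy) r'l].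
  - have := mix_quad (ltW lp) (ltW l1) (ltW Ku0) (ltW Kv0) (exprn_ge0 2 (normr_ge0 (y' - y))) ku2 kv2.
    rewrite !wE qE pairingDl !pairingZl; apply: eq_norm_le.
    exact: mix_expand.
  - by move: b1; rewrite ey ey'.
  - move: b2; rewrite ey ey' /=; apply: eq_norm_le.
    congr (_ + _); congr (pairing _ _); rewrite /q /p [RHS]addrAC subrr add0r //.
have [y ys gy] : exists2 y, `|y - y0| <= r1 / 2 & (g y).1 = chart i xs.
  apply: (@perturbed_identity_surj R n (fun y => (g y).1)).
  - by rewrite divr_ge0 // ltW.
  - move=> y y' yr yr'; have h2 := half_lt r10.
    exact: (est y' y (le_lt_trans yr' h2) (le_lt_trans yr h2)).1.
  - have [_ h] := gD y0 Dy0.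
    have h1 : `|(g y0).1 - y0| <= r1 / 8 by exact: le_trans (norm_fst_le (g y0 - (y0, p y0))) (le_trans h tB').
    by rewrite distrC in h1; exact: (dist_eighth (ltW xsr) h1).
have Dy : D y by exact: le_lt_trans ys (half_lt r10).
have r12 : r1 / 2 / 2 <= r1 / 2 by apply/ltW/half_lt; rewrite divr_gt0.
split.
  exists (chart_inv i y); have [d1 _] := gD y Dy.
  exact: etrans (esym (chartK d1)) (etrans (congr1 (chart_inv i) gy) (chartK ixs)).
exists i, (((Ku + Kv) + K * (1 + Kp) ^+ 2) * 4), (r1 / 8); split=> //.
- by rewrite mulr_gt0 // ltr_wpDr ?addr_gt0 // mulr_ge0 ?exprn_ge0 // ?addr_ge0 // ltW.
- by rewrite divr_gt0.
- move=> y1 y1r; apply: Dim; rewrite /D /=.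
  exact: le_lt_trans (le_trans (dist_eighth (ltW y1r) (ltW xsr)) r12) (half_lt r10).
move=> x1 x2 z1 z2 d1 d2 c1 c2.
have src x : chart_dom i (phi t (shift_form thw x)).1 ->
    `|chart i (phi t (shift_form thw x)).1 - chart i xs| < r1 / 8 ->
    exists2 y, D y & x = chart_inv i y.
  move=> dx cx; set z := phi t (shift_form thw x) in dx cx.
  have Hz : H z <= al.
    by rewrite (integral_flow_energy cM TH CF HF); exact: sw.2.
  have zr : `|chart i z.1 - y0| <= r1 / 2.
    exact: le_trans (dist_eighth (ltW cx) (ltW xsr)) r12.
  have te2' : `|- t| < e2 by rewrite normrN.
  have [dd dr] := disp z (- t) Hz dx zr te2'.
  have zE : ham_flow F (- t) z = shift_form thw x.
    by rewrite /z -(integral_flowD cM TH CF HF) addrC subrr (integral_flow0 cM TH CF HF).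
  rewrite zE in dd dr.
  by exists (chart i x); [exact: dr|rewrite chartK].
have [y1 Dy1 x1E] := src x1 d1 c1; have [y2 Dy2 x2E] := src x2 d2 c2.
have [_] := est y1 y2 Dy1 Dy2.
by rewrite /U /b /T /g /sg -x1E -x2E.
Qed.

End local_push.

Lemma mix_cancel (R : fieldType) (n : nat) (l l' : R) (a b : 'rV[R]_n) : l != 0 ->
  l *: a + (1 - l) *: b = l' *: b + (1 - l') *: b -> a = b.
Proof.
move=> l0 h; apply/rowP => j; move/rowP/(_ j): h; rewrite !mxE => h.
by apply: (mulfI l0); apply: (addIr ((1 - l) * b 0 j)); rewrite h; ring.
Qed.

Section aubry_invariance.
Context {R : realType} {n : nat} {M : smooth_manifold R n}.
Notation V := 'rV[R]_n.
Notation N := (cotangent_bundle M).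
Variables F H : N -> R.
Hypotheses (cM : compact [set: M]) (TH : tonelli H) (CF : C2_cotangent F)
  (HF : integral_of_motion H F).
Variable eta : one_form M.
Hypotheses (se : smooth_form eta) (ce : closed_form eta).
Let al := alpha H eta.
Let phi := ham_flow F.
Implicit Types (u v w : M -> R) (th : one_form M).

Lemma act_primitive : exists prim : N -> R -> R, (forall z, prim z 0 = 0) /\
  forall z (t : R), `|t| < 1 -> is_derive t 1 (prim z) (act eta F (phi t z)).
Proof.
have ex z : exists P : R -> R, P 0 = 0 /\
    forall t : R, `|t| < 1 -> is_derive t 1 P (act eta F (phi t z)).
  have cf : continuous (fun t : R => act eta F (phi t z)).
    move=> t; have c1 := (integral_flow_ham cM TH CF HF z t).1.
    have c2 : {for phi t z, continuous (act eta F)} by exact: act_continuous.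
    exact: (continuous_comp c1 c2).
  have [P P0 PD] := FTC_interval 1 cf; exists P; split=> //.
have [prim primP] := boolp.choice ex; exists prim; split=> z; first exact: (primP z).1.
exact: (primP z).2.
Qed.

Variable prim : N -> R -> R.
Hypothesis prim0 : forall z, prim z 0 = 0.
Hypothesis primD : forall z (t : R), `|t| < 1 -> is_derive t 1 (prim z) (act eta F (phi t z)).

Let subsol := subsolution H eta al.
Let push := push_at F eta prim.
Let sg := shift_form eta.

Lemma uniform_push v th : subsol v th ->
  exists2 e : R, 0 < e & forall u th' t, subsol u th' -> `|t| < e ->
    exists l : R, [/\ 0 < l, l <= 1 &
      forall xs, push (mix l (u : M -> R^o) v) (mix l th' th) t xs].
Proof.
move=> sv.
pose P (x : M) (d : R) := forall u th', subsol u th' -> exists2 l0 : R, 0 < l0 &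
  \forall y \near x, forall l, 0 < l -> l < l0 -> forall t, `|t| <= d ->
    push (mix l (u : M -> R^o) v) (mix l th' th) t y.
have [e e0 eP] : exists2 e : R, 0 < e & forall x d, [set: M] x -> 0 < d -> d < e -> P x d.
  apply: uniform_over_compact cM _ => x _.
  have [e e0 [W nW WP]] := local_push cM TH CF HF se ce prim0 primD x sv.
  exists e => //; apply: filterS (nbhs_interior nW) => y nWy d d0 de u th' su.
  have [l0 l00 lP] := WP u th' su; exists l0 => //; apply: filterS nWy => y' Wy' l lp ll t td.
  exact: (lP l t y' lp ll (le_lt_trans td de) Wy').
exists (e / 2) => [|u th' t su te]; first by rewrite divr_gt0.
have d0 : 0 < e / 2 by rewrite divr_gt0.
have [l l0 lP] : exists2 l : R, 0 < l & forall x d, [set: M] x -> 0 < d -> d < l ->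
    push (mix d (u : M -> R^o) v) (mix d th' th) t x.
  apply: uniform_over_compact cM _ => x _.
  have [l0 l00 near_x] := eP x (e / 2) I d0 (half_lt e0) u th' su.
  exists l0 => //; apply: filterS near_x => y yP d dp dl; exact: (yP d dp dl t (ltW te)).
have m0 : 0 < Num.min l 1 by rewrite lt_min l0 ltr01.
have := half_lt m0; set d := _ / 2; rewrite lt_min => /andP[dl d1].
have dp : 0 < d by rewrite divr_gt0.
by exists d; split=> //; [exact: ltW|move=> xs; exact: lP].
Qed.

Lemma pushed_subsolution w th (t : R) : subsol w th -> (forall xs, push w th t xs) ->
  exists w' th', subsol w' th' /\ forall xs, exists x, sg th' xs = phi t (sg th x).
Proof.
move=> [Qw Hw] P; have [src srcP] := boolp.choice (fun xs => (P xs).1).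
pose w' xs := w (src xs) + prim (sg th (src xs)) t.
pose th' xs : V := (phi t (sg th (src xs))).2 - eta xs.
have sE xs : sg th' xs = phi t (sg th (src xs)).
  have pE (x : M) (z : N) : z.1 = x -> (x, eta x + (z.2 - eta x)) = z.
    by case: z => a b /= <-; rewrite addrC subrK.
  exact: pE (srcP xs).
have Q' xs : exists2 i, chart_dom i xs & quad_at w' th' i xs.
  have [_ [i [C [r [ixs C0 r0 im est]]]]] := P xs; exists i => //.
  exists C, r; split=> // y y' yr yr'; have iy := im y yr; split=> //.
  have iy' := im y' yr'; have [dy cy] := chart_imgP iy; have [dy' cy'] := chart_imgP iy'.
  have := est (src (chart_inv i y)) (src (chart_inv i y')); cbv zeta.
  have s1 x : (sg th' x).1 = x by [].
  rewrite -/(sg th _) -/(sg th _) -/phi -!sE !s1 cy cy' => /(_ dy dy' yr yr').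
  have := shift_form_chart eta th' dy; rewrite cy -/(sg th' _) => ->.
  by rewrite /= [_ + form_in_chart th' i y]addrC addrK.
have QQ : forall i x, chart_dom i x -> quad_at w' th' i x.
  by move=> i x ix; have [j jx] := Q' x; exact: quad_at_chart.
exists w', th'; split; last by move=> xs; exists (src xs); exact: sE.
split=> // x; rewrite -/(sg th' x) sE (integral_flow_energy cM TH CF HF); exact: Hw.
Qed.

Lemma subsolution_dfun u : critical_subsolution H eta u -> subsol u (dfun u).
Proof. by move=> [Cu Hu]; split=> [i x ix|x]; [exact: C11_quad|exact: Hu]. Qed.

Lemma aubry_shift z w th : aubry_set H eta z -> subsol w th -> z = sg th z.1.
Proof.
move=> Az [Qw Hw]; have Q x : exists2 i, chart_dom i x & quad_at w th i x.
  by exists (chart_at x); [exact: dom_chart_at|apply: Qw; exact: dom_chart_at].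
have [Cw dw] := quad_C11 Q.
have cw : critical_subsolution H eta w by split=> // x; rewrite dw; exact: Hw.
by have [x _ <-] := Az w cw; rewrite /sg /shift_form /= dw.
Qed.

Lemma aubry_small v th : subsol v th -> exists2 e : R, 0 < e &
  forall t z, `|t| < e -> aubry_set H eta z -> aubry_set H eta (phi t z).
Proof.
move=> sv; have [e e0 eP] := uniform_push sv; exists e => // t z te Az.
have te' : `|- t| < e by rewrite normrN.
have back u th' : subsol u th' -> exists l : R, 0 < l /\ exists x,
    phi t z = sg (mix l th' th) x.
  move=> su; have [l [l0 l1 lP]] := eP u th' (- t) su te'; exists l; split=> //.
  have sw : subsol (mix l (u : M -> R^o) v) (mix l th' th).
    by apply: (mix_subsolution TH (ltW l0) l1 su sv).
  have [w' [th2 [sw' wP]]] := pushed_subsolution sw lP.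
  have zE := aubry_shift Az sw'; have [x xE] := wP z.1; exists x.
  rewrite {1}zE xE /phi -(integral_flowD cM TH CF HF) subrr.
  exact: (integral_flow0 cM TH CF HF).
move=> u /subsolution_dfun su; have [l [l0 [x xE]]] := back u (dfun u) su.
have [l' [_ [x' xE']]] := back v th sv.
have [e1] : sg (mix l (dfun u) th) x = sg (mix l' th th) x' by rewrite -xE -xE'.
rewrite -e1 => /addrI e2; have l0' : l != 0 by rewrite gt_eqF.
exists x => //; rewrite xE /sg /shift_form; congr pair; congr (_ + _).
have E := mix_cancel l0' e2; rewrite /mix E -scalerDl addrC subrK scale1r; exact: erefl.
Qed.

End aubry_invariance.

Section aubry_theorem.
Context {R : realType} {n : nat} {M : smooth_manifold R n}.
Variables F H : cotangent_bundle M -> R.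
Hypotheses (cM : compact [set: M]) (TH : tonelli H) (CF : C2_cotangent F)
  (HF : integral_of_motion H F).

Lemma aubry_set_sub (eta : one_form M) : smooth_form eta -> closed_form eta ->
  forall t z, aubry_set H eta z -> aubry_set H eta (ham_flow F t z).
Proof.
move=> se ce t z Az; have [[v sv]|nv] := pselect (exists v, critical_subsolution H eta v); last first.
  by move=> v sv; case: nv; exists v.
have [prim [prim0 primD]] := act_primitive cM TH CF HF se.
have [e e0 eP] := aubry_small cM TH CF HF se ce prim0 primD (subsolution_dfun sv).
have [m me] : exists m : nat, `|t| < m.+1%:R * e.
  exists (Num.truncn (`|t| / e)); rewrite -ltr_pdivrMr //.
  by have := truncnS_gt (`|t| / e).
pose s := t / m.+1%:R; have ms : t = m.+1%:R * s by rewrite mulrC divfK.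
have ss : `|s| < e.
  by rewrite normrM normfV (ger0_norm (ler0n _ _)) ltr_pdivrMr ?ltr0n // mulrC.
rewrite ms; move: (m.+1); elim=> [|k IH].
  by rewrite mul0r (integral_flow0 cM TH CF HF).
have -> : k.+1%:R * s = s + k%:R * s by rewrite -natr1 mulrDl mul1r addrC.
by rewrite (integral_flowD cM TH CF HF); exact: eP.
Qed.

End aubry_theorem.

Theorem lemma2p2 (R : realType) (n : nat) (M : smooth_manifold R n)
    (M_compact : compact [set: M]) (M_connected : connected [set: M])
    (H F : cotangent_bundle M -> R)
    (H_tonelli : tonelli H)
    (F_C2 : C2_cotangent F) (F_integral : integral_of_motion H F) :
  (forall (c : H1 M) (eta : one_form M), representatives c eta ->
    forall (mu : probability (borel (cotangent_bundle M)) R) (t : R),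
      cotangent_minimizing H eta mu ->
      exists2 mu' : probability (borel (cotangent_bundle M)) R,
        is_pushforward (ham_flow F t) mu mu' & cotangent_minimizing H eta mu')
  /\
  (forall (c : H1 M) (eta : one_form M), representatives c eta ->
    [/\ flow_invariant (ham_flow F) (mather_set H eta),
        flow_invariant (ham_flow F) (aubry_set H eta),
        preserves_components (ham_flow F) (mather_set H eta) &
        preserves_components (ham_flow F) (aubry_set H eta)]).

Proof.
split=> [c eta /representative_form[se ce] mu t|c eta /representative_form[se ce]].
  exact: (cotangent_minimizing_flow M_compact H_tonelli F_C2 F_integral se ce).
have sM := mather_set_sub M_compact H_tonelli F_C2 F_integral se ce.
have sA := aubry_set_sub M_compact H_tonelli F_C2 F_integral se ce.
split.
- exact: (invariant_of_sub M_compact H_tonelli F_C2 F_integral sM).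
- exact: (invariant_of_sub M_compact H_tonelli F_C2 F_integral sA).
- exact: (components_of_invariant M_compact H_tonelli F_C2 F_integral sM).
- exact: (components_of_invariant M_compact H_tonelli F_C2 F_integral sA).
Qed.
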